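(* Fix any $\mathbf{n}=(n_0,n_1,n_2,n_3)$ with $n_k\in\mathbb{Z}_{\ge 0}$ and any $\tau\in\mathbb{H}$ (and, wherever an equation $\mathrm{H}(\mathbf{n},B,\tau)$ occurs, assume $\max_k n_k\ge 1$). Then the following hold. (1) Let $p_1,p_2\in\mathbb{C}$ with $\pm[p_j]\notin E_\tau[2]$ and $A_1,A_2\in\mathbb{C}$. If $\mathrm{GLE}(\mathbf{n},p_1,A_1,\tau)$ and $\mathrm{GLE}(\mathbf{n},p_2,A_2,\tau)$ have the same global monodromy data, then $\mathrm{GLE}(\mathbf{n},p_1,A_1,\tau)=\mathrm{GLE}(\mathbf{n},p_2,A_2,\tau)$ (i.e. the two differential equations coincide). (2) Let $B_1,B_2\in\mathbb{C}$. If $\mathrm{H}(\mathbf{n},B_1,\tau)$ and $\mathrm{H}(\mathbf{n},B_2,\tau)$ have the same global monodromy data, then $\mathrm{H}(\mathbf{n},B_1,\tau)=\mathrm{H}(\mathbf{n},B_2,\tau)$. (3) Fix any $k\in\{0,1,2,3\}$ and let $\mathbf{n}_k$ be obtained from $\mathbf{n}$ by replacing $n_k$ with $n_k+2$. Then the global monodromy data of $\mathrm{H}(\mathbf{n},B_1,\tau)$ and of $\mathrm{H}(\mathbf{n}_k,B_2,\tau)$ cannot be the same for any $B_1,B_2\in\mathbb{C}$.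
   Context: Notation. $\mathbb{H}$ is the upper half plane; $\omega_0=0$, $\omega_1=1$, $\omega_2=\tau$, $\omega_3=1+\tau$; $\Lambda_\tau=\mathbb{Z}+\mathbb{Z}\tau$; $E_\tau=\mathbb{C}/\Lambda_\tau$; $[z]$ is the class of $z$ in $E_\tau$; $E_\tau[2]=\{[\omega_k/2]:k=0,1,2,3\}$. $\wp(z|\tau)$, $\zeta(z|\tau)$ and $\sigma(z|\tau)$ are the Weierstrass functions with period lattice $\Lambda_\tau$. $\mathrm{GLE}(\mathbf{n},p,A,\tau)$, for $\pm[p]\notin E_\tau[2]$ and $A\in\mathbb{C}$, is the linear ODE $y''(z)=I_{\mathbf n}(z;p,A,\tau)y(z)$, $z\in\mathbb{C}$, with $$I_{\mathbf n}(z;p,A,\tau)=\sum_{k=0}^3 n_k(n_k+1)\wp(z+\tfrac{\omega_k}{2}|\tau)+\tfrac34\big(\wp(z+p|\tau)+\wp(z-p|\tau)\big)+A\big(\zeta(z+p|\tau)-\zeta(z-p|\tau)\big)+B,$$ $$B=A^2-\zeta(2p|\tau)A-\tfrac34\wp(2p|\tau)-\sum_{k=0}^3 n_k(n_k+1)\wp(p+\tfrac{\omega_k}{2}|\tau),$$ the last condition being equivalent to $\pm[p]$ being apparent (non-logarithmic) singularities. $\mathrm{GLE}(\mathbf n,p,A,\tau)$ depends only on $p$ mod $\Lambda_\tau$ and is unchanged under $(p,A)\mapsto(-p,-A)$. $\mathrm{H}(\mathbf{n},B,\tau)$, for $B\in\mathbb{C}$, is the ODE $y''(z)=\big[\sum_{k=0}^3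 n_k(n_k+1)\wp(z+\tfrac{\omega_k}{2}|\tau)+B\big]y(z)$. Monodromy matrices. All solutions of $\mathrm{H}(\mathbf n,B,\tau)$ are meromorphic on $\mathbb{C}$. For $\mathrm{GLE}(\mathbf n,p,A,\tau)$ let $L$ be the straight segment joining $\pm p$; the local monodromy at $\omega_k/2$ is $I_2$ and at $\pm p$ is $-I_2$, and solutions are viewed as single-valued meromorphic functions on $\mathbb{C}\setminus(L+\Lambda_\tau)$, where $y(z+\omega_j)$ is well defined as the analytic continuation of $y$ along a fundamental cycle $\ell_j$ from a base point $q_0$ to $q_0+\omega_j$ not meeting $L+\Lambda_\tau$. (Equivalently, one uses the translation $z\mapsto z+\omega_j$ on the single-valued meromorphic functions $y/\Psi_p$, where $\Psi_p(z)=\sigma(z)/\sqrt{\sigma(z+p)\sigma(z-p)}$ is invariant under continuation along $\ell_j$.) For a basis $(y_1,y_2)$ of solutions, $N_1,N_2\in SL(2,\mathbb{C})$ are defined by $(y_1(z+\omega_j),y_2(z+\omega_j))^T=N_j(y_1(z),y_2(z))^T$, $j=1,2$. They commute and are unique up to a common conjugation. For $\mathrm{H}$ the monodromy group is generated by $N_1,N_2$; for $\mathrm{GLE}$ by $-I_2,N_1,N_2$. Two cases. (a) Completely reducible: all monodromy matrices have two linearly independent common eigenfunctions. Then up to common conjugation $N_1=\mathrm{diag}(e^{-2\pi i s},e^{2\pi i s})$, $N_2=\mathrm{diag}(e^{2\pi i r},e^{-2\pi i r})$ for some $(r,s)\in\mathbb{C}^2\setminus\frac12\mathbb{Z}^2$,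 and $(r,s)$ is unique modulo $\sim$, where $(r_1,s_1)\sim(r_2,s_2)$ iff $(r_1,s_1)\equiv\pm(r_2,s_2)\bmod\mathbb{Z}^2$. (b) Not completely reducible: the space of common eigenfunctions is one-dimensional. Then up to common conjugation $N_1=\varepsilon_1\begin{pmatrix}1&0\\1&1\end{pmatrix}$, $N_2=\varepsilon_2\begin{pmatrix}1&0\\ \mathcal{C}&1\end{pmatrix}$ with $\varepsilon_1,\varepsilon_2\in\{\pm1\}$, $\mathcal{C}\in\mathbb{C}\cup\{\infty\}$, where for $\mathcal{C}=\infty$ this means $N_1=\varepsilon_1 I_2$, $N_2=\varepsilon_2\begin{pmatrix}1&0\\1&1\end{pmatrix}$. The global monodromy data is the class of $(r,s)$ in $(\mathbb{C}^2\setminus\frac12\mathbb{Z}^2)/\sim$ in case (a), and the triple $(\mathrm{tr}N_1,\mathrm{tr}N_2,\mathcal{C})$ in case (b). *)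

(* Defs.v *)
From Stdlib Require Import Reals ZArith List.
From Coquelicot Require Import Coquelicot.

Open Scope C_scope.

Definition Cexp (z : C) : C :=
  (exp (Re z) * cos (Im z), exp (Re z) * sin (Im z))%R.

Definition Clim_seq (u : nat -> C) : C :=
  (real (Lim_seq (fun N => Re (u N))), real (Lim_seq (fun N => Im (u N)))).

Definition Csum (l : list C) : C := fold_right Cplus 0 l.
Definition Cprod (l : list C) : C := fold_right Cmult 1 l.

Definition lattice_point (tau : C) (mn : Z * Z) : C :=
  IZR (fst mn) + IZR (snd mn) * tau.

Definition in_lattice (tau z : C) : Prop :=
  exists mn : Z * Z, z = lattice_point tau mn.

(** [z] represents a point of [E_tau[2]]. *)
Definition two_torsion (tau z : C) : Prop := in_lattice tau (2 * z).

(** The nonzero lattice points [m + n tau] with [|m|, |n| <= N].  The sums and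
    products below converge absolutely, so exhausting the lattice by these
    squares gives the usual (unordered) value. *)
Definition Zrange (N : nat) : list Z :=
  map (fun i => (Z.of_nat i - Z.of_nat N)%Z) (seq 0 (2 * N + 1)).

Definition lattice_box (tau : C) (N : nat) : list C :=
  map (lattice_point tau)
    (filter (fun mn => negb (Z.eqb (fst mn) 0 && Z.eqb (snd mn) 0))
       (list_prod (Zrange N) (Zrange N))).

Definition lattice_sum (tau : C) (f : C -> C) : C :=
  Clim_seq (fun N => Csum (map f (lattice_box tau N))).

Definition lattice_prod (tau : C) (f : C -> C) : C :=
  Clim_seq (fun N => Cprod (map f (lattice_box tau N))).

Definition wp (tau z : C) : C :=
  1 / z ^ 2 + lattice_sum tau (fun w => 1 / (z - w) ^ 2 - 1 / w ^ 2).

Definition wzeta (tau z : C) : C :=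
  1 / z + lattice_sum tau (fun w => 1 / (z - w) + 1 / w + z / w ^ 2).

Definition wsigma (tau z : C) : C :=
  z * lattice_prod tau (fun w => (1 - z / w) * Cexp (z / w + z ^ 2 / (2 * w ^ 2))).

Definition omega (tau : C) (k : nat) : C :=
  match k with
  | 0%nat => 0
  | 1%nat => 1
  | 2%nat => tau
  | _ => 1 + tau
  end.

(** [potential] is a total function standing for a meromorphic one: its values
    on [singular] (which contains all its poles) are irrelevant.  For each
    equation below [singular] is closed, discrete and [Lambda_tau]-periodic. *)
Record equation := mk_equation {
  potential : C -> C;
  singular : C -> Prop
}.

Definition same_equation (e1 e2 : equation) : Prop :=
  forall z, ~ singular e1 z -> ~ singular e2 z -> potential e1 z = potential e2 z.

Definition Csum4 (f : nat -> C) : C := f 0%nat + f 1%nat + f 2%nat + f 3%nat.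

(** The multi-index [(n_0, n_1, n_2, n_3)] is a function [n : nat -> nat] of
    which only the values at 0, 1, 2, 3 are ever used. *)
Definition coef (n : nat -> nat) (k : nat) : R := INR (n k * (n k + 1)).

Definition GLE_B (n : nat -> nat) (p A tau : C) : C :=
  A ^ 2 - wzeta tau (2 * p) * A - 3 / 4 * wp tau (2 * p)
  - Csum4 (fun k => coef n k * wp tau (p + omega tau k / 2)).

Definition GLE (n : nat -> nat) (p A tau : C) : equation := {|
  potential := fun z =>
    Csum4 (fun k => coef n k * wp tau (z + omega tau k / 2))
    + 3 / 4 * (wp tau (z + p) + wp tau (z - p))
    + A * (wzeta tau (z + p) - wzeta tau (z - p))
    + GLE_B n p A tau;
  singular := fun z =>
    two_torsion tau z \/ in_lattice tau (z + p) \/ in_lattice tau (z - p)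
|}.

Definition Heun (n : nat -> nat) (B tau : C) : equation := {|
  potential := fun z =>
    Csum4 (fun k => coef n k * wp tau (z + omega tau k / 2)) + B;
  singular := two_torsion tau
|}.

Definition Cderive_at (f : C -> C) (z l : C) : Prop :=
  @is_derive C_AbsRing C_NormedModule f z l.

Definition holomorphic_on (U : C -> Prop) (f : C -> C) : Prop :=
  forall z, U z -> exists l, Cderive_at f z l.

(** Meromorphic on the whole plane; the values of [f] at its poles, and more
    generally on a discrete set, do not matter. *)
Definition meromorphic (f : C -> C) : Prop :=
  forall a, exists (N : nat) (g : C -> C),
    locally a (fun z => exists l, Cderive_at g z l) /\
    locally' a (fun z => f z = g z / (z - a) ^ N).

Definition solves_on (U : C -> Prop) (e : equation) (y : C -> C) : Prop :=
  exists dy : C -> C, forall z, U z ->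
    Cderive_at y z (dy z) /\ Cderive_at dy z (potential e z * y z).

(** Members are to be identified when they agree off [bad]. *)
Record solution_space := mk_space {
  bad : C -> Prop;
  member : (C -> C) -> Prop
}.

Definition Heun_space (n : nat -> nat) (B tau : C) : solution_space := {|
  bad := singular (Heun n B tau);
  member := fun y =>
    meromorphic y /\
    solves_on (fun z => ~ singular (Heun n B tau) z) (Heun n B tau) y
|}.

(** [psi] is on [U] a holomorphic branch of
    [Psi_p(z) = sigma(z) / sqrt (sigma(z + p) sigma(z - p))]. *)
Definition Psi_branch (tau p : C) (U : C -> Prop) (psi : C -> C) : Prop :=
  holomorphic_on U psi /\
  forall z, U z ->
    psi z ^ 2 * (wsigma tau (z + p) * wsigma tau (z - p)) = wsigma tau z ^ 2.

(** A solution [y] of GLE changes sign around [p] and [-p], hence is represented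
    by the single-valued meromorphic function [w = y / Psi_p]: locally, [w] times
    a branch of [Psi_p] solves the equation.  Since [Psi_p] is invariant under
    continuation along the fundamental cycles [l_j], translating [w] by
    [omega_j] amounts to continuing [y] along [l_j]. *)
Definition GLE_space (n : nat -> nat) (p A tau : C) : solution_space := {|
  bad := singular (GLE n p A tau);
  member := fun w =>
    meromorphic w /\
    forall z0, ~ singular (GLE n p A tau) z0 ->
      exists (U : C -> Prop) (psi : C -> C),
        open U /\ U z0 /\ (forall z, U z -> ~ singular (GLE n p A tau) z) /\
        Psi_branch tau p U psi /\
        solves_on U (GLE n p A tau) (fun z => psi z * w z)
|}.

Definition independent (S : solution_space) (y1 y2 : C -> C) : Prop :=
  forall a b : C,
    (forall z, ~ bad S z -> a * y1 z + b * y2 z = 0) -> a = 0 /\ b = 0.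

Definition basis (S : solution_space) (y1 y2 : C -> C) : Prop :=
  member S y1 /\ member S y2 /\ independent S y1 y2 /\
  forall y, member S y ->
    exists a b : C, forall z, ~ bad S z -> y z = a * y1 z + b * y2 z.

Definition mat2 := @matrix C 2 2.

Definition entry (M : mat2) (i j : nat) : C := @coeff_mat C 2 2 0 M i j.

Definition trace2 (M : mat2) : C := entry M 0 0 + entry M 1 1.

Definition translation_matrix (S : solution_space) (w : C) (y1 y2 : C -> C)
    (M : mat2) : Prop :=
  forall z, ~ bad S z ->
    y1 (z + w) = entry M 0 0 * y1 z + entry M 0 1 * y2 z /\
    y2 (z + w) = entry M 1 0 * y1 z + entry M 1 1 * y2 z.

Definition monodromy_matrices (S : solution_space) (tau : C) (N1 N2 : mat2) : Prop :=
  exists y1 y2, basis S y1 y2 /\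
    translation_matrix S (omega tau 1) y1 y2 N1 /\
    translation_matrix S (omega tau 2) y1 y2 N2.

(** For GLE the further generator [- I_2] of the monodromy group imposes no
    condition on eigenfunctions. *)
Definition common_eigenfunction (S : solution_space) (tau : C) (y : C -> C) : Prop :=
  member S y /\ (exists z, ~ bad S z /\ y z <> 0) /\
  exists l1 l2 : C, forall z, ~ bad S z ->
    y (z + omega tau 1) = l1 * y z /\ y (z + omega tau 2) = l2 * y z.

Definition completely_reducible (S : solution_space) (tau : C) : Prop :=
  exists y1 y2, common_eigenfunction S tau y1 /\ common_eigenfunction S tau y2 /\
    independent S y1 y2.

(** [None] encodes the value [infinity] of the third component. *)
Inductive monodromy_data :=
| Reducible_data (r s : C)
| Nonreducible_data (tr1 tr2 : C) (c : option C).

Definition half_integer_pair (r s : C) : Prop :=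
  exists a b : Z, 2 * r = IZR a /\ 2 * s = IZR b.

Definition rs_equiv (r1 s1 r2 s2 : C) : Prop :=
  exists a b : Z,
    (r1 = r2 + IZR a /\ s1 = s2 + IZR b) \/
    (r1 = - r2 + IZR a /\ s1 = - s2 + IZR b).

Definition same_data (d1 d2 : monodromy_data) : Prop :=
  match d1, d2 with
  | Reducible_data r1 s1, Reducible_data r2 s2 => rs_equiv r1 s1 r2 s2
  | Nonreducible_data t1 t2 c, Nonreducible_data t1' t2' c' =>
      t1 = t1' /\ t2 = t2' /\ c = c'
  | _, _ => False
  end.

Definition diag2 (a b : C) : mat2 := [[a, RtoC 0], [RtoC 0, b]].
Definition scaled_unipotent (e c : C) : mat2 := [[e, RtoC 0], [e * c, e]].

Definition normal_form (e1 e2 : C) (c : option C) : mat2 * mat2 :=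
  match c with
  | Some c => (scaled_unipotent e1 1, scaled_unipotent e2 c)
  | None => (scaled_unipotent e1 0, scaled_unipotent e2 1)
  end.

Definition has_data (S : solution_space) (tau : C) (d : monodromy_data) : Prop :=
  match d with
  | Reducible_data r s =>
      completely_reducible S tau /\ ~ half_integer_pair r s /\
      monodromy_matrices S tau
        (diag2 (Cexp (- (2 * PI * Ci * s))) (Cexp (2 * PI * Ci * s)))
        (diag2 (Cexp (2 * PI * Ci * r)) (Cexp (- (2 * PI * Ci * r))))
  | Nonreducible_data tr1 tr2 c =>
      ~ completely_reducible S tau /\
      exists e1 e2 : C, (e1 = 1 \/ e1 = -1) /\ (e2 = 1 \/ e2 = -1) /\
        let N := normal_form e1 e2 c in
        monodromy_matrices S tau (fst N) (snd N) /\
        tr1 = trace2 (fst N) /\ tr2 = trace2 (snd N)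
  end.

Definition same_global_monodromy_data (tau : C) (S1 S2 : solution_space) : Prop :=
  exists d1 d2, has_data S1 tau d1 /\ has_data S2 tau d2 /\ same_data d1 d2.

Definition bump2 (n : nat -> nat) (k : nat) : nat -> nat :=
  fun j => if Nat.eqb j k then (n j + 2)%nat else n j.

(* Main.v *)
Require Import Defs.
From Stdlib Require Import Reals ZArith List Lra Lia Classical Permutation.
From Coquelicot Require Import Coquelicot.

(** Let two equations have the same monodromy data. Bases of their solution
    spaces can then be chosen in such a way that translation by 1 and by [tau]
    acts on both by the same matrices ([same_data_same_potential]). Both equations
    are even, so [z |-> - z] acts on each solution space too, and its action is
    nearly determined by the monodromy: it exchanges the two common
    eigenfunctions, or in the unipotent case it fixes the common eigenfunction up
    to a sign ([diagonal_reflection], [unipotent_reflection]). It follows that,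
    after a normalisation of the second basis, the determinant
    [F = y1 y2' - y2 y1'] of the bases [y1, y2] and [y1', y2'] is an elliptic
    function with [F (- z) = - F z]. Only in the unipotent case may the parities
    of [y1] and [y1'] be opposite; then [F = y1 y1'] is elliptic and odd instead.

    The main point is that such an [F] is zero ([bilinear_zero]). Being odd and
    elliptic, it is odd about each half period [q], and so it is a sum of products
    of two solutions of opposite parities about [q] ([odd_bilinear_order]). The
    parity of a solution decides which of the two exponents at [q] it has
    ([indicial], [ord_eq_parity]). For the exponents [- n_k] and [n_k + 1] of both
    equations, opposite parities give a product of order at least 1. At one class
    of half periods the bound is weaker, and [F] may have a simple pole. For
    solutions of GLE divided by [Psi_p] this happens at 0, where the exponents
    are [- n_0 - 1] and [n_0]; when [n_k] is compared with [n_k + 2], it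
    happens at [omega_k / 2]. Solutions have no poles anywhere else: at [+- p] the
    exponents are 0 and 2. Hence [F] has at most one simple pole, and zeros at
    the three other half periods. The product of [F z] with [F (z + 1 / 2)] has no
    pole, and it has a zero, so it vanishes by Liouville's theorem; thus [F = 0]
    ([elliptic_zero]).

    The product of two nonzero solutions is not zero, so the parities are not
    opposite. Hence [y1 / y2 = y1' / y2'], and the quotient of two solutions
    determines the potential through its Schwarzian derivative
    ([ratio_potential]). This gives the first two assertions. For the third,
    equal potentials would have the same leading coefficients at [omega_k / 2],
    whereas [n_k (n_k + 1)] and [(n_k + 2) (n_k + 3)] differ.

    The analysis behind this is developed from Cauchy's formula for continuously
    differentiable functions on a disc ([Cauchy_formula]), proved by contracting
    the circle to a point. It gives orders of zeros ([C1_disc_order]), the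
    identity theorem ([mero_identity]) and Liouville's theorem. The functions
    [wp], [wzeta] and [wsigma] are studied by summing over the shells of the
    squares that exhaust the lattice ([lattice_sum_conv], [lattice_prod_conv]):
    this yields the relations between their derivatives, their poles, their
    parities and the periodicity of [wp]. The single-valued function [w] that
    represents a solution [Psi_p w] of GLE satisfies an equation with an
    additional first-order term, the twisted equation below, because the
    logarithmic derivative of [Psi_p] is expressed by zeta functions
    ([Psi_branch_derive]). *)

Open Scope C_scope.

(** * Neighbourhoods, limits and continuity in the complex plane *)

Lemma Cmod_minus_sym (a b : C) : Cmod (a - b) = Cmod (b - a).
Proof. rewrite <- Cmod_opp. f_equal. ring. Qed.

Lemma Cmod_rev (a b : C) : Cmod a - Cmod b <= Cmod (a - b).
Proof.
  assert (H := Cmod_triangle (a - b) b).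
  replace (a - b + b) with a in H by ring. lra.
Qed.

(** The balls of the product topology are squares; all estimates below are in
    terms of the modulus, hence of discs. *)
Lemma locally_disc (a : C) (P : C -> Prop) :
  locally a P <-> exists d, 0 < d /\ forall z, Cmod (z - a) < d -> P z.
Proof.
  split.
  - intros [d Hd]. exists d. split; [apply cond_pos|].
    intros z Hz. apply Hd. now apply C_NormedModule_mixin_compat1.
  - intros [d [Hd H]].
    assert (Hs : 0 < sqrt 2) by (apply sqrt_lt_R0; lra).
    assert (Hd' : 0 < d / sqrt 2) by (apply Rdiv_lt_0_compat; lra).
    exists (mkposreal _ Hd'). intros z Hz.
    apply H.
    apply (C_NormedModule_mixin_compat2 a z (mkposreal _ Hd')) in Hz.
    simpl in Hz. unfold minus, plus, opp in Hz; simpl in Hz.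
    replace (sqrt 2 * (d / sqrt 2))%R with d in Hz by (field; lra).
    exact Hz.
Qed.

Lemma locally'_disc (a : C) (P : C -> Prop) :
  locally' a P <-> exists d, 0 < d /\
    forall z, z <> a -> Cmod (z - a) < d -> P z.
Proof.
  unfold locally', within. rewrite locally_disc.
  split; intros [d [Hd H]]; exists d; split; auto.
Qed.

Lemma Cderive_eps (f : C -> C) (z l : C) :
  Cderive_at f z l <->
  forall e, 0 < e -> exists d, 0 < d /\
    forall w, Cmod (w - z) < d ->
      Cmod (f w - f z - l * (w - z)) <= e * Cmod (w - z).
Proof.
  unfold Cderive_at, is_derive. split.
  - intros [_ H] e He.
    specialize (H z (fun P HP => HP) (mkposreal e He)).
    apply locally_C in H.
    apply locally_disc in H. destruct H as [d [Hd H]].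
    exists d; split; auto. intros w Hw. specialize (H w Hw).
    unfold norm in H; simpl in H.
    unfold minus, plus, opp, scal in H; simpl in H. unfold mult in H; simpl in H.
    replace (f w - f z - l * (w - z)) with (f w + - f z + - ((w + - z) * l)) by ring.
    exact H.
  - intros H. split.
    + apply is_linear_scal_l.
    + intros x Hx e.
      assert (x = z).
      { symmetry. exact (is_filter_lim_locally_unique (V:=AbsRing_NormedModule C_AbsRing) z x Hx). }
      subst x.
      apply locally_C. apply locally_disc.
      destruct (H e (cond_pos e)) as [d [Hd H']].
      exists d; split; auto. intros w Hw. specialize (H' w Hw).
      replace (f w - f z - l * (w - z)) with (f w + - f z + - ((w + - z) * l)) in H' by ring.
      exact H'.
Qed.

Definition clim (f : C -> C) (a l : C) : Prop :=
  forall e, 0 < e -> locally' a (fun z => Cmod (f z - l) < e).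

Definition ccont (f : C -> C) (a : C) : Prop := clim f a (f a).

Lemma clim_ext (f g : C -> C) (a l : C) :
  locally' a (fun z => f z = g z) -> clim f a l -> clim g a l.
Proof.
  intros E H e He. specialize (H e He).
  generalize (filter_and _ _ E H). apply filter_imp.
  intros z [<- ?]. auto.
Qed.

Lemma clim_const (k a : C) : clim (fun _ => k) a k.
Proof.
  intros e He. apply filter_forall. intros z.
  replace (k - k) with (RtoC 0) by ring. now rewrite Cmod_0.
Qed.

Lemma clim_id (a : C) : clim (fun z => z) a a.
Proof.
  intros e He. apply locally'_disc. exists e. auto.
Qed.

Lemma clim_plus (f g : C -> C) (a l m : C) :
  clim f a l -> clim g a m -> clim (fun z => f z + g z) a (l + m).
Proof.
  intros Hf Hg e He.
  assert (He2 : 0 < e / 2) by lra.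
  generalize (filter_and _ _ (Hf _ He2) (Hg _ He2)). apply filter_imp. intros z [H1 H2].
  replace (f z + g z - (l + m)) with ((f z - l) + (g z - m)) by ring.
  eapply Rle_lt_trans; [apply Cmod_triangle|]. lra.
Qed.

Lemma clim_bounded (f : C -> C) (a l : C) :
  clim f a l -> locally' a (fun z => Cmod (f z) < Cmod l + 1).
Proof.
  intros Hf. generalize (Hf 1%R Rlt_0_1). apply filter_imp.
  intros z Hz. assert (H := Cmod_rev (f z) l). lra.
Qed.

(** Bounded times infinitesimal: the rules for products and inverses reduce to
    this. *)
Lemma clim_bounded_mult_0 (f g : C -> C) (a : C) (M : R) :
  locally' a (fun z => Cmod (f z) <= M) -> clim g a 0 ->
  clim (fun z => f z * g z) a 0.
Proof.
  intros Hf Hg e He.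
  assert (HM : 0 < Rabs M + 1) by (assert (H := Rabs_pos M); lra).
  assert (He' : 0 < e / (Rabs M + 1)) by (apply Rdiv_lt_0_compat; lra).
  generalize (filter_and _ _ Hf (Hg _ He')). apply filter_imp.
  intros z [H1 H2].
  replace (f z * g z - 0) with (f z * g z) by ring.
  replace (g z - 0) with (g z) in H2 by ring.
  rewrite Cmod_mult.
  assert (Cmod (f z) <= Rabs M + 1)%R by (assert (H := Rle_abs M); lra).
  apply Rle_lt_trans with ((Rabs M + 1) * Cmod (g z))%R.
  - apply Rmult_le_compat_r; auto using Cmod_ge_0.
  - apply Rmult_lt_compat_l with (r := (Rabs M + 1)%R) in H2; auto.
    replace ((Rabs M + 1) * (e / (Rabs M + 1)))%R with e in H2 by (field; lra). auto.
Qed.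

Lemma clim_shift (f : C -> C) (a l : C) :
  clim f a l <-> clim (fun z => f z - l) a 0.
Proof.
  unfold clim. split; intros H e He; generalize (H e He); apply filter_imp;
    intros z; replace (f z - l - 0) with (f z - l) by ring; auto.
Qed.

Lemma clim_eq (f : C -> C) (a l m : C) : clim f a l -> l = m -> clim f a m.
Proof. intros H <-. exact H. Qed.

Lemma clim_mult (f g : C -> C) (a l m : C) :
  clim f a l -> clim g a m -> clim (fun z => f z * g z) a (l * m).
Proof.
  intros Hf Hg. apply clim_shift.
  apply clim_ext with (fun z => f z * (g z - m) + m * (f z - l)).
  { apply filter_forall. intros z. ring. }
  eapply clim_eq; [apply clim_plus|].
  - apply clim_bounded_mult_0 with (M := (Cmod l + 1)%R).
    + generalize (clim_bounded _ _ _ Hf). apply filter_imp. intros; lra.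
    + now apply clim_shift in Hg.
  - apply clim_bounded_mult_0 with (M := Cmod m).
    + apply filter_forall. intros; lra.
    + now apply clim_shift in Hf.
  - ring.
Qed.

Lemma clim_opp (f : C -> C) (a l : C) : clim f a l -> clim (fun z => - f z) a (- l).
Proof.
  intros H. apply clim_ext with (fun z => (-1) * f z).
  { apply filter_forall; intros; ring. }
  eapply clim_eq; [apply clim_mult; [apply clim_const|exact H]|ring].
Qed.

Lemma clim_minus (f g : C -> C) (a l m : C) :
  clim f a l -> clim g a m -> clim (fun z => f z - g z) a (l - m).
Proof. intros Hf Hg. apply clim_plus; auto. now apply clim_opp. Qed.

Lemma clim_nonzero (f : C -> C) (a l : C) :
  clim f a l -> l <> 0 -> locally' a (fun z => Cmod l / 2 <= Cmod (f z)).
Proof.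
  intros Hf Hl. apply Cmod_gt_0 in Hl.
  assert (He2 : 0 < Cmod l / 2) by lra.
  generalize (Hf _ He2). apply filter_imp. intros z Hz.
  assert (H := Cmod_rev l (f z)). rewrite Cmod_minus_sym in H. lra.
Qed.

Lemma clim_inv (f : C -> C) (a l : C) :
  clim f a l -> l <> 0 -> clim (fun z => / f z) a (/ l).
Proof.
  intros Hf Hl. assert (Hl' := proj1 (Cmod_gt_0 l) Hl).
  assert (Hn := clim_nonzero _ _ _ Hf Hl).
  apply clim_shift.
  apply clim_ext with (fun z => (- / (l * f z)) * (f z - l)).
  { revert Hn. apply filter_imp. intros z Hz.
    assert (f z <> 0) by (apply Cmod_gt_0; lra). field. auto. }
  apply clim_bounded_mult_0 with (M := (/ (Cmod l * (Cmod l / 2)))%R).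
  - revert Hn. apply filter_imp. intros z Hz.
    assert (f z <> 0) by (apply Cmod_gt_0; lra).
    rewrite Cmod_opp, Cmod_inv by now apply Cmult_neq_0.
    rewrite Cmod_mult. apply Rinv_le_contravar.
    + apply Rmult_lt_0_compat; lra.
    + apply Rmult_le_compat_l; lra.
  - now apply clim_shift in Hf.
Qed.

Lemma clim_unique (f : C -> C) (a l m : C) : clim f a l -> clim f a m -> l = m.
Proof.
  intros Hl Hm. apply Ceq_minus. apply NNPP. intros Hne.
  apply Cmod_gt_0 in Hne.
  assert (He2 : 0 < Cmod (l - m) / 2) by lra.
  assert (H := filter_and _ _ (Hl _ He2) (Hm _ He2)).
  apply locally'_disc in H. destruct H as [d [Hd H]].
  assert (Hz : a + RtoC (d / 2) <> a).
  { intros E. apply (f_equal fst) in E. simpl in E. lra. }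
  specialize (H _ Hz).
  replace (a + RtoC (d / 2) - a) with (RtoC (d / 2)) in H by ring.
  rewrite Cmod_R, Rabs_pos_eq in H by lra.
  specialize (H ltac:(lra)). destruct H as [H1 H2].
  set (v := f _) in *.
  assert (H := Cmod_triangle (l - v) (v - m)).
  replace (l - v + (v - m)) with (l - m) in H by ring.
  rewrite (Cmod_minus_sym l v) in H. lra.
Qed.

Lemma clim_comp_affine (f : C -> C) (a b s l : C) : s <> 0 ->
  clim f (s * a + b) l -> clim (fun z => f (s * z + b)) a l.
Proof.
  intros Hs H e He. specialize (H e He). apply locally'_disc in H.
  destruct H as [d [Hd H]]. apply locally'_disc.
  assert (Hs' := proj1 (Cmod_gt_0 s) Hs).
  exists (d / Cmod s)%R. split; [now apply Rdiv_lt_0_compat|].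
  intros z Hz Hzd. apply H.
  - intros E. apply Hz.
    assert (s * (z - a) = 0) by (replace (s * (z - a)) with ((s * z + b) - (s * a + b)) by ring; rewrite E; ring).
    apply NNPP. intros Hne. apply (Cmult_neq_0 s (z - a)); auto.
    intros E'. apply Hne. now apply Ceq_minus.
  - replace (s * z + b - (s * a + b)) with (s * (z - a)) by ring.
    rewrite Cmod_mult. apply Rmult_lt_compat_l with (r := Cmod s) in Hzd; auto.
    replace (Cmod s * (d / Cmod s))%R with d in Hzd by (field; lra). auto.
Qed.

Lemma locally_ne (a b : C) : a <> b -> locally a (fun z => z <> b).
Proof.
  intros H. apply locally_disc. exists (Cmod (b - a)).
  assert (b - a <> 0) by (intros E; apply H; symmetry; now apply Ceq_minus).
  split; [now apply Cmod_gt_0|]. intros z Hz ->. lra.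
Qed.

Lemma locally_locally' (a : C) (P : C -> Prop) : locally a P -> locally' a P.
Proof. unfold locally', within. apply filter_imp. auto. Qed.

Lemma locally'_near (a : C) (P : C -> Prop) :
  locally' a P -> locally' a (fun z => locally z P).
Proof.
  intros H. unfold locally', within in *. apply locally_locally in H.
  revert H. apply filter_imp. intros z Hz Hne.
  generalize (filter_and _ _ Hz (locally_ne z a Hne)). apply filter_imp.
  intros w [H1 H2]. auto.
Qed.

Lemma locally'_ne (a : C) : locally' a (fun z => z <> a).
Proof. unfold locally', within. apply filter_forall. auto. Qed.

Lemma locally'_center (a : C) (P : C -> Prop) : locally' a P -> P a -> locally a P.
Proof.
  unfold locally', within. intros H Ha. revert H. apply filter_imp.
  intros z Hz. destruct (classic (z = a)) as [->|]; auto.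
Qed.

Lemma ccont_disc (f : C -> C) (a : C) :
  ccont f a <-> forall e, 0 < e -> locally a (fun z => Cmod (f z - f a) < e).
Proof.
  unfold ccont, clim. split; intros H e He; specialize (H e He).
  - apply locally'_center; auto. replace (f a - f a) with (RtoC 0) by ring.
    now rewrite Cmod_0.
  - now apply locally_locally'.
Qed.

Lemma ccont_nonzero (f : C -> C) (a : C) :
  ccont f a -> f a <> 0 -> locally a (fun z => f z <> 0).
Proof.
  intros H Ha. apply locally'_center; auto.
  generalize (clim_nonzero _ _ _ H Ha). apply filter_imp. intros z Hz.
  apply Cmod_gt_0 in Ha. apply Cmod_gt_0. lra.
Qed.

Lemma ccont_ext (f g : C -> C) (a : C) :
  locally a (fun z => f z = g z) -> ccont f a -> ccont g a.
Proof.
  intros E H. unfold ccont.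
  rewrite <- (locally_singleton _ _ E).
  apply clim_ext with f; auto. now apply locally_locally'.
Qed.

(** * Complex derivatives *)

Lemma Cderive_unique (f : C -> C) (z l m : C) :
  Cderive_at f z l -> Cderive_at f z m -> l = m.
Proof.
  intros H1 H2. apply is_C_derive_unique in H1, H2. congruence.
Qed.

Lemma Cderive_ext (f g : C -> C) (z l : C) :
  locally z (fun w => f w = g w) -> Cderive_at f z l -> Cderive_at g z l.
Proof.
  intros E H. rewrite Cderive_eps in *. intros e He.
  destruct (H e He) as [d [Hd Hd']].
  assert (E0 := locally_singleton _ _ E).
  apply locally_disc in E. destruct E as [d' [Hd1 E]].
  exists (Rmin d d'). split; [now apply Rmin_pos|].
  intros w Hw. rewrite <- E0, <- E by (eapply Rlt_le_trans; [apply Hw|apply Rmin_r]).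
  apply Hd'. eapply Rlt_le_trans; [apply Hw|apply Rmin_l].
Qed.

Lemma Cderive_eq (f : C -> C) (z l m : C) :
  Cderive_at f z l -> l = m -> Cderive_at f z m.
Proof. intros H <-. exact H. Qed.

Lemma Cderive_cont (f : C -> C) (z l : C) : Cderive_at f z l -> ccont f z.
Proof.
  intros H e He. rewrite Cderive_eps in H.
  destruct (H 1%R ltac:(lra)) as [d [Hd H']].
  assert (HM : 0 < 1 + Cmod l) by (assert (X := Cmod_ge_0 l); lra).
  apply locally'_disc. exists (Rmin d (e / (1 + Cmod l))).
  split; [apply Rmin_pos; auto; now apply Rdiv_lt_0_compat|].
  intros w _ Hw.
  assert (H1 : Cmod (w - z) < d) by (eapply Rlt_le_trans; [apply Hw|apply Rmin_l]).
  assert (H2 : Cmod (w - z) < e / (1 + Cmod l))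
    by (eapply Rlt_le_trans; [apply Hw|apply Rmin_r]).
  specialize (H' w H1).
  assert (H3 := Cmod_triangle (f w - f z - l * (w - z)) (l * (w - z))).
  replace (f w - f z - l * (w - z) + l * (w - z)) with (f w - f z) in H3 by ring.
  rewrite Cmod_mult in H3.
  apply Rmult_lt_compat_l with (r := (1 + Cmod l)%R) in H2; auto.
  replace ((1 + Cmod l) * (e / (1 + Cmod l)))%R with e in H2 by (field; lra). lra.
Qed.

(** [C] has two convertible normed-module structures over itself, which
    unification does not identify. *)
Lemma Cderive_AbsRing (f : C -> C) (z l : C) :
  Cderive_at f z l <->
  is_derive (K := C_AbsRing) (V := AbsRing_NormedModule C_AbsRing) f z l.
Proof.
  split; intros [_ H]; split;
    [apply is_linear_scal_l|exact H|apply is_linear_scal_l|exact H].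
Qed.

Lemma Cderive_const (k z : C) : Cderive_at (fun _ => k) z 0.
Proof. apply (is_derive_const (K := C_AbsRing) (V := C_NormedModule)). Qed.

Lemma Cderive_id (z : C) : Cderive_at (fun w => w) z 1.
Proof. apply Cderive_AbsRing, (is_derive_id (K := C_AbsRing)). Qed.

Lemma Cderive_plus (f g : C -> C) (z l m : C) :
  Cderive_at f z l -> Cderive_at g z m -> Cderive_at (fun w => f w + g w) z (l + m).
Proof. intros Hf Hg. apply (is_derive_plus (K := C_AbsRing) (V := C_NormedModule) f g z l m Hf Hg). Qed.

Lemma Cderive_mult (f g : C -> C) (z l m : C) :
  Cderive_at f z l -> Cderive_at g z m ->
  Cderive_at (fun w => f w * g w) z (l * g z + f z * m).
Proof.
  intros Hf Hg.
  apply Cderive_AbsRing in Hf, Hg. apply Cderive_AbsRing.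
  exact (is_derive_mult (K := C_AbsRing) f g z l m Hf Hg Cmult_comm).
Qed.

Lemma Cderive_comp (f g : C -> C) (z l m : C) :
  Cderive_at f (g z) l -> Cderive_at g z m ->
  Cderive_at (fun w => f (g w)) z (l * m).
Proof.
  intros Hf Hg. apply Cderive_AbsRing in Hg. eapply Cderive_eq.
  - exact (is_derive_comp (K := C_AbsRing) (V := C_NormedModule) f g z l m Hf Hg).
  - unfold scal; simpl; unfold mult; simpl. ring.
Qed.

Lemma Cderive_scal (k : C) (f : C -> C) (z l : C) :
  Cderive_at f z l -> Cderive_at (fun w => k * f w) z (k * l).
Proof.
  intros H. eapply Cderive_eq; [apply Cderive_mult; [apply Cderive_const|exact H]|cbv beta; ring].
Qed.

Lemma Cderive_opp (f : C -> C) (z l : C) :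
  Cderive_at f z l -> Cderive_at (fun w => - f w) z (- l).
Proof.
  intros H. apply Cderive_ext with (fun w => (-1) * f w).
  { apply filter_forall; intros; ring. }
  eapply Cderive_eq; [apply Cderive_scal, H|cbv beta; ring].
Qed.

Lemma Cderive_minus (f g : C -> C) (z l m : C) :
  Cderive_at f z l -> Cderive_at g z m -> Cderive_at (fun w => f w - g w) z (l - m).
Proof. intros. apply Cderive_plus; auto. now apply Cderive_opp. Qed.

(** For inverses, Cauchy integrals and series over the lattice, the error of
    the linear approximation comes with an explicit quadratic bound. *)
Lemma Cderive_quadratic (f : C -> C) (z l : C) (M : R) :
  locally z (fun w => Cmod (f w - f z - l * (w - z)) <= M * (Cmod (w - z) * Cmod (w - z))) ->
  Cderive_at f z l.
Proof.
  intros H. apply Cderive_eps. intros e He.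
  apply locally_disc in H. destruct H as [d [Hd H]].
  assert (HM : 0 < Rabs M + 1) by (assert (X := Rabs_pos M); lra).
  exists (Rmin d (e / (Rabs M + 1))).
  split; [apply Rmin_pos; auto; now apply Rdiv_lt_0_compat|].
  intros w Hw.
  assert (H1 : Cmod (w - z) < d) by (eapply Rlt_le_trans; [apply Hw|apply Rmin_l]).
  assert (H2 : Cmod (w - z) < e / (Rabs M + 1))
    by (eapply Rlt_le_trans; [apply Hw|apply Rmin_r]).
  eapply Rle_trans; [apply H, H1|].
  rewrite <- Rmult_assoc. apply Rmult_le_compat_r; [apply Cmod_ge_0|].
  apply Rmult_lt_compat_l with (r := (Rabs M + 1)%R) in H2; auto.
  replace ((Rabs M + 1) * (e / (Rabs M + 1)))%R with e in H2 by (field; lra).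
  assert (X := Rle_abs M). assert (Y := Cmod_ge_0 (w - z)). nra.
Qed.

Lemma Cderive_inv_id (z : C) : z <> 0 -> Cderive_at (fun w => / w) z (- / (z * z)).
Proof.
  intros Hz. assert (Hz' := proj1 (Cmod_gt_0 z) Hz).
  apply Cderive_quadratic with (M := (/ (Cmod z * Cmod z * (Cmod z / 2)))%R).
  apply locally_disc. exists (Cmod z / 2)%R. split; [lra|].
  intros w Hw.
  assert (Hw' : Cmod z / 2 <= Cmod w).
  { assert (H := Cmod_rev z w). rewrite Cmod_minus_sym in H. lra. }
  assert (w <> 0) by (apply Cmod_gt_0; lra).
  replace (/ w - / z - - / (z * z) * (w - z)) with ((w - z) * (w - z) * / (z * z * w))
    by (field; auto).
  rewrite !Cmod_mult, Cmod_inv by (repeat apply Cmult_neq_0; auto).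
  rewrite !Cmod_mult. rewrite Rmult_comm. apply Rmult_le_compat_r.
  - apply Rmult_le_pos; apply Cmod_ge_0.
  - apply Rinv_le_contravar; [repeat apply Rmult_lt_0_compat; lra|].
    apply Rmult_le_compat_l; auto. apply Rmult_le_pos; lra.
Qed.

Lemma Cderive_inv (f : C -> C) (z l : C) :
  Cderive_at f z l -> f z <> 0 ->
  Cderive_at (fun w => / f w) z (- l / (f z * f z)).
Proof.
  intros H Hz. eapply Cderive_eq.
  - apply (Cderive_comp (fun w => / w) f z); [now apply Cderive_inv_id|exact H].
  - cbv beta; field. auto.
Qed.

Lemma Cderive_div (f g : C -> C) (z l m : C) :
  Cderive_at f z l -> Cderive_at g z m -> g z <> 0 ->
  Cderive_at (fun w => f w / g w) z ((l * g z - f z * m) / (g z * g z)).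
Proof.
  intros Hf Hg Hz. eapply Cderive_eq.
  - apply Cderive_mult; [exact Hf|apply Cderive_inv; eauto].
  - cbv beta; field. auto.
Qed.

Lemma Cderive_pow (f : C -> C) (z l : C) (n : nat) :
  Cderive_at f z l ->
  Cderive_at (fun w => f w ^ n) z (INR n * f z ^ (pred n) * l).
Proof.
  intros H. induction n as [|n IH].
  - simpl. eapply Cderive_eq; [apply Cderive_const|cbv beta; ring].
  - apply Cderive_ext with (fun w => f w * f w ^ n).
    { apply filter_forall; intros; now rewrite Cpow_S. }
    eapply Cderive_eq; [apply Cderive_mult; [exact H|exact IH]|].
    cbv beta; rewrite S_INR, RtoC_plus. simpl pred.
    destruct n; [simpl; ring|]. simpl pred. rewrite (Cpow_S (f z) n). ring.
Qed.

Definition C1_at (f : C -> C) (z : C) : Prop :=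
  Cderive_at f z (C_derive f z) /\ ccont (C_derive f) z.

(** Continuity of the derivative is what allows the differentiation under the
    integral sign in the proof of Cauchy's formula. *)
Definition hol (f : C -> C) (a : C) : Prop := locally a (C1_at f).

Lemma hol_intro (f df : C -> C) (a : C) :
  locally a (fun z => Cderive_at f z (df z) /\ ccont df z) -> hol f a.
Proof.
  intros H. unfold hol.
  assert (E : locally a (fun z => C_derive f z = df z)).
  { revert H. apply filter_imp. intros z [H _]. now apply is_C_derive_unique. }
  apply locally_locally in E.
  generalize (filter_and _ _ H E). apply filter_imp.
  intros z [[H1 H2] E1]. split.
  - now rewrite (locally_singleton _ _ E1).
  - apply ccont_ext with df; auto. revert E1. apply filter_imp. auto.
Qed.

Lemma hol_ext (f g : C -> C) (a : C) :
  locally a (fun z => f z = g z) -> hol f a -> hol g a.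
Proof.
  intros E H. apply hol_intro with (C_derive f).
  apply locally_locally in E.
  generalize (filter_and _ _ E H). apply filter_imp.
  intros z [E' [H1 H2]]. split; auto. now apply Cderive_ext with f.
Qed.

Lemma hol_near (f : C -> C) (a : C) : hol f a -> locally a (hol f).
Proof. apply locally_locally. Qed.

Lemma hol_at (f : C -> C) (a : C) : hol f a -> C1_at f a.
Proof. apply locally_singleton. Qed.

Lemma hol_cont (f : C -> C) (a : C) : hol f a -> ccont f a.
Proof. intros H. apply hol_at in H. eapply Cderive_cont, H. Qed.

Lemma ccont_plus (f g : C -> C) (a : C) : ccont f a -> ccont g a -> ccont (fun z => f z + g z) a.
Proof. apply clim_plus. Qed.

Lemma ccont_mult (f g : C -> C) (a : C) : ccont f a -> ccont g a -> ccont (fun z => f z * g z) a.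
Proof. apply clim_mult. Qed.

Lemma ccont_inv (f : C -> C) (a : C) : ccont f a -> f a <> 0 -> ccont (fun z => / f z) a.
Proof. apply clim_inv. Qed.

Lemma hol_const (k a : C) : hol (fun _ => k) a.
Proof.
  apply hol_intro with (fun _ => RtoC 0). apply filter_forall. intros z. split.
  - apply Cderive_const. - apply clim_const.
Qed.

Lemma hol_id (a : C) : hol (fun z => z) a.
Proof.
  apply hol_intro with (fun _ => RtoC 1). apply filter_forall. intros z. split.
  - apply Cderive_id. - apply clim_const.
Qed.

Lemma hol_plus (f g : C -> C) (a : C) : hol f a -> hol g a -> hol (fun z => f z + g z) a.
Proof.
  intros Hf Hg. apply hol_intro with (fun z => C_derive f z + C_derive g z).
  generalize (filter_and _ _ Hf Hg). apply filter_imp.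
  intros z [[H1 H2] [H3 H4]]. split; [now apply Cderive_plus|now apply ccont_plus].
Qed.

Lemma hol_mult (f g : C -> C) (a : C) : hol f a -> hol g a -> hol (fun z => f z * g z) a.
Proof.
  intros Hf Hg.
  apply hol_intro with (fun z => C_derive f z * g z + f z * C_derive g z).
  generalize (filter_and _ _ (filter_and _ _ Hf Hg) (filter_and _ _ (hol_near _ _ Hf) (hol_near _ _ Hg))).
  apply filter_imp.
  intros z [[[H1 H2] [H3 H4]] [H5 H6]]. apply hol_cont in H5, H6.
  split; [now apply Cderive_mult|]. apply ccont_plus; now apply ccont_mult.
Qed.

Lemma hol_scal (k : C) (f : C -> C) (a : C) : hol f a -> hol (fun z => k * f z) a.
Proof. intros. apply hol_mult; auto. apply hol_const. Qed.

Lemma hol_opp (f : C -> C) (a : C) : hol f a -> hol (fun z => - f z) a.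
Proof.
  intros. apply hol_ext with (fun z => (-1) * f z).
  - apply filter_forall; intros; ring. - now apply hol_scal.
Qed.

Lemma hol_minus (f g : C -> C) (a : C) : hol f a -> hol g a -> hol (fun z => f z - g z) a.
Proof. intros. apply hol_plus; auto. now apply hol_opp. Qed.

Lemma hol_pow (f : C -> C) (a : C) (n : nat) : hol f a -> hol (fun z => f z ^ n) a.
Proof.
  intros H. induction n.
  - exact (hol_const 1 a). - exact (hol_mult _ _ _ H IHn).
Qed.

Lemma locally_comp_affine (P : C -> Prop) (a b s : C) : s <> 0 ->
  locally (s * a + b) P -> locally a (fun z => P (s * z + b)).
Proof.
  intros Hs H. apply locally_disc in H.
  destruct H as [d [Hd H]]. apply locally_disc.
  assert (Hs' := proj1 (Cmod_gt_0 s) Hs).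
  exists (d / Cmod s)%R. split; [now apply Rdiv_lt_0_compat|].
  intros z Hzd. apply H.
  replace (s * z + b - (s * a + b)) with (s * (z - a)) by ring.
  rewrite Cmod_mult. apply Rmult_lt_compat_l with (r := Cmod s) in Hzd; auto.
  replace (Cmod s * (d / Cmod s))%R with d in Hzd by (field; lra). auto.
Qed.

Lemma locally'_comp_affine (P : C -> Prop) (a b s : C) : s <> 0 ->
  locally' (s * a + b) P -> locally' a (fun z => P (s * z + b)).
Proof.
  intros Hs H. unfold locally', within in *.
  apply (locally_comp_affine _ _ _ _ Hs) in H. revert H. apply filter_imp.
  intros z H Hne. apply H. intros E. apply Hne.
  apply Ceq_minus in E. replace (s * z + b - (s * a + b)) with (s * (z - a)) in E by ring.
  apply Ceq_minus. apply NNPP. intros X. now apply (Cmult_neq_0 s (z - a)).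
Qed.

Lemma Cderive_affine (s b z : C) : Cderive_at (fun w => s * w + b) z s.
Proof.
  eapply Cderive_eq.
  - apply Cderive_plus; [apply Cderive_scal, Cderive_id|apply Cderive_const].
  - ring.
Qed.

Lemma Cderive_comp_affine (f : C -> C) (s b z l : C) :
  Cderive_at f (s * z + b) l -> Cderive_at (fun w => f (s * w + b)) z (l * s).
Proof. intros H. apply (Cderive_comp f); auto. apply Cderive_affine. Qed.

Lemma hol_comp_affine (f : C -> C) (a b s : C) : s <> 0 ->
  hol f (s * a + b) -> hol (fun z => f (s * z + b)) a.
Proof.
  intros Hs H.
  apply hol_intro with (fun z => C_derive f (s * z + b) * s).
  apply (locally_comp_affine _ _ _ _ Hs) in H. revert H. apply filter_imp.
  intros z [H1 H2]. split.
  - now apply Cderive_comp_affine.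
  - apply ccont_mult; [|apply clim_const].
    apply (clim_comp_affine (C_derive f)); auto.
Qed.

(** * Functions of real variables, and integrals over a circle *)

(** Joint continuity is what differentiation under the integral sign asks for.
    A function of one variable is treated as a function of two that ignores the
    first, so that one set of rules serves both. *)
Definition cont2 (f : R -> R -> C) (x y : R) : Prop :=
  forall e, 0 < e -> exists d, 0 < d /\
    forall u v, Rabs (u - x) < d -> Rabs (v - y) < d ->
      Cmod (f u v - f x y) < e.

Lemma cont2_const (k : C) (x y : R) : cont2 (fun _ _ => k) x y.
Proof.
  intros e He. exists 1%R. split; [lra|]. intros. replace (k - k) with (RtoC 0) by ring.
  now rewrite Cmod_0.
Qed.

Lemma cont2_comp (g : C -> C) (f : R -> R -> C) (x y : R) :
  ccont g (f x y) -> cont2 f x y -> cont2 (fun u v => g (f u v)) x y.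
Proof.
  intros Hg Hf e He. apply ccont_disc with (e := e) in Hg; auto.
  apply locally_disc in Hg. destruct Hg as [d [Hd Hg]].
  destruct (Hf d Hd) as [d' [Hd' H]]. exists d'. split; auto.
Qed.

Lemma cont2_plus (f g : R -> R -> C) (x y : R) :
  cont2 f x y -> cont2 g x y -> cont2 (fun u v => f u v + g u v) x y.
Proof.
  intros Hf Hg e He.
  destruct (Hf (e / 2)%R) as [d [Hd H]]; [lra|].
  destruct (Hg (e / 2)%R) as [d' [Hd' H']]; [lra|].
  exists (Rmin d d'). split; [now apply Rmin_pos|]. intros u v Hu Hv.
  assert (X := Rmin_l d d'). assert (Y := Rmin_r d d').
  specialize (H u v ltac:(lra) ltac:(lra)). specialize (H' u v ltac:(lra) ltac:(lra)).
  replace (f u v + g u v - (f x y + g x y)) with ((f u v - f x y) + (g u v - g x y)) by ring.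
  eapply Rle_lt_trans; [apply Cmod_triangle|lra].
Qed.

Lemma cont2_mult (f g : R -> R -> C) (x y : R) :
  cont2 f x y -> cont2 g x y -> cont2 (fun u v => f u v * g u v) x y.
Proof.
  intros Hf Hg e He.
  set (A := (Cmod (f x y) + 1)%R). set (B := (Cmod (g x y) + 1)%R).
  assert (HA : 0 < A) by (unfold A; assert (X := Cmod_ge_0 (f x y)); lra).
  assert (HB : 0 < B) by (unfold B; assert (X := Cmod_ge_0 (g x y)); lra).
  destruct (Hf (Rmin 1 (e / 2 / B))) as [d [Hd H]].
  { apply Rmin_pos; [lra|]. apply Rdiv_lt_0_compat; lra. }
  destruct (Hg (e / 2 / A)%R) as [d' [Hd' H']].
  { apply Rdiv_lt_0_compat; lra. }
  exists (Rmin d d'). split; [now apply Rmin_pos|]. intros u v Hu Hv.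
  assert (X := Rmin_l d d'). assert (Y := Rmin_r d d').
  specialize (H u v ltac:(lra) ltac:(lra)). specialize (H' u v ltac:(lra) ltac:(lra)).
  assert (X1 := Rmin_l 1 (e / 2 / B)). assert (Y1 := Rmin_r 1 (e / 2 / B)).
  replace (f u v * g u v - f x y * g x y)
    with (f u v * (g u v - g x y) + (f u v - f x y) * g x y) by ring.
  eapply Rle_lt_trans; [apply Cmod_triangle|]. rewrite !Cmod_mult.
  assert (Hfu : Cmod (f u v) <= A).
  { assert (Z := Cmod_rev (f u v) (f x y)). unfold A. lra. }
  assert (P1 : Cmod (f u v) * Cmod (g u v - g x y) <= A * Cmod (g u v - g x y))
    by (apply Rmult_le_compat_r; auto using Cmod_ge_0).
  assert (P2 : A * Cmod (g u v - g x y) < e / 2).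
  { replace (e / 2)%R with (A * (e / 2 / A))%R by (field; lra).
    now apply Rmult_lt_compat_l. }
  assert (P3 : Cmod (f u v - f x y) * Cmod (g x y) <= (e / 2 / B) * Cmod (g x y)).
  { apply Rmult_le_compat_r; [apply Cmod_ge_0|lra]. }
  assert (P4 : (e / 2 / B) * Cmod (g x y) <= e / 2).
  { replace (e / 2)%R with ((e / 2 / B) * B)%R at 2 by (field; lra).
    apply Rmult_le_compat_l; [apply Rlt_le, Rdiv_lt_0_compat; lra|unfold B; lra]. }
  lra.
Qed.

Lemma cont2_opp (f : R -> R -> C) (x y : R) : cont2 f x y -> cont2 (fun u v => - f u v) x y.
Proof.
  intros H. apply (cont2_comp (fun z => - z)); auto.
  apply clim_opp, clim_id.
Qed.

Lemma cont2_inv (f : R -> R -> C) (x y : R) :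
  cont2 f x y -> f x y <> 0 -> cont2 (fun u v => / f u v) x y.
Proof.
  intros H Hn. apply (cont2_comp (fun z => / z)); auto.
  apply (ccont_inv (fun z => z)); auto. apply clim_id.
Qed.

Lemma cont2_fst (x y : R) : cont2 (fun u _ => RtoC u) x y.
Proof.
  intros e He. exists e. split; auto. intros u v Hu _.
  rewrite <- RtoC_minus, Cmod_R. auto.
Qed.

Definition cis (t : R) : C := (cos t, sin t).

Lemma Cmod_cis (t : R) : Cmod (cis t) = 1%R.
Proof.
  unfold Cmod, cis; simpl. rewrite !Rmult_1_r.
  assert (H := sin2_cos2 t). unfold Rsqr in H.
  replace (cos t * cos t + sin t * sin t)%R with 1%R by lra. apply sqrt_1.
Qed.

Lemma Cmod_le_parts (z : C) : Cmod z <= Rabs (Re z) + Rabs (Im z).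
Proof.
  assert (H := Rabs_pos (Re z)). assert (H' := Rabs_pos (Im z)).
  unfold Cmod. apply Rsqr_incr_0_var; [|lra].
  rewrite Rsqr_sqrt by (simpl; nra). unfold Rsqr. simpl.
  unfold Re, Im in *. destruct z as [x y]; simpl in *.
  assert (X : (x * x = Rabs x * Rabs x)%R) by (rewrite <- Rabs_mult; rewrite Rabs_pos_eq; nra).
  assert (Y : (y * y = Rabs y * Rabs y)%R) by (rewrite <- Rabs_mult; rewrite Rabs_pos_eq; nra).
  nra.
Qed.

Lemma im_le_Cmod (z : C) : Rabs (Im z) <= Cmod z.
Proof. eapply Rle_trans; [|apply Rmax_Cmod]. apply Rmax_r. Qed.

Lemma cont2_cis (x y : R) : cont2 (fun _ v => cis v) x y.
Proof.
  intros e He.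
  assert (Hc := continuity_cos y). assert (Hs := continuity_sin y).
  destruct (Hc (e / 2)%R ltac:(lra)) as [d [Hd H]].
  destruct (Hs (e / 2)%R ltac:(lra)) as [d' [Hd' H']].
  exists (Rmin d d'). split; [now apply Rmin_pos|]. intros u v _ Hv.
  assert (X := Rmin_l d d'). assert (Y := Rmin_r d d').
  eapply Rle_lt_trans; [apply Cmod_le_parts|].
  unfold cis; simpl.
  destruct (Req_dec v y) as [->|Hne].
  - replace (cos y + - cos y)%R with 0%R by ring. replace (sin y + - sin y)%R with 0%R by ring.
    rewrite Rabs_R0. lra.
  - specialize (H v). specialize (H' v). simpl in H, H'. unfold R_dist, Rdist, D_x, no_cond in *.
    assert (Rabs (cos v - cos y) < e / 2)%R by (apply H; split; [auto|lra]).
    assert (Rabs (sin v - sin y) < e / 2)%R by (apply H'; split; [auto|lra]).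
    unfold Rminus in *. lra.
Qed.

Definition rderive (f : R -> C) (t : R) (l : C) : Prop :=
  is_derive (fun s => Re (f s)) t (Re l) /\ is_derive (fun s => Im (f s)) t (Im l).

Lemma is_derive_eps (f : R -> R) (t l : R) :
  is_derive f t l <->
  forall e, 0 < e -> exists d, 0 < d /\
    forall s, Rabs (s - t) < d -> Rabs (f s - f t - l * (s - t)) <= e * Rabs (s - t).
Proof.
  rewrite is_derive_Reals. split.
  - intros H e He. destruct (H e He) as [d Hd]. exists d. split; [apply cond_pos|].
    intros s Hs. destruct (Req_dec s t) as [->|Hne].
    + replace (f t - f t - l * (t - t))%R with 0%R by ring.
      replace (t - t)%R with 0%R by ring. rewrite Rabs_R0. lra.
    + specialize (Hd (s - t)%R ltac:(lra) Hs).
      replace (t + (s - t))%R with s in Hd by ring.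
      replace (f s - f t - l * (s - t))%R with (((f s - f t) / (s - t) - l) * (s - t))%R
        by (field; lra).
      rewrite Rabs_mult. apply Rmult_le_compat_r; [apply Rabs_pos|lra].
  - intros H e He. destruct (H (e / 2)%R ltac:(lra)) as [d [Hd H']].
    exists (mkposreal d Hd). intros h Hh Hhd. simpl in Hhd.
    specialize (H' (t + h)%R). replace (t + h - t)%R with h in H' by ring.
    specialize (H' Hhd).
    replace ((f (t + h) - f t) / h - l)%R with ((f (t + h) - f t - l * h) / h)%R by (field; auto).
    unfold Rdiv. rewrite Rabs_mult, Rabs_inv.
    assert (0 < Rabs h)%R by now apply Rabs_pos_lt.
    apply Rle_lt_trans with (e / 2 * Rabs h * / Rabs h)%R.
    + apply Rmult_le_compat_r; [now apply Rlt_le, Rinv_0_lt_compat|auto].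
    + replace (e / 2 * Rabs h * / Rabs h)%R with (e / 2)%R by (field; lra). lra.
Qed.

Lemma rderive_eps (f : R -> C) (t : R) (l : C) :
  rderive f t l <->
  forall e, 0 < e -> exists d, 0 < d /\
    forall s, Rabs (s - t) < d ->
      Cmod (f s - f t - l * RtoC (s - t)) <= e * Rabs (s - t).
Proof.
  unfold rderive. rewrite !is_derive_eps. split.
  - intros [H1 H2] e He.
    destruct (H1 (e / 2)%R ltac:(lra)) as [d [Hd H]].
    destruct (H2 (e / 2)%R ltac:(lra)) as [d' [Hd' H']].
    exists (Rmin d d'). split; [now apply Rmin_pos|]. intros s Hs.
    assert (X := Rmin_l d d'). assert (Y := Rmin_r d d').
    specialize (H s ltac:(lra)). specialize (H' s ltac:(lra)).
    eapply Rle_trans; [apply Cmod_le_parts|].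
    destruct (f s) as [p q], (f t) as [p' q'], l as [l1 l2]; simpl in *.
    replace (p + - p' + - (l1 * (s - t) - l2 * 0))%R with (p - p' - l1 * (s - t))%R by ring.
    replace (q + - q' + - (l1 * 0 + l2 * (s - t)))%R with (q - q' - l2 * (s - t))%R by ring.
    lra.
  - intros H. split; intros e He; destruct (H e He) as [d [Hd H']]; exists d; split; auto;
      intros s Hs; specialize (H' s Hs).
    + eapply Rle_trans; [|apply H']. eapply Rle_trans; [|apply re_le_Cmod].
      right. f_equal. destruct (f s), (f t), l; simpl. ring.
    + eapply Rle_trans; [|apply H']. eapply Rle_trans; [|apply im_le_Cmod].
      right. f_equal. destruct (f s), (f t), l; simpl. ring.
Qed.

Lemma rderive_comp (g : C -> C) (f : R -> C) (t : R) (l m : C) :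
  Cderive_at g (f t) l -> rderive f t m -> rderive (fun s => g (f s)) t (l * m).
Proof.
  intros Hg Hf. rewrite rderive_eps in *. rewrite Cderive_eps in Hg.
  intros e He.
  set (A := (Cmod m + 1)%R). set (B := (Cmod l + 1)%R).
  assert (HA : 0 < A) by (unfold A; assert (X := Cmod_ge_0 m); lra).
  assert (HB : 0 < B) by (unfold B; assert (X := Cmod_ge_0 l); lra).
  destruct (Hg (e / 2 / A)%R) as [d [Hd H]]; [apply Rdiv_lt_0_compat; lra|].
  destruct (Hf (Rmin 1 (e / 2 / B))) as [d' [Hd' H']].
  { apply Rmin_pos; [lra|]. apply Rdiv_lt_0_compat; lra. }
  exists (Rmin d' (d / A)). split; [apply Rmin_pos; auto; now apply Rdiv_lt_0_compat|].
  intros s Hs.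
  assert (X := Rmin_l d' (d / A)). assert (Y := Rmin_r d' (d / A)).
  specialize (H' s ltac:(lra)).
  assert (X1 := Rmin_l 1 (e / 2 / B)). assert (Y1 := Rmin_r 1 (e / 2 / B)).
  assert (P0 := Rabs_pos (s - t)).
  assert (Q : Cmod (f s - f t) <= A * Rabs (s - t)).
  { replace (f s - f t) with ((f s - f t - m * RtoC (s - t)) + m * RtoC (s - t)) by ring.
    eapply Rle_trans; [apply Cmod_triangle|]. rewrite Cmod_mult, Cmod_R. unfold A. nra. }
  assert (Hd2 : A * Rabs (s - t) < d).
  { replace d with (A * (d / A))%R by (field; lra). apply Rmult_lt_compat_l; lra. }
  specialize (H (f s) ltac:(lra)).
  replace (g (f s) - g (f t) - l * m * RtoC (s - t))
    with ((g (f s) - g (f t) - l * (f s - f t)) + l * (f s - f t - m * RtoC (s - t))) by ring.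
  eapply Rle_trans; [apply Cmod_triangle|]. rewrite Cmod_mult.
  assert (E1 : Cmod (g (f s) - g (f t) - l * (f s - f t)) <= e / 2 * Rabs (s - t)).
  { eapply Rle_trans; [apply H|].
    apply Rle_trans with (e / 2 / A * (A * Rabs (s - t)))%R.
    - apply Rmult_le_compat_l; auto. apply Rlt_le, Rdiv_lt_0_compat; lra.
    - right. field. lra. }
  assert (E2 : Cmod l * Cmod (f s - f t - m * RtoC (s - t)) <= e / 2 * Rabs (s - t)).
  { apply Rle_trans with (B * (e / 2 / B * Rabs (s - t)))%R.
    - apply Rmult_le_compat; try apply Cmod_ge_0; [unfold B; lra|].
      eapply Rle_trans; [apply H'|]. apply Rmult_le_compat_r; lra.
    - right. field. lra. }
  lra.
Qed.

Lemma rderive_cis (t : R) : rderive cis t (Ci * cis t).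
Proof.
  split; unfold cis; simpl.
  - replace (0 * cos t - 1 * sin t)%R with (- sin t)%R by ring.
    apply is_derive_Reals, derivable_pt_lim_cos.
  - replace (0 * sin t + 1 * cos t)%R with (cos t) by ring.
    apply is_derive_Reals, derivable_pt_lim_sin.
Qed.

Lemma rderive_RtoC (t : R) : rderive RtoC t 1.
Proof.
  split; simpl. - apply is_derive_Reals, derivable_pt_lim_id.
  - apply is_derive_Reals, (derivable_pt_lim_const 0 t).
Qed.

Definition cint (f : R -> C) : C :=
  (RInt (fun t => Re (f t)) 0 (2 * PI), RInt (fun t => Im (f t)) 0 (2 * PI)).

Definition rcont (f : R -> C) : Prop := forall x t, cont2 (fun _ => f) x t.

Lemma rcont_parts (f : R -> C) (t : R) : rcont f ->
  continuous (fun s => Re (f s)) t /\ continuous (fun s => Im (f s)) t.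
Proof.
  intros H. split; apply continuity_pt_filterlim; intros e He;
    destruct (H 0%R t e He) as [d [Hd H']]; exists d; split; auto;
    intros s [_ Hs]; simpl in *; unfold R_dist, Rdist in *;
    (eapply Rle_lt_trans; [|apply (H' 0%R s); auto; replace (0 - 0)%R with 0%R by ring; rewrite Rabs_R0; lra]).
  - eapply Rle_trans; [|apply re_le_Cmod]. right. f_equal.
  - eapply Rle_trans; [|apply im_le_Cmod]. right. f_equal.
Qed.

Lemma rcont_ex_RInt (f : R -> C) (a b : R) : rcont f ->
  ex_RInt (fun t => Re (f t)) a b /\ ex_RInt (fun t => Im (f t)) a b.
Proof.
  intros H. split; apply (ex_RInt_continuous (V := R_CompleteNormedModule)); intros t _; now apply rcont_parts.
Qed.

Lemma cint_ext (f g : R -> C) : (forall t, f t = g t) -> cint f = cint g.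
Proof.
  intros H. unfold cint. f_equal; apply RInt_ext; intros; now rewrite H.
Qed.

Lemma cint_plus (f g : R -> C) : rcont f -> rcont g ->
  cint (fun t => f t + g t) = cint f + cint g.
Proof.
  intros Hf Hg. unfold cint.
  destruct (rcont_ex_RInt f 0 (2 * PI) Hf). destruct (rcont_ex_RInt g 0 (2 * PI) Hg).
  unfold Cplus; simpl. f_equal.
  - rewrite <- (RInt_plus (V := R_CompleteNormedModule)); auto.
  - rewrite <- (RInt_plus (V := R_CompleteNormedModule)); auto.
Qed.

Lemma rcont_const (k : C) : rcont (fun _ => k).
Proof. intros x t. apply cont2_const. Qed.

Lemma rcont_mult (f g : R -> C) : rcont f -> rcont g -> rcont (fun t => f t * g t).
Proof. intros Hf Hg x t. apply (cont2_mult (fun _ => f) (fun _ => g)); auto. Qed.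

Lemma cint_scal (k : C) (f : R -> C) : rcont f -> cint (fun t => k * f t) = k * cint f.
Proof.
  intros Hf. destruct (rcont_ex_RInt f 0 (2 * PI) Hf) as [H1 H2].
  unfold cint. destruct k as [k1 k2]. unfold Cmult; simpl.
  f_equal.
  - rewrite (RInt_ext _ (fun t => minus (scal k1 (Re (f t))) (scal k2 (Im (f t))))).
    + rewrite (RInt_minus (V := R_CompleteNormedModule)); [|now apply (ex_RInt_scal (V := R_CompleteNormedModule))..].
      now rewrite !(RInt_scal (V := R_CompleteNormedModule)) by auto.
    + intros. reflexivity.
  - rewrite (RInt_ext _ (fun t => plus (scal k1 (Im (f t))) (scal k2 (Re (f t))))).
    + rewrite (RInt_plus (V := R_CompleteNormedModule)); [|now apply (ex_RInt_scal (V := R_CompleteNormedModule))..].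
      now rewrite !(RInt_scal (V := R_CompleteNormedModule)) by auto.
    + intros. reflexivity.
Qed.

(** Multiplying by the conjugate of the integral makes the integral real and
    nonnegative, and reduces the bound to that of a real integral. *)
Lemma cint_bound (f : R -> C) (M : R) : rcont f ->
  (forall t, 0 <= t <= 2 * PI -> Cmod (f t) <= M) -> Cmod (cint f) <= 2 * PI * M.
Proof.
  intros Hf HM.
  destruct (classic (cint f = 0)) as [E|Hne].
  { rewrite E, Cmod_0. assert (H := PI_RGT_0).
    specialize (HM 0%R ltac:(lra)). assert (X := Cmod_ge_0 (f 0%R)). nra. }
  apply Cmod_gt_0 in Hne. set (I := cint f) in *.
  assert (E : cint (fun t => Cconj I * f t) = Cconj I * I) by now apply cint_scal.
  assert (Hf' : rcont (fun t => Cconj I * f t)) by (apply rcont_mult; auto using rcont_const).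
  assert (E' : RInt (fun t => Re (Cconj I * f t)) 0 (2 * PI) = (Cmod I * Cmod I)%R).
  { apply (f_equal Re) in E. unfold cint at 1 in E.
    transitivity (Re (Cconj I * I)); [exact E|].
    rewrite Cmult_comm, <- Cmod2_conj. simpl. ring. }
  assert (B : RInt (fun t => Re (Cconj I * f t)) 0 (2 * PI)
               <= RInt (fun _ => Cmod I * M)%R 0 (2 * PI)).
  { assert (H := PI_RGT_0). apply RInt_le; [lra| |apply ex_RInt_const|].
    - exact (proj1 (rcont_ex_RInt _ 0 (2 * PI) Hf')).
    - intros t Ht. eapply Rle_trans; [apply Rle_abs|]. eapply Rle_trans; [apply re_le_Cmod|].
      rewrite Cmod_mult, Cmod_conj. apply Rmult_le_compat_l; [lra|apply HM; lra]. }
  rewrite E', RInt_const in B. unfold scal in B; simpl in B. unfold mult in B; simpl in B.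
  apply Rmult_le_reg_l with (Cmod I); auto. lra.
Qed.

Lemma cint_derive (f df : R -> C) :
  (forall t, rderive f t (df t)) -> rcont df -> f (2 * PI)%R = f 0%R -> cint df = 0.
Proof.
  intros H Hc E. unfold cint.
  assert (H1 := is_RInt_derive (fun s => Re (f s)) (fun s => Re (df s)) 0 (2 * PI)
    (fun t _ => proj1 (H t)) (fun t _ => proj1 (rcont_parts _ t Hc))).
  assert (H2 := is_RInt_derive (fun s => Im (f s)) (fun s => Im (df s)) 0 (2 * PI)
    (fun t _ => proj2 (H t)) (fun t _ => proj2 (rcont_parts _ t Hc))).
  apply is_RInt_unique in H1, H2. rewrite H1, H2, E.
  unfold minus, plus, opp; simpl. unfold RtoC. f_equal; ring.
Qed.

(** Differentiation under the integral sign: the derivative in the parameter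
    integrates to zero, so the integral does not move. The margin [e] makes
    both end points of the parameter interior. *)
Lemma cint_homotopy (K dK : R -> R -> C) (e : R) : 0 < e ->
  (forall x t, - e < x < 1 + e -> rderive (fun s => K s t) x (dK x t)) ->
  (forall x t, - e < x < 1 + e -> cont2 dK x t) ->
  (forall x, - e < x < 1 + e -> rcont (K x)) ->
  (forall x, 0 <= x <= 1 -> cint (dK x) = 0) ->
  cint (K 1%R) = cint (K 0%R).
Proof.
  intros He HD Hc HK H0.
  assert (Hloc : forall x, 0 <= x <= 1 -> locally x (fun y => - e < y < 1 + e)%R).
  { intros x Hx. exists (mkposreal e He). intros y Hy.
    unfold ball in Hy; simpl in Hy. unfold AbsRing_ball, abs, minus, plus, opp in Hy; simpl in Hy.
    apply Rabs_def2 in Hy. lra. }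
  assert (Hin : forall x, 0 <= x <= 1 -> - e < x < 1 + e) by (intros; lra).
  assert (Main : forall (P : C -> R), (P = Re \/ P = Im) ->
    RInt (fun t => P (K 0%R t)) 0 (2 * PI) = RInt (fun t => P (K 1%R t)) 0 (2 * PI)).
  { intros P HP.
    assert (HDP : forall x t, - e < x < 1 + e ->
              is_derive (fun s => P (K s t)) x (P (dK x t))).
    { intros x t Hx. destruct HP as [->| ->]; now apply HD. }
    apply (eq_is_derive (V := R_NormedModule) (fun x => RInt (fun t => P (K x t)) 0 (2 * PI)));
      [|lra].
    intros x Hx.
    assert (E : RInt (fun t => Derive (fun s => P (K s t)) x) 0 (2 * PI) = 0%R).
    { rewrite (RInt_ext _ (fun t => P (dK x t))).
      - specialize (H0 x Hx). unfold cint in H0. apply (f_equal P) in H0.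
        destruct HP as [->| ->]; exact H0.
      - intros t _. apply is_derive_unique. apply HDP; auto. }
    enough (HH : is_derive (fun x => RInt (fun t => P (K x t)) 0 (2 * PI)) x
                   (RInt (fun t => Derive (fun s => P (K s t)) x) 0 (2 * PI)))
      by (rewrite E in HH; exact HH).
    apply is_derive_RInt_param.
    - generalize (Hloc x Hx). apply filter_imp. intros y Hy t _. eexists. now apply HDP.
    - intros t _.
      apply continuity_2d_pt_ext_loc with (fun u v => P (dK u v)).
      + destruct (Hloc x Hx) as [d Hd]. exists d. intros u v Hu _.
        symmetry. apply is_derive_unique, HDP, Hd. exact Hu.
      + intros eps. destruct (Hc x t (Hin x Hx) eps (cond_pos eps)) as [d [Hd H]].
        exists (mkposreal d Hd). simpl. intros u v Hu Hv. specialize (H u v Hu Hv).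
        eapply Rle_lt_trans; [|exact H].
        destruct HP as [->| ->].
        * eapply Rle_trans; [|apply re_le_Cmod]. right. f_equal.
        * eapply Rle_trans; [|apply im_le_Cmod]. right. f_equal.
    - generalize (Hloc x Hx). apply filter_imp. intros y Hy.
      destruct HP as [->| ->]; apply (rcont_ex_RInt (K y) 0 (2 * PI) (HK y Hy)). }
  unfold cint. f_equal; symmetry; apply Main; auto.
Qed.

(** * Cauchy's integral formula *)

Definition circ (a : C) (r t : R) : C := a + RtoC r * cis t.
Definition dcirc (r t : R) : C := RtoC r * (Ci * cis t).

Lemma rderive_affine (k b : C) (f : R -> C) (t : R) (m : C) :
  rderive f t m -> rderive (fun s => k * f s + b) t (k * m).
Proof. intros H. apply (rderive_comp (fun z => k * z + b)); auto. apply Cderive_affine. Qed.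

Lemma rderive_ext (f g : R -> C) (t : R) (l m : C) :
  (forall s, f s = g s) -> l = m -> rderive f t l -> rderive g t m.
Proof.
  intros E <- [H1 H2]. split; (eapply is_derive_ext; [|eassumption]); intros s; simpl; now rewrite E.
Qed.

Lemma rderive_circ (a : C) (r t : R) : rderive (circ a r) t (dcirc r t).
Proof.
  unfold circ, dcirc. eapply rderive_ext; [| |apply (rderive_affine r a), rderive_cis].
  - intros s. simpl. ring. - reflexivity.
Qed.

Lemma rcont_cis : rcont cis.
Proof. intros x t. apply cont2_cis. Qed.

Lemma rcont_plus (f g : R -> C) : rcont f -> rcont g -> rcont (fun t => f t + g t).
Proof. intros Hf Hg x t. apply (cont2_plus (fun _ => f) (fun _ => g)); auto. Qed.

Lemma rcont_circ (a : C) (r : R) : rcont (circ a r).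
Proof. apply rcont_plus; [apply rcont_const|]. apply rcont_mult; auto using rcont_const, rcont_cis. Qed.

Lemma rcont_dcirc (r : R) : rcont (dcirc r).
Proof. repeat apply rcont_mult; auto using rcont_const, rcont_cis. Qed.

Lemma rcont_inv (f : R -> C) : rcont f -> (forall t, f t <> 0) -> rcont (fun t => / f t).
Proof. intros Hf Hn x t. apply (cont2_inv (fun _ => f)); auto. Qed.

Lemma rcont_comp (g : C -> C) (f : R -> C) :
  rcont f -> (forall t, ccont g (f t)) -> rcont (fun t => g (f t)).
Proof. intros Hf Hg x t. apply (cont2_comp g (fun _ => f)); auto. Qed.

Lemma Cmod_circ (a : C) (r t : R) : 0 <= r -> Cmod (circ a r t - a) = r.
Proof.
  intros Hr. unfold circ. replace (a + r * cis t - a) with (r * cis t) by ring.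
  rewrite Cmod_mult, Cmod_cis, Cmod_R, Rabs_pos_eq; auto. ring.
Qed.

Lemma circ_far (a z : C) (r t : R) : 0 <= r ->
  r - Cmod (z - a) <= Cmod (circ a r t - z).
Proof.
  intros Hr. assert (H := Cmod_rev (circ a r t - a) (z - a)).
  rewrite Cmod_circ in H by auto.
  replace (circ a r t - a - (z - a)) with (circ a r t - z) in H by ring. exact H.
Qed.

Lemma circ_ne (a z : C) (r t : R) : Cmod (z - a) < r -> circ a r t - z <> 0.
Proof.
  intros H. assert (X := Cmod_ge_0 (z - a)).
  assert (H' := circ_far a z r t ltac:(lra)). apply Cmod_gt_0. lra.
Qed.

Lemma circ_closed (a : C) (r : R) : circ a r (2 * PI) = circ a r 0.
Proof. unfold circ, cis. now rewrite cos_2PI, sin_2PI, cos_0, sin_0. Qed.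

(** Around the centre the integrand is constant. Moving the point inside the
    circle changes the integrand by the derivative of a closed function, whose
    integral is zero. *)
Lemma cint_winding (a z : C) (r : R) : Cmod (z - a) < r ->
  cint (fun t => dcirc r t * / (circ a r t - z)) = 2 * PI * Ci.
Proof.
  intros Hz.
  assert (Hr : 0 < r) by (assert (X := Cmod_ge_0 (z - a)); lra).
  set (w := z - a) in *.
  set (e := ((r - Cmod w) / (2 * r))%R).
  assert (He : 0 < e) by (apply Rdiv_lt_0_compat; lra).
  assert (Hp : forall x : R, - e < x < 1 + e -> Cmod (a + RtoC x * w - a) < r).
  { intros x Hx. replace (a + RtoC x * w - a) with (RtoC x * w) by ring.
    rewrite Cmod_mult, Cmod_R.
    assert (E : (e * (2 * r) = r - Cmod w)%R) by (unfold e; field; lra).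
    assert (X := Cmod_ge_0 w).
    assert (Rabs x < 1 + e)%R by (apply Rabs_def1; lra). nra. }
  assert (H := cint_homotopy
    (fun x t => dcirc r t * / (circ a r t - (a + RtoC x * w)))
    (fun x t => dcirc r t * (w * / ((circ a r t - (a + RtoC x * w)) * (circ a r t - (a + RtoC x * w)))))
    e He).
  cbv beta in H.
  assert (Hd : forall x t, - e < x < 1 + e -> circ a r t - (a + RtoC x * w) <> 0).
  { intros x t Hx. apply circ_ne, Hp, Hx. }
  rewrite (cint_ext _ (fun t => dcirc r t * / (circ a r t - (a + RtoC 1 * w)))).
  2:{ intros t. unfold w. do 3 f_equal. ring. }
  rewrite H; clear H.
  - rewrite (cint_ext _ (fun t => Ci)).
    + unfold cint; simpl. rewrite !RInt_const. unfold scal; simpl; unfold mult; simpl.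
      unfold Cmult; simpl. f_equal; ring.
    + intros t. unfold dcirc, circ.
      assert (cis t <> 0) by (apply Cmod_gt_0; rewrite Cmod_cis; lra).
      assert (RtoC r <> 0) by (intros E; apply RtoC_inj in E; lra).
      replace (a + r * cis t - (a + 0 * w)) with (r * cis t) by ring.
      field. auto.
  - intros x t Hx.
    eapply rderive_ext; [| |eapply (rderive_comp
      (fun u => dcirc r t * / (circ a r t - (a + u * w))) RtoC x _ 1)].
    + reflexivity.
    + rewrite Cmult_1_r. reflexivity.
    + eapply Cderive_eq; [apply Cderive_scal, Cderive_inv|].
      * apply Cderive_minus; [apply Cderive_const|]. apply Cderive_plus; [apply Cderive_const|].
        apply Cderive_mult; [apply Cderive_id|apply Cderive_const].
      * now apply Hd.
      * specialize (Hd x t Hx). cbv beta. field. auto.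
    + apply rderive_RtoC.
  - intros x t Hx. apply cont2_mult; [apply (rcont_dcirc r)|].
    apply cont2_mult; [apply cont2_const|].
    assert (cont2 (fun x t => circ a r t - (a + RtoC x * w)) x t).
    { apply cont2_plus; [apply (rcont_circ a r)|]. apply cont2_opp. apply cont2_plus; [apply cont2_const|].
      apply cont2_mult; [apply cont2_fst|apply cont2_const]. }
    apply (cont2_inv (fun x t => (circ a r t - (a + RtoC x * w)) * (circ a r t - (a + RtoC x * w)))).
    + now apply cont2_mult. + apply Cmult_neq_0; now apply Hd.
  - intros x Hx. apply rcont_mult; [apply rcont_dcirc|]. apply rcont_inv; [|intros; now apply Hd].
    apply rcont_plus; auto using rcont_circ, rcont_const.
  - intros x Hx. assert (Hx' : - e < x < 1 + e) by lra.
    apply cint_derive with (fun t => - w * / (circ a r t - (a + RtoC x * w))).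
    + intros t.
      eapply rderive_ext; [| |eapply (rderive_comp
        (fun u => - w * / (u - (a + RtoC x * w))) (circ a r) t
        (w * / ((circ a r t - (a + RtoC x * w)) * (circ a r t - (a + RtoC x * w)))) (dcirc r t))].
      * reflexivity.
      * apply Cmult_comm.
      * eapply Cderive_eq; [apply Cderive_scal, Cderive_inv; [|now apply Hd];
          apply Cderive_minus; [apply Cderive_id|apply Cderive_const]|].
        cbv beta. specialize (Hd x t Hx'). field. auto.
      * apply rderive_circ.
    + apply rcont_mult; [apply rcont_dcirc|]. apply rcont_mult; [apply rcont_const|].
      assert (rcont (fun t => circ a r t - (a + RtoC x * w)))
        by (apply rcont_plus; auto using rcont_circ, rcont_const).
      apply (rcont_inv (fun t => (circ a r t - (a + RtoC x * w)) * (circ a r t - (a + RtoC x * w)))).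
      * now apply rcont_mult. * intros t. apply Cmult_neq_0; now apply Hd.
    + now rewrite circ_closed.
Qed.

Lemma C_2PI_Ci_ne : 2 * PI * Ci <> 0.
Proof.
  assert (X := PI_RGT_0). apply Cmult_neq_0; [|apply Ci_nz].
  apply Cmult_neq_0; intros E; apply RtoC_inj in E; lra.
Qed.

(** Shrink the circle to [z] along the rays from [z]. The derivative of the
    integrand in the shrinking parameter [x] is, as a function of the angle,
    the derivative of [/ x * g] along the shrunken circle, so the integral does
    not move; at the end only [g z] times the winding number remains. *)
Lemma Cauchy_formula (g : C -> C) (a z : C) (r R0 : R) :
  r < R0 -> (forall u, Cmod (u - a) < R0 -> C1_at g u) -> Cmod (z - a) < r ->
  cint (fun t => g (circ a r t) * dcirc r t * / (circ a r t - z)) = 2 * PI * Ci * g z.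
Proof.
  intros HR Hg Hz.
  assert (Hr : 0 < r) by (assert (X := Cmod_ge_0 (z - a)); lra).
  set (e := ((R0 - r) / (2 * r))%R).
  assert (He : 0 < e) by (apply Rdiv_lt_0_compat; lra).
  assert (Hin : forall x t, - e < x < 1 + e ->
            Cmod (z + RtoC x * (circ a r t - z) - a) < R0).
  { intros x t Hx.
    replace (z + RtoC x * (circ a r t - z) - a)
      with (RtoC (1 - x) * (z - a) + RtoC x * (circ a r t - a))
      by (rewrite RtoC_minus; ring).
    eapply Rle_lt_trans; [apply Cmod_triangle|]. rewrite !Cmod_mult, !Cmod_R, Cmod_circ by lra.
    assert (E : (e * (2 * r) = R0 - r)%R) by (unfold e; field; lra).
    assert (X := Cmod_ge_0 (z - a)). assert (X1 := Rabs_pos (1 - x)).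
    assert (Y : Rabs (1 - x) + Rabs x < 1 + 2 * e).
    { unfold Rabs. destruct (Rcase_abs (1 - x)), (Rcase_abs x); lra. }
    assert (Rabs (1 - x) * Cmod (z - a) <= Rabs (1 - x) * r)%R by (apply Rmult_le_compat_l; lra).
    nra. }
  assert (Hne : forall t, circ a r t - z <> 0) by (intros; now apply circ_ne).
  set (p := fun (x t : R) => z + RtoC x * (circ a r t - z)).
  assert (Hcp : forall x t, cont2 p x t).
  { intros x t. apply cont2_plus; [apply cont2_const|]. apply cont2_mult; [apply cont2_fst|].
    apply cont2_plus; [apply (rcont_circ a r)|apply cont2_const]. }
  assert (Hq : rcont (fun t => dcirc r t * / (circ a r t - z))).
  { apply rcont_mult; [apply rcont_dcirc|]. apply rcont_inv; auto.
    apply rcont_plus; auto using rcont_circ, rcont_const. }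
  assert (H := cint_homotopy
    (fun x t => g (p x t) * (dcirc r t * / (circ a r t - z)))
    (fun x t => C_derive g (p x t) * dcirc r t) e He).
  cbv beta in H.
  rewrite (cint_ext _ (fun t => g (p 1%R t) * (dcirc r t * / (circ a r t - z)))).
  2:{ intros t. unfold p. replace (z + RtoC 1 * (circ a r t - z)) with (circ a r t) by ring. ring. }
  rewrite H; clear H.
  - rewrite (cint_ext _ (fun t => g z * (dcirc r t * / (circ a r t - z)))).
    2:{ intros t. unfold p. replace (z + RtoC 0 * (circ a r t - z)) with z by ring. ring. }
    rewrite cint_scal by auto. rewrite cint_winding by auto. ring.
  - intros x t Hx.
    eapply rderive_ext; [| |eapply (rderive_comp
      (fun u => g (z + u * (circ a r t - z)) * (dcirc r t * / (circ a r t - z))) RtoC x _ 1)].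
    + reflexivity.
    + rewrite Cmult_1_r. reflexivity.
    + eapply Cderive_eq.
      * apply Cderive_mult; [|apply Cderive_const].
        apply (Cderive_comp g (fun u => z + u * (circ a r t - z))).
        -- apply (Hg (z + RtoC x * (circ a r t - z))). now apply Hin.
        -- apply Cderive_plus; [apply Cderive_const|]. apply Cderive_mult; [apply Cderive_id|apply Cderive_const].
      * specialize (Hne t). unfold p. cbv beta. field. auto.
    + apply rderive_RtoC.
  - intros x t Hx. apply cont2_mult; [|apply (rcont_dcirc r)].
    apply (cont2_comp (C_derive g)); [|apply Hcp]. apply Hg. now apply Hin.
  - intros x Hx. apply rcont_mult; auto.
    intros x' t. apply (cont2_comp g (fun _ t => p x t)).
    + eapply Cderive_cont, Hg. now apply Hin.
    + unfold p. apply (rcont_plus (fun _ => z)); [apply rcont_const|].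
      apply rcont_mult; [apply rcont_const|]. apply rcont_plus; auto using rcont_circ, rcont_const.
  - intros x Hx. assert (Hx' : - e < x < 1 + e) by lra.
    assert (Hc : rcont (fun t => C_derive g (p x t) * dcirc r t)).
    { apply rcont_mult; [|apply rcont_dcirc].
      intros x' t. apply (cont2_comp (C_derive g) (fun _ t => p x t)).
      - apply Hg. now apply Hin.
      - unfold p. apply (rcont_plus (fun _ => z)); [apply rcont_const|].
        apply rcont_mult; [apply rcont_const|]. apply rcont_plus; auto using rcont_circ, rcont_const. }
    (* at [x = 0] the shrunken circle is a point, and the primitive below would
       have a vanishing denominator *)
    destruct (Req_dec x 0) as [E0|Hx0].
    + subst x.
      apply cint_derive with (fun t => C_derive g z * circ a r t + 0); auto.
      * intros t. eapply rderive_ext; [| |apply rderive_affine, rderive_circ].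
        -- reflexivity.
        -- unfold p. replace (z + RtoC 0 * (circ a r t - z)) with z by ring. reflexivity.
      * now rewrite circ_closed.
    + assert (Hx1 : RtoC x <> 0) by (intros E; apply RtoC_inj in E; lra).
      apply cint_derive with (fun t => / RtoC x * g (p x t)); auto.
      * intros t. unfold p.
        eapply rderive_ext; [| |eapply (rderive_comp
          (fun u => / RtoC x * g (z + RtoC x * (u - z))) (circ a r) t _ (dcirc r t))].
        -- reflexivity.
        -- reflexivity.
        -- eapply Cderive_eq.
           ++ apply Cderive_scal. apply (Cderive_comp g (fun u => z + RtoC x * (u - z))).
              ** apply (Hg (z + RtoC x * (circ a r t - z))). now apply Hin.
              ** apply Cderive_plus; [apply Cderive_const|]. apply Cderive_scal.
                 apply Cderive_minus; [apply Cderive_id|apply Cderive_const].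
           ++ cbv beta. field. auto.
        -- apply rderive_circ.
      * unfold p. now rewrite circ_closed.
Qed.

(** * Consequences of Cauchy's formula *)

Lemma rcont_bounded (f : R -> C) : rcont f ->
  exists B, 0 <= B /\ forall t, 0 <= t <= 2 * PI -> Cmod (f t) <= B.
Proof.
  intros Hf. assert (HPI := PI_RGT_0).
  destruct (continuity_ab_maj (fun t => Cmod (f t)) 0 (2 * PI)) as [m [Hm _]].
  - lra.
  - intros t _ e He. destruct (Hf 0%R t e He) as [d [Hd H]]. exists d. split; auto.
    intros s [_ Hs]. simpl in *. unfold R_dist, Rdist in *.
    eapply Rle_lt_trans; [|apply (H 0%R s); [rewrite Rminus_diag, Rabs_R0; lra|exact Hs]].
    apply Rabs_le. assert (X := Cmod_rev (f s) (f t)). assert (Y := Cmod_rev (f t) (f s)).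
    rewrite (Cmod_minus_sym (f t)) in Y. lra.
  - exists (Cmod (f m)). split; [apply Cmod_ge_0|exact Hm].
Qed.

Lemma cint_lin3 (f g h : R -> C) (k : C) : rcont f -> rcont g -> rcont h ->
  cint f - cint g - k * cint h = cint (fun t => f t - g t - k * h t).
Proof.
  intros Hf Hg Hh.
  rewrite (cint_ext (fun t => f t - g t - k * h t) (fun t => (f t + (-1) * g t) + (-k) * h t))
    by (intros; ring).
  rewrite (cint_plus (fun t => f t + (-1) * g t) (fun t => (-k) * h t)),
    (cint_plus f (fun t => (-1) * g t)), !cint_scal;
    auto using rcont_mult, rcont_const, rcont_plus.
  ring.
Qed.

Lemma rcont_pow (f : R -> C) (n : nat) : rcont f -> rcont (fun t => f t ^ n).
Proof.
  intros H. induction n; [exact (rcont_const 1)|exact (rcont_mult _ _ H IHn)].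
Qed.

(** Second-order Taylor remainder of [x |-> x ^ (- k)]; [u] and [v] are the
    inverses of two points at distance [h]. *)
Lemma inv_pow_remainder (k : nat) (D : R) : 0 <= D ->
  exists M, 0 <= M /\ forall u v h : C, u - v = h * u * v ->
    Cmod u <= D -> Cmod v <= D ->
    Cmod (u ^ k - v ^ k - INR k * h * v ^ (S k)) <= M * (Cmod h * Cmod h).
Proof.
  intros HD. induction k as [|k [M [HM IH]]].
  - exists 0%R. split; [lra|]. intros u v h _ _ _. simpl.
    match goal with |- (Cmod ?e <= _)%R => replace e with (RtoC 0) by ring end.
    rewrite Cmod_0. lra.
  - exists (D * M + INR (S k) * (D * D ^ (S (S k))))%R. split.
    { apply Rplus_le_le_0_compat; repeat apply Rmult_le_pos; auto using pos_INR, pow_le. }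
    intros u v h E Hu Hv. specialize (IH u v h E Hu Hv).
    replace (u ^ S k - v ^ S k - INR (S k) * h * v ^ S (S k))
      with (u * (u ^ k - v ^ k - INR k * h * v ^ (S k)) + INR (S k) * (h * h) * (u * v ^ (S (S k)))).
    2:{ rewrite S_INR, RtoC_plus, !Cpow_S.
        transitivity (u * u ^ k - v ^ k * v - (RtoC (INR k) + 1) * h * (v * (v * v ^ k)) + 
          (v ^ k * (v + h * u * v - u) + (RtoC (INR k) + 1) * h * v * v ^ k * (v + h * u * v - u))); [ring|].
        rewrite <- E. ring. }
    eapply Rle_trans; [apply Cmod_triangle|].
    rewrite !Cmod_mult, Cmod_R, Cmod_pow, (Rabs_pos_eq (INR (S k))) by apply pos_INR.
    assert (P := Cmod_ge_0 h). assert (Q := Cmod_ge_0 u). assert (Q' := Cmod_ge_0 v).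
    assert (X1 : Cmod u * Cmod (u ^ k - v ^ k - INR k * h * v ^ (S k)) <= D * (M * (Cmod h * Cmod h)))
      by (apply Rmult_le_compat; auto using Cmod_ge_0).
    assert (X2 : Cmod u * Cmod v ^ S (S k) <= D * D ^ S (S k))
      by (apply Rmult_le_compat; auto using pow_le, pow_incr).
    assert (X3 := Rmult_le_compat_l (INR (S k) * (Cmod h * Cmod h)) _ _
       (Rmult_le_pos _ _ (pos_INR _) (Rmult_le_pos _ _ P P)) X2).
    lra.
Qed.

(** The Cauchy integral of order [k] of a density on the circle.
    Differentiating in [z] raises [k], so these functions are as smooth as one
    wishes. The factor [2 PI i] is left out, and [dcirc] is part of the
    density. *)
Definition Phi (phi : R -> C) (a : C) (r : R) (k : nat) (z : C) : C :=
  cint (fun t => phi t * (/ (circ a r t - z)) ^ k).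

Lemma rcont_kernel (phi : R -> C) (a z : C) (r : R) (k : nat) : rcont phi ->
  Cmod (z - a) < r -> rcont (fun t => phi t * (/ (circ a r t - z)) ^ k).
Proof.
  intros H Hz. apply rcont_mult; auto. apply rcont_pow, rcont_inv.
  - apply rcont_plus; auto using rcont_circ, rcont_const.
  - intros t. now apply circ_ne.
Qed.

Lemma Phi_derive (phi : R -> C) (a z : C) (r : R) (k : nat) : rcont phi ->
  Cmod (z - a) < r ->
  Cderive_at (Phi phi a r k) z (INR k * Phi phi a r (S k) z).
Proof.
  intros Hphi Hz.
  destruct (rcont_bounded phi Hphi) as [B [HB0 HB]].
  set (d := ((r - Cmod (z - a)) / 2)%R). assert (Hd : 0 < d) by (unfold d; lra).
  assert (Hid : 0 < / d) by now apply Rinv_0_lt_compat.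
  destruct (inv_pow_remainder k (/ d)) as [M [HM0 HM]]; [lra|].
  apply Cderive_quadratic with (2 * PI * (B * M))%R.
  apply locally_disc. exists d. split; auto. intros w Hw.
  assert (Hr : 0 <= r) by (assert (X := Cmod_ge_0 (z - a)); lra).
  assert (Hw' : Cmod (w - a) < r - d).
  { replace (w - a) with ((w - z) + (z - a)) by ring.
    eapply Rle_lt_trans; [apply Cmod_triangle|]. unfold d in *. lra. }
  assert (Hwr : Cmod (w - a) < r) by lra.
  unfold Phi. rewrite (Cmult_comm _ (w - z)), Cmult_assoc.
  rewrite cint_lin3 by now apply rcont_kernel.
  eapply Rle_trans.
  - apply cint_bound with (M := (B * (M * (Cmod (w - z) * Cmod (w - z))))%R).
    + assert (R1 := rcont_kernel phi a w r k Hphi Hwr).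
      assert (R2 := rcont_kernel phi a z r k Hphi Hz).
      assert (R3 := rcont_kernel phi a z r (S k) Hphi Hz).
      intros x t. apply (cont2_plus (fun _ t => _) (fun _ t => _)).
      * apply (cont2_plus (fun _ t => _) (fun _ t => _)); [apply R1|].
        apply (cont2_opp (fun _ t => _)). apply R2.
      * apply (cont2_opp (fun _ t => _)).
        apply (cont2_mult (fun _ t => _) (fun _ t => _)); [apply cont2_const|apply R3].
    + intros t Ht.
      assert (N1 := circ_ne a z r t Hz). assert (N2 := circ_ne a w r t Hwr).
      assert (F1 := circ_far a z r t Hr). assert (F2 := circ_far a w r t Hr).
      assert (F1' : d <= Cmod (circ a r t - z)) by (unfold d in *; lra).
      set (v := / (circ a r t - z)). set (u := / (circ a r t - w)).
      replace (phi t * u ^ k - phi t * v ^ k - (w - z) * RtoC (INR k) * (phi t * v ^ S k))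
        with (phi t * (u ^ k - v ^ k - INR k * (w - z) * v ^ (S k))) by ring.
      rewrite Cmod_mult. apply Rmult_le_compat; try apply Cmod_ge_0; [now apply HB|].
      apply HM.
      * unfold u, v. field. auto.
      * unfold u. rewrite Cmod_inv by auto. apply Rinv_le_contravar; lra.
      * unfold v. rewrite Cmod_inv by auto. apply Rinv_le_contravar; lra.
  - right. ring.
Qed.

Lemma Phi_hol (phi : R -> C) (a z : C) (r : R) (k : nat) : rcont phi ->
  Cmod (z - a) < r -> hol (Phi phi a r k) z.
Proof.
  intros Hphi Hz. apply hol_intro with (fun z => INR k * Phi phi a r (S k) z).
  apply locally_disc. exists (r - Cmod (z - a))%R. split; [lra|]. intros w Hw.
  assert (Hwr : Cmod (w - a) < r).
  { replace (w - a) with ((w - z) + (z - a)) by ring.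
    eapply Rle_lt_trans; [apply Cmod_triangle|]. lra. }
  split; [now apply Phi_derive|].
  eapply Cderive_cont. apply Cderive_scal. now apply Phi_derive.
Qed.

Definition C1_disc (g : C -> C) (a : C) (R0 : R) : Prop :=
  forall u, Cmod (u - a) < R0 -> C1_at g u.

Lemma hol_C1_disc (g : C -> C) (a : C) :
  hol g a <-> exists R0, 0 < R0 /\ C1_disc g a R0.
Proof. apply locally_disc. Qed.

Lemma C1_disc_hol (g : C -> C) (a z : C) (R0 : R) :
  C1_disc g a R0 -> Cmod (z - a) < R0 -> hol g z.
Proof.
  intros H Hz. apply locally_disc. exists (R0 - Cmod (z - a))%R. split; [lra|].
  intros w Hw. apply H. replace (w - a) with ((w - z) + (z - a)) by ring.
  eapply Rle_lt_trans; [apply Cmod_triangle|]. lra.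
Qed.

Lemma rcont_C1_circ (g : C -> C) (a : C) (r R0 : R) : 0 < r < R0 -> C1_disc g a R0 ->
  rcont (fun t => g (circ a r t)).
Proof.
  intros Hr H. apply rcont_comp; [apply rcont_circ|]. intros t.
  eapply Cderive_cont, H. rewrite Cmod_circ; lra.
Qed.

Lemma Cauchy_Phi (g : C -> C) (a z : C) (r R0 : R) : r < R0 -> C1_disc g a R0 ->
  Cmod (z - a) < r ->
  Phi (fun t => g (circ a r t) * dcirc r t) a r 1 z = 2 * PI * Ci * g z.
Proof.
  intros Hr H Hz. rewrite <- (Cauchy_formula g a z r R0) by auto.
  apply cint_ext. intros t. now rewrite Cpow_1_r.
Qed.

(** By Cauchy's formula [g] is near [a] a Cauchy integral of order 1, hence
    [C_derive g] is one of order 2. *)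
Lemma hol_derive (g : C -> C) (a : C) : hol g a -> hol (C_derive g) a.
Proof.
  intros H. apply hol_C1_disc in H. destruct H as [R0 [HR H]].
  set (r := (R0 / 2)%R). set (phi := fun t => g (circ a r t) * dcirc r t).
  assert (Hphi : rcont phi).
  { apply rcont_mult; [|apply rcont_dcirc]. apply rcont_C1_circ with R0; auto. unfold r; lra. }
  apply hol_ext with (fun z => / (2 * PI * Ci) * Phi phi a r 2 z).
  2:{ apply hol_scal, Phi_hol; auto. replace (a - a) with (RtoC 0) by ring.
      rewrite Cmod_0. unfold r; lra. }
  apply locally_disc. exists r. split; [unfold r; lra|]. intros z Hz.
  symmetry. apply is_C_derive_unique.
  apply Cderive_ext with (fun z => / (2 * PI * Ci) * Phi phi a r 1 z).
  - apply locally_disc. exists (r - Cmod (z - a))%R. split; [lra|]. intros w Hw.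
    assert (Hwr : Cmod (w - a) < r).
    { replace (w - a) with ((w - z) + (z - a)) by ring.
      eapply Rle_lt_trans; [apply Cmod_triangle|]. lra. }
    unfold phi. rewrite (Cauchy_Phi g a w r R0) by (auto; unfold r; lra).
    assert (X := C_2PI_Ci_ne). field. split; [apply Ci_nz|].
    intros E. apply X. rewrite E. ring.
  - eapply Cderive_eq; [apply Cderive_scal, Phi_derive; auto|]. simpl INR. ring.
Qed.

Lemma Cauchy_estimate (g : C -> C) (a z : C) (r R0 B : R) : r < R0 -> C1_disc g a R0 ->
  Cmod (z - a) < r -> 
  (forall t, 0 <= t <= 2 * PI -> Cmod (g (circ a r t)) <= B) ->
  Cmod (g z) <= B * (r / (r - Cmod (z - a))).
Proof.
  intros Hr H Hz HB. assert (X := Cmod_ge_0 (z - a)). assert (HPI := PI_RGT_0).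
  assert (E := Cauchy_formula g a z r R0 Hr H Hz).
  apply (f_equal Cmod) in E. rewrite !Cmod_mult, !Cmod_R, Cmod_Ci in E.
  rewrite !Rabs_pos_eq in E by lra.
  assert (Hi : 0 < / (r - Cmod (z - a))) by (apply Rinv_0_lt_compat; lra).
  assert (Y : 2 * PI * Cmod (g z) <= 2 * PI * (B * (r / (r - Cmod (z - a))))).
  { replace (2 * PI * Cmod (g z))%R with (2 * PI * 1 * Cmod (g z))%R by ring. rewrite <- E.
    apply cint_bound.
    - apply rcont_mult; [apply rcont_mult; [apply rcont_C1_circ with R0; auto; lra|apply rcont_dcirc]|].
      apply rcont_inv; [apply rcont_plus; auto using rcont_circ, rcont_const|].
      intros; now apply circ_ne.
    - intros t Ht. assert (N := circ_ne a z r t Hz). rewrite !Cmod_mult, Cmod_inv by auto.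
      unfold dcirc. rewrite !Cmod_mult, Cmod_Ci, Cmod_cis, Cmod_R, Rabs_pos_eq by lra.
      assert (F := circ_far a z r t ltac:(lra)).
      assert (B1 : Cmod (g (circ a r t)) <= B) by now apply HB.
      rewrite !Rmult_1_r.
      apply Rle_trans with ((B * r) * / (r - Cmod (z - a)))%R; [|right; field; lra].
      assert (Z := Cmod_ge_0 (g (circ a r t))).
      apply Rmult_le_compat; [apply Rmult_le_pos; lra| |apply Rmult_le_compat_r; lra|
        apply Rinv_le_contravar; lra].
      apply Rlt_le, Rinv_0_lt_compat; lra. }
  apply Rmult_le_reg_l with (2 * PI)%R; lra.
Qed.

(** The quotient by [z - a] of a function vanishing at [a] is itself a Cauchy
    integral, so it is holomorphic at [a] too. *)
Lemma C1_disc_divide (g : C -> C) (a : C) (R0 : R) : C1_disc g a R0 -> g a = 0 ->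
  exists h, C1_disc h a R0 /\ forall z, Cmod (z - a) < R0 -> g z = (z - a) * h z.
Proof.
  intros H Ha.
  exists (fun z => if Ceq_dec z a then C_derive g a else g z / (z - a)).
  split.
  2:{ intros z Hz. destruct (Ceq_dec z a) as [->|Hne]; [rewrite Ha; ring|].
      field. intros E. apply Hne. now apply Ceq_minus. }
  intros z0 Hz0. apply hol_at.
  set (r := ((Cmod (z0 - a) + R0) / 2)%R).
  assert (Hr : 0 < r < R0) by (unfold r; assert (X := Cmod_ge_0 (z0 - a)); lra).
  assert (Hz0r : Cmod (z0 - a) < r) by (unfold r; lra).
  assert (Haa : Cmod (a - a) < r)
    by (replace (a - a) with (RtoC 0) by ring; rewrite Cmod_0; lra).
  set (phi := fun t => g (circ a r t) * dcirc r t).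
  assert (Hphi : rcont phi)
    by (apply rcont_mult; [now apply rcont_C1_circ with R0|apply rcont_dcirc]).
  assert (Nca : forall t, circ a r t - a <> 0) by (intros; now apply circ_ne).
  assert (Hic : rcont (fun t => / (circ a r t - a))).
  { apply rcont_inv; auto. apply rcont_plus; auto using rcont_circ, rcont_const. }
  set (psi := fun t => phi t * / (circ a r t - a)).
  assert (Hpsi : rcont psi) by now apply rcont_mult.
  assert (NP := C_2PI_Ci_ne). set (K := 2 * PI * Ci) in *.
  apply hol_ext with (fun z => / K * Phi psi a r 1 z); [|now apply hol_scal, Phi_hol].
  apply locally_disc. exists (r - Cmod (z0 - a))%R. split; [lra|]. intros z Hz.
  assert (Hzr : Cmod (z - a) < r).
  { replace (z - a) with ((z - z0) + (z0 - a)) by ring.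
    eapply Rle_lt_trans; [apply Cmod_triangle|]. lra. }
  destruct (Ceq_dec z a) as [->|Hne].
  - symmetry. apply is_C_derive_unique.
    apply Cderive_ext with (fun z => / K * Phi phi a r 1 z).
    + apply locally_disc. exists r. split; [lra|]. intros w Hw.
      unfold phi. rewrite (Cauchy_Phi g a w r R0) by (auto; lra). fold K. field. auto.
    + eapply Cderive_eq; [apply Cderive_scal, Phi_derive; auto|].
      simpl INR. rewrite Cmult_1_l. f_equal. apply cint_ext. intros t. unfold psi.
      rewrite Cpow_1_r. simpl. ring.
  - assert (Hne' : z - a <> 0) by (intros E; apply Hne; now apply Ceq_minus).
    assert (E : Phi phi a r 1 z - Phi phi a r 1 a - (z - a) * Phi psi a r 1 z = 0).
    { unfold Phi. rewrite cint_lin3 by (now apply rcont_kernel).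
      rewrite (cint_ext _ (fun t => 0 * phi t)); [rewrite cint_scal by auto; ring|].
      intros t. rewrite !Cpow_1_r. unfold psi.
      assert (N1 := circ_ne a z r t Hzr). specialize (Nca t). field. auto. }
    unfold phi in E at 1 2. rewrite (Cauchy_Phi g a z r R0), (Cauchy_Phi g a a r R0) in E by (auto; lra).
    fold K in E. rewrite Ha in E.
    assert (E2 : (z - a) * Phi psi a r 1 z = K * g z).
    { apply Ceq_minus. transitivity (- (K * g z - K * 0 - (z - a) * Phi psi a r 1 z)); [ring|].
      rewrite E. ring. }
    replace (Phi psi a r 1 z) with (K * g z / (z - a)) by (rewrite <- E2; field; auto).
    field. auto.
Qed.

(** If [g] can be divided by [z - a] indefinitely, Cauchy's estimate for the
    quotients bounds [|g z|] by a constant times [(|z - a| / r) ^ m] for every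
    [m]. *)
Lemma C1_disc_order (g : C -> C) (a : C) (R0 : R) : C1_disc g a R0 ->
  (forall z, Cmod (z - a) < R0 -> g z = 0) \/
  exists (m : nat) (h : C -> C), C1_disc h a R0 /\ h a <> 0 /\
    forall z, Cmod (z - a) < R0 -> g z = (z - a) ^ m * h z.
Proof.
  intros H.
  destruct (classic (exists (m : nat) (h : C -> C), C1_disc h a R0 /\ h a <> 0 /\
    forall z, Cmod (z - a) < R0 -> g z = (z - a) ^ m * h z)) as [|Hno]; [now right|left].
  assert (Hall : forall m : nat, exists h, C1_disc h a R0 /\
            forall z, Cmod (z - a) < R0 -> g z = (z - a) ^ m * h z).
  { induction m as [|m [h [Hh E]]].
    - exists g. split; auto. intros; simpl; ring.
    - destruct (classic (h a = 0)) as [Ha|Ha]; [|exfalso; apply Hno; eauto 6].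
      destruct (C1_disc_divide h a R0 Hh Ha) as [h' [Hh' E']].
      exists h'. split; auto. intros z Hz. rewrite E, E' by auto. simpl. ring. }
  intros z Hz. apply NNPP. intros Hne.
  set (r := ((Cmod (z - a) + R0) / 2)%R).
  assert (X := Cmod_ge_0 (z - a)).
  assert (Hr : 0 < r < R0) by (unfold r; lra).
  assert (Hzr : Cmod (z - a) < r) by (unfold r; lra).
  destruct (rcont_bounded (fun t => g (circ a r t))) as [B [HB0 HB]].
  { now apply rcont_C1_circ with R0. }
  assert (HB' : forall m h, C1_disc h a R0 ->
     (forall z, Cmod (z - a) < R0 -> g z = (z - a) ^ m * h z) ->
     Cmod (g z) <= (Cmod (z - a) / r) ^ m * (B * (r / (r - Cmod (z - a))))).
  { intros m h Hh E.
    assert (Hrm : 0 < r ^ m) by (apply pow_lt; lra).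
    assert (Y : Cmod (h z) <= B / r ^ m * (r / (r - Cmod (z - a)))).
    { apply Cauchy_estimate with R0; auto; [lra|]. intros t Ht.
      specialize (HB t Ht). rewrite E in HB by (rewrite Cmod_circ; lra).
      rewrite Cmod_mult, Cmod_pow, Cmod_circ in HB by lra.
      apply Rmult_le_reg_l with (r ^ m)%R; auto.
      replace (r ^ m * (B / r ^ m))%R with B by (field; lra). auto. }
    rewrite E, Cmod_mult, Cmod_pow by lra.
    apply Rle_trans with (Cmod (z - a) ^ m * (B / r ^ m * (r / (r - Cmod (z - a)))))%R.
    - apply Rmult_le_compat_l; auto using pow_le.
    - right. unfold Rdiv. rewrite Rpow_mult_distr, pow_inv. ring. }
  apply Cmod_gt_0 in Hne.
  set (K := (B * (r / (r - Cmod (z - a))))%R) in *.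
  assert (HK : 0 <= K).
  { unfold K. apply Rmult_le_pos; auto. apply Rlt_le, Rdiv_lt_0_compat; lra. }
  destruct (pow_lt_1_zero (Cmod (z - a) / r)%R) with (y := (Cmod (g z) / (K + 1))%R) as [N HN].
  - rewrite Rabs_pos_eq.
    + apply Rmult_lt_reg_r with r; [lra|]. unfold Rdiv. rewrite Rmult_assoc, Rinv_l; lra.
    + apply Rmult_le_pos; auto. apply Rlt_le, Rinv_0_lt_compat; lra.
  - apply Rdiv_lt_0_compat; lra.
  - specialize (HN N (Nat.le_refl N)). destruct (Hall N) as [h [Hh E]].
    specialize (HB' N h Hh E).
    assert (Y := Rle_abs ((Cmod (z - a) / r) ^ N)).
    assert (Z : (Cmod (z - a) / r) ^ N * K <= Cmod (g z) / (K + 1) * K)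
      by (apply Rmult_le_compat_r; lra).
    assert (W : Cmod (g z) / (K + 1) * K < Cmod (g z)).
    { apply Rmult_lt_reg_r with (K + 1)%R; [lra|].
      replace (Cmod (g z) / (K + 1) * K * (K + 1))%R with (Cmod (g z) * K)%R by (field; lra).
      apply Rmult_lt_compat_l; lra. }
    lra.
Qed.

(** * Orders of meromorphic functions *)

Definition zpow (u : C) (m : Z) : C :=
  if (0 <=? m)%Z then u ^ (Z.to_nat m) else / u ^ (Z.to_nat (- m)).

Lemma zpow_sub (u : C) (i j : nat) : u <> 0 -> zpow u (Z.of_nat i - Z.of_nat j) = u ^ i / u ^ j.
Proof.
  intros Hu. unfold zpow. destruct (Z.leb_spec 0 (Z.of_nat i - Z.of_nat j)).
  - replace i with (Z.to_nat (Z.of_nat i - Z.of_nat j) + j)%nat at 2 by lia.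
    rewrite Cpow_add_r. field. now apply Cpow_nz.
  - replace j with (Z.to_nat (- (Z.of_nat i - Z.of_nat j)) + i)%nat at 2 by lia.
    rewrite Cpow_add_r. field. split; now apply Cpow_nz.
Qed.

Lemma zpow_nat (u : C) (i : nat) : zpow u (Z.of_nat i) = u ^ i.
Proof.
  unfold zpow. destruct (Z.leb_spec 0 (Z.of_nat i)); [|lia]. now rewrite Nat2Z.id.
Qed.

Lemma Z_sub_nat (m : Z) : exists i j : nat, m = (Z.of_nat i - Z.of_nat j)%Z.
Proof. exists (Z.to_nat m), (Z.to_nat (- m)). lia. Qed.

Lemma zpow_add (u : C) (m m' : Z) : u <> 0 -> zpow u (m + m') = zpow u m * zpow u m'.
Proof.
  intros Hu. destruct (Z_sub_nat m) as [i [j ->]]. destruct (Z_sub_nat m') as [i' [j' ->]].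
  replace (Z.of_nat i - Z.of_nat j + (Z.of_nat i' - Z.of_nat j'))%Z
    with (Z.of_nat (i + i') - Z.of_nat (j + j'))%Z by lia.
  rewrite !zpow_sub, !Cpow_add_r by auto. field. split; now apply Cpow_nz.
Qed.

Lemma zpow_nz (u : C) (m : Z) : u <> 0 -> zpow u m <> 0.
Proof.
  intros Hu. unfold zpow. destruct (0 <=? m)%Z; [now apply Cpow_nz|].
  intros E. assert (N := Cpow_nz u (Z.to_nat (- m)) Hu).
  apply N. rewrite <- (Cmult_1_r (u ^ _)). rewrite <- (Cinv_l (u ^ Z.to_nat (- m))) by auto.
  rewrite E. ring.
Qed.

Lemma zpow_mult (u v : C) (m : Z) : u <> 0 -> v <> 0 -> zpow (u * v) m = zpow u m * zpow v m.
Proof.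
  intros Hu Hv. unfold zpow. destruct (0 <=? m)%Z; rewrite Cpow_mult_l; auto.
  field. split; now apply Cpow_nz.
Qed.

Lemma zpow_1 (u : C) : zpow u 1 = u.
Proof. unfold zpow. simpl. ring. Qed.

Lemma zpow_opp (u : C) (m : Z) : u <> 0 -> zpow u (- m) = / zpow u m.
Proof.
  intros Hu. assert (N := zpow_nz u m Hu).
  assert (E : zpow u m * zpow u (- m) = 1).
  { rewrite <- zpow_add by auto. rewrite Z.add_opp_diag_r. reflexivity. }
  replace (zpow u (- m)) with (/ zpow u m * (zpow u m * zpow u (- m))) by (field; auto).
  rewrite E. ring.
Qed.

(** A function that vanishes around [a] satisfies this for every [m]. *)
Definition ord_ge (f : C -> C) (a : C) (m : Z) : Prop :=
  exists g, hol g a /\ locally' a (fun z => f z = zpow (z - a) m * g z).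

Definition ord_eq (f : C -> C) (a : C) (m : Z) : Prop :=
  exists g, hol g a /\ g a <> 0 /\ locally' a (fun z => f z = zpow (z - a) m * g z).

Definition mero (f : C -> C) : Prop := forall a, exists m, ord_ge f a m.

Lemma Cminus_ne (z a : C) : z <> a -> z - a <> 0.
Proof. intros H E. apply H. now apply Ceq_minus. Qed.

Lemma ord_ge_ext (f g : C -> C) (a : C) (m : Z) :
  locally' a (fun z => f z = g z) -> ord_ge f a m -> ord_ge g a m.
Proof.
  intros E [h [Hh E']]. exists h. split; auto.
  generalize (filter_and _ _ E E'). apply filter_imp. intros z [<- ?]. auto.
Qed.

Lemma ord_ge_mono (f : C -> C) (a : C) (m m' : Z) : (m' <= m)%Z ->
  ord_ge f a m -> ord_ge f a m'.
Proof.
  intros Hm [g [Hg E]]. exists (fun z => (z - a) ^ (Z.to_nat (m - m')) * g z). split.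
  - apply hol_mult; auto. apply (hol_pow (fun z => z - a)).
    apply hol_minus; [apply hol_id|apply hol_const].
  - generalize (filter_and _ _ E (locally'_ne a)). apply filter_imp. intros z [-> Hz].
    rewrite Cmult_assoc, <- zpow_nat, Z2Nat.id, <- zpow_add by (try apply Cminus_ne; auto; lia).
    do 2 f_equal. lia.
Qed.

Lemma ord_ge_plus (f g : C -> C) (a : C) (m : Z) :
  ord_ge f a m -> ord_ge g a m -> ord_ge (fun z => f z + g z) a m.
Proof.
  intros [f' [Hf Ef]] [g' [Hg Eg]]. exists (fun z => f' z + g' z). split; [now apply hol_plus|].
  generalize (filter_and _ _ Ef Eg). apply filter_imp. intros z [-> ->]. ring.
Qed.

Lemma ord_ge_mult (f g : C -> C) (a : C) (m n : Z) :
  ord_ge f a m -> ord_ge g a n -> ord_ge (fun z => f z * g z) a (m + n).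
Proof.
  intros [f' [Hf Ef]] [g' [Hg Eg]]. exists (fun z => f' z * g' z). split; [now apply hol_mult|].
  generalize (filter_and _ _ (filter_and _ _ Ef Eg) (locally'_ne a)). apply filter_imp.
  intros z [[-> ->] Hz]. rewrite zpow_add by now apply Cminus_ne. ring.
Qed.

Lemma ord_ge_hol (f : C -> C) (a : C) : hol f a -> ord_ge f a 0.
Proof.
  intros H. exists f. split; auto. apply filter_forall. intros z. unfold zpow; simpl. ring.
Qed.

Lemma ord_ge_scal (k : C) (f : C -> C) (a : C) (m : Z) :
  ord_ge f a m -> ord_ge (fun z => k * f z) a m.
Proof. intros H. apply (ord_ge_mult (fun _ => k) f a 0 m); auto. apply ord_ge_hol, hol_const. Qed.

Lemma ord_ge_zero (f : C -> C) (a : C) (m : Z) : locally' a (fun z => f z = 0) -> ord_ge f a m.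
Proof.
  intros H. exists (fun _ => 0). split; [apply hol_const|]. revert H. apply filter_imp.
  intros z ->. ring.
Qed.

Lemma ord_ge_shift (f : C -> C) (a b : C) (m : Z) :
  ord_ge f (a + b) m -> ord_ge (fun z => f (z + b)) a m.
Proof.
  intros [g [Hg E]]. replace (a + b) with (1 * a + b) in * by ring.
  exists (fun z => g (1 * z + b)). split; [now apply hol_comp_affine; [apply C1_nz|]|].
  apply (locally'_comp_affine _ a b 1 C1_nz) in E. revert E. apply filter_imp.
  intros z. replace (1 * z + b) with (z + b) by ring. intros ->.
  f_equal. f_equal. ring.
Qed.

Lemma hol_order (g : C -> C) (a : C) : hol g a ->
  locally a (fun z => g z = 0) \/
  exists (m : nat) h, hol h a /\ h a <> 0 /\ locally a (fun z => g z = (z - a) ^ m * h z).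
Proof.
  intros H. apply hol_C1_disc in H. destruct H as [R0 [HR H]].
  destruct (C1_disc_order g a R0 H) as [E|[m [h [Hh [Ha E]]]]].
  - left. apply locally_disc. eauto.
  - right. exists m, h. split; [apply hol_C1_disc; eauto|]. split; auto.
    apply locally_disc. eauto.
Qed.

Lemma ord_dichotomy (f : C -> C) (a : C) (m : Z) : ord_ge f a m ->
  locally' a (fun z => f z = 0) \/ exists m', (m <= m')%Z /\ ord_eq f a m'.
Proof.
  intros [g [Hg E]]. destruct (hol_order g a Hg) as [E'|[k [h [Hh [Ha E']]]]].
  - left. apply locally_locally' in E'. generalize (filter_and _ _ E E'). apply filter_imp.
    intros z [-> ->]. ring.
  - right. exists (m + Z.of_nat k)%Z. split; [lia|]. exists h. split; auto. split; auto.
    apply locally_locally' in E'.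
    generalize (filter_and _ _ (filter_and _ _ E E') (locally'_ne a)). apply filter_imp.
    intros z [[-> ->] Hz]. rewrite zpow_add, zpow_nat by now apply Cminus_ne. ring.
Qed.

Lemma ord_eq_ge (f : C -> C) (a : C) (m : Z) : ord_eq f a m -> ord_ge f a m.
Proof. intros [g [H [_ E]]]. exists g. auto. Qed.

Lemma ord_eq_nonzero (f : C -> C) (a : C) (m : Z) : ord_eq f a m -> locally' a (fun z => f z <> 0).
Proof.
  intros [g [Hg [Ha E]]].
  assert (N := locally_locally' _ _ (ccont_nonzero _ _ (hol_cont _ _ Hg) Ha)).
  generalize (filter_and _ _ (filter_and _ _ E N) (locally'_ne a)). apply filter_imp.
  intros z [[-> Hn] Hz]. apply Cmult_neq_0; auto. now apply zpow_nz, Cminus_ne.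
Qed.

Lemma mero_plus (f g : C -> C) : mero f -> mero g -> mero (fun z => f z + g z).
Proof.
  intros Hf Hg a. destruct (Hf a) as [m H], (Hg a) as [n H'].
  exists (Z.min m n). apply ord_ge_plus; (eapply ord_ge_mono; [|eassumption]); lia.
Qed.

Lemma mero_scal (k : C) (f : C -> C) : mero f -> mero (fun z => k * f z).
Proof. intros Hf a. destruct (Hf a) as [m H]. exists m. now apply ord_ge_scal. Qed.

Lemma locally'_false (a : C) : ~ locally' a (fun _ => False).
Proof.
  intros H. apply locally'_disc in H. destruct H as [d [Hd H]].
  apply (H (a + RtoC (d / 2))).
  - intros E. apply (f_equal fst) in E. simpl in E. lra.
  - replace (a + RtoC (d / 2) - a) with (RtoC (d / 2)) by ring.
    rewrite Cmod_R, Rabs_pos_eq; lra.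
Qed.

(** Connectedness of the unit interval, in the form in which a local property
    is carried along a segment. *)
Lemma interval_induction (P : R -> Prop) :
  (forall x, 0 <= x <= 1 -> exists d, 0 < d /\
     forall y y', 0 <= y <= 1 -> 0 <= y' <= 1 ->
       Rabs (y - x) < d -> Rabs (y' - x) < d -> P y -> P y') ->
  P 0%R -> P 1%R.
Proof.
  intros Hloc H0.
  destruct (completeness (fun y => 0 <= y <= 1 /\ P y)) as [s [Hub Hlub]].
  - exists 1%R. intros y [Hy _]. lra.
  - exists 0%R. split; [lra|auto].
  - assert (Hs : 0 <= s <= 1).
    { split; [apply Hub; split; [lra|auto]|apply Hlub; intros y [Hy _]; lra]. }
    destruct (Hloc s Hs) as [d [Hd H]].
    assert (Hex : exists y, ((0 <= y <= 1)%R /\ P y) /\ s - d < y).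
    { apply NNPP. intros Hno. assert (s <= s - d)%R; [|lra].
      apply Hlub. intros y Hy. apply Rnot_lt_le. intros Hlt. apply Hno. exists y. auto. }
    destruct Hex as [y [[Hy HP] Hys]].
    assert (y <= s)%R by (apply Hub; auto).
    destruct (Rle_dec 1 (s + d / 2)) as [Hge|Hlt].
    + apply (H y); auto; [lra| |]; apply Rabs_def1; lra.
    + exfalso. assert (s + d / 2 <= s)%R; [|lra].
      apply Hub. split; [lra|]. apply (H y); auto; [lra| |]; apply Rabs_def1; lra.
Qed.

(** At every point a meromorphic function either vanishes around it or has no
    other zero around it. So the set of points around which it vanishes is open
    and closed, and it is followed along the segment from [b] to [c]. *)
Lemma mero_identity (f : C -> C) (b : C) : mero f ->
  locally' b (fun z => f z = 0) -> forall c, locally' c (fun z => f z = 0).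
Proof.
  intros Hf Hb c.
  set (Z0 := fun a => locally' a (fun z => f z = 0)).
  assert (Hdich : forall a, locally a Z0 \/ locally a (fun z => ~ Z0 z)).
  { intros a. destruct (Hf a) as [m Hm]. destruct (ord_dichotomy f a m Hm) as [E|[m' [_ E]]].
    - left. apply locally'_center; auto.
      generalize (locally'_near _ _ E). apply filter_imp. intros z. apply locally_locally'.
    - right. apply ord_eq_nonzero in E.
      assert (Hx : forall z, locally' z (fun w => f w <> 0) -> ~ Z0 z).
      { intros z H1 H2. apply (locally'_false z). generalize (filter_and _ _ H1 H2).
        apply filter_imp. tauto. }
      apply locally'_center; auto.
      generalize (locally'_near _ _ E). apply filter_imp. intros z Hz. apply Hx.
      now apply locally_locally'. }
  assert (H : Z0 (b + RtoC 1 * (c - b))).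
  { apply (interval_induction (fun t => Z0 (b + RtoC t * (c - b)))).
    2:{ replace (b + RtoC 0 * (c - b)) with b by ring. exact Hb. }
    intros x Hx.
    assert (Hk : 0 < Cmod (c - b) + 1) by (assert (X := Cmod_ge_0 (c - b)); lra).
    assert (Hd : exists d, 0 < d /\
       ((forall z, Cmod (z - (b + RtoC x * (c - b))) < d -> Z0 z) \/
        (forall z, Cmod (z - (b + RtoC x * (c - b))) < d -> ~ Z0 z))).
    { destruct (Hdich (b + RtoC x * (c - b))) as [H|H]; apply locally_disc in H;
        destruct H as [d [Hd H]]; exists d; auto. }
    destruct Hd as [d [Hd H]]. exists (d / (Cmod (c - b) + 1))%R.
    split; [now apply Rdiv_lt_0_compat|].
    assert (Hclose : forall y, Rabs (y - x) < d / (Cmod (c - b) + 1) ->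
       Cmod (b + RtoC y * (c - b) - (b + RtoC x * (c - b))) < d).
    { intros y Hy. replace (b + RtoC y * (c - b) - (b + RtoC x * (c - b)))
        with (RtoC (y - x) * (c - b)) by (rewrite RtoC_minus; ring).
      rewrite Cmod_mult, Cmod_R.
      apply Rmult_lt_compat_r with (r := (Cmod (c - b) + 1)%R) in Hy; auto.
      replace (d / (Cmod (c - b) + 1) * (Cmod (c - b) + 1))%R with d in Hy by (field; lra).
      assert (X := Rabs_pos (y - x)). nra. }
    intros y y' _ _ Hy Hy' HP. destruct H as [H|H].
    - apply H. now apply Hclose.
    - exfalso. apply (H _ (Hclose y Hy)). exact HP. }
  replace c with (b + RtoC 1 * (c - b)) by ring. exact H.
Qed.

Lemma mero_mult_zero (f g : C -> C) : mero f -> mero g ->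
  (forall a, locally' a (fun z => f z * g z = 0)) ->
  (forall a, locally' a (fun z => f z = 0)) \/ (forall a, locally' a (fun z => g z = 0)).
Proof.
  intros Hf Hg H. destruct (Hf 0) as [m Hm].
  destruct (ord_dichotomy f 0 m Hm) as [E|[m' [_ E]]].
  - left. intros a. now apply mero_identity with (RtoC 0).
  - right. intros a. apply mero_identity with (RtoC 0); auto. apply ord_eq_nonzero in E.
    generalize (filter_and _ _ E (H (RtoC 0))). apply filter_imp. intros z [H1 H2].
    apply NNPP. intros H3. now apply (Cmult_neq_0 (f z) (g z)).
Qed.

(** Cauchy's estimate for the difference quotient, which is holomorphic and
    bounded by [2 B / r] on the circle. *)
Lemma Cauchy_estimate_derive (g : C -> C) (a : C) (r R0 B : R) : 0 < r < R0 ->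
  C1_disc g a R0 -> (forall u, Cmod (u - a) < R0 -> Cmod (g u) <= B) ->
  Cmod (C_derive g a) <= 2 * B / r.
Proof.
  intros Hr H HB.
  assert (Haa : (Cmod (a - a) = 0)%R) by (replace (a - a) with (RtoC 0) by ring; apply Cmod_0).
  destruct (C1_disc_divide (fun z => g z - g a) a R0) as [h [Hh E]].
  - intros u Hu. apply hol_at, hol_minus; [|apply hol_const]. now apply C1_disc_hol with a R0.
  - ring.
  - assert (Ed : C_derive g a = h a).
    { apply is_C_derive_unique. apply Cderive_ext with (fun z => g a + (z - a) * h z).
      - apply locally_disc. exists R0. split; [lra|]. intros z Hz.
        rewrite <- E by auto. ring.
      - eapply Cderive_eq.
        + apply Cderive_plus; [apply Cderive_const|]. apply Cderive_mult.
          * apply Cderive_minus; [apply Cderive_id|apply Cderive_const].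
          * apply Hh. rewrite Haa. lra.
        + cbv beta. ring. }
    rewrite Ed.
    assert (Y := Cauchy_estimate h a a r R0 (2 * B / r) (proj2 Hr) Hh).
    rewrite Haa in Y. replace (r / (r - 0))%R with 1%R in Y by (field; lra).
    rewrite Rmult_1_r in Y. apply Y; [lra|].
    intros t _. assert (Hc := Cmod_circ a r t ltac:(lra)).
    specialize (E (circ a r t)). rewrite Hc in E. specialize (E ltac:(lra)).
    apply (f_equal Cmod) in E. rewrite Cmod_mult, Hc in E.
    assert (Z : Cmod (g (circ a r t) - g a) <= B + B).
    { eapply Rle_trans; [apply Cmod_triangle|]. rewrite Cmod_opp.
      apply Rplus_le_compat; apply HB; lra. }
    apply Rmult_le_reg_l with r; [lra|].
    replace (r * (2 * B / r))%R with (2 * B)%R by (field; lra). lra.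
Qed.

(** The factor [(z - a) ^ 2] makes the product differentiable at [a], with
    derivative 0; Cauchy's estimate on discs around [z] of radius less than [|z
    - a|] shows that its derivative tends to 0. *)
Lemma hol_square_mult (g : C -> C) (a : C) : ccont g a ->
  locally' a (C1_at g) -> hol (fun z => (z - a) ^ 2 * g z) a.
Proof.
  intros Hc H.
  set (G := fun z => (z - a) ^ 2 * g z).
  set (B := (Cmod (g a) + 1)%R).
  assert (HB0 : 0 < B) by (unfold B; assert (X := Cmod_ge_0 (g a)); lra).
  assert (HB : locally' a (fun z => Cmod (g z) <= B)).
  { generalize (clim_bounded _ _ _ Hc). apply filter_imp. unfold B; intros; lra. }
  assert (HaB : Cmod (g a) <= B) by (unfold B; lra).
  assert (Hnear := locally'_near _ _ H).
  assert (HG : locally' a (C1_at G)).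
  { revert Hnear. apply filter_imp. intros z Hz. apply hol_at. apply hol_mult; auto.
    apply (hol_pow (fun z => z - a)), hol_minus; [apply hol_id|apply hol_const]. }
  assert (D0 : Cderive_at G a 0).
  { apply Cderive_quadratic with B.
    assert (HB' : locally a (fun z => Cmod (g z) <= B)) by now apply locally'_center.
    revert HB'. apply filter_imp. intros z Hz. unfold G.
    replace ((z - a) ^ 2 * g z - (a - a) ^ 2 * g a - 0 * (z - a))
      with (g z * ((z - a) * (z - a))) by (simpl; ring).
    rewrite !Cmod_mult. apply Rmult_le_compat_r; auto.
    apply Rmult_le_pos; apply Cmod_ge_0. }
  apply locally'_center; auto. split.
  { now rewrite (is_C_derive_unique _ _ _ D0). }
  unfold ccont. rewrite (is_C_derive_unique _ _ _ D0).
  intros e He.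
  generalize (filter_and _ _ H HB). intros HH. apply locally'_disc in HH.
  destruct HH as [d [Hd HH]].
  apply locally'_disc. exists (Rmin (d / 2) (e / (6 * B))).
  split; [apply Rmin_pos; [lra|apply Rdiv_lt_0_compat; lra]|].
  intros z Hz Hzd.
  assert (Hzd1 := Rlt_le_trans _ _ _ Hzd (Rmin_l _ _)).
  assert (Hzd2 := Rlt_le_trans _ _ _ Hzd (Rmin_r _ _)).
  set (rho := Cmod (z - a)) in *.
  assert (Hrho : 0 < rho) by (apply Cmod_gt_0, Cminus_ne; auto).
  assert (Hin : forall u, Cmod (u - z) < rho -> u <> a /\ Cmod (u - a) < d).
  { intros u Hu. split.
    - intros ->. rewrite Cmod_minus_sym in Hu. unfold rho in Hu. lra.
    - replace (u - a) with ((u - z) + (z - a)) by ring.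
      eapply Rle_lt_trans; [apply Cmod_triangle|]. fold rho. lra. }
  assert (Hg' : Cmod (C_derive g z) <= 2 * B / (rho / 2)).
  { apply Cauchy_estimate_derive with rho; [lra| |].
    - intros u Hu. apply HH; now apply Hin.
    - intros u Hu. apply HH; now apply Hin. }
  assert (Ed : C_derive G z = INR 2 * (z - a) ^ 1 * (1 - 0) * g z + (z - a) ^ 2 * C_derive g z).
  { apply is_C_derive_unique. unfold G. apply Cderive_mult.
    - apply (Cderive_pow (fun z => z - a)), Cderive_minus; [apply Cderive_id|apply Cderive_const].
    - apply HH; auto. fold rho. lra. }
  rewrite Ed.
  replace (INR 2 * (z - a) ^ 1 * (1 - 0) * g z + (z - a) ^ 2 * C_derive g z - 0)
    with (INR 2 * (z - a) * g z + (z - a) * (z - a) * C_derive g z) by (simpl; ring).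
  eapply Rle_lt_trans; [apply Cmod_triangle|]. rewrite !Cmod_mult, Cmod_R. fold rho.
  rewrite Rabs_pos_eq by apply pos_INR. simpl INR.
  assert (Hgz : Cmod (g z) <= B) by (apply HH; auto; fold rho; lra).
  assert (T1 : (1 + 1) * rho * Cmod (g z) <= 2 * rho * B) by nra.
  assert (T2 : rho * rho * Cmod (C_derive g z) <= 4 * rho * B).
  { apply Rle_trans with (rho * rho * (2 * B / (rho / 2)))%R.
    - apply Rmult_le_compat_l; auto. nra.
    - right. field. lra. }
  apply Rmult_lt_compat_r with (r := (6 * B)%R) in Hzd2; [|lra].
  replace (e / (6 * B) * (6 * B))%R with e in Hzd2 by (field; lra). lra.
Qed.

(** Differentiability alone is required of the numerators in [meromorphic], a
    continuous derivative in [mero]: this costs two more orders of the pole. *)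
Lemma meromorphic_mero (f : C -> C) : meromorphic f ->
  (forall a, locally' a (C1_at f)) -> mero f.
Proof.
  intros Hf HC a. destruct (Hf a) as [N [g [Hg E]]].
  exists (- Z.of_nat (N + 2))%Z. exists (fun z => (z - a) ^ 2 * g z). split.
  - apply hol_square_mult.
    + apply locally_singleton in Hg. destruct Hg as [l Hl]. eapply Cderive_cont, Hl.
    + generalize (filter_and _ _ (locally'_near _ _ (filter_and _ _ E (locally'_ne a)))
        (locally'_near _ _ (HC a))). apply filter_imp. intros z [E1 H1].
      apply hol_at. apply hol_ext with (fun z => f z * (z - a) ^ N).
      * revert E1. apply filter_imp. intros w [-> Hw]. field.
        now apply Cpow_nz, Cminus_ne.
      * apply hol_mult; auto. apply (hol_pow (fun z => z - a)), hol_minus; [apply hol_id|apply hol_const].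
  - generalize (filter_and _ _ E (locally'_ne a)). apply filter_imp. intros z [-> Hz].
    assert (Hza := Cminus_ne _ _ Hz).
    rewrite zpow_opp, zpow_nat, Cpow_add_r by auto. field; repeat split; auto using Cpow_nz.
Qed.

(** * Elliptic functions *)

(** The difference quotient of [f] at 0 is of order [1 / r] on the circle of
    radius [r], which is chosen so large that Cauchy's estimate at [z]
    contradicts [f z <> f 0]. *)
Lemma Liouville (f : C -> C) (B : R) :
  (forall z, C1_at f z) -> (forall z, Cmod (f z) <= B) -> forall z, f z = f 0.
Proof.
  intros H HB z. apply Ceq_minus, NNPP. intros Hne. apply Cmod_gt_0 in Hne.
  assert (HB0 : 0 <= B) by (eapply Rle_trans; [apply Cmod_ge_0|apply (HB z)]).
  set (k := Cmod (f z - f 0)) in *.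
  assert (Hz0 := Cmod_ge_0 z).
  set (r := (Cmod z + Cmod z * (2 * B) / k + 1)%R).
  assert (Hq : 0 <= Cmod z * (2 * B) / k).
  { apply Rmult_le_pos; [nra|]. now apply Rlt_le, Rinv_0_lt_compat. }
  assert (Hr : Cmod z < r) by (unfold r; lra).
  destruct (C1_disc_divide (fun u => f u - f 0) 0 (r + 1)) as [h [Hh E]].
  - intros u _. apply hol_at, hol_minus; [|apply hol_const].
    unfold hol. apply filter_forall. exact H.
  - ring.
  - assert (Ez : z - 0 = z) by ring.
    assert (Y := Cauchy_estimate h 0 z r (r + 1) (2 * B / r) ltac:(lra) Hh).
    rewrite Ez in Y. specialize (Y Hr).
    assert (Hbd : Cmod (h z) <= 2 * B / r * (r / (r - Cmod z))).
    { apply Y. intros t _. assert (Hc := Cmod_circ 0 r t ltac:(lra)).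
      specialize (E (circ 0 r t)). rewrite Hc in E. specialize (E ltac:(lra)).
      apply (f_equal Cmod) in E. rewrite Cmod_mult, Hc in E.
      assert (Z : Cmod (f (circ 0 r t) - f 0) <= B + B).
      { eapply Rle_trans; [apply Cmod_triangle|]. rewrite Cmod_opp.
        apply Rplus_le_compat; apply HB. }
      apply Rmult_le_reg_l with r; [lra|].
      replace (r * (2 * B / r))%R with (2 * B)%R by (field; lra). lra. }
    specialize (E z). rewrite Ez in E. specialize (E ltac:(lra)).
    assert (Hk : k <= Cmod z * (2 * B / (r - Cmod z))).
    { unfold k. rewrite E, Cmod_mult. apply Rmult_le_compat_l; auto.
      eapply Rle_trans; [apply Hbd|]. right. field. lra. }
    assert (Hrz : (k * (r - Cmod z) = Cmod z * (2 * B) + k)%R).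
    { unfold r. field. lra. }
    assert (X : k * (r - Cmod z) <= Cmod z * (2 * B)).
    { apply Rle_trans with (Cmod z * (2 * B / (r - Cmod z)) * (r - Cmod z))%R.
      - apply Rmult_le_compat_r; lra. - right. field. lra. }
    lra.
Qed.

(** Compactness of the unit interval, deduced from its connectedness. *)
Lemma interval_bounded (P : R -> R -> Prop) :
  (forall x M M', M <= M' -> P x M -> P x M') ->
  (forall x, 0 <= x <= 1 -> exists d M, 0 < d /\
     forall y, Rabs (y - x) < d -> P y M) ->
  exists M, forall y, 0 <= y <= 1 -> P y M.
Proof.
  intros Hmono Hloc.
  apply (interval_induction (fun x => exists M, forall y, (0 <= y <= x)%R -> P y M)).
  - intros x Hx. destruct (Hloc x Hx) as [d [M [Hd H]]]. exists d. split; auto.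
    intros y y' Hy Hy' Hyd Hyd' [M' H']. exists (Rmax M M'). intros u Hu.
    destruct (Rle_dec u y) as [Huy|Huy].
    + apply Hmono with M'; [apply Rmax_r|]. apply H'. lra.
    + apply Hmono with M; [apply Rmax_l|]. apply H.
      apply Rabs_def2 in Hyd, Hyd'. apply Rabs_def1; lra.
  - destruct (Hloc 0%R ltac:(lra)) as [d [M [Hd H]]]. exists M. intros y Hy.
    apply H. replace (y - 0)%R with 0%R by lra. now rewrite Rabs_R0.
Qed.

(** Compactness of the interval is used twice: first in [t], for a strip around
    each [s], then in [s]. In the first use [M] bounds the function and the
    inverse of the width of the strip at once. *)
Lemma parallelogram_bounded (f : C -> C) (tau : C) : (forall z, ccont f z) ->
  exists M, forall s t : R, 0 <= s <= 1 -> 0 <= t <= 1 ->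
    Cmod (f (RtoC s + RtoC t * tau)%C) <= M.
Proof.
  intros Hf.
  assert (Hstrip : forall s : R, exists d M, 0 < d /\ forall s', Rabs (s' - s) < d ->
    forall t, 0 <= t <= 1 -> Cmod (f (RtoC s' + RtoC t * tau)%C) <= M).
  { intros s.
    destruct (interval_bounded (fun t M => 0 < M /\ forall s', Rabs (s' - s) < / M ->
       Cmod (f (RtoC s' + RtoC t * tau)%C) <= M)) as [M HM].
    - intros t M M' HM [HM0 H]. split; [lra|]. intros s' Hs'.
      assert (/ M' <= / M)%R by (apply Rinv_le_contravar; lra).
      specialize (H s' ltac:(lra)). lra.
    - intros t Ht. specialize (Hf (RtoC s + RtoC t * tau)).
      apply (proj1 (ccont_disc _ _)) with (e := 1%R) in Hf; [|lra].
      apply locally_disc in Hf. destruct Hf as [d [Hd H]].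
      set (K := (Cmod tau + 1)%R). assert (HK : 0 < K) by (unfold K; assert (X := Cmod_ge_0 tau); lra).
      set (A := Cmod (f (RtoC s + RtoC t * tau)%C)). assert (HA : 0 <= A) by apply Cmod_ge_0.
      assert (Hid : 0 < 2 / d) by (apply Rdiv_lt_0_compat; lra).
      exists (d / (2 * K))%R, (A + 1 + 2 / d)%R.
      split; [apply Rdiv_lt_0_compat; lra|]. intros t' Ht'. split; [lra|].
      intros s' Hs'.
      assert (Hs2 : Rabs (s' - s) < d / 2).
      { eapply Rlt_le_trans; [apply Hs'|]. replace (d / 2)%R with (/ (2 / d))%R by (field; lra).
        apply Rinv_le_contravar; lra. }
      assert (Ht2 : Rabs (t' - t) * K < d / 2).
      { apply Rmult_lt_compat_r with (r := K) in Ht'; auto.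
        replace (d / (2 * K) * K)%R with (d / 2)%R in Ht' by (field; lra). exact Ht'. }
      assert (Hin : Cmod (RtoC s' + RtoC t' * tau - (RtoC s + RtoC t * tau)) < d).
      { replace (RtoC s' + RtoC t' * tau - (RtoC s + RtoC t * tau))
          with (RtoC (s' - s) + RtoC (t' - t) * tau) by (rewrite !RtoC_minus; ring).
        eapply Rle_lt_trans; [apply Cmod_triangle|]. rewrite Cmod_mult, !Cmod_R.
        assert (X := Rabs_pos (t' - t)). unfold K in *. nra. }
      specialize (H _ Hin). assert (X := Cmod_rev (f (RtoC s' + RtoC t' * tau)%C) (f (RtoC s + RtoC t * tau)%C)).
      fold A in X. lra.
    - assert (HM0 : 0 < M) by (apply (HM 0%R); lra).
      exists (/ M)%R, M. split; [now apply Rinv_0_lt_compat|].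
      intros s' Hs' t Ht. now apply HM. }
  destruct (interval_bounded (fun s M => forall t, 0 <= t <= 1 ->
     Cmod (f (RtoC s + RtoC t * tau)%C) <= M)) as [M HM].
  - intros x M M' HM H t Ht. specialize (H t Ht). lra.
  - intros s Hs. apply Hstrip.
  - exists M. auto.
Qed.

Lemma in_lattice_plus (tau z w : C) : in_lattice tau z -> in_lattice tau w -> in_lattice tau (z + w).
Proof.
  intros [[m n] ->] [[m' n'] ->]. exists (m + m', n + n')%Z. unfold lattice_point; simpl.
  rewrite !plus_IZR, !RtoC_plus. ring.
Qed.

Lemma in_lattice_opp (tau z : C) : in_lattice tau z -> in_lattice tau (- z).
Proof.
  intros [[m n] ->]. exists (- m, - n)%Z. unfold lattice_point; simpl.
  rewrite !opp_IZR, !RtoC_opp. ring.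
Qed.

Lemma in_lattice_minus (tau z w : C) : in_lattice tau z -> in_lattice tau w -> in_lattice tau (z - w).
Proof. intros. apply in_lattice_plus; auto. now apply in_lattice_opp. Qed.

Lemma in_lattice_0 (tau : C) : in_lattice tau 0.
Proof. exists (0, 0)%Z. unfold lattice_point; simpl. ring. Qed.

Lemma in_lattice_1 (tau : C) : in_lattice tau 1.
Proof. exists (1, 0)%Z. unfold lattice_point; simpl. ring. Qed.

Lemma in_lattice_tau (tau : C) : in_lattice tau tau.
Proof. exists (0, 1)%Z. unfold lattice_point; simpl. ring. Qed.

Lemma lattice_ind (tau : C) (P : C -> Prop) :
  (forall z, P z -> P (z + 1)) -> (forall z, P z -> P (z - 1)) ->
  (forall z, P z -> P (z + tau)) -> (forall z, P z -> P (z - tau)) ->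
  forall z w, in_lattice tau w -> P z -> P (z + w).
Proof.
  intros H1 H1' H2 H2' z w [[m n] ->] Hz. unfold lattice_point; simpl.
  assert (Hm : forall m z, P z -> P (z + RtoC (IZR m))).
  { intros k. induction k using Z.peano_ind; intros u Hu.
    - replace (u + RtoC (IZR 0)) with u by ring. auto.
    - unfold Z.succ. rewrite plus_IZR, RtoC_plus.
      replace (u + (RtoC (IZR k) + RtoC 1)) with (u + RtoC (IZR k) + 1) by ring. auto.
    - unfold Z.pred. rewrite plus_IZR, RtoC_plus.
      replace (u + (RtoC (IZR k) + RtoC (-1))) with (u + RtoC (IZR k) - 1)
        by ring. auto. }
  assert (Hn : forall n z, P z -> P (z + RtoC (IZR n) * tau)).
  { intros k. induction k using Z.peano_ind; intros u Hu.
    - replace (u + RtoC (IZR 0) * tau) with u by ring. auto.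
    - unfold Z.succ. rewrite plus_IZR, RtoC_plus.
      replace (u + (RtoC (IZR k) + RtoC 1) * tau) with (u + RtoC (IZR k) * tau + tau) by ring. auto.
    - unfold Z.pred. rewrite plus_IZR, RtoC_plus.
      replace (u + (RtoC (IZR k) + RtoC (-1)) * tau) with (u + RtoC (IZR k) * tau - tau)
        by ring. auto. }
  rewrite Cplus_assoc. auto.
Qed.

Lemma clim_filterlim (f : C -> C) (a l : C) :
  clim f a l -> filterlim f (locally' a) (locally l).
Proof.
  intros H P HP. apply locally_disc in HP. destruct HP as [d [Hd HP]].
  specialize (H d Hd). unfold filtermap. revert H. apply filter_imp. auto.
Qed.

Lemma reduce_parallelogram (tau z : C) : 0 < Im tau ->
  exists s t w, 0 <= s <= 1 /\ 0 <= t <= 1 /\ in_lattice tau w /\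
    z = RtoC s + RtoC t * tau + w.
Proof.
  intros Ht. set (y := (Im z / Im tau)%R). set (x := (Re z - y * Re tau)%R).
  assert (Hfl : forall u : R, exists k : Z, 0 <= u - IZR k <= 1).
  { intros u. exists (up u - 1)%Z. destruct (archimed u). rewrite minus_IZR. lra. }
  destruct (Hfl x) as [m Hm], (Hfl y) as [n Hn].
  exists (x - IZR m)%R, (y - IZR n)%R, (lattice_point tau (m, n)).
  repeat split; try lra; [now exists (m, n)|].
  unfold lattice_point; simpl. rewrite !RtoC_minus.
  transitivity (RtoC x + RtoC y * tau); [|ring].
  destruct z as [a b], tau as [p q]; simpl in *. unfold Cplus, Cmult; simpl.
  f_equal; unfold x, y; field; lra.
Qed.

(** Taking limits at all points fills in the removable singularities, and makes
    an elliptic function without poles entire and bounded. *)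
Lemma elliptic_constant (F : C -> C) (tau : C) : 0 < Im tau ->
  (forall a, ord_ge F a 0) ->
  (forall a, locally' a (fun z => F (z + 1) = F z)) ->
  (forall a, locally' a (fun z => F (z + tau) = F z)) ->
  exists k, forall a, locally' a (fun z => F z = k).
Proof.
  intros Htau HF H1 H2.
  assert (Hlim : forall a, exists g, hol g a /\ locally a (fun z => C_lim F z = g z) /\
            clim F a (C_lim F a) /\ locally' a (fun z => F z = g z)).
  { intros a. destruct (HF a) as [g [Hg E]]. exists g. split; auto.
    assert (E' : locally' a (fun z => F z = g z)).
    { revert E. apply filter_imp. intros z ->. unfold zpow; simpl. ring. }
    assert (L : forall z, locally' z (fun w => F w = g w) -> hol g z -> clim F z (g z)).
    { intros z Hz Hgz. apply clim_ext with g; [|exact (hol_cont _ _ Hgz)].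
      revert Hz. apply filter_imp. auto. }
    assert (L' : forall z, locally' z (fun w => F w = g w) -> hol g z -> C_lim F z = g z).
    { intros z Hz Hgz. apply is_C_lim_unique, clim_filterlim. auto. }
    split; [|split; [rewrite L'; auto|exact E']].
    apply locally'_center; auto.
    generalize (filter_and _ _ (locally'_near _ _ E') (locally_locally' _ _ (hol_near _ _ Hg))).
    apply filter_imp. intros z [Hz Hgz]. apply L'; auto. now apply locally_locally'. }
  set (E := C_lim F) in *.
  assert (HE : forall z, hol E z).
  { intros z. destruct (Hlim z) as [g [Hg [Eg _]]]. apply hol_ext with g; auto.
    revert Eg. apply filter_imp. auto. }
  assert (HEl : forall z, clim F z (E z)) by (intros z; now destruct (Hlim z) as [g [_ [_ [H _]]]]).
  assert (Hper : forall b, (forall a, locally' a (fun z => F (z + b) = F z)) ->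
            forall z, E (z + b) = E z).
  { intros b Hb z. apply clim_unique with F z; auto.
    apply clim_ext with (fun z => F (z + b)); auto.
    apply clim_ext with (fun w => F (1 * w + b)).
    { apply filter_forall. intros w. f_equal. ring. }
    apply clim_comp_affine; [apply C1_nz|].
    replace (1 * z + b) with (z + b) by ring. auto. }
  destruct (parallelogram_bounded E tau) as [M HM]; [intros z; now apply hol_cont|].
  assert (HC : forall z, E z = E 0).
  { apply Liouville with M.
    - intros z. now apply hol_at.
    - intros z. destruct (reduce_parallelogram tau z Htau) as [s [t [w [Hs [Ht [Hw ->]]]]]].
      apply (lattice_ind tau (fun z => Cmod (E z) <= M)); auto.
      + intros u Hu. now rewrite Hper.
      + intros u Hu. rewrite <- (Hper 1) by auto. replace (u - 1 + 1) with u by ring. auto.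
      + intros u Hu. now rewrite Hper.
      + intros u Hu. rewrite <- (Hper tau) by auto. replace (u - tau + tau) with u by ring. auto. }
  exists (E 0). intros a. destruct (Hlim a) as [g [_ [Eg [_ E']]]].
  generalize (filter_and _ _ (locally_locally' _ _ Eg) E'). apply filter_imp.
  intros z [E1 ->]. now rewrite <- E1.
Qed.

Lemma ord_ge_pos_lim (f : C -> C) (a : C) (m : Z) : (1 <= m)%Z -> ord_ge f a m -> clim f a 0.
Proof.
  intros Hm H. apply (ord_ge_mono f a m 1 Hm) in H. destruct H as [g [Hg E]].
  apply clim_ext with (fun z => (z - a) * g z).
  { revert E. apply filter_imp. intros z ->. now rewrite zpow_1. }
  eapply clim_eq.
  - apply clim_mult; [apply clim_minus; [apply clim_id|apply clim_const]|exact (hol_cont _ _ Hg)].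
  - ring.
Qed.

Lemma lattice_coords (tau : C) (x y : R) : 0 < Im tau ->
  in_lattice tau (RtoC x + RtoC y * tau) -> exists m n : Z, x = IZR m /\ y = IZR n.
Proof.
  intros Ht [[m n] E]. exists m, n. unfold lattice_point in E; simpl in E.
  destruct tau as [p q]; simpl in *. injection E as E1 E2.
  assert (y = IZR n) by (apply Rmult_eq_reg_r with q; lra). subst y. split; lra.
Qed.

Lemma half_not_integer (m : Z) : (1 / 2)%R <> IZR m.
Proof.
  intros E. assert (IZR 1 = IZR (2 * m)) by (rewrite mult_IZR; lra).
  apply eq_IZR in H. lia.
Qed.

(** In the product of [F] with its translate by 1/2 the zero of one factor
    cancels the pole of the other, so that the product is constant by
    Liouville's theorem; it vanishes at [q0 + tau / 2]. So one of the two
    factors is zero, and they are translates of each other. *)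
Lemma elliptic_zero (F : C -> C) (tau q0 : C) : 0 < Im tau ->
  (forall a, locally' a (fun z => F (z + 1) = F z)) ->
  (forall a, locally' a (fun z => F (z + tau) = F z)) ->
  two_torsion tau q0 ->
  (forall a, two_torsion tau a -> ~ in_lattice tau (a - q0) -> ord_ge F a 1) ->
  (forall a, in_lattice tau (a - q0) -> ord_ge F a (-1)) ->
  (forall a, ~ two_torsion tau a -> ord_ge F a 0) ->
  forall a, locally' a (fun z => F z = 0).
Proof.
  intros Htau H1 H2 Hq0 HT Hq HN.
  set (h := RtoC (1 / 2)).
  assert (Hh : h + h = 1) by (unfold h; rewrite <- RtoC_plus; f_equal; lra).
  assert (Hhn : ~ in_lattice tau h).
  { intros H. replace h with (RtoC (1 / 2) + RtoC 0 * tau) in H by (unfold h; ring).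
    apply lattice_coords in H; auto. destruct H as [m [n [E _]]]. now apply half_not_integer in E. }
  assert (Htor : forall a, two_torsion tau (a + h) <-> two_torsion tau a).
  { intros a. unfold two_torsion. replace (2 * (a + h)) with (2 * a + (h + h)) by ring. rewrite Hh. split; intros H.
    - replace (2 * a) with (2 * a + 1 - 1) by ring. apply in_lattice_minus; auto using in_lattice_1.
    - apply in_lattice_plus; auto using in_lattice_1. }
  assert (Htq : forall a, in_lattice tau (a - q0) -> two_torsion tau a).
  { intros a H. unfold two_torsion. replace (2 * a) with ((a - q0) + (a - q0) + 2 * q0) by ring.
    exact (in_lattice_plus _ _ _ (in_lattice_plus _ _ _ H H) Hq0). }
  assert (Hmero : mero F).
  { intros a. destruct (classic (in_lattice tau (a - q0))); eauto.
    destruct (classic (two_torsion tau a)); eauto. }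
  assert (Hmero' : mero (fun z => F (z + h))).
  { intros a. destruct (Hmero (a + h)) as [m Hm]. exists m. now apply ord_ge_shift. }
  assert (Hpt : forall a, two_torsion tau a -> ~ in_lattice tau (a - q0) ->
     ~ in_lattice tau (a + h - q0) -> ord_ge (fun z => F z * F (z + h)) a 2).
  { intros a Ha Hn1 Hn2. apply (ord_ge_mult F (fun z => F (z + h)) a 1 1); auto.
    apply ord_ge_shift. apply HT; auto. now apply Htor. }
  destruct (elliptic_constant (fun z => F z * F (z + h)) tau) as [k Hk]; auto.
  - intros a. destruct (classic (in_lattice tau (a - q0))) as [Ha|Ha].
    + apply (ord_ge_mult F (fun z => F (z + h)) a (-1) 1); auto.
      apply ord_ge_shift. apply HT; [apply Htor; auto|].
      intros H. apply Hhn. replace h with ((a + h - q0) - (a - q0)) by ring. now apply in_lattice_minus.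
    + destruct (classic (in_lattice tau (a + h - q0))) as [Ha'|Ha'].
      * apply (ord_ge_mult F (fun z => F (z + h)) a 1 (-1)).
        -- apply HT; auto. apply Htor. auto.
        -- apply ord_ge_shift. auto.
      * destruct (classic (two_torsion tau a)) as [Ht|Ht].
        -- apply ord_ge_mono with 2%Z; [lia|auto].
        -- apply (ord_ge_mult F (fun z => F (z + h)) a 0 0); auto.
           apply ord_ge_shift, HN. now rewrite Htor.
  - intros a. assert (H1h := H1 (a + h)).
    assert (X : locally' a (fun z => F (z + h + 1) = F (z + h))).
    { replace (a + h) with (1 * a + h) in H1h by ring.
      apply (locally'_comp_affine _ a h 1 C1_nz) in H1h. revert H1h. apply filter_imp.
      intros z. replace (1 * z + h) with (z + h) by ring. auto. }
    generalize (filter_and _ _ (H1 a) X). apply filter_imp. intros z [-> <-].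
    do 2 f_equal. ring.
  - intros a. assert (H1h := H2 (a + h)).
    assert (X : locally' a (fun z => F (z + h + tau) = F (z + h))).
    { replace (a + h) with (1 * a + h) in H1h by ring.
      apply (locally'_comp_affine _ a h 1 C1_nz) in H1h. revert H1h. apply filter_imp.
      intros z. replace (1 * z + h) with (z + h) by ring. auto. }
    generalize (filter_and _ _ (H2 a) X). apply filter_imp. intros z [-> <-].
    do 2 f_equal. ring.
  -
    (* at [q0 + tau / 2] both factors vanish, so the constant is 0 *)
    set (h' := RtoC (1 / 2) * tau).
    assert (Hh' : h' + h' = tau).
    { unfold h'. transitivity ((RtoC (1 / 2) + RtoC (1 / 2)) * tau); [ring|].
      rewrite <- RtoC_plus. replace (1 / 2 + 1 / 2)%R with 1%R by lra. ring. }
    assert (Hk0 : k = 0).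
    { apply clim_unique with (fun z => F z * F (z + h)) (q0 + h').
      { apply clim_ext with (fun _ => k); [|apply clim_const].
        generalize (Hk (q0 + h')). apply filter_imp. auto. }
      apply ord_ge_pos_lim with 2%Z; [lia|]. apply Hpt.
      - unfold two_torsion. replace (2 * (q0 + h')) with (2 * q0 + (h' + h')) by ring.
        rewrite Hh'. apply in_lattice_plus; auto using in_lattice_tau.
      - intros H. replace (q0 + h' - q0) with (RtoC 0 + h') in H by ring.
        apply lattice_coords in H; auto. destruct H as [m [n [_ E]]]. now apply half_not_integer in E.
      - intros H. replace (q0 + h' + h - q0) with (RtoC (1 / 2) + h') in H by (unfold h; ring).
        apply lattice_coords in H; auto. destruct H as [m [n [_ E]]]. now apply half_not_integer in E. }
    subst k.
    destruct (mero_mult_zero _ _ Hmero Hmero' Hk) as [Hz|Hz]; auto.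
    intros a. specialize (Hz (a - h)). replace (a - h) with (1 * a + (- h)) in Hz by ring.
    apply (locally'_comp_affine _ a (- h) 1 C1_nz) in Hz. revert Hz. apply filter_imp.
    intros z Hz. cbv beta in Hz. replace (1 * z + - h + h) with (z + (- h + h)) in Hz by ring.
    replace (- h + h) with (RtoC 0) in Hz by ring. now rewrite Cplus_0_r in Hz.
Qed.

(** * Sums and products over the lattice *)

Definition index_box (N : nat) : list (Z * Z) :=
  filter (fun mn => negb (Z.eqb (fst mn) 0 && Z.eqb (snd mn) 0))
    (list_prod (Zrange N) (Zrange N)).

Definition supnorm (mn : Z * Z) : Z := Z.max (Z.abs (fst mn)) (Z.abs (snd mn)).

Lemma in_Zrange (N : nat) (m : Z) : In m (Zrange N) <-> (Z.abs m <= Z.of_nat N)%Z.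
Proof.
  unfold Zrange. rewrite in_map_iff. split.
  - intros [i [<- Hi]]. apply in_seq in Hi. lia.
  - intros H. exists (Z.to_nat (m + Z.of_nat N)). split; [lia|]. apply in_seq. lia.
Qed.

Lemma NoDup_Zrange (N : nat) : NoDup (Zrange N).
Proof.
  apply FinFun.Injective_map_NoDup; [|apply seq_NoDup]. intros i j. lia.
Qed.

Lemma length_Zrange (N : nat) : length (Zrange N) = (2 * N + 1)%nat.
Proof. unfold Zrange. now rewrite length_map, length_seq. Qed.

Lemma in_index_box (N : nat) (mn : Z * Z) :
  In mn (index_box N) <-> mn <> (0, 0)%Z /\ (supnorm mn <= Z.of_nat N)%Z.
Proof.
  destruct mn as [m n]. unfold index_box, supnorm. rewrite filter_In, in_prod_iff, !in_Zrange. simpl.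
  rewrite Bool.negb_true_iff, Bool.andb_false_iff, !Z.eqb_neq. split.
  - intros [[H1 H2] H]. split; [|lia]. intros E. injection E as -> ->. lia.
  - intros [H1 H2]. split; [lia|]. destruct (Z.eq_dec m 0); [right|now left].
    subst. intros ->. now apply H1.
Qed.

Lemma NoDup_list_prod {A B : Type} (l : list A) (l' : list B) :
  NoDup l -> NoDup l' -> NoDup (list_prod l l').
Proof.
  intros Hl Hl'. induction Hl as [|x l Hx Hl IH]; simpl; [constructor|].
  apply NoDup_app; auto.
  - apply FinFun.Injective_map_NoDup; auto. intros y y' E. now injection E.
  - intros [u v] H1 H2. apply in_map_iff in H1. destruct H1 as [y [E Hy]]. injection E as <- <-.
    apply in_prod_iff in H2. tauto.
Qed.

Lemma NoDup_index_box (N : nat) : NoDup (index_box N).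
Proof. apply NoDup_filter, NoDup_list_prod; apply NoDup_Zrange. Qed.

(** The indices of sup norm [N + 1], added in the step from [N] to [N + 1]. *)
Definition index_shell (N : nat) : list (Z * Z) :=
  filter (fun mn => Z.eqb (supnorm mn) (Z.of_nat (S N))) (index_box (S N)).

Lemma index_box_S (N : nat) : Permutation (index_box (S N)) (index_shell N ++ index_box N).
Proof.
  apply NoDup_Permutation.
  - apply NoDup_index_box.
  - apply NoDup_app; [apply NoDup_filter, NoDup_index_box|apply NoDup_index_box|].
    intros mn H1 H2. apply filter_In in H1. destruct H1 as [_ H1].
    apply Z.eqb_eq in H1. apply in_index_box in H2. lia.
  - intros mn. rewrite in_app_iff. unfold index_shell. rewrite filter_In, !in_index_box, Z.eqb_eq.
    split; [|intuition lia]. intros [H1 H2].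
    destruct (Z.eq_dec (supnorm mn) (Z.of_nat (S N))); [left|right]; intuition lia.
Qed.

(** The shell lies on the four sides of a square, of [2 N + 3] points each. *)
Lemma length_index_shell (N : nat) : (length (index_shell N) <= 12 * S N)%nat.
Proof.
  set (L := map (fun n => (Z.of_nat (S N), n)) (Zrange (S N)) ++
            map (fun n => (- Z.of_nat (S N), n)%Z) (Zrange (S N)) ++
            map (fun m => (m, Z.of_nat (S N))) (Zrange (S N)) ++
            map (fun m => (m, - Z.of_nat (S N))%Z) (Zrange (S N))).
  assert (HL : length L = (4 * (2 * S N + 1))%nat).
  { unfold L. rewrite !length_app, !length_map, length_Zrange. lia. }
  enough (length (index_shell N) <= length L)%nat by lia.
  apply NoDup_incl_length; [apply NoDup_filter, NoDup_index_box|].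
  intros [m n] H. apply filter_In in H. destruct H as [_ H]. apply Z.eqb_eq in H.
  unfold supnorm in H; simpl in H. unfold L. rewrite !in_app_iff, !in_map_iff.
  destruct (Z.eq_dec (Z.abs m) (Z.of_nat (S N))) as [E|E].
  - assert (In n (Zrange (S N))) by (apply in_Zrange; lia).
    destruct (Z.abs_spec m) as [[_ E']|[_ E']].
    + left. exists n. split; auto. f_equal. lia.
    + right; left. exists n. split; auto. f_equal. lia.
  - assert (In m (Zrange (S N))) by (apply in_Zrange; lia).
    destruct (Z.abs_spec n) as [[_ E']|[_ E']].
    + right; right; left. exists m. split; auto. f_equal. lia.
    + right; right; right. exists m. split; auto. f_equal. lia.
Qed.

(** A constant that measures the distance of the lattice from being degenerate;
    the bounds on sums and products over the lattice are explicit in it. *)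
Definition lattice_lower (tau : C) (c : R) : Prop :=
  (0 < c)%R /\ forall mn, c * IZR (supnorm mn) <= Cmod (lattice_point tau mn).

(** The imaginary part bounds the coefficient of [tau]; subtracting its
    contribution bounds the other one. *)
Lemma lattice_lower_ex (tau : C) : 0 < Im tau -> exists c, lattice_lower tau c.
Proof.
  intros Ht. assert (Ht0 := Cmod_ge_0 tau).
  set (K := (1 + Cmod tau / Im tau)%R).
  assert (HK : 0 < K).
  { unfold K. assert (0 <= Cmod tau / Im tau)%R; [|lra].
    apply Rmult_le_pos; auto. now apply Rlt_le, Rinv_0_lt_compat. }
  exists (Rmin (Im tau) (/ K)). split; [apply Rmin_pos; auto; now apply Rinv_0_lt_compat|].
  intros [m n]. set (w := lattice_point tau (m, n)).
  assert (Hn : Rabs (IZR n) * Im tau <= Cmod w).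
  { eapply Rle_trans; [|apply im_le_Cmod]. unfold w, lattice_point; simpl.
    rewrite <- (Rabs_pos_eq (Im tau)) at 1 by lra. rewrite <- Rabs_mult. right. f_equal.
    unfold Im. ring. }
  assert (Hm : Rabs (IZR m) <= Cmod w * K).
  { replace (RtoC (IZR m)) with (w - RtoC (IZR n) * tau) by (unfold w, lattice_point; simpl; ring).
    assert (E : Cmod (RtoC (IZR m)) <= Cmod w + Rabs (IZR n) * Cmod tau).
    { replace (RtoC (IZR m)) with (w - RtoC (IZR n) * tau) by (unfold w, lattice_point; simpl; ring).
      eapply Rle_trans; [apply Cmod_triangle|]. rewrite Cmod_opp, Cmod_mult, Cmod_R. lra. }
    rewrite Cmod_R in E. eapply Rle_trans; [apply E|].
    assert (X : Rabs (IZR n) * Cmod tau <= Cmod w * (Cmod tau / Im tau)).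
    { replace (Rabs (IZR n) * Cmod tau)%R with (Rabs (IZR n) * Im tau * (Cmod tau / Im tau))%R by (field; lra).
      apply Rmult_le_compat_r; auto. unfold K in HK.
      apply Rmult_le_pos; auto. now apply Rlt_le, Rinv_0_lt_compat. }
    unfold K. lra. }
  assert (HR1 := Rmin_l (Im tau) (/ K)). assert (HR2 := Rmin_r (Im tau) (/ K)).
  assert (Hk : Rmin (Im tau) (/ K) * Rabs (IZR m) <= Cmod w).
  { apply Rle_trans with (/ K * Rabs (IZR m))%R.
    - apply Rmult_le_compat_r; auto using Rabs_pos.
    - apply Rmult_le_reg_l with K; auto. rewrite <- Rmult_assoc, Rinv_r by lra. lra. }
  assert (Hk' : Rmin (Im tau) (/ K) * Rabs (IZR n) <= Cmod w).
  { eapply Rle_trans; [|apply Hn]. rewrite Rmult_comm. apply Rmult_le_compat_l; auto using Rabs_pos. }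
  rewrite <- abs_IZR in Hk, Hk'. unfold supnorm; simpl.
  destruct (Z.max_spec (Z.abs m) (Z.abs n)) as [[_ ->]|[_ ->]]; auto.
Qed.

Definition nzlat (tau w : C) : Prop := exists mn, mn <> (0, 0)%Z /\ w = lattice_point tau mn.

Lemma nzlat_lower (tau w : C) (c : R) : lattice_lower tau c -> nzlat tau w -> c <= Cmod w.
Proof.
  intros [Hc H] [[m n] [Hne ->]]. specialize (H (m, n)).
  assert (1 <= supnorm (m, n))%Z.
  { unfold supnorm; simpl. destruct (Z.eq_dec m 0), (Z.eq_dec n 0); subst; try lia. now destruct Hne. }
  apply IZR_le in H0. nra.
Qed.

Lemma nzlat_ne (tau w : C) (c : R) : lattice_lower tau c -> nzlat tau w -> w <> 0.
Proof.
  intros Hc Hw. apply Cmod_gt_0. assert (H := nzlat_lower _ _ _ Hc Hw). destruct Hc. lra.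
Qed.

Lemma nzlat_box (tau w : C) (N : nat) : In w (lattice_box tau N) -> nzlat tau w.
Proof.
  unfold lattice_box. fold (index_box N). rewrite in_map_iff. intros [mn [<- H]].
  apply in_index_box in H. exists mn. tauto.
Qed.

Definition shell (tau : C) (N : nat) : list C := map (lattice_point tau) (index_shell N).

Lemma lattice_box_S (tau : C) (N : nat) :
  Permutation (lattice_box tau (S N)) (shell tau N ++ lattice_box tau N).
Proof.
  unfold lattice_box, shell. fold (index_box (S N)) (index_box N). rewrite <- map_app.
  apply Permutation_map, index_box_S.
Qed.

Lemma in_shell (tau w : C) (N : nat) (c : R) : lattice_lower tau c -> In w (shell tau N) ->
  nzlat tau w /\ c * INR (S N) <= Cmod w.
Proof.
  intros [Hc H] Hw. unfold shell in Hw. apply in_map_iff in Hw. destruct Hw as [mn [<- Hmn]].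
  apply filter_In in Hmn. destruct Hmn as [H1 H2]. apply in_index_box in H1. apply Z.eqb_eq in H2.
  split; [exists mn; tauto|]. rewrite INR_IZR_INZ, <- H2. apply H.
Qed.

Lemma Csum_app (l l' : list C) : Csum (l ++ l') = Csum l + Csum l'.
Proof. unfold Csum. induction l as [|x l IH]; simpl; [ring|]. rewrite IH. ring. Qed.

Lemma Cprod_app (l l' : list C) : Cprod (l ++ l') = Cprod l * Cprod l'.
Proof. unfold Cprod. induction l as [|x l IH]; simpl; [ring|]. rewrite IH. ring. Qed.

Lemma Csum_perm (l l' : list C) : Permutation l l' -> Csum l = Csum l'.
Proof. unfold Csum. induction 1; simpl; try congruence. ring. Qed.

Lemma Cprod_perm (l l' : list C) : Permutation l l' -> Cprod l = Cprod l'.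
Proof. unfold Cprod. induction 1; simpl; try congruence. ring. Qed.

Lemma Csum_bound (f : C -> C) (l : list C) (M : R) :
  (forall w, In w l -> Cmod (f w) <= M) -> Cmod (Csum (map f l)) <= INR (length l) * M.
Proof.
  induction l as [|x l IH]; intros H.
  - simpl. rewrite Cmod_0. lra.
  - change (length (x :: l)) with (S (length l)). rewrite S_INR.
    change (Csum (map f (x :: l))) with (f x + Csum (map f l)).
    eapply Rle_trans; [apply Cmod_triangle|].
    assert (Cmod (f x) <= M)%R by (apply H; now left).
    assert (Cmod (Csum (map f l)) <= INR (length l) * M)%R by (apply IH; intros; apply H; now right).
    lra.
Qed.

Definition cconv (u : nat -> C) (l : C) : Prop :=
  forall e, 0 < e -> exists N0, forall N, (N0 <= N)%nat -> Cmod (u N - l) < e.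

Lemma cconv_Clim_seq (u : nat -> C) (l : C) : cconv u l -> Clim_seq u = l.
Proof.
  intros H. unfold Clim_seq.
  assert (H1 : is_lim_seq (fun N => Re (u N)) (Re l)).
  { apply is_lim_seq_spec. intros e. destruct (H e (cond_pos e)) as [N0 HN]. exists N0.
    intros N HN'. eapply Rle_lt_trans; [|apply (HN N HN')].
    eapply Rle_trans; [|apply re_le_Cmod]. right. f_equal. }
  assert (H2 : is_lim_seq (fun N => Im (u N)) (Im l)).
  { apply is_lim_seq_spec. intros e. destruct (H e (cond_pos e)) as [N0 HN]. exists N0.
    intros N HN'. eapply Rle_lt_trans; [|apply (HN N HN')].
    eapply Rle_trans; [|apply im_le_Cmod]. right. f_equal. }
  apply is_lim_seq_unique in H1, H2. rewrite H1, H2. now destruct l.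
Qed.

Lemma cconv_unique (u : nat -> C) (l m : C) : cconv u l -> cconv u m -> l = m.
Proof. intros H1 H2. apply cconv_Clim_seq in H1, H2. congruence. Qed.

Lemma cconv_const (k : C) : cconv (fun _ => k) k.
Proof.
  intros e He. exists 0%nat. intros. replace (k - k) with (RtoC 0) by ring. now rewrite Cmod_0.
Qed.

Lemma cconv_plus (u v : nat -> C) (l m : C) :
  cconv u l -> cconv v m -> cconv (fun N => u N + v N) (l + m).
Proof.
  intros Hu Hv e He. destruct (Hu (e / 2)%R ltac:(lra)) as [N1 H1].
  destruct (Hv (e / 2)%R ltac:(lra)) as [N2 H2].
  exists (max N1 N2). intros N HN. specialize (H1 N ltac:(lia)). specialize (H2 N ltac:(lia)).
  replace (u N + v N - (l + m)) with ((u N - l) + (v N - m)) by ring.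
  eapply Rle_lt_trans; [apply Cmod_triangle|lra].
Qed.

Lemma cconv_bound (u : nat -> C) (l : C) (M : R) :
  cconv u l -> (forall N, Cmod (u N) <= M) -> Cmod l <= M.
Proof.
  intros H HM. apply Rnot_lt_le. intros Hlt.
  destruct (H (Cmod l - M)%R ltac:(lra)) as [N HN]. specialize (HN N (Nat.le_refl N)).
  specialize (HM N). assert (X := Cmod_rev l (u N)). rewrite Cmod_minus_sym in X. lra.
Qed.

Lemma cconv_mult (u v : nat -> C) (l m : C) :
  cconv u l -> cconv v m -> cconv (fun N => u N * v N) (l * m).
Proof.
  intros Hu Hv e He.
  set (A := (Cmod m + 1)%R). set (B := (Cmod l + 1)%R).
  assert (HA : 0 < A) by (unfold A; assert (X := Cmod_ge_0 m); lra).
  assert (HB : 0 < B) by (unfold B; assert (X := Cmod_ge_0 l); lra).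
  destruct (Hu (e / 2 / A)%R) as [N1 H1]; [apply Rdiv_lt_0_compat; lra|].
  destruct (Hv (e / 2 / B)%R) as [N2 H2]; [apply Rdiv_lt_0_compat; lra|].
  destruct (Hv 1%R ltac:(lra)) as [N3 H3].
  exists (max N1 (max N2 N3)). intros N HN.
  specialize (H1 N ltac:(lia)). specialize (H2 N ltac:(lia)). specialize (H3 N ltac:(lia)).
  replace (u N * v N - l * m) with ((u N - l) * v N + l * (v N - m)) by ring.
  eapply Rle_lt_trans; [apply Cmod_triangle|]. rewrite !Cmod_mult.
  assert (X := Cmod_rev (v N) m).
  assert (P1 : Cmod (u N - l) * Cmod (v N) <= Cmod (u N - l) * A)
    by (apply Rmult_le_compat_l; [apply Cmod_ge_0|unfold A; lra]).
  assert (P2 : Cmod (u N - l) * A < e / 2).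
  { apply Rmult_lt_compat_r with (r := A) in H1; auto.
    replace (e / 2 / A * A)%R with (e / 2)%R in H1 by (field; lra). auto. }
  assert (P3 : Cmod l * Cmod (v N - m) <= B * Cmod (v N - m))
    by (apply Rmult_le_compat_r; [apply Cmod_ge_0|unfold B; lra]).
  assert (P4 : B * Cmod (v N - m) < e / 2).
  { apply Rmult_lt_compat_l with (r := B) in H2; auto.
    replace (B * (e / 2 / B))%R with (e / 2)%R in H2 by (field; lra). auto. }
  lra.
Qed.

(** Increments of order [1 / N ^ 2] are summable: the sum telescopes against [2
    / N]. *)
Lemma cconv_quadratic (u : nat -> C) (A : R) : 0 <= A ->
  (forall N, Cmod (u (S N) - u N) <= A / (INR (S N) * INR (S N))) ->
  (exists l, cconv u l) /\ forall N, Cmod (u N - u 0%nat) <= 2 * A.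
Proof.
  intros HA H.
  assert (Hpos : forall N, 0 < INR (S N)) by (intros; apply lt_0_INR; lia).
  assert (Htel : forall N M, Cmod (u (N + M)%nat - u N) <= 2 * A * (/ INR (S N) - / INR (S (N + M)))).
  { intros N M. induction M as [|M IH].
    - rewrite Nat.add_0_r. replace (u N - u N) with (RtoC 0) by ring. rewrite Cmod_0. lra.
    - rewrite Nat.add_succ_r. set (k := (N + M)%nat) in *.
      replace (u (S k) - u N) with ((u (S k) - u k) + (u k - u N)) by ring.
      eapply Rle_trans; [apply Cmod_triangle|]. specialize (H k).
      assert (Hk := Hpos k). rewrite (S_INR (S k)). set (x := INR (S k)) in *.
      assert (Hx : 1 <= x) by (unfold x; rewrite S_INR; assert (Y := pos_INR k); lra).
      assert (E : A / (x * x) <= 2 * A * (/ x - / (x + 1))).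
      { replace (2 * A * (/ x - / (x + 1)))%R with (A / (x * x) * (2 * x / (x + 1)))%R by (field; lra).
        rewrite <- (Rmult_1_r (A / (x * x))) at 1. apply Rmult_le_compat_l.
        - apply Rmult_le_pos; auto. apply Rlt_le, Rinv_0_lt_compat. nra.
        - apply Rmult_le_reg_r with (x + 1)%R; [lra|].
          replace (2 * x / (x + 1) * (x + 1))%R with (2 * x)%R by (field; lra). lra. }
      lra. }
  assert (Hle : forall N M, (N <= M)%nat -> Cmod (u M - u N) <= 2 * A / INR (S N)).
  { intros N M HNM. replace M with (N + (M - N))%nat by lia.
    eapply Rle_trans; [apply Htel|]. unfold Rdiv. apply Rmult_le_compat_l; [lra|].
    assert (0 < / INR (S (N + (M - N))))%R by now apply Rinv_0_lt_compat. lra. }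
  split.
  - assert (Hc : forall e : posreal, exists N0, forall n m, (N0 <= n)%nat -> (N0 <= m)%nat ->
              Cmod (u n - u m) < e).
    { intros e. destruct (archimed (4 * A / e + 1)%R) as [Hup _].
      set (N0 := Z.to_nat (up (4 * A / e + 1))).
      assert (He := cond_pos e).
      assert (Hq : 0 <= 4 * A / e) by (apply Rmult_le_pos; [lra|now apply Rlt_le, Rinv_0_lt_compat]).
      assert (HN0 : 4 * A / e < INR (S N0)).
      { rewrite S_INR. unfold N0. rewrite INR_IZR_INZ, Z2Nat.id; [lra|].
        apply le_IZR. lra. }
      assert (Hb : 2 * A / INR (S N0) < e / 2).
      { apply Rmult_lt_reg_r with (INR (S N0)); auto.
        replace (2 * A / INR (S N0) * INR (S N0))%R with (2 * A)%R by (field; specialize (Hpos N0); lra).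
        apply Rmult_lt_compat_l with (r := (e / 2)%R) in HN0; [|lra].
        replace (e / 2 * (4 * A / e))%R with (2 * A)%R in HN0 by (field; lra). lra. }
      exists N0. intros n m Hn Hm. assert (X := Hle N0 n Hn). assert (Y := Hle N0 m Hm).
      replace (u n - u m) with ((u n - u N0) + (u N0 - u m)) by ring.
      eapply Rle_lt_trans; [apply Cmod_triangle|]. rewrite (Cmod_minus_sym (u N0)). lra. }
    assert (H1 : ex_finite_lim_seq (fun N => Re (u N))).
    { apply ex_lim_seq_cauchy_corr. intros e. destruct (Hc e) as [N0 HN]. exists N0.
      intros n m Hn Hm. eapply Rle_lt_trans; [|apply (HN n m Hn Hm)].
      eapply Rle_trans; [|apply re_le_Cmod]. right. f_equal. }
    assert (H2 : ex_finite_lim_seq (fun N => Im (u N))).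
    { apply ex_lim_seq_cauchy_corr. intros e. destruct (Hc e) as [N0 HN]. exists N0.
      intros n m Hn Hm. eapply Rle_lt_trans; [|apply (HN n m Hn Hm)].
      eapply Rle_trans; [|apply im_le_Cmod]. right. f_equal. }
    destruct H1 as [x Hx], H2 as [y Hy]. exists (x, y). intros e He.
    apply is_lim_seq_spec in Hx, Hy.
    assert (He2 : 0 < e / 2) by lra.
    destruct (Hx (mkposreal _ He2)) as [N1 HN1], (Hy (mkposreal _ He2)) as [N2 HN2]. simpl in *.
    exists (max N1 N2). intros N HN. eapply Rle_lt_trans; [apply Cmod_le_parts|]. simpl.
    specialize (HN1 N ltac:(lia)). specialize (HN2 N ltac:(lia)). unfold Rminus in *. unfold Re, Im in *. lra.
  - intros N. eapply Rle_trans; [apply Hle; lia|]. simpl INR. right. field.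
Qed.

(** The decay that makes sums over the lattice converge, since the shell at
    distance [N] has [O (N)] points. *)
Definition cubic (tau : C) (f : C -> C) (K : R) : Prop :=
  forall w, nzlat tau w -> Cmod (f w) <= K / (Cmod w * Cmod w * Cmod w).

Lemma lattice_box_0 (tau : C) : lattice_box tau 0 = nil.
Proof. reflexivity. Qed.

Lemma shell_sum_bound (tau : C) (c K : R) (f : C -> C) (N : nat) : lattice_lower tau c ->
  0 <= K -> cubic tau f K ->
  Cmod (Csum (map f (shell tau N))) <= 12 * K / (c * c * c) / (INR (S N) * INR (S N)).
Proof.
  intros Hc HK Hf. assert (Hc0 := proj1 Hc).
  assert (Hx : 0 < INR (S N)) by (apply lt_0_INR; lia). set (x := INR (S N)) in *.
  assert (Hcx : 0 < c * x) by now apply Rmult_lt_0_compat.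
  eapply Rle_trans.
  - apply Csum_bound with (M := (K / ((c * x) * (c * x) * (c * x)))%R). intros w Hw.
    destruct (in_shell _ _ _ _ Hc Hw) as [Hnz Hw']. fold x in Hw'.
    eapply Rle_trans; [apply Hf; auto|]. unfold Rdiv. apply Rmult_le_compat_l; auto.
    apply Rinv_le_contravar; [repeat apply Rmult_lt_0_compat; auto|].
    apply Rmult_le_compat; auto; try lra; [nra|]. apply Rmult_le_compat; lra.
  - unfold shell. rewrite length_map.
    assert (L := length_index_shell N). apply le_INR in L. rewrite mult_INR in L.
    replace (INR 12) with 12%R in L by (simpl; ring). fold x in L.
    apply Rle_trans with (12 * x * (K / (c * x * (c * x) * (c * x))))%R.
    + apply Rmult_le_compat_r; auto. apply Rmult_le_pos; auto. apply Rlt_le, Rinv_0_lt_compat.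
      repeat apply Rmult_lt_0_compat; auto.
    + right. field. lra.
Qed.

Lemma lattice_sum_conv (tau : C) (c K : R) (f : C -> C) : lattice_lower tau c ->
  0 <= K -> cubic tau f K ->
  cconv (fun N => Csum (map f (lattice_box tau N))) (lattice_sum tau f) /\
  forall N, Cmod (Csum (map f (lattice_box tau N))) <= 24 / (c * c * c) * K.
Proof.
  intros Hc HK Hf. assert (Hc0 := proj1 Hc).
  assert (Hi : 0 < / (c * c * c)) by (apply Rinv_0_lt_compat; repeat apply Rmult_lt_0_compat; auto).
  destruct (cconv_quadratic (fun N => Csum (map f (lattice_box tau N))) (12 * K / (c * c * c)))
    as [[l Hl] HB].
  - apply Rmult_le_pos; lra.
  - intros N. rewrite (Csum_perm _ _ (Permutation_map f (lattice_box_S tau N))), map_app, Csum_app.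
    match goal with |- (Cmod ?e <= _)%R => replace e with (Csum (map f (shell tau N))) by ring end.
    now apply shell_sum_bound.
  - split.
    + unfold lattice_sum. now rewrite (cconv_Clim_seq _ _ Hl).
    + intros N. specialize (HB N). rewrite lattice_box_0 in HB. simpl in HB.
      replace (Csum (map f (lattice_box tau N))) with (Csum (map f (lattice_box tau N)) - 0) by ring.
      eapply Rle_trans; [apply HB|]. right. field. lra.
Qed.

Lemma lattice_sum_bound (tau : C) (c K : R) (f : C -> C) : lattice_lower tau c ->
  0 <= K -> cubic tau f K -> Cmod (lattice_sum tau f) <= 24 / (c * c * c) * K.
Proof.
  intros Hc HK Hf. destruct (lattice_sum_conv _ _ _ _ Hc HK Hf) as [H1 H2].
  eapply cconv_bound; eauto.
Qed.

Lemma Csum_lin (f g h : C -> C) (k : C) (l : list C) :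
  Csum (map f l) + (-1) * Csum (map g l) + k * Csum (map h l)
  = Csum (map (fun w => f w + (-1) * g w + k * h w) l).
Proof. unfold Csum. induction l as [|x l IH]; simpl; [ring|]. rewrite <- IH. ring. Qed.

Lemma cubic_lin (tau : C) (f g h : C -> C) (k : C) (K1 K2 K3 : R) :
  cubic tau f K1 -> cubic tau g K2 -> cubic tau h K3 ->
  cubic tau (fun w => f w + (-1) * g w + k * h w) (K1 + K2 + Cmod k * K3).
Proof.
  intros H1 H2 H3 w Hw. specialize (H1 w Hw). specialize (H2 w Hw). specialize (H3 w Hw).
  eapply Rle_trans; [apply Cmod_triangle|].
  assert (X := Cmod_triangle (f w) ((-1) * g w)).
  replace ((-1) * g w) with (- g w) in * by ring. rewrite Cmod_opp in X. rewrite Cmod_mult.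
  apply (Rmult_le_compat_l (Cmod k)) in H3; [|apply Cmod_ge_0]. unfold Rdiv in *.
  rewrite !Rmult_plus_distr_r. lra.
Qed.

Lemma lattice_sum_lin (tau : C) (c : R) (f g h : C -> C) (k : C) (K1 K2 K3 : R) :
  lattice_lower tau c -> 0 <= K1 -> 0 <= K2 -> 0 <= K3 ->
  cubic tau f K1 -> cubic tau g K2 -> cubic tau h K3 ->
  lattice_sum tau f - lattice_sum tau g + k * lattice_sum tau h
  = lattice_sum tau (fun w => f w + (-1) * g w + k * h w).
Proof.
  intros Hc P1 P2 P3 H1 H2 H3.
  apply (lattice_sum_conv _ _ _ _ Hc P1) in H1 as L1. apply (lattice_sum_conv _ _ _ _ Hc P2) in H2 as L2.
  apply (lattice_sum_conv _ _ _ _ Hc P3) in H3 as L3.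
  assert (H := cubic_lin _ _ _ _ k _ _ _ H1 H2 H3).
  assert (P : 0 <= K1 + K2 + Cmod k * K3).
  { assert (X := Cmod_ge_0 k). assert (0 <= Cmod k * K3)%R by now apply Rmult_le_pos. lra. }
  apply (lattice_sum_conv _ _ _ _ Hc P) in H. destruct H as [H _].
  eapply cconv_unique; [|exact H].
  assert (Q : cconv (fun N => Csum (map f (lattice_box tau N)) + (-1) * Csum (map g (lattice_box tau N))
       + k * Csum (map h (lattice_box tau N)))
    (lattice_sum tau f + (-1) * lattice_sum tau g + k * lattice_sum tau h)).
  { apply cconv_plus; [apply cconv_plus; [apply L1|]|]; apply cconv_mult; try apply cconv_const;
      [apply L2|apply L3]. }
  intros e He. destruct (Q e He) as [N0 HN]. exists N0. intros N HNN. specialize (HN N HNN).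
  rewrite Csum_lin in HN.
  replace (lattice_sum tau f - lattice_sum tau g + k * lattice_sum tau h)
    with (lattice_sum tau f + (-1) * lattice_sum tau g + k * lattice_sum tau h) by ring. exact HN.
Qed.

(** * Infinite products over the lattice *)

Definition Rsum (l : list R) : R := fold_right Rplus 0%R l.

(** By induction on the list, from [1 + x <= exp x]. *)
Lemma Cprod_near_1 (a : C -> C) (l : list C) :
  Cmod (Cprod (map (fun w => 1 + a w)%C l)) <= exp (Rsum (map (fun w => Cmod (a w)) l)) /\
  Cmod (Cprod (map (fun w => 1 + a w)%C l) - 1) <=
    exp (Rsum (map (fun w => Cmod (a w)) l)) * Rsum (map (fun w => Cmod (a w)) l) /\
  0 <= Rsum (map (fun w => Cmod (a w)) l).
Proof.
  induction l as [|x l [IH1 [IH2 IH3]]].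
  - simpl. rewrite exp_0, Cmod_1. replace (RtoC 1 - RtoC 1) with (RtoC 0) by ring.
    rewrite Cmod_0. lra.
  - simpl map. unfold Cprod, Rsum in *. simpl fold_right.
    set (P := fold_right Cmult (RtoC 1) _) in *. set (s := fold_right Rplus 0%R _) in *.
    assert (Hax := Cmod_ge_0 (a x)). rewrite exp_plus.
    assert (He := exp_pos s). assert (He' := exp_ineq1_le (Cmod (a x))).
    assert (HP : Cmod ((1 + a x) * P) <= exp (Cmod (a x)) * exp s).
    { rewrite Cmod_mult. apply Rmult_le_compat; auto using Cmod_ge_0.
      eapply Rle_trans; [apply Cmod_triangle|]. rewrite Cmod_1. lra. }
    split; [exact HP|]. split; [|lra].
    replace ((1 + a x) * P - 1) with ((P - 1) + a x * P) by ring.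
    eapply Rle_trans; [apply Cmod_triangle|]. rewrite Cmod_mult.
    assert (H1 : Cmod (a x) * Cmod P <= Cmod (a x) * exp s) by now apply Rmult_le_compat_l.
    assert (H2 : 1 <= exp (Cmod (a x))) by lra.
    assert (H3 : 0 <= exp s * (s + Cmod (a x))) by (apply Rmult_le_pos; lra).
    assert (H4 : exp s * (s + Cmod (a x)) <= exp (Cmod (a x)) * (exp s * (s + Cmod (a x)))).
    { rewrite <- (Rmult_1_l (exp s * _)) at 1. now apply Rmult_le_compat_r. }
    lra.
Qed.

Lemma Rsum_Csum (f : C -> R) (l : list C) :
  Csum (map (fun w => RtoC (f w)) l) = RtoC (Rsum (map f l)).
Proof.
  unfold Csum, Rsum. induction l as [|x l IH]; simpl; auto. rewrite IH, RtoC_plus. reflexivity.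
Qed.

Lemma cubic_mod (tau : C) (f : C -> C) (K : R) :
  cubic tau f K -> cubic tau (fun w => RtoC (Cmod (f w))) K.
Proof. intros H w Hw. rewrite Cmod_R, Rabs_pos_eq by apply Cmod_ge_0. auto. Qed.

(** The partial products are bounded by the exponential of the sum of the [|a
    w|], and each shell multiplies them by [1 + O (1 / N ^ 2)]. *)
Lemma lattice_prod_conv (tau : C) (c K : R) (a : C -> C) : lattice_lower tau c ->
  0 <= K -> cubic tau a K ->
  cconv (fun N => Cprod (map (fun w => 1 + a w) (lattice_box tau N)))
    (lattice_prod tau (fun w => 1 + a w)) /\
  forall N, Cmod (Cprod (map (fun w => 1 + a w)%C (lattice_box tau N))) <= exp (24 / (c * c * c) * K).
Proof.
  intros Hc HK Ha. assert (Hc0 := proj1 Hc).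
  assert (Ha' := cubic_mod _ _ _ Ha).
  assert (Hi : 0 < / (c * c * c)) by (apply Rinv_0_lt_compat; repeat apply Rmult_lt_0_compat; auto).
  set (B := exp (24 / (c * c * c) * K)).
  assert (HB : forall N, Cmod (Cprod (map (fun w => 1 + a w)%C (lattice_box tau N))) <= B).
  { intros N. destruct (Cprod_near_1 a (lattice_box tau N)) as [H1 [_ H3]].
    eapply Rle_trans; [apply H1|]. unfold B.
    destruct (lattice_sum_conv _ _ _ _ Hc HK Ha') as [_ H4]. specialize (H4 N).
    rewrite Rsum_Csum, Cmod_R, Rabs_pos_eq in H4 by auto.
    destruct H4 as [H4|H4]; [apply Rlt_le, exp_increasing, H4|rewrite H4; lra]. }
  split; auto.
  set (A := (12 * K / (c * c * c))%R).
  assert (HA : 0 <= A) by (apply Rmult_le_pos; lra).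
  assert (HB0 : 0 < B) by apply exp_pos.
  destruct (cconv_quadratic (fun N => Cprod (map (fun w => 1 + a w) (lattice_box tau N)))
     (B * exp A * A)) as [[l Hl] _].
  - assert (HeA := exp_pos A). apply Rmult_le_pos; [|exact HA]. apply Rmult_le_pos; lra.
  - intros N.
    rewrite (Cprod_perm _ _ (Permutation_map (fun w => 1 + a w) (lattice_box_S tau N))), map_app, Cprod_app.
    set (P := Cprod (map _ (lattice_box tau N))). set (S0 := Cprod (map _ (shell tau N))).
    replace (S0 * P - P) with (P * (S0 - 1)) by ring. rewrite Cmod_mult.
    destruct (Cprod_near_1 a (shell tau N)) as [_ [H2 H3]].
    assert (H4 := shell_sum_bound tau c K _ N Hc HK Ha').
    rewrite Rsum_Csum, Cmod_R, Rabs_pos_eq in H4 by auto. fold A in H4.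
    set (s := Rsum _) in *. fold S0 in H2.
    assert (Hx : 1 <= INR (S N)) by (rewrite S_INR; assert (Y := pos_INR N); lra).
    set (x := INR (S N)) in *.
    assert (HsA : s <= A).
    { eapply Rle_trans; [apply H4|]. unfold Rdiv. rewrite <- (Rmult_1_r A) at 2.
      apply Rmult_le_compat_l; auto. rewrite <- Rinv_1. apply Rinv_le_contravar; nra. }
    assert (Hes : exp s <= exp A) by (destruct HsA as [HsA|HsA]; [apply Rlt_le, exp_increasing, HsA|rewrite HsA; lra]).
    replace (B * exp A * A / (x * x))%R with (B * (exp A * (A / (x * x))))%R by (field; lra).
    apply Rmult_le_compat; try apply Cmod_ge_0; [apply HB|].
    eapply Rle_trans; [apply H2|]. apply Rmult_le_compat; auto. apply Rlt_le, exp_pos.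
  - unfold lattice_prod. now rewrite (cconv_Clim_seq _ _ Hl).
Qed.

(** * Mean value bounds and the exponential function *)

(** After a rotation of [f 1 - f 0] onto the positive real axis, the mean value
    theorem applies to the real part. *)
Lemma mean_value_bound (f df : R -> C) (M : R) :
  (forall t, 0 <= t <= 1 -> rderive f t (df t)) ->
  (forall t, 0 <= t <= 1 -> Cmod (df t) <= M) -> Cmod (f 1%R - f 0%R) <= M.
Proof.
  intros H HM. set (d := f 1%R - f 0%R).
  assert (Hd : forall t, 0 <= t <= 1 ->
            is_derive (fun s => Re (Cconj d * f s)) t (Re (Cconj d * df t))).
  { intros t Ht.
    refine (proj1 (rderive_ext _ _ _ _ _ _ _ (rderive_affine (Cconj d) 0 f t _ (H t Ht)))).
    - intros s. cbv beta. ring. - reflexivity. }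
  destruct (MVT_gen (fun s => Re (Cconj d * f s)) 0 1 (fun t => Re (Cconj d * df t))) as [c [Hc E]].
  - intros x Hx. apply Hd. rewrite Rmin_left, Rmax_right in Hx by lra. lra.
  - intros x Hx. apply continuity_pt_filterlim, (ex_derive_continuous (V := R_NormedModule)).
    eexists. apply Hd. rewrite Rmin_left, Rmax_right in Hx by lra. lra.
  - rewrite Rmin_left, Rmax_right in Hc by lra.
    assert (E2 : (Re (Cconj d * f 1%R) - Re (Cconj d * f 0%R) = Cmod d * Cmod d)%R).
    { transitivity (Re (d * Cconj d)).
      - unfold d. destruct (f 1%R), (f 0%R). simpl. ring.
      - rewrite <- Cmod2_conj. simpl. ring. }
    rewrite E2 in E.
    assert (HB : Re (Cconj d * df c) <= Cmod d * M).
    { eapply Rle_trans; [apply Rle_abs|]. eapply Rle_trans; [apply re_le_Cmod|].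
      rewrite Cmod_mult, Cmod_conj. apply Rmult_le_compat_l; [apply Cmod_ge_0|apply HM; lra]. }
    destruct (Rle_lt_or_eq_dec 0 (Cmod d) (Cmod_ge_0 d)) as [Hp|Hz].
    + apply Rmult_le_reg_l with (Cmod d); auto. lra.
    + rewrite <- Hz. eapply Rle_trans; [apply Cmod_ge_0|apply (HM 0%R); lra].
Qed.

Lemma segment_bound (f df : C -> C) (a b : C) (M : R) :
  (forall t, 0 <= t <= 1 -> Cderive_at f (a + RtoC t * (b - a)) (df (a + RtoC t * (b - a)))) ->
  (forall t, 0 <= t <= 1 -> Cmod (df (a + RtoC t * (b - a))%C) <= M) ->
  Cmod (f b - f a) <= M * Cmod (b - a).
Proof.
  intros H HM.
  assert (X := mean_value_bound (fun t => f (a + RtoC t * (b - a)))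
    (fun t => df (a + RtoC t * (b - a)) * (b - a)) (M * Cmod (b - a))).
  cbv beta in X.
  replace (a + RtoC 1 * (b - a)) with b in X by ring.
  replace (a + RtoC 0 * (b - a)) with a in X by ring. apply X.
  - intros t Ht. eapply rderive_ext; [| |eapply (rderive_comp f (fun s => a + RtoC s * (b - a)) t _ (b - a))].
    + reflexivity.
    + reflexivity.
    + auto.
    + eapply rderive_ext; [| |apply (rderive_affine (b - a) a), rderive_RtoC].
      * intros s. cbv beta. ring. * ring.
  - intros t Ht. rewrite Cmod_mult. apply Rmult_le_compat_r; auto using Cmod_ge_0.
Qed.

Lemma segment_in_disc (a z z' : C) (d t : R) : 0 <= t <= 1 ->
  Cmod (z - a) < d -> Cmod (z' - a) < d -> Cmod (z + RtoC t * (z' - z) - a) < d.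
Proof.
  intros Ht Hz Hz'.
  replace (z + RtoC t * (z' - z) - a) with (RtoC (1 - t) * (z - a) + RtoC t * (z' - a))
    by (rewrite RtoC_minus; ring).
  eapply Rle_lt_trans; [apply Cmod_triangle|]. rewrite !Cmod_mult, !Cmod_R, !Rabs_pos_eq by lra.
  destruct (Req_dec t 0) as [->|]; nra.
Qed.

(** The mean value bound is applied to [f1] and then to [f] minus its linear
    part. *)
Lemma Taylor_bound (f f1 f2 : C -> C) (a z z' : C) (d M : R) :
  (forall u, Cmod (u - a) < d ->
     Cderive_at f u (f1 u) /\ Cderive_at f1 u (f2 u) /\ Cmod (f2 u) <= M) ->
  Cmod (z - a) < d -> Cmod (z' - a) < d ->
  Cmod (f z' - f z - f1 z * (z' - z)) <= M * (Cmod (z' - z) * Cmod (z' - z)).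
Proof.
  intros H Hz Hz'.
  assert (HM0 : 0 <= M) by (eapply Rle_trans; [apply Cmod_ge_0|apply (H z Hz)]).
  assert (H1 : forall t, 0 <= t <= 1 ->
     Cmod (f1 (z + RtoC t * (z' - z))%C - f1 z) <= M * Cmod (z' - z)).
  { intros t Ht. set (y := z + RtoC t * (z' - z)).
    assert (Hy : Cmod (y - a) < d) by now apply segment_in_disc.
    eapply Rle_trans; [apply (segment_bound f1 f2 z y M)|].
    - intros s Hs. apply H. now apply segment_in_disc.
    - intros s Hs. apply H. now apply segment_in_disc.
    - apply Rmult_le_compat_l; auto. unfold y.
      replace (z + RtoC t * (z' - z) - z) with (RtoC t * (z' - z)) by ring.
      rewrite Cmod_mult, Cmod_R, Rabs_pos_eq by lra. assert (X := Cmod_ge_0 (z' - z)). nra. }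
  assert (X := segment_bound (fun u => f u - f1 z * (u - z)) (fun u => f1 u - f1 z) z z' (M * Cmod (z' - z))).
  cbv beta in X.
  replace (f z' - f z - f1 z * (z' - z))
    with (f z' - f1 z * (z' - z) - (f z - f1 z * (z - z))) by ring.
  rewrite <- Rmult_assoc. apply X; auto.
  intros t Ht. eapply Cderive_eq.
  - apply Cderive_minus; [exact (proj1 (H _ (segment_in_disc a z z' d t Ht Hz Hz')))|].
    apply Cderive_scal, Cderive_minus; [apply Cderive_id|apply Cderive_const].
  - ring.
Qed.

Lemma Cexp_plus (z w : C) : Cexp (z + w) = Cexp z * Cexp w.
Proof.
  destruct z as [a b], w as [c d]. unfold Cexp, Cmult; simpl.
  rewrite exp_plus, cos_plus, sin_plus. f_equal; ring.
Qed.

Lemma Cexp_0 : Cexp 0 = 1.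
Proof. unfold Cexp; simpl. rewrite exp_0, cos_0, sin_0. unfold RtoC. f_equal; ring. Qed.

Lemma Cmod_Cexp (z : C) : Cmod (Cexp z) = exp (Re z).
Proof.
  replace (Cexp z) with (RtoC (exp (Re z)) * cis (Im z))
    by (unfold Cexp, cis, RtoC, Cmult; simpl; f_equal; ring).
  rewrite Cmod_mult, Cmod_cis, Cmod_R, Rabs_pos_eq by apply Rlt_le, exp_pos. ring.
Qed.

Lemma exp_le (x y : R) : x <= y -> exp x <= exp y.
Proof. intros [H| ->]; [now apply Rlt_le, exp_increasing|lra]. Qed.

Lemma Cmod_Cexp_le (z : C) : Cmod (Cexp z) <= exp (Cmod z).
Proof.
  rewrite Cmod_Cexp. apply exp_le. eapply Rle_trans; [apply Rle_abs|apply re_le_Cmod].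
Qed.

Lemma Cexp_ne (z : C) : Cexp z <> 0.
Proof. apply Cmod_gt_0. rewrite Cmod_Cexp. apply exp_pos. Qed.

Lemma Cexp_opp (z : C) : Cexp (- z) = / Cexp z.
Proof.
  assert (N := Cexp_ne z). assert (E : Cexp z * Cexp (- z) = 1).
  { rewrite <- Cexp_plus. replace (z + - z) with (RtoC 0) by ring. apply Cexp_0. }
  replace (Cexp (- z)) with (/ Cexp z * (Cexp z * Cexp (- z))) by (field; auto).
  rewrite E. ring.
Qed.

Lemma rderive_Cexp_line (h : C) (t : R) :
  rderive (fun s => Cexp (RtoC s * h)) t (h * Cexp (RtoC t * h)).
Proof.
  destruct h as [x y]. unfold rderive, Cexp; simpl. split.
  - auto_derive; auto. unfold Rminus. ring.
  - auto_derive; auto. unfold Rminus. ring.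
Qed.

(** Two applications of the mean value bound along the segment from 0 to [h].
    *)
Lemma Cexp_remainder (h : C) : Cmod (Cexp h - 1 - h) <= exp (Cmod h) * (Cmod h * Cmod h).
Proof.
  assert (Hh := Cmod_ge_0 h). assert (He := exp_pos (Cmod h)).
  assert (Hb : forall t, 0 <= t <= 1 -> Cmod (Cexp (RtoC t * h)) <= exp (Cmod h)).
  { intros t Ht. eapply Rle_trans; [apply Cmod_Cexp_le|]. apply exp_le.
    rewrite Cmod_mult, Cmod_R, Rabs_pos_eq by lra. nra. }
  assert (H1 : forall t, 0 <= t <= 1 -> Cmod (Cexp (RtoC t * h) - 1) <= Cmod h * exp (Cmod h)).
  { intros t Ht.
    assert (X := mean_value_bound (fun s => Cexp (RtoC s * (RtoC t * h)))
      (fun s => (RtoC t * h) * Cexp (RtoC s * (RtoC t * h))) (Cmod h * exp (Cmod h))).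
    cbv beta in X. rewrite Cmult_1_l, Cmult_0_l, Cexp_0 in X. apply X.
    - intros s Hs. apply rderive_Cexp_line.
    - intros s Hs. rewrite Cmod_mult. apply Rmult_le_compat; try apply Cmod_ge_0.
      + rewrite Cmod_mult, Cmod_R, Rabs_pos_eq by lra. nra.
      + rewrite Cmult_assoc, <- RtoC_mult. apply Hb. nra. }
  assert (X := mean_value_bound (fun s => Cexp (RtoC s * h) - RtoC s * h)
    (fun s => h * (Cexp (RtoC s * h) - 1)) (exp (Cmod h) * (Cmod h * Cmod h))).
  cbv beta in X. rewrite !Cmult_1_l, !Cmult_0_l, Cexp_0 in X.
  replace (Cexp h - 1 - h) with (Cexp h - h - (1 - 0)) by ring. apply X.
  - intros t Ht. destruct (rderive_Cexp_line h t) as [R1 R2].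
    destruct (rderive_affine h 0 RtoC t 1 (rderive_RtoC t)) as [S1 S2].
    split.
    + replace (Re (h * (Cexp (RtoC t * h) - 1)))
        with (minus (Re (h * Cexp (RtoC t * h))) (Re (h * 1)))
        by (unfold minus, plus, opp; simpl; ring).
      eapply is_derive_ext; [|apply (is_derive_minus (V := R_NormedModule) _ _ _ _ _ R1 S1)].
      intros s. unfold minus, plus, opp; simpl. ring.
    + replace (Im (h * (Cexp (RtoC t * h) - 1)))
        with (minus (Im (h * Cexp (RtoC t * h))) (Im (h * 1)))
        by (unfold minus, plus, opp; simpl; ring).
      eapply is_derive_ext; [|apply (is_derive_minus (V := R_NormedModule) _ _ _ _ _ R2 S2)].
      intros s. unfold minus, plus, opp; simpl. ring.
  - intros t Ht. rewrite Cmod_mult. specialize (H1 t Ht).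
    apply Rle_trans with (Cmod h * (Cmod h * exp (Cmod h)))%R; [now apply Rmult_le_compat_l|].
    right; ring.
Qed.

Lemma Cderive_Cexp (z : C) : Cderive_at Cexp z (Cexp z).
Proof.
  apply Cderive_quadratic with (Cmod (Cexp z) * exp 1)%R.
  apply locally_disc. exists 1%R. split; [lra|]. intros w Hw.
  replace w with (z + (w - z)) at 1 by ring. rewrite Cexp_plus.
  replace (Cexp z * Cexp (w - z) - Cexp z - Cexp z * (w - z))
    with (Cexp z * (Cexp (w - z) - 1 - (w - z))) by ring.
  rewrite Cmod_mult, Rmult_assoc. apply Rmult_le_compat_l; [apply Cmod_ge_0|].
  eapply Rle_trans; [apply Cexp_remainder|]. apply Rmult_le_compat_r.
  - apply Rmult_le_pos; apply Cmod_ge_0. - apply exp_le. lra.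
Qed.

(** * The Weierstrass functions *)

(** For large [w] the distance to [w] is comparable with [|w|]. Only finitely
    many [w] remain, each at a positive distance from [a]. *)
Lemma lattice_separation (tau a : C) : 0 < Im tau -> ~ nzlat tau a ->
  exists c d, 0 < c /\ 0 < d <= 1 /\
    forall z w, Cmod (z - a) < d -> nzlat tau w -> c * Cmod w <= Cmod (z - w).
Proof.
  intros Ht Ha. destruct (lattice_lower_ex tau Ht) as [c1 [Hc1 Hlow]].
  set (R0 := (2 * (Cmod a + 1))%R).
  assert (HR0 : 0 < R0) by (unfold R0; assert (X := Cmod_ge_0 a); lra).
  assert (Hmin : forall l, (forall w, In w l -> nzlat tau w) ->
     exists d, 0 < d /\ forall w, In w l -> d <= Cmod (a - w)).
  { induction l as [|x l IH]; intros Hl.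
    - exists 1%R. split; [lra|]. intros w [].
    - destruct IH as [d [Hd H]]; [intros; apply Hl; now right|].
      assert (Hx : 0 < Cmod (a - x)).
      { apply Cmod_gt_0, Cminus_ne. intros E. apply Ha. rewrite E. apply Hl. now left. }
      exists (Rmin d (Cmod (a - x))). split; [now apply Rmin_pos|].
      intros w [->|Hw]; [apply Rmin_r|]. eapply Rle_trans; [apply Rmin_l|auto]. }
  destruct (archimed (R0 / c1)) as [Hup _].
  assert (Hq : 0 < R0 / c1) by now apply Rdiv_lt_0_compat.
  set (N0 := Z.to_nat (up (R0 / c1))).
  destruct (Hmin (lattice_box tau N0)) as [d0 [Hd0 Hd]]; [intros w; apply nzlat_box|].
  set (d := Rmin 1 (d0 / 2)).
  assert (Hd1 : 0 < d) by (apply Rmin_pos; lra).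
  assert (Hdl := Rmin_l 1 (d0 / 2)). assert (Hdr := Rmin_r 1 (d0 / 2)). fold d in Hdl, Hdr.
  set (c := Rmin (1 / 2) (d0 / 2 / R0)).
  assert (Hcl := Rmin_l (1 / 2) (d0 / 2 / R0)). assert (Hcr := Rmin_r (1 / 2) (d0 / 2 / R0)). fold c in Hcl, Hcr.
  exists c, d. split; [apply Rmin_pos; [lra|apply Rdiv_lt_0_compat; lra]|]. split; [lra|].
  intros z w Hz Hw.
  assert (X := Cmod_rev w z). rewrite (Cmod_minus_sym w z) in X.
  assert (Y := Cmod_rev z a). assert (Hw0 := Cmod_ge_0 w).
  destruct (Rle_lt_dec R0 (Cmod w)) as [Hbig|Hsmall].
  - apply Rle_trans with (1 / 2 * Cmod w)%R; [now apply Rmult_le_compat_r|]. unfold R0 in Hbig. lra.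
  - assert (Hin : In w (lattice_box tau N0)).
    { destruct Hw as [mn [Hne ->]]. unfold lattice_box. fold (index_box N0). apply in_map, in_index_box.
      split; auto. specialize (Hlow mn). unfold N0. rewrite Z2Nat.id by (apply le_IZR; lra).
      apply le_IZR. apply Rle_trans with (R0 / c1)%R; [|lra].
      apply Rmult_le_reg_l with c1; auto. replace (c1 * (R0 / c1))%R with R0 by (field; lra). lra. }
    specialize (Hd w Hin).
    assert (Z := Cmod_rev (a - w) (a - z)). replace (a - w - (a - z)) with (z - w) in Z by ring.
    rewrite (Cmod_minus_sym a z) in Z.
    apply Rle_trans with (d0 / 2 / R0 * R0)%R.
    + apply Rmult_le_compat; lra || (apply Rlt_le, Rmin_pos; [lra|apply Rdiv_lt_0_compat; lra]).
    + replace (d0 / 2 / R0 * R0)%R with (d0 / 2)%R by (field; lra). lra.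
Qed.

Definition zeta_term (z w : C) : C := 1 / (z - w) + 1 / w + z / w ^ 2.
Definition wp_term (z w : C) : C := 1 / (z - w) ^ 2 - 1 / w ^ 2.
Definition sigma_term (z w : C) : C := (1 - z / w) * Cexp (z / w + z ^ 2 / (2 * w ^ 2)).

(** The parts of [wzeta], [wp] and [wsigma] that are regular at the origin. *)
Definition zeta_reg (tau z : C) : C := lattice_sum tau (zeta_term z).
Definition wp_reg (tau z : C) : C := lattice_sum tau (wp_term z).
Definition sigma_reg (tau z : C) : C := lattice_prod tau (sigma_term z).

(** A point where the terms of the series are under control: [R0] bounds it,
    and [c] separates it from the nonzero lattice points. *)
Definition away (tau : C) (c R0 : R) (z : C) : Prop :=
  (Cmod z <= R0)%R /\ forall w, nzlat tau w -> c * Cmod w <= Cmod (z - w).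

Lemma away_ne (tau z w : C) (c c1 R0 : R) : 0 < c -> lattice_lower tau c1 ->
  away tau c R0 z -> nzlat tau w -> z - w <> 0.
Proof.
  intros Hc H1 [_ H] Hw. apply Cmod_gt_0. eapply Rlt_le_trans; [|apply H; auto].
  apply Rmult_lt_0_compat; auto. apply Cmod_gt_0. eapply nzlat_ne; eauto.
Qed.

(** The term equals [z ^ 2 / (w ^ 2 * (z - w))]. *)
Lemma zeta_term_cubic (tau z : C) (c c1 R0 : R) : 0 < c -> lattice_lower tau c1 ->
  away tau c R0 z -> cubic tau (zeta_term z) (R0 * R0 / c).
Proof.
  intros Hc H1 Hz w Hw. assert (N1 := away_ne _ _ _ _ _ _ Hc H1 Hz Hw).
  assert (N2 := nzlat_ne _ _ _ H1 Hw). destruct Hz as [Hz Hz'].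
  assert (P := proj1 (Cmod_gt_0 w) N2). specialize (Hz' w Hw).
  replace (zeta_term z w) with (z * z * / (w * w * (z - w)))
    by (unfold zeta_term; field; auto).
  rewrite !Cmod_mult, Cmod_inv, !Cmod_mult by (repeat apply Cmult_neq_0; auto).
  assert (Pz := Cmod_ge_0 z).
  replace (R0 * R0 / c / (Cmod w * Cmod w * Cmod w))%R
    with (R0 * R0 * / (Cmod w * Cmod w * (c * Cmod w)))%R by (field; lra).
  apply Rmult_le_compat; [nra| |nra|].
  - apply Rlt_le, Rinv_0_lt_compat. repeat apply Rmult_lt_0_compat; auto. now apply Cmod_gt_0.
  - apply Rinv_le_contravar; [repeat apply Rmult_lt_0_compat; auto|].
    apply Rmult_le_compat_l; auto. nra.
Qed.

(** The term equals [z * (2 * w - z) / (w ^ 2 * (z - w) ^ 2)]. *)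
Lemma wp_term_cubic (tau z : C) (c c1 R0 : R) : 0 < c -> lattice_lower tau c1 ->
  away tau c R0 z -> cubic tau (wp_term z) (R0 * (2 + R0 / c1) / (c * c)).
Proof.
  intros Hc H1 Hz w Hw. assert (N1 := away_ne _ _ _ _ _ _ Hc H1 Hz Hw).
  assert (N2 := nzlat_ne _ _ _ H1 Hw). assert (L := nzlat_lower _ _ _ H1 Hw).
  destruct Hz as [Hz Hz'].
  assert (P := proj1 (Cmod_gt_0 w) N2). specialize (Hz' w Hw). destruct H1 as [Hc1 _].
  replace (wp_term z w) with (z * (2 * w - z) * / (w * w * ((z - w) * (z - w))))
    by (unfold wp_term; field; auto).
  rewrite !Cmod_mult, Cmod_inv, !Cmod_mult by (repeat apply Cmult_neq_0; auto).
  assert (Pz := Cmod_ge_0 z).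
  assert (Hq : 0 <= R0 / c1) by (apply Rmult_le_pos; [lra|now apply Rlt_le, Rinv_0_lt_compat]).
  assert (Hn : Cmod (2 * w - z) <= (2 + R0 / c1) * Cmod w).
  { eapply Rle_trans; [apply Cmod_triangle|]. rewrite Cmod_opp, Cmod_mult, Cmod_R, Rabs_pos_eq by lra.
    assert (R0 <= R0 / c1 * Cmod w)%R; [|lra].
    apply Rle_trans with (R0 / c1 * c1)%R; [right; field; lra|now apply Rmult_le_compat_l]. }
  replace (R0 * (2 + R0 / c1) / (c * c) / (Cmod w * Cmod w * Cmod w))%R
    with (R0 * ((2 + R0 / c1) * Cmod w) * / (Cmod w * Cmod w * ((c * Cmod w) * (c * Cmod w))))%R
    by (field; lra).
  assert (Pcw : 0 < c * Cmod w) by now apply Rmult_lt_0_compat.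
  apply Rmult_le_compat.
  - apply Rmult_le_pos; auto using Cmod_ge_0.
  - apply Rlt_le, Rinv_0_lt_compat. repeat apply Rmult_lt_0_compat; auto; now apply Cmod_gt_0.
  - apply Rmult_le_compat; auto using Cmod_ge_0.
  - apply Rinv_le_contravar; [repeat apply Rmult_lt_0_compat; auto|].
    apply Rmult_le_compat_l; [nra|]. apply Rmult_le_compat; lra.
Qed.

(** The second-order remainder of a term is [(z' - z) ^ 2 / ((z - w) ^ 2 * (z'
    - w))]. Being cubic with a constant of order [(z' - z) ^ 2], it allows the
    series to be differentiated term by term. *)
Lemma zeta_remainder_cubic (tau z z' : C) (c c1 R0 : R) : 0 < c -> lattice_lower tau c1 ->
  away tau c R0 z -> away tau c R0 z' ->
  cubic tau (fun w => zeta_term z' w + (-1) * zeta_term z w + (z' - z) * wp_term z w)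
    (Cmod (z' - z) * Cmod (z' - z) / (c * c * c)).
Proof.
  intros Hc H1 Hz Hy w Hw. assert (N1 := away_ne _ _ _ _ _ _ Hc H1 Hz Hw).
  assert (N1' := away_ne _ _ _ _ _ _ Hc H1 Hy Hw).
  assert (N2 := nzlat_ne _ _ _ H1 Hw).
  destruct Hz as [Hz Hz']. destruct Hy as [Hy Hy'].
  assert (P := proj1 (Cmod_gt_0 w) N2). specialize (Hz' w Hw). specialize (Hy' w Hw).
  match goal with |- (Cmod ?e <= _)%R =>
    replace e with ((z' - z) * (z' - z) * / ((z - w) * (z - w) * (z' - w)))
      by (unfold wp_term, zeta_term; field; auto) end.
  rewrite !Cmod_mult, Cmod_inv, !Cmod_mult by (repeat apply Cmult_neq_0; auto).
  assert (Pcw : 0 < c * Cmod w) by now apply Rmult_lt_0_compat.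
  replace (Cmod (z' - z) * Cmod (z' - z) / (c * c * c) / (Cmod w * Cmod w * Cmod w))%R
    with (Cmod (z' - z) * Cmod (z' - z) * / ((c * Cmod w) * (c * Cmod w) * (c * Cmod w)))%R
    by (field; lra).
  assert (X := Cmod_ge_0 (z' - z)).
  apply Rmult_le_compat_l; [nra|].
  apply Rinv_le_contravar; [repeat apply Rmult_lt_0_compat; auto|].
  apply Rmult_le_compat; auto; [nra|lra|]. apply Rmult_le_compat; lra.
Qed.

Lemma away_near (tau a : C) : 0 < Im tau -> ~ nzlat tau a ->
  exists c c1 d, 0 < c /\ lattice_lower tau c1 /\ 0 < d /\
    forall z, Cmod (z - a) < d -> away tau c (Cmod a + 1) z.
Proof.
  intros Ht Ha. destruct (lattice_separation tau a Ht Ha) as [c [d [Hc [Hd H]]]].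
  destruct (lattice_lower_ex tau Ht) as [c1 H1].
  exists c, c1, d. split; auto. split; auto. split; [lra|]. intros z Hz. split; auto.
  assert (X := Cmod_rev z a). lra.
Qed.

Definition bounded_near (f : C -> C) (a : C) : Prop :=
  exists M, locally a (fun z => Cmod (f z) <= M).

Lemma reg_near (tau a : C) : 0 < Im tau -> ~ nzlat tau a ->
  locally a (fun z => Cderive_at (zeta_reg tau) z (- wp_reg tau z)) /\
  bounded_near (zeta_reg tau) a /\ bounded_near (wp_reg tau) a.
Proof.
  intros Ht Ha. destruct (away_near tau a Ht Ha) as [c [c1 [d [Hc [H1 [Hd H]]]]]].
  set (R0 := (Cmod a + 1)%R) in *. assert (HR : 0 < R0) by (unfold R0; assert (X := Cmod_ge_0 a); lra).
  assert (Hc1 := proj1 H1).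
  assert (K1 : 0 <= R0 * R0 / c).
  { apply Rmult_le_pos; [nra|]. now apply Rlt_le, Rinv_0_lt_compat. }
  assert (K2 : 0 <= R0 * (2 + R0 / c1) / (c * c)).
  { apply Rmult_le_pos.
    - apply Rmult_le_pos; [lra|]. assert (0 < R0 / c1)%R by now apply Rdiv_lt_0_compat. lra.
    - apply Rlt_le, Rinv_0_lt_compat. nra. }
  assert (Hi : 0 < 24 / (c1 * c1 * c1))
    by (apply Rdiv_lt_0_compat; [lra|repeat apply Rmult_lt_0_compat; auto]).
  split; [|split].
  - apply locally_disc. exists d. split; auto. intros z Hz.
    apply Cderive_quadratic with (24 / (c1 * c1 * c1) * / (c * c * c))%R.
    apply locally_disc. exists (d - Cmod (z - a))%R. split; [lra|]. intros z' Hz'.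
    assert (Hz'a : Cmod (z' - a) < d).
    { replace (z' - a) with ((z' - z) + (z - a)) by ring.
      eapply Rle_lt_trans; [apply Cmod_triangle|lra]. }
    replace (zeta_reg tau z' - zeta_reg tau z - - wp_reg tau z * (z' - z))
      with (zeta_reg tau z' - zeta_reg tau z + (z' - z) * wp_reg tau z) by ring.
    unfold zeta_reg, wp_reg.
    rewrite (lattice_sum_lin tau c1 _ _ _ _ _ _ _ H1 K1 K1 K2)
      by (eauto using zeta_term_cubic, wp_term_cubic).
    assert (X := Cmod_ge_0 (z' - z)).
    assert (Hccc : 0 < / (c * c * c)) by (apply Rinv_0_lt_compat; repeat apply Rmult_lt_0_compat; auto).
    eapply Rle_trans.
    + apply (lattice_sum_bound tau c1 (Cmod (z' - z) * Cmod (z' - z) / (c * c * c)));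
        [exact H1| |eapply zeta_remainder_cubic; eauto].
      apply Rmult_le_pos; [nra|lra].
    + right. unfold Rdiv. ring.
  - exists (24 / (c1 * c1 * c1) * (R0 * R0 / c))%R. apply locally_disc. exists d. split; auto.
    intros z Hz. apply lattice_sum_bound; auto. eapply zeta_term_cubic; eauto.
  - exists (24 / (c1 * c1 * c1) * (R0 * (2 + R0 / c1) / (c * c)))%R. apply locally_disc. exists d.
    split; auto. intros z Hz. apply lattice_sum_bound; auto. eapply wp_term_cubic; eauto.
Qed.

(** * The sigma product *)

(** The exponential factor is made so that the terms of order [/ w] and [/ w ^
    2] of the derivative cancel. *)
Lemma sigma_term_derive (u w : C) : w <> 0 ->
  Cderive_at (fun u => sigma_term u w) u
    (- (u * u / (w * w * w)) * Cexp (u / w + u ^ 2 / (2 * w ^ 2))).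
Proof.
  intros Hw. unfold sigma_term. eapply Cderive_eq.
  - apply Cderive_mult.
    + apply Cderive_minus; [apply Cderive_const|].
      apply (Cderive_mult (fun u => u) (fun _ => / w)); [apply Cderive_id|apply Cderive_const].
    + apply (Cderive_comp Cexp); [apply Cderive_Cexp|].
      apply Cderive_plus.
      * apply (Cderive_mult (fun u => u) (fun _ => / w)); [apply Cderive_id|apply Cderive_const].
      * apply (Cderive_mult (fun u => u ^ 2) (fun _ => / (2 * w ^ 2)));
          [apply (Cderive_pow (fun u => u)), Cderive_id|apply Cderive_const].
  - cbv beta. set (e := Cexp _). replace (INR 2) with 2%R by (simpl; lra). simpl. field. auto.
Qed.

Lemma sigma_exponent_bound (u w : C) (c1 R0 : R) : 0 < c1 -> c1 <= Cmod w ->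
  Cmod u <= R0 ->
  Cmod (u / w + u ^ 2 / (2 * w ^ 2)) <= R0 / c1 + R0 * R0 / (2 * (c1 * c1)).
Proof.
  intros Hc Hw Hu. assert (Pu := Cmod_ge_0 u).
  assert (Nw : w <> 0) by (apply Cmod_gt_0; lra).
  assert (N2 : RtoC 2 <> 0) by (intros E; apply RtoC_inj in E; lra).
  eapply Rle_trans; [apply Cmod_triangle|].
  assert (N3 : 2 * w ^ 2 <> 0) by (apply Cmult_neq_0; [auto|now apply Cpow_nz]).
  rewrite !Cmod_div by auto.
  rewrite Cmod_mult, !Cmod_pow, Cmod_R, Rabs_pos_eq by lra. simpl pow. rewrite !Rmult_1_r.
  apply Rplus_le_compat; unfold Rdiv; apply Rmult_le_compat; auto; try nra;
    try (apply Rlt_le, Rinv_0_lt_compat; nra); apply Rinv_le_contravar; nra.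
Qed.

Lemma sigma_term_cubic (tau z : C) (c1 R0 : R) : lattice_lower tau c1 -> Cmod z <= R0 ->
  cubic tau (fun w => sigma_term z w - 1)
    (R0 * R0 * R0 * exp (R0 / c1 + R0 * R0 / (2 * (c1 * c1)))).
Proof.
  intros H1 Hz w Hw. assert (L := nzlat_lower _ _ _ H1 Hw). assert (Nw := nzlat_ne _ _ _ H1 Hw).
  assert (Hc1 := proj1 H1). assert (P := proj1 (Cmod_gt_0 w) Nw).
  set (Q := exp (R0 / c1 + R0 * R0 / (2 * (c1 * c1)))).
  assert (HQ : 0 < Q) by apply exp_pos.
  assert (Hz0 := Cmod_ge_0 z).
  assert (Hi : 0 < / (Cmod w * Cmod w * Cmod w))
    by (apply Rinv_0_lt_compat; repeat apply Rmult_lt_0_compat; auto).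
  assert (X := segment_bound (fun u => sigma_term u w)
    (fun u => - (u * u / (w * w * w)) * Cexp (u / w + u ^ 2 / (2 * w ^ 2))) 0 z
    (R0 * R0 * Q / (Cmod w * Cmod w * Cmod w))).
  cbv beta in X.
  replace (sigma_term 0 w) with (RtoC 1) in X.
  2:{ unfold sigma_term. replace (0 / w + 0 ^ 2 / (2 * w ^ 2)) with (RtoC 0).
      - rewrite Cexp_0. unfold Cdiv. ring.
      - unfold Cdiv; simpl. ring. }
  replace (z - 0) with z in X by ring.
  eapply Rle_trans; [apply X|].
  - intros t _. now apply sigma_term_derive.
  - intros t Ht. replace (0 + RtoC t * z) with (RtoC t * z) by ring.
    assert (Htz : Cmod (RtoC t * z) <= R0).
    { rewrite Cmod_mult, Cmod_R, Rabs_pos_eq by lra. nra. }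
    set (u := RtoC t * z) in *. assert (Pu := Cmod_ge_0 u).
    rewrite Cmod_mult, Cmod_opp, Cmod_div, !Cmod_mult by (repeat apply Cmult_neq_0; auto).
    replace (R0 * R0 * Q / (Cmod w * Cmod w * Cmod w))%R
      with (R0 * R0 / (Cmod w * Cmod w * Cmod w) * Q)%R by (field; lra).
    apply Rmult_le_compat; [|apply Cmod_ge_0| |].
    + apply Rmult_le_pos; [nra|lra].
    + apply Rmult_le_compat_r; [lra|nra].
    + eapply Rle_trans; [apply Cmod_Cexp_le|]. apply exp_le. now apply sigma_exponent_bound.
  - apply Rle_trans with (R0 * R0 * Q / (Cmod w * Cmod w * Cmod w) * R0)%R.
    + apply Rmult_le_compat_l; auto. apply Rmult_le_pos; [|lra]. apply Rmult_le_pos; [nra|lra].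
    + right. field. lra.
Qed.

Lemma sigma_term_ne (z w : C) : w <> 0 -> z - w <> 0 -> sigma_term z w <> 0.
Proof.
  intros Hw Hzw. unfold sigma_term. apply Cmult_neq_0; [|apply Cexp_ne].
  replace (1 - z / w) with (- (z - w) * / w) by (field; auto).
  apply Cmult_neq_0.
  - intros E. apply Hzw. replace (z - w) with (- - (z - w)) by ring. rewrite E. ring.
  - apply Cmod_gt_0. rewrite Cmod_inv by auto. now apply Rinv_0_lt_compat, Cmod_gt_0.
Qed.

Lemma sigma_term_inv_bound (tau z w : C) (c c1 R0 : R) : 0 < c -> lattice_lower tau c1 ->
  away tau c R0 z -> nzlat tau w ->
  Cmod (/ sigma_term z w) <= / c * exp (R0 / c1 + R0 * R0 / (2 * (c1 * c1))).
Proof.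
  intros Hc H1 Hz Hw. assert (N1 := away_ne _ _ _ _ _ _ Hc H1 Hz Hw).
  assert (L := nzlat_lower _ _ _ H1 Hw). assert (Nw := nzlat_ne _ _ _ H1 Hw).
  destruct Hz as [Hz Hz']. specialize (Hz' w Hw). assert (P := proj1 (Cmod_gt_0 w) Nw).
  set (x := z / w + z ^ 2 / (2 * w ^ 2)).
  replace (/ sigma_term z w) with (- w / (z - w) * Cexp (- x)).
  2:{ unfold sigma_term. fold x. rewrite Cexp_opp. assert (Nx := Cexp_ne x). field.
      repeat split; auto. intros E. apply N1. replace (z - w) with (- (w - z)) by ring. rewrite E. ring. }
  rewrite Cmod_mult, Cmod_div, Cmod_opp by auto.
  assert (Pcw : 0 < c * Cmod w) by now apply Rmult_lt_0_compat.
  apply Rmult_le_compat; try apply Cmod_ge_0.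
  - apply Rmult_le_pos; [lra|]. apply Rlt_le, Rinv_0_lt_compat. lra.
  - apply Rmult_le_reg_r with (Cmod (z - w)); [lra|].
    replace (Cmod w / Cmod (z - w) * Cmod (z - w))%R with (Cmod w) by (field; lra).
    apply Rmult_le_reg_l with c; auto. rewrite <- Rmult_assoc, Rinv_r by lra. lra.
  - eapply Rle_trans; [apply Cmod_Cexp_le|]. apply exp_le. rewrite Cmod_opp.
    apply sigma_exponent_bound; auto. apply H1.
Qed.

Lemma Cprod_inv (f : C -> C) (l : list C) : (forall w, In w l -> f w <> 0) ->
  Cprod (map f l) * Cprod (map (fun w => / f w) l) = 1.
Proof.
  unfold Cprod. induction l as [|x l IH]; intros H; simpl; [ring|].
  assert (Hx : f x <> 0) by (apply H; now left).
  assert (E : forall w, In w l -> f w <> 0) by (intros; apply H; now right).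
  specialize (IH E). set (p := fold_right _ _ (map f l)) in *.
  set (q := fold_right _ _ (map (fun w => / f w) l)) in *.
  transitivity (p * q); [field; auto|exact IH].
Qed.

Lemma Clim_seq_ext (u v : nat -> C) : (forall N, u N = v N) -> Clim_seq u = Clim_seq v.
Proof.
  intros H. unfold Clim_seq. f_equal; f_equal; apply Lim_seq_ext; intros N; now rewrite H.
Qed.

Lemma lattice_prod_ext (tau : C) (f g : C -> C) : (forall w, f w = g w) ->
  lattice_prod tau f = lattice_prod tau g.
Proof.
  intros H. unfold lattice_prod. apply Clim_seq_ext. intros N. f_equal. now apply map_ext.
Qed.

Lemma sigma_prod_conv (tau z : C) (c1 R0 : R) : lattice_lower tau c1 -> 0 <= R0 -> Cmod z <= R0 ->
  cconv (fun N => Cprod (map (sigma_term z) (lattice_box tau N))) (sigma_reg tau z) /\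
  forall N, Cmod (Cprod (map (sigma_term z) (lattice_box tau N))) <=
    exp (24 / (c1 * c1 * c1) * (R0 * R0 * R0 * exp (R0 / c1 + R0 * R0 / (2 * (c1 * c1))))).
Proof.
  intros H1 HR Hz.
  assert (E : forall w, 1 + (sigma_term z w - 1) = sigma_term z w) by (intros; ring).
  assert (HK : 0 <= R0 * R0 * R0 * exp (R0 / c1 + R0 * R0 / (2 * (c1 * c1)))).
  { apply Rmult_le_pos; [|apply Rlt_le, exp_pos]. apply Rmult_le_pos; nra. }
  destruct (lattice_prod_conv tau c1 _ _ H1 HK (sigma_term_cubic tau z c1 R0 H1 Hz)) as [L B].
  split.
  - unfold sigma_reg. rewrite (lattice_prod_ext _ _ _ (fun w => eq_sym (E w))).
    intros e He. destruct (L e He) as [N0 HN]. exists N0. intros N HNN.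
    rewrite (map_ext _ _ (fun w => eq_sym (E w))). auto.
  - intros N. rewrite (map_ext _ _ (fun w => eq_sym (E w))). apply B.
Qed.

(** The product of the inverses of the factors converges as well, and the two
    limits have product 1. *)
Lemma sigma_reg_ne (tau a : C) : 0 < Im tau -> ~ nzlat tau a -> sigma_reg tau a <> 0.
Proof.
  intros Ht Ha. destruct (away_near tau a Ht Ha) as [c [c1 [d [Hc [H1 [Hd H]]]]]].
  assert (Haw : away tau c (Cmod a + 1) a).
  { apply H. replace (a - a) with (RtoC 0) by ring. rewrite Cmod_0. lra. }
  set (R0 := (Cmod a + 1)%R) in *. assert (HR : 0 < R0) by (unfold R0; assert (X := Cmod_ge_0 a); lra).
  destruct (sigma_prod_conv tau a c1 R0 H1 ltac:(lra) (proj1 Haw)) as [L _].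
  set (Q := exp (R0 / c1 + R0 * R0 / (2 * (c1 * c1)))) in *.
  assert (HQ : 0 < Q) by apply exp_pos.
  assert (Hic : 0 < / c) by now apply Rinv_0_lt_compat.
  assert (HK : 0 <= R0 * R0 * R0 * Q) by (apply Rmult_le_pos; [apply Rmult_le_pos; nra|lra]).
  assert (Hinv : cubic tau (fun w => / sigma_term a w - 1) (/ c * Q * (R0 * R0 * R0 * Q))).
  { intros w Hw. assert (N1 := away_ne _ _ _ _ _ _ Hc H1 Haw Hw). assert (Nw := nzlat_ne _ _ _ H1 Hw).
    assert (Ns := sigma_term_ne a w Nw N1).
    replace (/ sigma_term a w - 1) with (/ sigma_term a w * - (sigma_term a w - 1)) by (field; auto).
    rewrite Cmod_mult, Cmod_opp. unfold Rdiv. rewrite (Rmult_assoc (/ c * Q)).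
    apply Rmult_le_compat; try apply Cmod_ge_0.
    - eapply sigma_term_inv_bound; eauto.
    - apply (sigma_term_cubic tau a c1 R0 H1 (proj1 Haw) w Hw). }
  assert (HK' : 0 <= / c * Q * (R0 * R0 * R0 * Q)) by (apply Rmult_le_pos; nra).
  destruct (lattice_prod_conv tau c1 _ _ H1 HK' Hinv) as [L' _].
  intros E. rewrite E in L.
  assert (L2 := cconv_mult _ _ _ _ L L').
  assert (X : RtoC 1 = 0 * lattice_prod tau (fun w => 1 + (/ sigma_term a w - 1))).
  { eapply cconv_unique; [|exact L2].
    intros e He. exists 0%nat. intros N _.
    rewrite (map_ext (fun w => 1 + (/ sigma_term a w - 1)) (fun w => / sigma_term a w))
      by (intros; ring).
    rewrite Cprod_inv.
    - replace (RtoC 1 - 1) with (RtoC 0) by ring. now rewrite Cmod_0.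
    - intros w Hw. apply nzlat_box in Hw. apply sigma_term_ne; [exact (nzlat_ne _ _ _ H1 Hw)|exact (away_ne _ _ _ _ _ _ Hc H1 Haw Hw)]. }
  rewrite Cmult_0_l in X. apply C1_nz. exact X.
Qed.

Lemma Cprod_sigma_derive (u : C) (l : list C) : (forall w, In w l -> w <> 0 /\ u - w <> 0) ->
  Cderive_at (fun u => Cprod (map (sigma_term u) l)) u
    (Csum (map (zeta_term u) l) * Cprod (map (sigma_term u) l)).
Proof.
  unfold Cprod, Csum. induction l as [|x l IH]; intros H; simpl.
  - eapply Cderive_eq; [apply Cderive_const|ring].
  - destruct (H x (or_introl eq_refl)) as [Hx Hux].
    eapply Cderive_eq.
    + apply Cderive_mult; [now apply sigma_term_derive|]. apply IH. intros; apply H; now right.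
    + cbv beta. set (P := fold_right _ _ (map (sigma_term u) l)). set (S0 := fold_right _ _ (map (zeta_term u) l)).
      unfold sigma_term, zeta_term. set (e := Cexp _). field. auto.
Qed.

Lemma Csum_zeta_derive (u : C) (l : list C) : (forall w, In w l -> w <> 0 /\ u - w <> 0) ->
  Cderive_at (fun u => Csum (map (zeta_term u) l)) u (- Csum (map (wp_term u) l)).
Proof.
  unfold Csum. induction l as [|x l IH]; intros H; simpl.
  - eapply Cderive_eq; [apply Cderive_const|ring].
  - destruct (H x (or_introl eq_refl)) as [Hx Hux].
    eapply Cderive_eq.
    + apply Cderive_plus; [|apply IH; intros; apply H; now right].
      unfold zeta_term. apply Cderive_plus; [apply Cderive_plus; [|apply Cderive_const]|].
      * apply (Cderive_div (fun _ => RtoC 1)); auto; [apply Cderive_const|].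
        apply Cderive_minus; [apply Cderive_id|apply Cderive_const].
      * apply (Cderive_mult (fun u => u) (fun _ => / x ^ 2)); [apply Cderive_id|apply Cderive_const].
    + cbv beta. unfold wp_term. field. auto.
Qed.

(** The logarithmic derivative of a partial product is the partial sum of
    [zeta_reg]. The quadratic bounds on the Taylor remainders of the partial
    products are uniform in [N], so they hold in the limit. *)
Lemma sigma_reg_derive (tau a : C) : 0 < Im tau -> ~ nzlat tau a ->
  locally a (fun z => Cderive_at (sigma_reg tau) z (zeta_reg tau z * sigma_reg tau z)).
Proof.
  intros Ht Ha. destruct (away_near tau a Ht Ha) as [c [c1 [d [Hc [H1 [Hd H]]]]]].
  set (R0 := (Cmod a + 1)%R) in *. assert (HR : 0 < R0) by (unfold R0; assert (X := Cmod_ge_0 a); lra).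
  assert (Hc1 := proj1 H1).
  assert (K1 : 0 <= R0 * R0 / c).
  { apply Rmult_le_pos; [nra|]. now apply Rlt_le, Rinv_0_lt_compat. }
  assert (K2 : 0 <= R0 * (2 + R0 / c1) / (c * c)).
  { apply Rmult_le_pos.
    - apply Rmult_le_pos; [lra|]. assert (0 < R0 / c1)%R by now apply Rdiv_lt_0_compat. lra.
    - apply Rlt_le, Rinv_0_lt_compat. nra. }
  set (MT := (24 / (c1 * c1 * c1) * (R0 * R0 / c))%R).
  set (Mp := (24 / (c1 * c1 * c1) * (R0 * (2 + R0 / c1) / (c * c)))%R).
  set (MP := exp (24 / (c1 * c1 * c1) * (R0 * R0 * R0 * exp (R0 / c1 + R0 * R0 / (2 * (c1 * c1)))))).
  set (P := fun N z => Cprod (map (sigma_term z) (lattice_box tau N))).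
  set (T := fun N z => Csum (map (zeta_term z) (lattice_box tau N))).
  set (W := fun N z => Csum (map (wp_term z) (lattice_box tau N))).
  assert (HP : forall z, Cmod (z - a) < d -> cconv (fun N => P N z) (sigma_reg tau z) /\
     forall N, Cmod (P N z) <= MP).
  { intros z Hz. apply sigma_prod_conv; auto; [lra|]. now apply H. }
  assert (HT : forall z, Cmod (z - a) < d -> cconv (fun N => T N z) (zeta_reg tau z) /\
     forall N, Cmod (T N z) <= MT).
  { intros z Hz. apply lattice_sum_conv; auto. eapply zeta_term_cubic; eauto. }
  assert (HW : forall z N, Cmod (z - a) < d -> Cmod (W N z) <= Mp).
  { intros z N Hz. apply lattice_sum_conv; auto. eapply wp_term_cubic; eauto. }
  assert (Hne : forall z N, Cmod (z - a) < d -> forall w, In w (lattice_box tau N) -> w <> 0 /\ z - w <> 0).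
  { intros z N Hz w Hw. apply nzlat_box in Hw. split; [exact (nzlat_ne _ _ _ H1 Hw)|].
    exact (away_ne _ _ _ _ _ _ Hc H1 (H z Hz) Hw). }
  assert (HT0 : 0 <= MT).
  { eapply Rle_trans; [apply (Cmod_ge_0 (T 0%nat a))|]. apply HT.
    replace (a - a) with (RtoC 0) by ring. now rewrite Cmod_0. }
  assert (Htay : forall N z z', Cmod (z - a) < d -> Cmod (z' - a) < d ->
     Cmod (P N z' - P N z - T N z * P N z * (z' - z)) <=
       (Mp + MT * MT) * MP * (Cmod (z' - z) * Cmod (z' - z))).
  { intros N z z' Hz Hz'.
    apply (Taylor_bound (P N) (fun u => T N u * P N u)
       (fun u => - W N u * P N u + T N u * (T N u * P N u)) a z z' d); auto.
    intros u Hu.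
    assert (D1 := Cprod_sigma_derive u _ (Hne u N Hu)).
    assert (D2 := Csum_zeta_derive u _ (Hne u N Hu)).
    split; [exact D1|]. split; [exact (Cderive_mult _ _ _ _ _ D2 D1)|].
    replace (- W N u * P N u + T N u * (T N u * P N u)) with ((- W N u + T N u * T N u) * P N u) by ring.
    rewrite Cmod_mult. apply Rmult_le_compat; try apply Cmod_ge_0; [|now apply HP].
    eapply Rle_trans; [apply Cmod_triangle|]. rewrite Cmod_opp, Cmod_mult.
    apply Rplus_le_compat; [now apply HW|].
    apply Rmult_le_compat; try apply Cmod_ge_0; now apply HT. }
  apply locally_disc. exists d. split; auto. intros z Hz.
  apply Cderive_quadratic with ((Mp + MT * MT) * MP)%R.
  apply locally_disc. exists (d - Cmod (z - a))%R. split; [lra|]. intros z' Hz'.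
  assert (Hz'a : Cmod (z' - a) < d).
  { replace (z' - a) with ((z' - z) + (z - a)) by ring.
    eapply Rle_lt_trans; [apply Cmod_triangle|lra]. }
  apply cconv_bound with (fun N => P N z' - P N z - T N z * P N z * (z' - z)).
  2:{ intros N. now apply Htay. }
  destruct (HP z Hz) as [L1 _]. destruct (HP z' Hz'a) as [L2 _]. destruct (HT z Hz) as [L3 _].
  assert (Q : cconv (fun N => P N z' + (-1) * P N z + T N z * P N z * (- (z' - z)))
     (sigma_reg tau z' + (-1) * sigma_reg tau z + zeta_reg tau z * sigma_reg tau z * (- (z' - z)))).
  { apply cconv_plus; [apply cconv_plus; auto; apply cconv_mult; auto using cconv_const|].
    apply cconv_mult; [|apply cconv_const]. now apply cconv_mult. }
  intros e He. destruct (Q e He) as [N0 HN]. exists N0. intros N HNN. specialize (HN N HNN).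
  match type of HN with (Cmod ?x < _)%R => match goal with |- (Cmod ?y < _)%R => replace y with x by ring end end.
  exact HN.
Qed.

(** * Derivatives and poles of the Weierstrass functions *)

Lemma in_lattice_cases (tau z : C) : in_lattice tau z <-> z = 0 \/ nzlat tau z.
Proof.
  split.
  - intros [[m n] E]. destruct (classic ((m, n) = (0, 0)%Z)) as [X|X].
    + left. rewrite E, X. unfold lattice_point; simpl. ring.
    + right. exists (m, n). auto.
  - intros [->|[mn [_ ->]]]; [apply in_lattice_0|now exists mn].
Qed.

Lemma nzlat_0 (tau : C) : 0 < Im tau -> ~ nzlat tau 0.
Proof.
  intros Ht H. destruct (lattice_lower_ex tau Ht) as [c Hc]. now apply (nzlat_ne _ _ _ Hc) in H.
Qed.

Lemma nzlat_discrete (tau a : C) : 0 < Im tau -> ~ nzlat tau a ->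
  locally a (fun z => ~ nzlat tau z).
Proof.
  intros Ht Ha. destruct (away_near tau a Ht Ha) as [c [c1 [d [Hc [H1 [Hd H]]]]]].
  apply locally_disc. exists d. split; auto. intros z Hz Hn.
  apply (away_ne _ _ _ _ _ _ Hc H1 (H z Hz) Hn). ring.
Qed.

Lemma lattice_discrete (tau a : C) : 0 < Im tau -> locally' a (fun z => ~ in_lattice tau z).
Proof.
  intros Ht.
  assert (H0 : forall b, ~ nzlat tau b -> locally' b (fun z => ~ in_lattice tau z)).
  { intros b Hb. destruct (classic (b = 0)) as [->|Hb0].
    - generalize (filter_and _ _ (locally_locally' _ _ (nzlat_discrete tau 0 Ht Hb)) (locally'_ne (RtoC 0))).
      apply filter_imp. intros z [H1 H2] H3. apply in_lattice_cases in H3. tauto.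
    - generalize (filter_and _ _ (locally_locally' _ _ (nzlat_discrete tau b Ht Hb))
        (locally_locally' _ _ (locally_ne b 0 Hb0))).
      apply filter_imp. intros z [H1 H2] H3. apply in_lattice_cases in H3. tauto. }
  destruct (classic (nzlat tau a)) as [Ha|Ha]; auto.
  assert (La : in_lattice tau a) by (apply in_lattice_cases; auto).
  assert (H := H0 0 (nzlat_0 tau Ht)). replace (RtoC 0) with (1 * a + (- a)) in H by ring.
  apply (locally'_comp_affine _ a (- a) 1 C1_nz) in H. revert H. apply filter_imp.
  intros z Hz Hl. apply Hz. replace (1 * z + - a) with (z - a) by ring. now apply in_lattice_minus.
Qed.

Lemma not_in_lattice_split (tau a : C) : ~ in_lattice tau a -> a <> 0 /\ ~ nzlat tau a.
Proof. rewrite in_lattice_cases. tauto. Qed.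

Lemma wzeta_derive (tau z : C) : 0 < Im tau -> ~ in_lattice tau z ->
  Cderive_at (wzeta tau) z (- wp tau z).
Proof.
  intros Ht Hz. apply not_in_lattice_split in Hz. destruct Hz as [H0 Hz].
  destruct (reg_near tau z Ht Hz) as [H _]. apply locally_singleton in H.
  change (Cderive_at (fun z => 1 / z + zeta_reg tau z) z (- (1 / z ^ 2 + wp_reg tau z))).
  eapply Cderive_eq.
  - apply Cderive_plus; [|exact H]. apply (Cderive_div (fun _ => RtoC 1) (fun z => z)); auto;
      [apply Cderive_const|apply Cderive_id].
  - cbv beta. field. auto.
Qed.

Lemma wsigma_derive (tau z : C) : 0 < Im tau -> ~ in_lattice tau z ->
  Cderive_at (wsigma tau) z (wzeta tau z * wsigma tau z).
Proof.
  intros Ht Hz. apply not_in_lattice_split in Hz. destruct Hz as [H0 Hz].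
  assert (H := locally_singleton _ _ (sigma_reg_derive tau z Ht Hz)).
  change (Cderive_at (fun z => z * sigma_reg tau z) z ((1 / z + zeta_reg tau z) * (z * sigma_reg tau z))).
  eapply Cderive_eq.
  - apply Cderive_mult; [apply Cderive_id|exact H].
  - cbv beta. field. auto.
Qed.

Lemma wsigma_ne (tau z : C) : 0 < Im tau -> ~ in_lattice tau z -> wsigma tau z <> 0.
Proof.
  intros Ht Hz. apply not_in_lattice_split in Hz. destruct Hz as [H0 Hz].
  apply (Cmult_neq_0 z (sigma_reg tau z)); auto. now apply sigma_reg_ne.
Qed.

Lemma bounded_near_plus (f g : C -> C) (a : C) :
  bounded_near f a -> bounded_near g a -> bounded_near (fun z => f z + g z) a.
Proof.
  intros [M H] [M' H']. exists (M + M')%R. generalize (filter_and _ _ H H'). apply filter_imp.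
  intros z [H1 H2]. eapply Rle_trans; [apply Cmod_triangle|lra].
Qed.

Lemma bounded_near_cont (f : C -> C) (a : C) : ccont f a -> bounded_near f a.
Proof.
  intros H. exists (Cmod (f a) + 1)%R. apply locally'_center; [|lra].
  generalize (clim_bounded _ _ _ H). apply filter_imp. intros; lra.
Qed.

Lemma bounded_near_shift (f : C -> C) (a b : C) :
  bounded_near f (a + b) -> bounded_near (fun z => f (z + b)) a.
Proof.
  intros [M H]. exists M. replace (a + b) with (1 * a + b) in H by ring.
  apply (locally_comp_affine _ a b 1 C1_nz) in H. revert H. apply filter_imp.
  intros z. replace (1 * z + b) with (z + b) by ring. auto.
Qed.

Lemma wzeta_wp_bounded (tau a : C) : 0 < Im tau -> ~ in_lattice tau a ->
  bounded_near (wzeta tau) a /\ bounded_near (wp tau) a.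
Proof.
  intros Ht Ha. apply not_in_lattice_split in Ha. destruct Ha as [H0 Ha].
  destruct (reg_near tau a Ht Ha) as [_ [H1 H2]].
  split; apply bounded_near_plus; auto; apply bounded_near_cont.
  - apply (ccont_mult (fun _ => RtoC 1) (fun z => / z)); [apply clim_const|].
    apply (ccont_inv (fun z => z)); auto. apply clim_id.
  - apply (ccont_mult (fun _ => RtoC 1) (fun z => / z ^ 2)); [apply clim_const|].
    apply (ccont_inv (fun z => z ^ 2)); [|now apply Cpow_nz].
    apply hol_cont, (hol_pow (fun z => z)), hol_id.
Qed.

Lemma clim_pow_bounded (f : C -> C) (a : C) (k : nat) : (1 <= k)%nat -> bounded_near f a ->
  clim (fun z => (z - a) ^ k * f z) a 0.
Proof.
  intros Hk [M H].
  apply clim_ext with (fun z => f z * (z - a) ^ k).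
  { apply filter_forall. intros; ring. }
  apply clim_bounded_mult_0 with M; [now apply locally_locally'|].
  assert (Hc : ccont (fun z => (z - a) ^ k) a).
  { apply hol_cont, (hol_pow (fun z => z - a)), hol_minus; [apply hol_id|apply hol_const]. }
  eapply clim_eq; [exact Hc|]. replace (a - a) with (RtoC 0) by ring. destruct k; [lia|]. simpl. ring.
Qed.

Lemma wzeta_pole (tau : C) : 0 < Im tau -> clim (fun z => z * wzeta tau z) 0 1.
Proof.
  intros Ht. destruct (reg_near tau 0 Ht (nzlat_0 tau Ht)) as [_ [H1 _]].
  apply (clim_pow_bounded _ _ 1) in H1; auto.
  apply clim_ext with (fun z => 1 + (z - 0) ^ 1 * zeta_reg tau z).
  - generalize (locally'_ne (RtoC 0)). apply filter_imp. intros z Hz.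
    change (wzeta tau z) with (1 / z + zeta_reg tau z). simpl. field. auto.
  - eapply clim_eq; [apply clim_plus; [apply clim_const|exact H1]|ring].
Qed.

Lemma wp_pole (tau : C) : 0 < Im tau -> clim (fun z => z ^ 2 * wp tau z) 0 1.
Proof.
  intros Ht. destruct (reg_near tau 0 Ht (nzlat_0 tau Ht)) as [_ [_ H1]].
  apply (clim_pow_bounded _ _ 2) in H1; auto.
  apply clim_ext with (fun z => 1 + (z - 0) ^ 2 * wp_reg tau z).
  - generalize (locally'_ne (RtoC 0)). apply filter_imp. intros z Hz.
    change (wp tau z) with (1 / z ^ 2 + wp_reg tau z). simpl. field. auto.
  - eapply clim_eq; [apply clim_plus; [apply clim_const|exact H1]|ring].
Qed.

(** * Parity of the Weierstrass functions *)

Lemma Cinv_opp (x : C) : / (- x) = - / x.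
Proof.
  destruct x as [a b]. unfold Cinv, Copp; simpl.
  replace (- a * (- a * 1) + - b * (- b * 1))%R with (a * (a * 1) + b * (b * 1))%R by ring.
  f_equal; unfold Rdiv; ring.
Qed.

(** The boxes are symmetric, so the partial sums and products already have the
    parity of their limits. *)
Lemma lattice_box_opp (tau : C) (N : nat) :
  Permutation (lattice_box tau N) (map Copp (lattice_box tau N)).
Proof.
  unfold lattice_box. fold (index_box N). rewrite map_map.
  rewrite (map_ext (fun x => - lattice_point tau x)
    (fun x => lattice_point tau ((fun mn => (- fst mn, - snd mn)%Z) x))).
  2:{ intros [m n]. unfold lattice_point; simpl. rewrite !opp_IZR, !RtoC_opp. ring. }
  rewrite <- (map_map (fun mn => (- fst mn, - snd mn)%Z) (lattice_point tau)).
  apply Permutation_map. apply NoDup_Permutation.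
  - apply NoDup_index_box.
  - apply FinFun.Injective_map_NoDup; [|apply NoDup_index_box].
    intros [m n] [m' n'] E. simpl in E. injection E as E1 E2. f_equal; lia.
  - intros [m n]. rewrite in_map_iff. split.
    + intros H. exists (- m, - n)%Z. simpl. rewrite !Z.opp_involutive. split; auto.
      apply in_index_box in H. apply in_index_box. destruct H as [H1 H2]. unfold supnorm in *. simpl in *.
      split; [|lia]. intros E. apply H1. injection E as E1 E2. f_equal; lia.
    + intros [[m' n'] [E H]]. simpl in E. injection E as E1 E2. apply in_index_box in H.
      apply in_index_box. destruct H as [H1 H2]. unfold supnorm in *. simpl in *.
      split; [|lia]. intros E. apply H1. injection E as E3 E4. f_equal; lia.
Qed.

Lemma Clim_seq_opp (u : nat -> C) : Clim_seq (fun N => - u N) = - Clim_seq u.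
Proof.
  assert (R0 : forall x, real (Rbar_opp x) = (- real x)%R) by (intros []; simpl; lra).
  unfold Clim_seq, Copp; simpl. f_equal.
  - rewrite (Lim_seq_ext _ (fun N => - Re (u N))%R) by reflexivity. now rewrite Lim_seq_opp.
  - rewrite (Lim_seq_ext _ (fun N => - Im (u N))%R) by reflexivity. now rewrite Lim_seq_opp.
Qed.

Lemma wp_even (tau z : C) : wp tau (- z) = wp tau z.
Proof.
  unfold wp. f_equal.
  - f_equal. simpl. ring.
  - unfold lattice_sum. apply Clim_seq_ext. intros N.
    rewrite (Csum_perm _ _ (Permutation_map _ (lattice_box_opp tau N))), map_map.
    f_equal. apply map_ext. intros w.
    replace (- z - - w) with (- (z - w)) by ring.
    replace ((- (z - w)) ^ 2) with ((z - w) ^ 2) by (simpl; ring).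
    replace ((- w) ^ 2) with (w ^ 2) by (simpl; ring). reflexivity.
Qed.

Lemma Csum_opp (f : C -> C) (l : list C) : Csum (map (fun w => - f w) l) = - Csum (map f l).
Proof. unfold Csum. induction l as [|x l IH]; simpl; [ring|]. rewrite IH. ring. Qed.

Lemma wzeta_odd (tau z : C) : wzeta tau (- z) = - wzeta tau z.
Proof.
  unfold wzeta. rewrite Copp_plus_distr. f_equal.
  - unfold Cdiv. rewrite Cinv_opp. ring.
  - unfold lattice_sum. rewrite <- Clim_seq_opp. apply Clim_seq_ext. intros N.
    rewrite (Csum_perm _ _ (Permutation_map _ (lattice_box_opp tau N))), map_map, <- Csum_opp.
    f_equal. apply map_ext. intros w.
    replace (- z - - w) with (- (z - w)) by ring. unfold Cdiv. rewrite !Cinv_opp.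
    replace ((- w) ^ 2) with (w ^ 2) by (simpl; ring). ring.
Qed.

Lemma wsigma_odd (tau z : C) : wsigma tau (- z) = - wsigma tau z.
Proof.
  unfold wsigma.
  assert (E : forall p q, - (p * q) = - p * q) by (intros; ring). rewrite E. f_equal.
  unfold lattice_prod. apply Clim_seq_ext. intros N.
  rewrite (Cprod_perm _ _ (Permutation_map _ (lattice_box_opp tau N))), map_map.
  f_equal. apply map_ext. intros w. unfold Cdiv. rewrite Cinv_opp.
  replace ((- w) ^ 2) with (w ^ 2) by (simpl; ring).
  replace ((- z) ^ 2) with (z ^ 2) by (simpl; ring).
  replace (- z * - / w) with (z * / w) by ring. reflexivity.
Qed.

(** * The twisted equation *)

(** If [psi' = l psi] and [l' = dl], then [psi w] solves [y'' = V y] exactly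
    when [w'' + 2 l w' + (dl + l ^ 2 - V) w = 0]. The factor [psi] makes the
    solutions of both families of equations single-valued: it is a branch of
    [Psi_p], or 1 when there are no apparent singularities. *)
Record twisted := mk_twisted { tbad : C -> Prop; tl : C -> C; tdl : C -> C; tV : C -> C }.

Definition tsolves (T : twisted) (z0 : C) (y : C -> C) : Prop :=
  exists dy, locally z0 (fun z => Cderive_at y z (dy z) /\
    Cderive_at dy z (- (2 * tl T z * dy z) - (tdl T z + tl T z * tl T z - tV T z) * y z)).

Lemma tsolves_hol (T : twisted) (z0 : C) (y : C -> C) : tsolves T z0 y -> hol y z0.
Proof.
  intros [dy H]. apply hol_intro with dy. revert H. apply filter_imp. intros z [H1 H2].
  split; auto. eapply Cderive_cont, H2.
Qed.

Lemma tsolves_ext (T : twisted) (z0 : C) (y y' : C -> C) :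
  locally z0 (fun z => y z = y' z) -> tsolves T z0 y -> tsolves T z0 y'.
Proof.
  intros E [dy H]. exists dy. apply locally_locally in E.
  generalize (filter_and _ _ E H). apply filter_imp. intros z [E' [H1 H2]]. split.
  - now apply Cderive_ext with y.
  - now rewrite <- (locally_singleton _ _ E').
Qed.

Lemma tsolves_lin (T : twisted) (z0 : C) (y y' : C -> C) (a b : C) :
  tsolves T z0 y -> tsolves T z0 y' -> tsolves T z0 (fun z => a * y z + b * y' z).
Proof.
  intros [dy H] [dy' H']. exists (fun z => a * dy z + b * dy' z).
  generalize (filter_and _ _ H H'). apply filter_imp. intros z [[H1 H2] [H3 H4]]. split.
  - apply Cderive_plus; now apply Cderive_scal.
  - eapply Cderive_eq; [apply Cderive_plus; apply Cderive_scal; eassumption|]. ring.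
Qed.

Lemma INR_IZR_C (n : nat) : RtoC (INR n) = RtoC (IZR (Z.of_nat n)).
Proof. now rewrite INR_IZR_INZ. Qed.

Lemma Cpow_pred (u : C) (n : nat) : u <> 0 -> INR n * u ^ pred n = INR n * u ^ n / u.
Proof.
  intros Hu. destruct n; simpl pred.
  - simpl. field. auto.
  - rewrite (Cpow_S u n). field. auto.
Qed.

Lemma zpow_derive (a z : C) (m : Z) : z <> a ->
  Cderive_at (fun z => zpow (z - a) m) z (IZR m * zpow (z - a) m / (z - a)).
Proof.
  intros Hz. assert (Hza := Cminus_ne _ _ Hz).
  destruct (Z_sub_nat m) as [i [j ->]].
  apply Cderive_ext with (fun z => (z - a) ^ i / (z - a) ^ j).
  - generalize (locally_ne z a Hz). apply filter_imp. intros w Hw.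
    rewrite zpow_sub; auto. now apply Cminus_ne.
  - assert (D1 : Cderive_at (fun z => z - a) z 1).
    { eapply Cderive_eq; [apply Cderive_minus; [apply Cderive_id|apply Cderive_const]|ring]. }
    assert (Nj := Cpow_nz (z - a) j Hza).
    eapply Cderive_eq.
    + apply Cderive_div; [apply (Cderive_pow _ _ _ i D1)|apply (Cderive_pow _ _ _ j D1)|exact Nj].
    + cbv beta. rewrite !Cpow_pred, zpow_sub, minus_IZR, RtoC_minus, <- !INR_IZR_C by auto.
      field. auto.
Qed.

(** The coefficient of [(z - a) ^ (m - 2)] in the equation is found by dividing
    by this power and letting [z] tend to [a]. *)
Lemma indicial (T : twisted) (y : C -> C) (a : C) (m : Z) (lam mu iota : C) :
  ord_eq y a m -> locally' a (fun z => tsolves T z y) ->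
  clim (fun z => (z - a) * tl T z) a lam ->
  clim (fun z => (z - a) ^ 2 * tdl T z) a mu ->
  clim (fun z => (z - a) ^ 2 * tV T z) a iota ->
  IZR m * (IZR m - 1) + 2 * lam * IZR m + mu + lam * lam - iota = 0.
Proof.
  intros [g [Hg [Hga E]]] HT Hl Hd HI.
  assert (Hg1 := hol_derive _ _ Hg). assert (Hg2 := hol_derive _ _ Hg1).
  set (g1 := C_derive g) in *. set (g2 := C_derive g1) in *.
  set (k := RtoC (IZR m)).
  set (Q := fun z => k * (k - 1) * g z + 2 * k * ((z - a) * g1 z) + (z - a) * (z - a) * g2 z
     + 2 * ((z - a) * tl T z) * (k * g z + (z - a) * g1 z)
     + ((z - a) ^ 2 * tdl T z + ((z - a) * tl T z) * ((z - a) * tl T z) - (z - a) ^ 2 * tV T z) * g z).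
  assert (HQ0 : locally' a (fun z => Q z = 0)).
  { assert (HgN := locally_locally' _ _ (locally_locally _ _ Hg)).
    generalize (filter_and _ _ (filter_and _ _ HT (locally'_near _ _ (filter_and _ _ E (locally'_ne a))))
      (filter_and _ _ (locally'_ne a) (filter_and _ _ HgN (locally_locally' _ _ Hg1)))).
    apply filter_imp. intros z [[[dy Hy] E1] [Hz [HgN' [D2 _]]]]. clear HgN.
    fold g2 in D2.
    assert (Hnear : locally z (fun w => zpow (w - a) m * (k * (g w / (w - a)) + g1 w) = dy w)).
    { apply locally_locally in E1.
      generalize (filter_and _ _ (filter_and _ _ Hy E1) HgN'). apply filter_imp.
      intros w [[[Dy _] E2] [Dg _]]. fold g1 in Dg.
      assert (Hw := proj2 (locally_singleton _ _ E2)). assert (Hwa := Cminus_ne _ _ Hw).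
      apply (Cderive_unique y w); [|exact Dy].
      apply Cderive_ext with (fun z => zpow (z - a) m * g z).
      - revert E2. apply filter_imp. intros x [Hx _]. now symmetry.
      - eapply Cderive_eq; [apply Cderive_mult; [now apply zpow_derive|exact Dg]|].
        cbv beta. fold k. field. auto. }
    assert (Hza := Cminus_ne _ _ Hz).
    destruct (locally_singleton _ _ Hy) as [_ Ddy].
    destruct (locally_singleton _ _ E1) as [Ey _].
    destruct (locally_singleton _ _ HgN') as [Dg _]. fold g1 in Dg.
    assert (Edy := locally_singleton _ _ Hnear). cbv beta in Edy.
    assert (Ddy' : Cderive_at dy z (k * zpow (z - a) m / (z - a) * (k * (g z / (z - a)) + g1 z)
       + zpow (z - a) m * (k * ((g1 z * (z - a) - g z * 1) / ((z - a) * (z - a))) + g2 z))).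
    { apply Cderive_ext with (fun w => zpow (w - a) m * (k * (g w / (w - a)) + g1 w)); [exact Hnear|].
      eapply Cderive_eq.
      - apply Cderive_mult; [now apply zpow_derive|].
        apply Cderive_plus; [|exact D2]. apply Cderive_scal.
        apply (Cderive_div g (fun w => w - a)); [exact Dg| |exact Hza].
        apply Cderive_minus; [apply Cderive_id|apply Cderive_const].
      - cbv beta. fold k. field. auto. }
    assert (Eq := Cderive_unique _ _ _ _ Ddy Ddy').
    rewrite <- Edy, Ey in Eq.
    assert (Nz := zpow_nz (z - a) m Hza). set (p := zpow (z - a) m) in *.
    apply Ceq_minus in Eq.
    transitivity (- ((z - a) * (z - a) / p) * 0); [|ring]. rewrite <- Eq. unfold Q. simpl. field. auto. }
  assert (HQl : clim Q a (k * (k - 1) * g a + 2 * k * (0 * g1 a) + 0 * 0 * g2 a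
     + 2 * lam * (k * g a + 0 * g1 a) + (mu + lam * lam - iota) * g a)).
  { assert (U : clim (fun z => z - a) a 0).
    { eapply clim_eq; [apply clim_minus; [apply clim_id|apply clim_const]|ring]. }
    assert (C0 : clim g a (g a)) by exact (hol_cont _ _ Hg).
    assert (C1 : clim g1 a (g1 a)) by exact (hol_cont _ _ Hg1).
    assert (C2 : clim g2 a (g2 a)) by exact (hol_cont _ _ Hg2).
    unfold Q. repeat first [assumption | apply clim_const | apply clim_minus | apply clim_plus | apply clim_mult]. }
  assert (Z0 : clim Q a 0).
  { apply clim_ext with (fun _ => RtoC 0); [|apply clim_const]. revert HQ0. apply filter_imp. auto. }
  assert (X := clim_unique _ _ _ _ HQl Z0).
  apply NNPP. intros N. apply (Cmult_neq_0 _ _ N Hga). rewrite <- X. fold k. ring.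
Qed.

Lemma zpow_m1_sq (m : Z) : zpow (-1) m * zpow (-1) m = 1.
Proof.
  assert (N : (-1 : C) <> 0) by (intros E; apply RtoC_inj in E; lra).
  rewrite <- zpow_mult by auto. replace (-1 * -1) with (RtoC 1) by ring.
  unfold zpow. destruct (0 <=? m)%Z; rewrite Cpow_1_l; [auto|]. field.
Qed.

(** Reflecting [(z - q) ^ m * g z] about [q] multiplies its leading coefficient
    by [(-1) ^ m]. *)
Lemma ord_eq_parity (y : C -> C) (q s : C) (m : Z) : ord_eq y q m ->
  locally' q (fun z => y (2 * q - z) = s * y z) -> zpow (-1) m = s.
Proof.
  intros [g [Hg [Hgq E]]] Hs.
  assert (N : (-1 : C) <> 0) by (intros X; apply RtoC_inj in X; lra).
  assert (Eq : 2 * q - q = q) by ring.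
  assert (Haff : forall P : C -> Prop, locally' q P -> locally' q (fun z => P (2 * q - z))).
  { intros P HP. replace q with (-1 * q + 2 * q) in HP at 1 by ring.
    apply (locally'_comp_affine _ q (2 * q) (-1) N) in HP. revert HP. apply filter_imp.
    intros z. replace (-1 * z + 2 * q) with (2 * q - z) by ring. auto. }
  assert (L1 : clim (fun z => g (2 * q - z)) q (g q)).
  { intros e He. apply (Haff (fun z => Cmod (g z - g q) < e)). exact (hol_cont _ _ Hg e He). }
  assert (L2 : clim (fun z => zpow (-1) m * g (2 * q - z) - s * g z) q (zpow (-1) m * g q - s * g q)).
  { apply clim_minus; apply clim_mult; auto using clim_const. exact (hol_cont _ _ Hg). }
  assert (L3 : clim (fun z => zpow (-1) m * g (2 * q - z) - s * g z) q 0).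
  { apply clim_ext with (fun _ => RtoC 0); [|apply clim_const].
    generalize (filter_and _ _ (filter_and _ _ Hs E) (filter_and _ _ (Haff _ E) (locally'_ne q))).
    apply filter_imp. intros z [[H1 H2] [H3 H4]]. assert (Hz := Cminus_ne _ _ H4).
    rewrite H2, H3 in H1. replace (2 * q - z - q) with (-1 * (z - q)) in H1 by ring.
    rewrite zpow_mult in H1 by auto. assert (Np := zpow_nz (z - q) m Hz).
    set (p := zpow (z - q) m) in *.
    apply Ceq_minus in H1.
    transitivity (/ p * 0); [ring|]. rewrite <- H1. field. auto. }
  assert (X := clim_unique _ _ _ _ L2 L3).
  apply Ceq_minus, NNPP. intros Hne. apply (Cmult_neq_0 _ _ Hne Hgq). rewrite <- X. ring.
Qed.

Lemma opposite_parity_sum (m m' : Z) (s : C) : zpow (-1) m = s -> zpow (-1) m' = - s ->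
  Z.odd (m + m') = true.
Proof.
  intros <- H. assert (N : (-1 : C) <> 0) by (intros X; apply RtoC_inj in X; lra).
  rewrite <- Z.negb_even. apply Bool.negb_true_iff, Bool.not_true_iff_false. intros He.
  apply Z.even_spec in He. destruct He as [k Hk].
  assert (E1 : zpow (-1) (m + m') = 1).
  { rewrite Hk. replace (2 * k)%Z with (k + k)%Z by lia. rewrite zpow_add by auto. apply zpow_m1_sq. }
  rewrite zpow_add, H in E1 by auto.
  replace (zpow (-1) m * - zpow (-1) m) with (- (zpow (-1) m * zpow (-1) m)) in E1 by ring.
  rewrite zpow_m1_sq in E1.
  assert (E2 : (RtoC 2) = 0) by (transitivity (1 - Copp 1); [ring|rewrite E1; ring]).
  apply RtoC_inj in E2. lra.
Qed.

(** The point [q] may be singular for the equation, but only poles are allowed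
    there. *)
Definition local_sol (T : twisted) (q : C) (y : C -> C) : Prop :=
  (exists m, ord_ge y q m) /\ locally' q (fun z => tsolves T z y).

(** Only an upper bound for the set of exponents: it is not asserted that both
    occur. *)
Definition exponents (T : twisted) (q : C) (e1 e2 : Z) : Prop :=
  forall y m, local_sol T q y -> ord_eq y q m -> m = e1 \/ m = e2.

(** The part of the argument that depends on the pair of equations: it bounds
    from below the order at [q] of a sum of products of solutions that is odd
    about [q]. *)
Definition pairing (T T' : twisted) (q : C) (d : Z) : Prop :=
  forall (y y' : C -> C) (s : C), s <> 0 -> local_sol T q y -> local_sol T' q y' ->
    locally' q (fun z => y (2 * q - z) = s * y z) ->
    locally' q (fun z => y' (2 * q - z) = - s * y' z) ->
    ord_ge (fun z => y z * y' z) q d.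

(** Solutions of opposite parities have exponents of opposite parities, so
    these are [e1] and [e2'], or [e2] and [e1']. *)
Lemma exponents_pairing (T T' : twisted) (q : C) (e1 e2 e1' e2' d : Z) :
  exponents T q e1 e2 -> exponents T' q e1' e2' ->
  Z.odd (e1 + e2) = true -> Z.even (e1 + e1') = true -> Z.even (e2 + e2') = true ->
  (d <= e1 + e2')%Z -> (d <= e2 + e1')%Z -> pairing T T' q d.
Proof.
  intros H H' P1 P2 P3 D1 D2 y y' s Hs Hy Hy' Ey Ey'.
  destruct (proj1 Hy) as [m0 O]. destruct (proj1 Hy') as [m0' O'].
  destruct (ord_dichotomy _ _ _ O) as [Z1|[m [_ Om]]].
  { apply ord_ge_zero. revert Z1. apply filter_imp. intros z ->. ring. }
  destruct (ord_dichotomy _ _ _ O') as [Z1|[m' [_ Om']]].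
  { apply ord_ge_zero. revert Z1. apply filter_imp. intros z ->. ring. }
  assert (Hodd := opposite_parity_sum m m' s (ord_eq_parity _ _ _ _ Om Ey) (ord_eq_parity _ _ _ _ Om' Ey')).
  apply ord_ge_mono with (m + m')%Z.
  2:{ apply ord_ge_mult; now apply ord_eq_ge. }
  apply Z.odd_spec in P1, Hodd. apply Z.even_spec in P2, P3.
  destruct P1 as [a1 P1], Hodd as [a2 P4], P2 as [a3 P2], P3 as [a4 P3].
  destruct (H y m Hy Om) as [->| ->], (H' y' m' Hy' Om') as [->| ->]; lia.
Qed.

Lemma local_sol_lin (T : twisted) (q : C) (y y' : C -> C) (a b : C) :
  local_sol T q y -> local_sol T q y' -> local_sol T q (fun z => a * y z + b * y' z).
Proof.
  intros [[m Hm] H] [[m' Hm'] H']. split.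
  - exists (Z.min m m'). apply ord_ge_plus; apply ord_ge_scal;
      (eapply ord_ge_mono; [|eassumption]); lia.
  - generalize (filter_and _ _ H H'). apply filter_imp. intros z [H1 H2]. now apply tsolves_lin.
Qed.

Lemma local_sol_ext (T : twisted) (q : C) (y y' : C -> C) :
  locally' q (fun z => y z = y' z) -> local_sol T q y -> local_sol T q y'.
Proof.
  intros E [[m Hm] H]. split.
  - exists m. now apply ord_ge_ext with y.
  - generalize (filter_and _ _ (locally'_near _ _ E) H). apply filter_imp.
    intros z [E' H']. now apply tsolves_ext with y.
Qed.

(** Split every factor into its even and odd parts about [q]. Products of equal
    parities are even, and cancel in a sum that is odd. *)
Lemma odd_bilinear_order (T T' : twisted) (q c11 c12 c21 c22 : C) (d : Z) (y1 y2 y1' y2' : C -> C) :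
  pairing T T' q d ->
  local_sol T q y1 -> local_sol T q y2 -> local_sol T' q y1' -> local_sol T' q y2' ->
  local_sol T q (fun z => y1 (2 * q - z)) -> local_sol T q (fun z => y2 (2 * q - z)) ->
  local_sol T' q (fun z => y1' (2 * q - z)) -> local_sol T' q (fun z => y2' (2 * q - z)) ->
  let F := fun z => c11 * (y1 z * y1' z) + c12 * (y1 z * y2' z) + c21 * (y2 z * y1' z) + c22 * (y2 z * y2' z) in
  locally' q (fun z => F (2 * q - z) = - F z) -> ord_ge F q d.
Proof.
  intros HP H1 H2 H1' H2' R1 R2 R1' R2' F HF.
  set (ev := fun (y : C -> C) z => / 2 * y z + / 2 * y (2 * q - z)).
  set (od := fun (y : C -> C) z => / 2 * y z + (- / 2) * y (2 * q - z)).
  assert (Hinv : forall z, 2 * q - (2 * q - z) = z) by (intros; ring).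
  assert (Hprod : forall y y', local_sol T q y -> local_sol T q (fun z => y (2 * q - z)) ->
     local_sol T' q y' -> local_sol T' q (fun z => y' (2 * q - z)) ->
     ord_ge (fun z => ev y z * od y' z + od y z * ev y' z) q d).
  { intros y y' Hy Ry Hy' Ry'. apply ord_ge_plus.
    - apply (HP (ev y) (od y') 1); [apply C1_nz|now apply local_sol_lin..| |];
        apply filter_forall; intros z; unfold ev, od; rewrite Hinv; ring.
    - apply (HP (od y) (ev y') (-1)); [intros X; apply RtoC_inj in X; lra|now apply local_sol_lin..| |];
        apply filter_forall; intros z; unfold ev, od; rewrite Hinv; ring. }
  apply ord_ge_ext with (fun z =>
    c11 * (ev y1 z * od y1' z + od y1 z * ev y1' z) + c12 * (ev y1 z * od y2' z + od y1 z * ev y2' z)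
    + c21 * (ev y2 z * od y1' z + od y2 z * ev y1' z) + c22 * (ev y2 z * od y2' z + od y2 z * ev y2' z)).
  - revert HF. apply filter_imp. intros z Hz.
    transitivity (/ 2 * (F z - F (2 * q - z))).
    + unfold F, ev, od. field.
    + rewrite Hz. field.
  - repeat apply ord_ge_plus; apply ord_ge_scal; auto.
Qed.

(** * From monodromy to potentials *)

(** In [adm_ord], moving [a] by a period allows the apparent singularities to
    be examined at [p] and [- p] alone. *)
Record admissible (tau : C) (T : twisted) : Prop := {
  adm_disc : forall a, locally' a (fun z => ~ tbad T z);
  adm_opp : forall z, ~ tbad T z -> ~ tbad T (- z);
  adm_add : forall z w, in_lattice tau w -> ~ tbad T z -> ~ tbad T (z + w);
  adm_ord : forall a, ~ two_torsion tau a -> exists w, in_lattice tau w /\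
    forall y, local_sol T (a + w) y -> ord_ge y (a + w) 0;
  adm_reg : forall z, ~ tbad T z -> exponents T z 0 1;
  adm_l : forall z, ~ tbad T z -> Cderive_at (tl T) z (tdl T z)
}.

Definition tsol (T : twisted) (y : C -> C) : Prop :=
  mero y /\ forall z, ~ tbad T z -> tsolves T z y.

Lemma tsol_local (tau : C) (T : twisted) (y : C -> C) (q : C) : admissible tau T ->
  tsol T y -> local_sol T q y.
Proof.
  intros HA [H1 H2]. split; [apply H1|]. generalize (adm_disc _ _ HA q). apply filter_imp. auto.
Qed.

Lemma tsol_lin (T : twisted) (y y' : C -> C) (a b : C) :
  tsol T y -> tsol T y' -> tsol T (fun z => a * y z + b * y' z).
Proof.
  intros [H1 H2] [H1' H2']. split; [apply mero_plus; now apply mero_scal|].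
  intros z Hz. apply tsolves_lin; auto.
Qed.

Definition in_span (T : twisted) (y1 y2 f : C -> C) : Prop :=
  exists a b, forall z, ~ tbad T z -> f z = a * y1 z + b * y2 z.

Lemma in_span_local_sol (tau : C) (T : twisted) (y1 y2 f : C -> C) (q : C) : admissible tau T ->
  tsol T y1 -> tsol T y2 -> in_span T y1 y2 f -> local_sol T q f.
Proof.
  intros HA H1 H2 [a [b E]]. apply local_sol_ext with (fun z => a * y1 z + b * y2 z).
  - generalize (adm_disc _ _ HA q). apply filter_imp. intros z Hz. now rewrite E.
  - apply local_sol_lin; eapply tsol_local; eauto.
Qed.

(** Stability is stated for the generators of the lattice and their opposites,
    where it can be read off from two invertible matrices. *)
Record frame (tau : C) (T : twisted) (y1 y2 : C -> C) : Prop := {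
  fr_sol1 : tsol T y1;
  fr_sol2 : tsol T y2;
  fr_opp : in_span T y1 y2 (fun z => y1 (- z)) /\ in_span T y1 y2 (fun z => y2 (- z));
  fr_gen : forall w : C, (w = 1 \/ w = - (1) \/ w = tau \/ w = - tau) ->
    in_span T y1 y2 (fun z => y1 (z + w)) /\ in_span T y1 y2 (fun z => y2 (z + w))
}.

Lemma in_span_trans (T : twisted) (y1 y2 f g : C -> C) (h : C -> C) (a b : C) :
  (forall z, ~ tbad T z -> f z = a * y1 (h z) + b * y2 (h z)) ->
  in_span T y1 y2 (fun z => y1 (h z)) -> in_span T y1 y2 (fun z => y2 (h z)) ->
  in_span T y1 y2 f.
Proof.
  intros E [a1 [b1 E1]] [a2 [b2 E2]]. exists (a * a1 + b * a2), (a * b1 + b * b2).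
  intros z Hz. rewrite E, E1, E2 by auto. ring.
Qed.

Lemma frame_reflect (tau : C) (T : twisted) (y1 y2 : C -> C) (w : C) :
  admissible tau T -> frame tau T y1 y2 -> in_lattice tau w ->
  in_span T y1 y2 (fun z => y1 (w - z)) /\ in_span T y1 y2 (fun z => y2 (w - z)).
Proof.
  intros HA HF Hw.
  set (P := fun w => in_lattice tau w /\ in_span T y1 y2 (fun z => y1 (w - z)) /\
                     in_span T y1 y2 (fun z => y2 (w - z))).
  assert (Hstep : forall u : C, in_lattice tau u -> (u = 1 \/ u = - (1) \/ u = tau \/ u = - tau) ->
            forall v, P v -> P (v + u)).
  { intros u Hu Hgen v [Hv [P1 P2]]. split; [now apply in_lattice_plus|].
    destruct (fr_gen _ _ _ _ HF u Hgen) as [[a1 [b1 E1]] [a2 [b2 E2]]].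
    assert (Hb : forall z, ~ tbad T z -> ~ tbad T (v - z)).
    { intros z Hz. replace (v - z) with (- z + v) by ring. apply (adm_add _ _ HA); auto.
      now apply (adm_opp _ _ HA). }
    split.
    - apply (in_span_trans T y1 y2 _ y1 (fun z => v - z) a1 b1); auto.
      intros z Hz. replace (v + u - z) with (v - z + u) by ring. apply E1. auto.
    - apply (in_span_trans T y1 y2 _ y1 (fun z => v - z) a2 b2); auto.
      intros z Hz. replace (v + u - z) with (v - z + u) by ring. apply E2. auto. }
  assert (HP : P (0 + w)).
  { apply (lattice_ind tau P).
    - intros z. apply (Hstep 1); auto using in_lattice_1.
    - intros z. apply (Hstep (- (1))); auto using in_lattice_1, in_lattice_opp.
    - intros z. apply (Hstep tau); auto using in_lattice_tau.
    - intros z. apply (Hstep (- tau)); auto using in_lattice_tau, in_lattice_opp.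
    - exact Hw.
    - split; [apply in_lattice_0|]. destruct (fr_opp _ _ _ _ HF) as [[a [b E]] [a' [b' E']]].
      split; [exists a, b|exists a', b']; intros z Hz; replace (0 - z) with (- z) by ring; auto. }
  replace (0 + w) with w in HP by ring. apply HP.
Qed.

(** The points where no solution of a frame has a pole form a periodic set. *)
Lemma frame_ord (tau : C) (T : twisted) (y1 y2 : C -> C) (a : C) :
  admissible tau T -> frame tau T y1 y2 -> ~ two_torsion tau a ->
  ord_ge y1 a 0 /\ ord_ge y2 a 0.
Proof.
  intros HA HF Ha. destruct (adm_ord _ _ HA a Ha) as [w [Hw H]].
  set (P := fun a => ord_ge y1 a 0 /\ ord_ge y2 a 0).
  assert (Hstep : forall u : C, (u = 1 \/ u = - (1) \/ u = tau \/ u = - tau) ->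
            forall v, P v -> P (v - u)).
  { intros u Hu v [P1 P2].
    assert (X : forall (c d : C) (f : C -> C), (forall z, ~ tbad T z -> f z = c * y1 (z + u) + d * y2 (z + u)) -> ord_ge f (v - u) 0).
    { intros c d f E. apply ord_ge_ext with (fun z => c * y1 (z + u) + d * y2 (z + u)).
      - generalize (adm_disc _ _ HA (v - u)). apply filter_imp. intros z Hz. now rewrite E.
      - apply ord_ge_plus; apply ord_ge_scal, ord_ge_shift; now replace (v - u + u) with v by ring. }
    assert (Hin : in_lattice tau u /\ (- u = 1 \/ - u = - (1) \/ - u = tau \/ - u = - tau)).
    { destruct Hu as [->|[->|[->| ->]]]; split; auto using in_lattice_1, in_lattice_tau, in_lattice_opp.
      - left. ring. - right; right; left. ring. }
    destruct Hin as [Hl Hu'].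
    destruct (fr_gen _ _ _ _ HF (- u) Hu') as [[a1 [b1 E1]] [a2 [b2 E2]]].
    split; [apply (X a1 b1)|apply (X a2 b2)]; auto; intros z Hz.
    - rewrite <- E1 by now apply (adm_add _ _ HA). f_equal. ring.
    - rewrite <- E2 by now apply (adm_add _ _ HA). f_equal. ring. }
  assert (HP : P (a + w + - w)).
  { apply (lattice_ind tau P).
    - intros z Hz. replace (z + 1) with (z - - (1)) by ring. apply (Hstep (- (1))); auto.
    - intros z. apply (Hstep 1); auto.
    - intros z Hz. replace (z + tau) with (z - - tau) by ring. apply (Hstep (- tau)); auto.
    - intros z. apply (Hstep tau); auto.
    - now apply in_lattice_opp.
    - split; apply H; apply (tsol_local tau); auto; apply HF. }
  replace (a + w + - w) with a in HP by ring. exact HP.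
Qed.

(** The half periods are written with a minus sign because [wp (z + omega_k /
    2)] has its pole there. *)
Lemma two_torsion_rep (tau a : C) : two_torsion tau a ->
  exists k, (k <= 3)%nat /\ in_lattice tau (a - - (omega tau k / 2)).
Proof.
  intros [[m n] E]. unfold lattice_point in E; simpl in E.
  assert (Ea : a = / 2 * (RtoC (IZR m) + RtoC (IZR n) * tau)) by (rewrite <- E; field).
  assert (H2 : forall m : Z, exists p, m = (2 * p)%Z \/ m = (2 * p - 1)%Z).
  { intros x. destruct (Z.Even_or_Odd x) as [[p Hp]|[p Hp]]; [exists p|exists (p + 1)%Z]; lia. }
  destruct (H2 m) as [p Hp], (H2 n) as [r Hr].
  assert (X : forall e f : Z, m = (2 * p - e)%Z -> n = (2 * r - f)%Z ->
     a - - ((RtoC (IZR e) + RtoC (IZR f) * tau) / 2) = lattice_point tau (p, r)).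
  { intros e f -> ->. rewrite Ea, !minus_IZR, !mult_IZR, !RtoC_minus, !RtoC_mult.
    unfold lattice_point; cbn [fst snd]. field. }
  destruct Hp as [Hp|Hp], Hr as [Hr|Hr].
  - exists 0%nat. split; [lia|]. exists (p, r). rewrite <- (X 0%Z 0%Z) by lia. simpl. field.
  - exists 2%nat. split; [lia|]. exists (p, r). rewrite <- (X 0%Z 1%Z) by lia. simpl. field.
  - exists 1%nat. split; [lia|]. exists (p, r). rewrite <- (X 1%Z 0%Z) by lia. simpl. field.
  - exists 3%nat. split; [lia|]. exists (p, r). rewrite <- (X 1%Z 1%Z) by lia. simpl. field.
Qed.

Lemma omega_in_lattice (tau : C) (k : nat) : in_lattice tau (omega tau k).
Proof.
  destruct k as [|[|[|k]]]; simpl; auto using in_lattice_0, in_lattice_1, in_lattice_tau, in_lattice_plus.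
Qed.

Lemma half_omega_two_torsion (tau : C) (k : nat) : two_torsion tau (- (omega tau k / 2)).
Proof.
  unfold two_torsion. replace (2 * - (omega tau k / 2)) with (- omega tau k) by field.
  apply in_lattice_opp, omega_in_lattice.
Qed.

(** Being odd and elliptic, [F] is odd about every half period, where [pairing]
    bounds its order from below. Elsewhere the solutions have no poles. So [F]
    has too few poles for its zeros. *)
Lemma bilinear_zero (tau : C) (T T' : twisted) (y1 y2 y1' y2' : C -> C) (c11 c12 c21 c22 : C) (k0 : nat) :
  0 < Im tau -> admissible tau T -> admissible tau T' ->
  frame tau T y1 y2 -> frame tau T' y1' y2' -> (k0 <= 3)%nat ->
  (forall k, (k <= 3)%nat ->
     pairing T T' (- (omega tau k / 2)) (if Nat.eqb k k0 then -1 else 1)%Z) ->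
  let F := fun z => c11 * (y1 z * y1' z) + c12 * (y1 z * y2' z) + c21 * (y2 z * y1' z) + c22 * (y2 z * y2' z) in
  (forall z, ~ tbad T z -> ~ tbad T' z -> F (z + 1) = F z) ->
  (forall z, ~ tbad T z -> ~ tbad T' z -> F (z + tau) = F z) ->
  (forall z, ~ tbad T z -> ~ tbad T' z -> F (- z) = - F z) ->
  forall a, locally' a (fun z => F z = 0).
Proof.
  intros Ht HA HA' HF HF' Hk0 Hpair F H1 H2 Hodd.
  assert (Hd : forall a, locally' a (fun z => ~ tbad T z /\ ~ tbad T' z)).
  { intros a. apply filter_and; [apply (adm_disc _ _ HA)|apply (adm_disc _ _ HA')]. }
  assert (Hper : forall w, in_lattice tau w -> forall z, ~ tbad T z -> ~ tbad T' z -> F (z + w) = F z).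
  { intros w Hw.
    assert (X : (fun w => in_lattice tau w /\ forall z, ~ tbad T z -> ~ tbad T' z -> F (z + w) = F z) (0 + w)).
    { apply (lattice_ind tau (fun w => in_lattice tau w /\ forall z, ~ tbad T z -> ~ tbad T' z -> F (z + w) = F z)); auto.
      - intros u [Hu E]. split; [apply in_lattice_plus; auto using in_lattice_1|]. intros z Z1 Z2.
        rewrite Cplus_assoc, H1; auto; now apply (adm_add tau).
      - intros u [Hu E]. split; [apply in_lattice_minus; auto using in_lattice_1|]. intros z Z1 Z2.
        assert (Hl : in_lattice tau (u - 1)) by (apply in_lattice_minus; auto using in_lattice_1).
        rewrite <- H1 by now apply (adm_add tau). replace (z + (u - 1) + 1) with (z + u) by ring. auto.
      - intros u [Hu E]. split; [apply in_lattice_plus; auto using in_lattice_tau|]. intros z Z1 Z2.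
        rewrite Cplus_assoc, H2; auto; now apply (adm_add tau).
      - intros u [Hu E]. split; [apply in_lattice_minus; auto using in_lattice_tau|]. intros z Z1 Z2.
        assert (Hl : in_lattice tau (u - tau)) by (apply in_lattice_minus; auto using in_lattice_tau).
        rewrite <- H2 by now apply (adm_add tau). replace (z + (u - tau) + tau) with (z + u) by ring. auto.
      - split; [apply in_lattice_0|]. intros z _ _. f_equal. ring. }
    replace (0 + w) with w in X by ring. apply X. }
  assert (Hordper : forall d a w, in_lattice tau w -> ord_ge F a d -> ord_ge F (a + w) d).
  { intros d a w Hw H. apply ord_ge_ext with (fun z => F (z + - w)).
    - generalize (Hd (a + w)). apply filter_imp. intros z [Z1 Z2]. apply Hper; auto using in_lattice_opp.
    - apply ord_ge_shift. replace (a + w + - w) with a by ring. exact H. }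
  assert (Hq : forall k, (k <= 3)%nat -> ord_ge F (- (omega tau k / 2)) (if Nat.eqb k k0 then -1 else 1)%Z).
  { intros k Hk. set (q := - (omega tau k / 2)).
    assert (E2q : 2 * q = - omega tau k) by (unfold q; field).
    assert (Hl : in_lattice tau (2 * q)) by (rewrite E2q; apply in_lattice_opp, omega_in_lattice).
    destruct (frame_reflect tau T y1 y2 _ HA HF Hl) as [R1 R2].
    destruct (frame_reflect tau T' y1' y2' _ HA' HF' Hl) as [R1' R2'].
    assert (S1 := fr_sol1 _ _ _ _ HF). assert (S2 := fr_sol2 _ _ _ _ HF).
    assert (S1' := fr_sol1 _ _ _ _ HF'). assert (S2' := fr_sol2 _ _ _ _ HF').
    apply (odd_bilinear_order T T' q c11 c12 c21 c22 _ y1 y2 y1' y2' (Hpair k Hk));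
      try (eapply tsol_local; eassumption);
      try (exact (in_span_local_sol tau T y1 y2 _ q HA S1 S2 R1));
      try (exact (in_span_local_sol tau T y1 y2 _ q HA S1 S2 R2));
      try (exact (in_span_local_sol tau T' y1' y2' _ q HA' S1' S2' R1'));
      try (exact (in_span_local_sol tau T' y1' y2' _ q HA' S1' S2' R2')).
    generalize (Hd q). apply filter_imp. intros z [Z1 Z2]. fold (F z). fold (F (2 * q - z)).
    replace (2 * q - z) with (- z + 2 * q) by ring.
    rewrite Hper; auto; [now apply (adm_opp tau)|now apply (adm_opp tau)]. }
  apply (elliptic_zero F tau (- (omega tau k0 / 2))); auto.
  - intros a. generalize (Hd a). apply filter_imp. intros z [Z1 Z2]. auto.
  - intros a. generalize (Hd a). apply filter_imp. intros z [Z1 Z2]. auto.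
  - apply half_omega_two_torsion.
  - intros a Ha Hne. destruct (two_torsion_rep tau a Ha) as [k [Hk Hl]].
    assert (Hkk : Nat.eqb k k0 = false).
    { apply Nat.eqb_neq. intros ->. auto. }
    specialize (Hq k Hk). rewrite Hkk in Hq.
    replace a with (- (omega tau k / 2) + (a - - (omega tau k / 2))) by ring. auto.
  - intros a Ha. specialize (Hq k0 Hk0). rewrite Nat.eqb_refl in Hq.
    replace a with (- (omega tau k0 / 2) + (a - - (omega tau k0 / 2))) by ring. auto.
  - intros a Ha. destruct (frame_ord tau T y1 y2 a HA HF Ha) as [O1 O2].
    destruct (frame_ord tau T' y1' y2' a HA' HF' Ha) as [O1' O2'].
    unfold F. repeat apply ord_ge_plus; apply ord_ge_scal; apply (ord_ge_mult _ _ a 0 0); auto.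
Qed.

Definition tindep (T : twisted) (y1 y2 : C -> C) : Prop :=
  forall a b : C, (forall z, ~ tbad T z -> a * y1 z + b * y2 z = 0) -> a = 0 /\ b = 0.

Lemma tsol_zero (T : twisted) (y : C -> C) (a : C) : tsol T y ->
  locally' a (fun z => y z = 0) -> forall z, ~ tbad T z -> y z = 0.
Proof.
  intros [Hm Hs] H z Hz. assert (H' := mero_identity y a Hm H z).
  apply clim_unique with y z.
  - exact (hol_cont _ _ (tsolves_hol _ _ _ (Hs z Hz))).
  - apply clim_ext with (fun _ => RtoC 0); [|apply clim_const]. revert H'. apply filter_imp. auto.
Qed.

(** A nonzero solution with vanishing Cauchy data at a regular point would have
    an order there other than the exponents 0 and 1. *)
Lemma Cauchy_data_zero (tau : C) (T : twisted) (y : C -> C) (z0 : C) : admissible tau T ->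
  tsol T y -> ~ tbad T z0 -> y z0 = 0 -> Cderive_at y z0 0 -> forall z, ~ tbad T z -> y z = 0.
Proof.
  intros HA Hy Hz0 H0 H1.
  destruct (hol_order y z0 (tsolves_hol _ _ _ (proj2 Hy z0 Hz0))) as [E|[m [h [Hh [Hn E]]]]].
  { apply (tsol_zero T y z0 Hy). now apply locally_locally'. }
  exfalso. assert (E0 := locally_singleton _ _ E). cbv beta in E0. rewrite H0 in E0.
  replace (z0 - z0) with (RtoC 0) in E0 by ring.
  destruct m as [|[|m]].
  - apply Hn. rewrite E0. simpl. ring.
  - apply Hn. apply (Cderive_unique y z0); auto.
    apply Cderive_ext with (fun z => (z - z0) ^ 1 * h z).
    { revert E. apply filter_imp. auto. }
    eapply Cderive_eq.
    + apply Cderive_mult; [|apply (hol_at _ _ Hh)].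
      apply (Cderive_pow (fun z => z - z0)), Cderive_minus; [apply Cderive_id|apply Cderive_const].
    + cbv beta. simpl. ring.
  - assert (O : ord_eq y z0 (Z.of_nat (S (S m)))).
    { exists h. split; auto. split; auto. apply locally_locally'. revert E. apply filter_imp.
      intros z ->. now rewrite zpow_nat. }
    destruct (adm_reg _ _ HA z0 Hz0 y _ (tsol_local tau T y z0 HA Hy) O); lia.
Qed.

Lemma Wronskian_ne (tau : C) (T : twisted) (y1 y2 : C -> C) (z0 d1 d2 : C) : admissible tau T ->
  tsol T y1 -> tsol T y2 -> tindep T y1 y2 -> ~ tbad T z0 ->
  Cderive_at y1 z0 d1 -> Cderive_at y2 z0 d2 -> y1 z0 * d2 - y2 z0 * d1 <> 0.
Proof.
  intros HA H1 H2 Hi Hz0 D1 D2 W.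
  assert (X : forall a b, a * y1 z0 + b * y2 z0 = 0 -> a * d1 + b * d2 = 0 -> a = 0 /\ b = 0).
  { intros a b E1 E2. apply Hi.
    apply (Cauchy_data_zero tau T (fun z => a * y1 z + b * y2 z) z0 HA); auto.
    - now apply tsol_lin.
    - eapply Cderive_eq; [apply Cderive_plus; apply Cderive_scal; eassumption|exact E2]. }
  destruct (X (- y2 z0) (y1 z0)) as [_ Y1]; [ring|rewrite <- W; ring|].
  destruct (X (- d2) d1) as [Y2 Y3]; [transitivity (- (y1 z0 * d2 - y2 z0 * d1)); [ring|rewrite W; ring]|ring|].
  destruct (X 1 0) as [Y4 _].
  - rewrite Y1. ring. - rewrite Y3. ring. - now apply C1_nz.
Qed.

Lemma cancel_pair (A B a1 b1 a2 b2 : C) : a1 * b2 - a2 * b1 <> 0 ->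
  A * b1 + B * a1 = 0 -> A * b2 + B * a2 = 0 -> A = 0 /\ B = 0.
Proof.
  intros W E1 E2. split; apply NNPP; intros N; apply (Cmult_neq_0 _ _ N W).
  - transitivity (a1 * (A * b2 + B * a2) - a2 * (A * b1 + B * a1)); [ring|]. rewrite E1, E2. ring.
  - transitivity (b2 * (A * b1 + B * a1) - b1 * (A * b2 + B * a2)); [ring|]. rewrite E1, E2. ring.
Qed.

(** The potential of [y'' = V y] is determined by the quotient of two
    solutions: it is [- 1 / 2] times its Schwarzian derivative, and twisting
    does not change the quotient. Put [r = y1' / y1 = y2' / y2]. Inserting [yi'
    = r yi] in the second equation and subtracting [r] times the first gives a
    relation between [yi] and its derivative with the same coefficients for [i
    = 1, 2]. The Wronskian does not vanish, so both coefficients are 0, and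
    eliminating the derivatives of [r] from them leaves [V = V']. *)
Lemma ratio_potential_aux (tau : C) (T T' : twisted) (y1 y2 y1' y2' : C -> C) (z0 : C) :
  admissible tau T -> admissible tau T' -> tsol T y1 -> tsol T y2 -> tsol T' y1' -> tsol T' y2' ->
  tindep T y1 y2 -> tindep T' y1' y2' ->
  (forall a, locally' a (fun z => y1 z * y2' z = y2 z * y1' z)) ->
  ~ tbad T z0 -> ~ tbad T' z0 -> y2 z0 <> 0 -> tV T z0 = tV T' z0.
Proof.
  intros HA HA' H1 H2 H1' H2' Hi Hi' HD Hz Hz' Hne.
  assert (Reg : locally z0 (fun z => ~ tbad T z /\ ~ tbad T' z)).
  { apply locally'_center; auto. apply filter_and; [apply (adm_disc _ _ HA)|apply (adm_disc _ _ HA')]. }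
  destruct (proj2 H1 z0 Hz) as [d1 D1]. destruct (proj2 H2 z0 Hz) as [d2 D2].
  destruct (proj2 H1' z0 Hz') as [d1' D1']. destruct (proj2 H2' z0 Hz') as [d2' D2'].
  assert (Hne' : locally z0 (fun z => y2 z <> 0)).
  { apply ccont_nonzero; auto. exact (hol_cont _ _ (tsolves_hol _ _ _ (proj2 H2 z0 Hz))). }
  set (r := fun z => y2' z / y2 z).
  assert (ED : forall z, ~ tbad T z -> ~ tbad T' z -> y1 z * y2' z = y2 z * y1' z).
  { intros z Z1 Z2. assert (Ct : forall T y, tsol T y -> ~ tbad T z -> ccont y z).
    { intros T0 y [_ Hy] Zb. exact (hol_cont _ _ (tsolves_hol _ _ _ (Hy z Zb))). }
    apply (clim_unique (fun z => y1 z * y2' z) z).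
    - apply clim_mult; [apply (Ct T y1)|apply (Ct T' y2')]; auto.
    - apply clim_ext with (fun z => y2 z * y1' z).
      + generalize (HD z). apply filter_imp. auto.
      + apply clim_mult; [apply (Ct T y2)|apply (Ct T' y1')]; auto. }
  set (r1 := fun z => (d2' z * y2 z - y2' z * d2 z) / (y2 z * y2 z)).
  assert (All : locally z0 (fun z =>
     Cderive_at r z (r1 z) /\ y1' z = r z * y1 z /\ y2' z = r z * y2 z /\
     d1' z = r1 z * y1 z + r z * d1 z /\ d2' z = r1 z * y2 z + r z * d2 z /\
     y1 z * d2 z - y2 z * d1 z <> 0)).
  { assert (E1 : locally z0 (fun z => r z * y1 z = y1' z)).
    { generalize (filter_and _ _ Reg Hne'). apply filter_imp. intros z [[Z1 Z2] N].
      assert (E := ED z Z1 Z2). unfold r.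
      transitivity (y1 z * y2' z / y2 z); [field; auto|]. rewrite E. field. auto. }
    apply locally_locally in E1.
    generalize (filter_and _ _ (filter_and _ _ (filter_and _ _ D1 D2) (filter_and _ _ D1' D2'))
      (filter_and _ _ (filter_and _ _ Reg Hne') E1)).
    apply filter_imp. intros z [[[[A1 _] [A2 _]] [[A1' _] [A2' _]]] [[[Z1 Z2] N] E]].
    assert (Dr : Cderive_at r z (r1 z)) by now apply Cderive_div.
    split; [exact Dr|]. split; [symmetry; exact (locally_singleton _ _ E)|].
    split; [unfold r; field; auto|]. split; [|split].
    - apply (Cderive_unique y1' z); auto. apply Cderive_ext with (fun z => r z * y1 z); auto.
      now apply Cderive_mult.
    - unfold r, r1. field. auto.
    - exact (Wronskian_ne tau T y1 y2 z _ _ HA H1 H2 Hi Z1 A1 A2). }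
  assert (Main : forall z, locally z (fun z => Cderive_at r z (r1 z) /\ y1' z = r z * y1 z /\ y2' z = r z * y2 z /\
     d1' z = r1 z * y1 z + r z * d1 z /\ d2' z = r1 z * y2 z + r z * d2 z /\
     y1 z * d2 z - y2 z * d1 z <> 0) ->
     (Cderive_at y1 z (d1 z) /\ Cderive_at d1 z (- (2 * tl T z * d1 z) - (tdl T z + tl T z * tl T z - tV T z) * y1 z)) ->
     (Cderive_at y2 z (d2 z) /\ Cderive_at d2 z (- (2 * tl T z * d2 z) - (tdl T z + tl T z * tl T z - tV T z) * y2 z)) ->
     (Cderive_at y1' z (d1' z) /\ Cderive_at d1' z (- (2 * tl T' z * d1' z) - (tdl T' z + tl T' z * tl T' z - tV T' z) * y1' z)) ->
     (Cderive_at y2' z (d2' z) /\ Cderive_at d2' z (- (2 * tl T' z * d2' z) - (tdl T' z + tl T' z * tl T' z - tV T' z) * y2' z)) ->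
     y2 z <> 0 ->
     exists s, Cderive_at r1 z s /\ r1 z = r z * (tl T z - tl T' z) /\
       s + 2 * tl T' z * r1 z + r z * ((tdl T' z + tl T' z * tl T' z - tV T' z)
          - (tdl T z + tl T z * tl T z - tV T z)) = 0).
  { intros z L [A1 B1] [A2 B2] [A1' B1'] [A2' B2'] N.
    destruct (locally_singleton _ _ L) as [Dr [E1 [E2 [F1 [F2 W]]]]].
    set (Q := tdl T z + tl T z * tl T z - tV T z) in *.
    set (Q' := tdl T' z + tl T' z * tl T' z - tV T' z) in *.
    assert (Hs : exists s, Cderive_at r1 z s).
    { eexists. unfold r1. apply Cderive_div; [|apply Cderive_mult; eassumption|now apply Cmult_neq_0].
      apply Cderive_minus; apply Cderive_mult; eassumption. }
    destruct Hs as [s Hs]. exists s. split; auto.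
    assert (G1 : - (2 * tl T' z * d1' z) - Q' * y1' z =
       s * y1 z + r1 z * d1 z + (r1 z * d1 z + r z * (- (2 * tl T z * d1 z) - Q * y1 z))).
    { apply (Cderive_unique d1' z); auto.
      apply Cderive_ext with (fun z => r1 z * y1 z + r z * d1 z).
      - revert L. apply filter_imp. intros w [_ [_ [_ [-> _]]]]. auto.
      - apply Cderive_plus; apply Cderive_mult; auto. }
    assert (G2 : - (2 * tl T' z * d2' z) - Q' * y2' z =
       s * y2 z + r1 z * d2 z + (r1 z * d2 z + r z * (- (2 * tl T z * d2 z) - Q * y2 z))).
    { apply (Cderive_unique d2' z); auto.
      apply Cderive_ext with (fun z => r1 z * y2 z + r z * d2 z).
      - revert L. apply filter_imp. intros w [_ [_ [_ [_ [-> _]]]]]. auto.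
      - apply Cderive_plus; apply Cderive_mult; auto. }
    rewrite F1, E1 in G1. rewrite F2, E2 in G2. apply Ceq_minus in G1, G2.
    destruct (cancel_pair (2 * r1 z - 2 * r z * (tl T z - tl T' z))
       (s + 2 * tl T' z * r1 z + r z * (Q' - Q)) (y1 z) (d1 z) (y2 z) (d2 z) W) as [K1 K2].
    - transitivity (- (0)); [rewrite <- G1; ring|ring].
    - transitivity (- (0)); [rewrite <- G2; ring|ring].
    - split; [|exact K2]. apply Ceq_minus.
      transitivity (/ 2 * (2 * r1 z - 2 * r z * (tl T z - tl T' z))); [field|rewrite K1; ring]. }
  assert (L1 : locally z0 (fun z => r z * (tl T z - tl T' z) = r1 z)).
  { apply locally_locally in All.
    generalize (filter_and _ _ (filter_and _ _ (filter_and _ _ D1 D2) (filter_and _ _ D1' D2'))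
      (filter_and _ _ All Hne')).
    apply filter_imp. intros z [[[B1 B2] [B1' B2']] [L N]].
    destruct (Main z L B1 B2 B1' B2' N) as [s [_ [E _]]]. now symmetry. }
  destruct (Main z0 All (locally_singleton _ _ D1) (locally_singleton _ _ D2)
    (locally_singleton _ _ D1') (locally_singleton _ _ D2') Hne) as [s [Ds [E1 E2]]].
  destruct (locally_singleton _ _ All) as [Dr [E3 [E4 _]]].
  assert (Es : s = r1 z0 * (tl T z0 - tl T' z0) + r z0 * (tdl T z0 - tdl T' z0)).
  { apply (Cderive_unique r1 z0); auto.
    apply Cderive_ext with (fun z => r z * (tl T z - tl T' z)); auto.
    apply (Cderive_mult r (fun z => tl T z - tl T' z)); auto.
    apply (Cderive_minus (tl T) (tl T')); [now apply (adm_l _ _ HA)|now apply (adm_l _ _ HA')]. }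
  assert (Nr : r z0 <> 0).
  { intros R0. rewrite R0 in E3, E4.
    apply (Wronskian_ne tau T' y1' y2' z0 (d1' z0) (d2' z0)); auto.
    - exact (proj1 (locally_singleton _ _ D1')).
    - exact (proj1 (locally_singleton _ _ D2')).
    - rewrite E3, E4. ring. }
  rewrite Es, E1 in E2.
  apply Ceq_minus, NNPP. intros Hn. apply (Cmult_neq_0 _ _ Nr Hn). rewrite <- E2. ring.
Qed.

(** At a zero of [y2] the solution [y1] does not vanish, and the two exchange
    their roles. *)
Lemma ratio_potential (tau : C) (T T' : twisted) (y1 y2 y1' y2' : C -> C) (z0 : C) :
  admissible tau T -> admissible tau T' -> tsol T y1 -> tsol T y2 -> tsol T' y1' -> tsol T' y2' ->
  tindep T y1 y2 -> tindep T' y1' y2' ->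
  (forall a, locally' a (fun z => y1 z * y2' z = y2 z * y1' z)) ->
  ~ tbad T z0 -> ~ tbad T' z0 -> tV T z0 = tV T' z0.
Proof.
  intros HA HA' H1 H2 H1' H2' Hi Hi' HD Hz Hz'.
  destruct (classic (y2 z0 = 0)) as [E2|E2].
  - destruct (classic (y1 z0 = 0)) as [E1|E1].
    + exfalso. destruct (proj2 H1 z0 Hz) as [d1 D1]. destruct (proj2 H2 z0 Hz) as [d2 D2].
      apply (Wronskian_ne tau T y1 y2 z0 (d1 z0) (d2 z0)); auto.
      * exact (proj1 (locally_singleton _ _ D1)). * exact (proj1 (locally_singleton _ _ D2)).
      * rewrite E1, E2. ring.
    + assert (Sw : forall T y y', tindep T y y' -> tindep T y' y).
      { intros T0 y y' X a b E. destruct (X b a) as [X1 X2]; auto.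
        intros z Zb. rewrite <- (E z Zb). ring. }
      apply (ratio_potential_aux tau T T' y2 y1 y2' y1'); auto.
      intros a. generalize (HD a). apply filter_imp. intros z Ez. now symmetry.
  - now apply (ratio_potential_aux tau T T' y1 y2 y1' y2').
Qed.

(** * Monodromy data *)

(** The clause [pr_opp] says that the equation is even. *)
Record presents (tau : C) (S : solution_space) (T : twisted) : Prop := {
  pr_adm : admissible tau T;
  pr_bad : forall z, bad S z <-> tbad T z;
  pr_sol : forall y, member S y -> tsol T y;
  pr_opp : forall y, member S y -> member S (fun z => y (- z))
}.

Lemma presents_in_span (tau : C) (S : solution_space) (T : twisted) (y1 y2 y : C -> C) :
  presents tau S T -> basis S y1 y2 -> member S y -> in_span T y1 y2 y.
Proof.
  intros HP [_ [_ [_ H]]] Hy. destruct (H y Hy) as [a [b E]]. exists a, b.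
  intros z Hz. apply E. now rewrite (pr_bad _ _ _ HP).
Qed.

Lemma presents_indep (tau : C) (S : solution_space) (T : twisted) (y1 y2 : C -> C) :
  presents tau S T -> basis S y1 y2 -> tindep T y1 y2.
Proof.
  intros HP [_ [_ [H _]]] a b E. apply H. intros z Hz. apply E. now rewrite <- (pr_bad _ _ _ HP).
Qed.

Definition translates (T : twisted) (w : C) (y1 y2 : C -> C) (a b c d : C) : Prop :=
  forall z, ~ tbad T z -> y1 (z + w) = a * y1 z + b * y2 z /\ y2 (z + w) = c * y1 z + d * y2 z.

Lemma translates_inv (tau : C) (T : twisted) (w : C) (y1 y2 : C -> C) (a b c d : C) :
  admissible tau T -> in_lattice tau w -> translates T w y1 y2 a b c d -> a * d - b * c <> 0 ->
  translates T (- w) y1 y2 (d / (a * d - b * c)) (- b / (a * d - b * c))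
    (- c / (a * d - b * c)) (a / (a * d - b * c)).
Proof.
  intros HA Hw H N z Hz.
  assert (Hz' : ~ tbad T (z + - w)) by (apply (adm_add tau); auto using in_lattice_opp).
  destruct (H _ Hz') as [E1 E2]. replace (z + - w + w) with z in E1, E2 by ring.
  rewrite E1, E2. split; field; auto.
Qed.

Lemma frame_of_basis (tau : C) (S : solution_space) (T : twisted) (y1 y2 : C -> C)
    (a1 b1 c1 d1 a2 b2 c2 d2 : C) :
  presents tau S T -> basis S y1 y2 ->
  translates T 1 y1 y2 a1 b1 c1 d1 -> translates T tau y1 y2 a2 b2 c2 d2 ->
  a1 * d1 - b1 * c1 <> 0 -> a2 * d2 - b2 * c2 <> 0 -> frame tau T y1 y2.
Proof.
  intros HP HB H1 H2 N1 N2. assert (HA := pr_adm _ _ _ HP).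
  assert (Hsp : forall w a b c d, translates T w y1 y2 a b c d ->
    in_span T y1 y2 (fun z => y1 (z + w)) /\ in_span T y1 y2 (fun z => y2 (z + w))).
  { intros w a b c d H. split; [exists a, b|exists c, d]; intros z Hz; now apply H. }
  destruct HB as [M1 [M2 HB']] eqn:EB. constructor.
  - now apply (pr_sol _ _ _ HP). - now apply (pr_sol _ _ _ HP).
  - split; apply (presents_in_span tau S T); auto; now apply (pr_opp _ _ _ HP).
  - intros w [->|[->|[->| ->]]].
    + eapply Hsp, H1.
    + eapply Hsp, (translates_inv tau); eauto using in_lattice_1.
    + eapply Hsp, H2.
    + eapply Hsp, (translates_inv tau); eauto using in_lattice_tau.
Qed.

Lemma tindep_ne (T : twisted) (y1 y2 : C -> C) : tindep T y1 y2 ->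
  ~ (forall z, ~ tbad T z -> y1 z = 0).
Proof.
  intros H E. destruct (H 1 0) as [X _]; [|now apply C1_nz].
  intros z Hz. rewrite E by auto. ring.
Qed.

Lemma tindep_eq (T : twisted) (y1 y2 : C -> C) (a b c d : C) : tindep T y1 y2 ->
  (forall z, ~ tbad T z -> a * y1 z + b * y2 z = c * y1 z + d * y2 z) -> a = c /\ b = d.
Proof.
  intros H E. destruct (H (a - c) (b - d)) as [X Y].
  - intros z Hz. assert (Ez := E z Hz). apply Ceq_minus in Ez. rewrite <- Ez. ring.
  - split; now apply Ceq_minus.
Qed.

(** Reflecting inverts the multipliers. Since these are not all [+-1], the two
    common eigenfunctions are exchanged; and [b * c = 1] because the reflection
    is an involution. *)
Lemma diagonal_reflection (tau : C) (S : solution_space) (T : twisted) (y1 y2 : C -> C) (m1 m2 : C) :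
  presents tau S T -> basis S y1 y2 -> m1 <> 0 -> m2 <> 0 ->
  translates T 1 y1 y2 m1 0 0 (/ m1) -> translates T tau y1 y2 m2 0 0 (/ m2) ->
  (m1 * m1 <> 1 \/ m2 * m2 <> 1) ->
  exists b c : C, b * c = 1 /\ forall z, ~ tbad T z -> y1 (- z) = b * y2 z /\ y2 (- z) = c * y1 z.
Proof.
  intros HP HB N1 N2 H1 H2 Hm. assert (HA := pr_adm _ _ _ HP).
  assert (Hi := presents_indep _ _ _ _ _ HP HB).
  assert (Hbo : forall z, ~ tbad T z -> ~ tbad T (- z)) by apply (adm_opp _ _ HA).
  destruct HB as [M1 [M2 HB']] eqn:EB.
  destruct (presents_in_span tau S T y1 y2 _ HP HB (pr_opp _ _ _ HP y1 M1)) as [a [b E1]].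
  destruct (presents_in_span tau S T y1 y2 _ HP HB (pr_opp _ _ _ HP y2 M2)) as [c [d E2]].
  assert (Key : forall w m : C, in_lattice tau w -> m <> 0 -> translates T w y1 y2 m 0 0 (/ m) ->
     m * m <> 1 -> a = 0 /\ d = 0).
  { intros w m Hw Nm H Hmm.
    assert (Hb : forall z, ~ tbad T z -> ~ tbad T (- (z + w)))
      by (intros z Hz; apply Hbo, (adm_add tau); auto).
    assert (Rel : forall z, ~ tbad T z -> y1 (- z) = m * y1 (- (z + w)) /\ y2 (- z) = / m * y2 (- (z + w))).
    { intros z Hz. destruct (H _ (Hb z Hz)) as [F1 F2].
      replace (- (z + w) + w) with (- z) in F1, F2 by ring. rewrite F1, F2. split; ring. }
    assert (Hfac : forall k : C, k * m = / m * k -> k = 0).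
    { intros k Hk. apply NNPP. intros Nk. apply Hmm.
      transitivity (m * (k * m) / k); [field; auto|]. rewrite Hk. field. auto. }
    assert (X1 : m * (a * m) = a /\ m * (b * / m) = b).
    { apply (tindep_eq T y1 y2); auto. intros z Hz. destruct (Rel z Hz) as [R1 _]. rewrite E1 in R1 by auto.
      rewrite R1, (E1 (z + w)) by now apply (adm_add tau). destruct (H z Hz) as [F1 F2]. rewrite F1, F2. ring. }
    assert (X2 : / m * (c * m) = c /\ / m * (d * / m) = d).
    { apply (tindep_eq T y1 y2); auto. intros z Hz. destruct (Rel z Hz) as [_ R1]. rewrite E2 in R1 by auto.
      rewrite R1, (E2 (z + w)) by now apply (adm_add tau). destruct (H z Hz) as [F1 F2]. rewrite F1, F2. ring. }
    split; apply Hfac.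
    - rewrite <- (proj1 X1) at 2. field. auto.
    - rewrite <- (proj2 X2) at 1. field. auto. }
  assert (Had : a = 0 /\ d = 0).
  { destruct Hm as [Hm|Hm].
    - apply (Key 1 m1); auto using in_lattice_1.
    - apply (Key tau m2); auto using in_lattice_tau. }
  destruct Had as [-> ->]. exists b, c. split.
  - destruct (tindep_eq T y1 y2 (b * c) 0 1 0 Hi) as [X _]; auto.
    intros z Hz. assert (F := E1 (- z) (Hbo z Hz)). cbv beta in F. replace (- - z) with z in F by ring.
    rewrite (E2 z Hz) in F. rewrite F at 2. ring.
  - intros z Hz. rewrite (E1 z Hz), (E2 z Hz). split; ring.
Qed.

Lemma Cmult_1_ne (b c : C) : b * c = 1 -> b <> 0.
Proof. intros H ->. apply C1_nz. rewrite <- H. ring. Qed.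

Lemma tindep_scal (T : twisted) (y1 y2 : C -> C) (b : C) : b <> 0 -> tindep T y1 y2 ->
  tindep T y1 (fun z => b * y2 z).
Proof.
  intros N H x y E. destruct (H x (y * b)) as [X Y].
  - intros z Hz. rewrite <- (E z Hz). ring.
  - split; auto. apply NNPP. intros Ny. now apply (Cmult_neq_0 y b).
Qed.

Lemma tsol_scal (T : twisted) (y : C -> C) (b : C) : tsol T y -> tsol T (fun z => b * y z).
Proof.
  intros [Hm Hs]. split; [now apply mero_scal|]. intros z Hz.
  apply tsolves_ext with (fun z => b * y z + 0 * y z); [apply filter_forall; intros; ring|].
  apply tsolves_lin; auto.
Qed.

(** The combination [b' y1 y2' - b y2 y1'] is elliptic, and it is odd because
    the reflection exchanges its two terms up to their signs. Its vanishing
    says that the quotients of the solutions agree. *)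
Lemma diagonal_case (tau : C) (S S' : solution_space) (T T' : twisted) (y1 y2 y1' y2' : C -> C)
    (m1 m2 : C) (k0 : nat) :
  0 < Im tau -> presents tau S T -> presents tau S' T' ->
  basis S y1 y2 -> basis S' y1' y2' -> m1 <> 0 -> m2 <> 0 -> (m1 * m1 <> 1 \/ m2 * m2 <> 1) ->
  translates T 1 y1 y2 m1 0 0 (/ m1) -> translates T tau y1 y2 m2 0 0 (/ m2) ->
  translates T' 1 y1' y2' m1 0 0 (/ m1) -> translates T' tau y1' y2' m2 0 0 (/ m2) ->
  (k0 <= 3)%nat -> (forall k, (k <= 3)%nat ->
     pairing T T' (- (omega tau k / 2)) (if Nat.eqb k k0 then -1 else 1)%Z) ->
  forall z, ~ tbad T z -> ~ tbad T' z -> tV T z = tV T' z.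
Proof.
  intros Ht HP HP' HB HB' N1 N2 Hm H1 H2 H1' H2' Hk0 Hpair z0 Hz0 Hz0'.
  destruct (diagonal_reflection _ _ _ _ _ _ _ HP HB N1 N2 H1 H2 Hm) as [b [c [Ebc R]]].
  destruct (diagonal_reflection _ _ _ _ _ _ _ HP' HB' N1 N2 H1' H2' Hm) as [b' [c' [Ebc' R']]].
  assert (HF : frame tau T y1 y2).
  { eapply frame_of_basis; [exact HP|exact HB|exact H1|exact H2| |]; intros E;
      apply C1_nz; rewrite <- E; field; auto. }
  assert (HF' : frame tau T' y1' y2').
  { eapply frame_of_basis; [exact HP'|exact HB'|exact H1'|exact H2'| |]; intros E;
      apply C1_nz; rewrite <- E; field; auto. }
  assert (Hz := bilinear_zero tau T T' y1 y2 y1' y2' 0 b' (- b) 0 k0 Ht (pr_adm _ _ _ HP) (pr_adm _ _ _ HP')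
    HF HF' Hk0 Hpair).
  cbv zeta in Hz.
  apply (ratio_potential tau T T' y1 (fun z => b * y2 z) y1' (fun z => b' * y2' z)); auto;
    try apply (pr_adm _ _ _ HP); try apply (pr_adm _ _ _ HP'); try apply HF; try apply HF'.
  - apply tsol_scal, HF. - apply tsol_scal, HF'.
  - apply tindep_scal; [eapply Cmult_1_ne; eauto|]. eapply presents_indep; eauto.
  - apply tindep_scal; [eapply Cmult_1_ne; eauto|]. eapply presents_indep; eauto.
  - assert (X : forall a, locally' a (fun z => 0 * (y1 z * y1' z) + b' * (y1 z * y2' z) + - b * (y2 z * y1' z) + 0 * (y2 z * y2' z) = 0)).
    { apply Hz.
      - intros z Z1 Z2. destruct (H1 z Z1) as [-> ->]. destruct (H1' z Z2) as [-> ->]. field. auto.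
      - intros z Z1 Z2. destruct (H2 z Z1) as [-> ->]. destruct (H2' z Z2) as [-> ->]. field. auto.
      - intros z Z1 Z2. destruct (R z Z1) as [-> ->]. destruct (R' z Z2) as [-> ->].
        transitivity (b' * c' * (b * (y2 z * y1' z)) - b * c * (b' * (y1 z * y2' z))); [ring|].
        rewrite Ebc, Ebc'. ring. }
    intros a. generalize (X a). apply filter_imp. intros z E. apply Ceq_minus. rewrite <- E. ring.
Qed.

(** Reflecting inverts the unipotent matrices. So it preserves the line of
    common eigenfunctions, and acts on the quotient by this line with the
    opposite sign. *)
Lemma unipotent_reflection (tau : C) (S : solution_space) (T : twisted) (y1 y2 : C -> C) (e1 e2 a1 a2 : C) :
  presents tau S T -> basis S y1 y2 -> e1 * e1 = 1 -> e2 * e2 = 1 -> (a1 <> 0 \/ a2 <> 0) ->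
  translates T 1 y1 y2 e1 0 (e1 * a1) e1 -> translates T tau y1 y2 e2 0 (e2 * a2) e2 ->
  exists a c : C, (a = 1 \/ a = - (1)) /\
    forall z, ~ tbad T z -> y1 (- z) = a * y1 z /\ y2 (- z) = c * y1 z - a * y2 z.
Proof.
  intros HP HB N1 N2 Ha H1 H2. assert (HA := pr_adm _ _ _ HP).
  assert (Hi := presents_indep _ _ _ _ _ HP HB).
  assert (Hbo : forall z, ~ tbad T z -> ~ tbad T (- z)) by apply (adm_opp _ _ HA).
  destruct HB as [M1 [M2 HB']] eqn:EB.
  destruct (presents_in_span tau S T y1 y2 _ HP HB (pr_opp _ _ _ HP y1 M1)) as [a [b E1]].
  destruct (presents_in_span tau S T y1 y2 _ HP HB (pr_opp _ _ _ HP y2 M2)) as [c [d E2]].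
  assert (Key : forall w e k : C, in_lattice tau w -> e * e = 1 -> translates T w y1 y2 e 0 (e * k) e ->
     k <> 0 -> b = 0 /\ d = - a).
  { intros w e k Hw Ne H Hk.
    assert (Hb : forall z, ~ tbad T z -> ~ tbad T (- (z + w)))
      by (intros z Hz; apply Hbo, (adm_add tau); auto).
    assert (Rel : forall z, ~ tbad T z -> y1 (- z) = e * y1 (- (z + w)) /\
       y2 (- z) = e * k * y1 (- (z + w)) + e * y2 (- (z + w))).
    { intros z Hz. destruct (H _ (Hb z Hz)) as [F1 F2].
      replace (- (z + w) + w) with (- z) in F1, F2 by ring. rewrite F1, F2. split; ring. }
    assert (X1 : a + b * k = a /\ b = b).
    { apply (tindep_eq T y1 y2); auto. intros z Hz. destruct (Rel z Hz) as [R1 _]. rewrite E1 in R1 by auto.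
      rewrite R1, (E1 (z + w)) by now apply (adm_add tau). destruct (H z Hz) as [F1 F2]. rewrite F1, F2.
      transitivity (e * e * ((a + b * k) * y1 z + b * y2 z)); [rewrite Ne; ring|ring]. }
    destruct X1 as [X1 _].
    assert (Eb : b = 0).
    { apply NNPP. intros Nb. apply (Cmult_neq_0 b k); auto.
      transitivity (a + b * k - a); [ring|rewrite X1; ring]. }
    split; auto.
    assert (X2 : k * a + c + d * k = c /\ d = d).
    { apply (tindep_eq T y1 y2); auto. intros z Hz. destruct (Rel z Hz) as [_ R1]. rewrite E2 in R1 by auto.
      rewrite R1, (E2 (z + w)), (E1 (z + w)) by now apply (adm_add tau). destruct (H z Hz) as [F1 F2]. rewrite F1, F2, Eb.
      transitivity (e * e * ((k * a + c + d * k) * y1 z + d * y2 z)); [rewrite Ne; ring|ring]. }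
    destruct X2 as [X2 _].
    apply Ceq_minus, NNPP. intros Nd. apply (Cmult_neq_0 (d - - a) k); auto.
    transitivity (k * a + c + d * k - c); [ring|rewrite X2; ring]. }
  assert (Hbd : b = 0 /\ d = - a).
  { destruct Ha as [Ha|Ha].
    - apply (Key 1 e1 a1); auto using in_lattice_1.
    - apply (Key tau e2 a2); auto using in_lattice_tau. }
  destruct Hbd as [-> ->]. exists a, c. split.
  - destruct (tindep_eq T y1 y2 (a * a) 0 1 0 Hi) as [X _].
    + intros z Hz. assert (F := E1 (- z) (Hbo z Hz)). cbv beta in F. replace (- - z) with z in F by ring.
      rewrite (E1 z Hz) in F. rewrite F at 2. ring.
    + destruct (classic (a = 1)) as [|N]; [now left|right].
      apply Ceq_minus, NNPP. intros N'. apply (Cmult_neq_0 (a - 1) (a - - (1))); auto using Cminus_ne.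
      transitivity (a * a - 1); [ring|rewrite X; ring].
  - intros z Hz. rewrite (E1 z Hz), (E2 z Hz). split; ring.
Qed.

(** When [y1] and [y1'] have the same parity, the determinant [y1 y2' - y2 y1']
    is elliptic, and it becomes odd after a suitable multiple [k y1'] is added
    to [y2']. When they have opposite parities, already [y1 y1'] is elliptic
    and odd, hence zero, which is absurd. *)
Lemma unipotent_case (tau : C) (S S' : solution_space) (T T' : twisted) (y1 y2 y1' y2' : C -> C)
    (e1 e2 a1 a2 : C) (k0 : nat) :
  0 < Im tau -> presents tau S T -> presents tau S' T' ->
  basis S y1 y2 -> basis S' y1' y2' -> e1 * e1 = 1 -> e2 * e2 = 1 -> (a1 <> 0 \/ a2 <> 0) ->
  translates T 1 y1 y2 e1 0 (e1 * a1) e1 -> translates T tau y1 y2 e2 0 (e2 * a2) e2 ->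
  translates T' 1 y1' y2' e1 0 (e1 * a1) e1 -> translates T' tau y1' y2' e2 0 (e2 * a2) e2 ->
  (k0 <= 3)%nat -> (forall k, (k <= 3)%nat ->
     pairing T T' (- (omega tau k / 2)) (if Nat.eqb k k0 then -1 else 1)%Z) ->
  forall z, ~ tbad T z -> ~ tbad T' z -> tV T z = tV T' z.
Proof.
  intros Ht HP HP' HB HB' N1 N2 Ha H1 H2 H1' H2' Hk0 Hpair z0 Hz0 Hz0'.
  destruct (unipotent_reflection _ _ _ _ _ _ _ _ _ HP HB N1 N2 Ha H1 H2) as [a [c [Ea R]]].
  destruct (unipotent_reflection _ _ _ _ _ _ _ _ _ HP' HB' N1 N2 Ha H1' H2') as [a' [c' [Ea' R']]].
  assert (Hdet : forall e k : C, e * e = 1 -> e * e - 0 * (e * k) <> 0).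
  { intros e k He E. apply C1_nz. rewrite <- He. rewrite <- E. ring. }
  assert (HF : frame tau T y1 y2).
  { eapply frame_of_basis; [exact HP|exact HB|exact H1|exact H2| |]; auto. }
  assert (HF' : frame tau T' y1' y2').
  { eapply frame_of_basis; [exact HP'|exact HB'|exact H1'|exact H2'| |]; auto. }
  assert (Hi := presents_indep _ _ _ _ _ HP HB). assert (Hi' := presents_indep _ _ _ _ _ HP' HB').
  assert (BZ := fun c11 c12 c21 c22 => bilinear_zero tau T T' y1 y2 y1' y2' c11 c12 c21 c22 k0 Ht
    (pr_adm _ _ _ HP) (pr_adm _ _ _ HP') HF HF' Hk0 Hpair).
  cbv zeta in BZ.
  assert (Haa : a * a = 1) by (destruct Ea as [->| ->]; ring).
  destruct (classic (a' = a)) as [->|Ne].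
  - set (k := a * (c - c') / 2).
    apply (ratio_potential tau T T' y1 y2 y1' (fun z => k * y1' z + 1 * y2' z)); auto;
      try apply (pr_adm _ _ _ HP); try apply (pr_adm _ _ _ HP'); try apply HF; try apply HF'.
    + apply tsol_lin; apply HF'.
    + intros x y E. destruct (Hi' (x + y * k) y) as [X Y].
      * intros z Hz. rewrite <- (E z Hz). ring.
      * split; auto. rewrite Y in X. rewrite <- X. ring.
    + assert (X : forall b, locally' b (fun z => k * (y1 z * y1' z) + 1 * (y1 z * y2' z) + - (1) * (y2 z * y1' z) + 0 * (y2 z * y2' z) = 0)).
      { apply BZ.
        - intros z Z1 Z2. destruct (H1 z Z1) as [-> ->]. destruct (H1' z Z2) as [-> ->].
          transitivity (e1 * e1 * (k * (y1 z * y1' z) + 1 * (y1 z * y2' z) + - (1) * (y2 z * y1' z) + 0 * (y2 z * y2' z))); [ring|rewrite N1; ring].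
        - intros z Z1 Z2. destruct (H2 z Z1) as [-> ->]. destruct (H2' z Z2) as [-> ->].
          transitivity (e2 * e2 * (k * (y1 z * y1' z) + 1 * (y1 z * y2' z) + - (1) * (y2 z * y1' z) + 0 * (y2 z * y2' z))); [ring|rewrite N2; ring].
        - intros z Z1 Z2. destruct (R z Z1) as [-> ->]. destruct (R' z Z2) as [-> ->].
          transitivity ((a * a * k - 2 * k) * (y1 z * y1' z) - a * a * (y1 z * y2' z) + a * a * (y2 z * y1' z)).
          + unfold k. field.
          + rewrite Haa. ring. }
      intros b. generalize (X b). apply filter_imp. intros z E. apply Ceq_minus. rewrite <- E. ring.
  - exfalso.
    assert (Eaa : a' = - a).
    { destruct Ea as [->| ->], Ea' as [->| ->]; try (now destruct Ne); ring. }
    assert (X : forall b, locally' b (fun z => 1 * (y1 z * y1' z) + 0 * (y1 z * y2' z) + 0 * (y2 z * y1' z) + 0 * (y2 z * y2' z) = 0)).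
    { apply BZ.
      - intros z Z1 Z2. destruct (H1 z Z1) as [-> ->]. destruct (H1' z Z2) as [-> ->].
        transitivity (e1 * e1 * (y1 z * y1' z)); [ring|rewrite N1; ring].
      - intros z Z1 Z2. destruct (H2 z Z1) as [-> ->]. destruct (H2' z Z2) as [-> ->].
        transitivity (e2 * e2 * (y1 z * y1' z)); [ring|rewrite N2; ring].
      - intros z Z1 Z2. destruct (R z Z1) as [-> ->]. destruct (R' z Z2) as [-> ->]. rewrite Eaa.
        transitivity (- (a * a) * (y1 z * y1' z)); [ring|rewrite Haa; ring]. }
    destruct (mero_mult_zero y1 y1') as [Z|Z].
    + apply HF. + apply HF'.
    + intros b. generalize (X b). apply filter_imp. intros z E. rewrite <- E. ring.
    + apply (tindep_ne T y1 y2 Hi). apply (tsol_zero T y1 0); [apply HF|apply Z].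
    + apply (tindep_ne T' y1' y2' Hi'). apply (tsol_zero T' y1' 0); [apply HF'|apply Z].
Qed.

Lemma entry_mat2 (a b c d : C) :
  entry [[a, b], [c, d]] 0 0 = a /\ entry [[a, b], [c, d]] 0 1 = b /\
  entry [[a, b], [c, d]] 1 0 = c /\ entry [[a, b], [c, d]] 1 1 = d.
Proof. repeat split; reflexivity. Qed.

Lemma translates_of_matrix (tau : C) (S : solution_space) (T : twisted) (w : C) (y1 y2 : C -> C) (a b c d : C) :
  presents tau S T -> translation_matrix S w y1 y2 [[a, b], [c, d]] -> translates T w y1 y2 a b c d.
Proof.
  intros HP H z Hz. rewrite <- (pr_bad _ _ _ HP) in Hz. destruct (H z Hz) as [E1 E2].
  destruct (entry_mat2 a b c d) as [X1 [X2 [X3 X4]]]. rewrite X1, X2 in E1. rewrite X3, X4 in E2. auto.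
Qed.

Lemma basis_swap (S : solution_space) (y1 y2 : C -> C) : basis S y1 y2 -> basis S y2 y1.
Proof.
  intros [H1 [H2 [H3 H4]]]. repeat split; auto.
  - intros; apply (H3 b a). intros z Hz. rewrite <- (H z Hz). ring.
  - intros; apply (H3 b a). intros z Hz. rewrite <- (H z Hz). ring.
  - intros y Hy. destruct (H4 y Hy) as [a [b E]]. exists b, a. intros z Hz. rewrite E by auto. ring.
Qed.

Lemma translates_swap (T : twisted) (w : C) (y1 y2 : C -> C) (a b c d : C) :
  translates T w y1 y2 a b c d -> translates T w y2 y1 d c b a.
Proof. intros H z Hz. destruct (H z Hz) as [E1 E2]. rewrite E1, E2. split; ring. Qed.

Lemma Cexp_integer (k : Z) : Cexp (2 * PI * Ci * IZR k) = 1.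
Proof.
  assert (E : 2 * PI * Ci * IZR k = (0, 2 * IZR k * PI)%R).
  { unfold Cmult, RtoC, Ci; simpl. f_equal; ring. }
  rewrite E. unfold Cexp; simpl. rewrite exp_0.
  assert (Hs : sin (2 * IZR k * PI) = 0%R).
  { apply sin_eq_0_1. exists (2 * k)%Z. now rewrite mult_IZR. }
  assert (Hc : cos (2 * IZR k * PI) = 1%R).
  { replace (2 * IZR k * PI)%R with (2 * (IZR k * PI))%R by ring. rewrite cos_2a_sin.
    rewrite (sin_eq_0_1 (IZR k * PI)) by (now exists k). ring. }
  rewrite Hs, Hc. unfold RtoC. f_equal; ring.
Qed.

Lemma Cexp_square_1 (r : C) : Cexp (2 * PI * Ci * r) * Cexp (2 * PI * Ci * r) = 1 ->
  exists k : Z, 2 * r = IZR k.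
Proof.
  set (u := 2 * PI * Ci * r). intros H. assert (HPI := PI_RGT_0).
  assert (Hre : Re u = 0%R).
  { apply (f_equal Cmod) in H. rewrite Cmod_mult, Cmod_Cexp, Cmod_1, <- exp_plus in H.
    rewrite <- exp_0 in H. apply exp_inv in H. lra. }
  assert (Hs : sin (Im u) = 0%R).
  { destruct (classic (Cexp u = 1)) as [E|N].
    - apply (f_equal Im) in E. change (exp (Re u) * sin (Im u) = 0)%R in E. rewrite Hre, exp_0 in E. lra.
    - assert (E : Cexp u = - (1)).
      { apply Ceq_minus, NNPP. intros N'. apply (Cmult_neq_0 (Cexp u - 1) (Cexp u - - (1))); auto using Cminus_ne.
        transitivity (Cexp u * Cexp u - 1); [ring|rewrite H; ring]. }
      apply (f_equal Im) in E. change (exp (Re u) * sin (Im u) = - 0)%R in E. rewrite Hre, exp_0 in E. lra. }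
  apply sin_eq_0_0 in Hs. destruct Hs as [k Hk]. exists k.
  assert (Eu : u = RtoC (IZR k) * PI * Ci).
  { rewrite (surjective_pairing u). unfold Re, Im in *. rewrite Hre, Hk.
    unfold Cmult, RtoC, Ci; simpl. f_equal; ring. }
  assert (NP : RtoC PI <> 0) by (intros E; apply RtoC_inj in E; lra).
  unfold u in Eu. transitivity (2 * PI * Ci * r / (PI * Ci)); [field; auto using Ci_nz|].
  rewrite Eu. field. auto using Ci_nz.
Qed.

(** Equal data give bases with the same monodromy matrices: changing [(r, s)]
    by integers does not change the matrices, changing the signs exchanges the
    two basis functions, and the traces determine the signs [e1] and [e2]. *)
Lemma same_data_same_potential (tau : C) (S S' : solution_space) (T T' : twisted) (k0 : nat) :
  0 < Im tau -> presents tau S T -> presents tau S' T' ->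
  (k0 <= 3)%nat -> (forall k, (k <= 3)%nat ->
     pairing T T' (- (omega tau k / 2)) (if Nat.eqb k k0 then -1 else 1)%Z) ->
  same_global_monodromy_data tau S S' ->
  forall z, ~ tbad T z -> ~ tbad T' z -> tV T z = tV T' z.
Proof.
  intros Ht HP HP' Hk0 Hpair [d [d' [Hd [Hd' Hsame]]]].
  destruct d as [r s|tr1 tr2 c], d' as [r' s'|tr1' tr2' c']; simpl in Hsame; try contradiction.
  - destruct Hd as [_ [Hnh [y1 [y2 [HB [H1 H2]]]]]].
    destruct Hd' as [_ [_ [y1' [y2' [HB' [H1' H2']]]]]].
    unfold diag2 in *. simpl omega in *.
    apply (translates_of_matrix tau S T) in H1, H2; auto.
    apply (translates_of_matrix tau S' T') in H1', H2'; auto.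
    set (m1 := Cexp (- (2 * PI * Ci * s))) in *. set (m2 := Cexp (2 * PI * Ci * r)) in *.
    assert (N1 : m1 <> 0) by apply Cexp_ne. assert (N2 : m2 <> 0) by apply Cexp_ne.
    assert (I1 : Cexp (2 * PI * Ci * s) = / m1).
    { unfold m1. rewrite Cexp_opp. assert (N := Cexp_ne (2 * PI * Ci * s)). field. auto. }
    assert (I2 : Cexp (- (2 * PI * Ci * r)) = / m2) by apply Cexp_opp.
    rewrite I1 in H1. rewrite I2 in H2.
    assert (Hm : m1 * m1 <> 1 \/ m2 * m2 <> 1).
    { apply NNPP. intros Hno. apply Hnh.
      assert (E1 : m1 * m1 = 1) by (apply NNPP; tauto). assert (E2 : m2 * m2 = 1) by (apply NNPP; tauto).
      destruct (Cexp_square_1 r E2) as [k Hk].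
      destruct (Cexp_square_1 s) as [k' Hk'].
      - rewrite I1. transitivity (/ (m1 * m1)); [field; auto|rewrite E1; field].
      - exists k, k'. auto. }
    destruct Hsame as [a [b [[-> ->]|[-> ->]]]].
    + assert (J1 : Cexp (2 * PI * Ci * s') = / m1).
      { rewrite <- I1. replace (2 * PI * Ci * (s' + IZR b)) with (2 * PI * Ci * s' + 2 * PI * Ci * IZR b) by ring.
        rewrite Cexp_plus, Cexp_integer. ring. }
      assert (J2 : Cexp (2 * PI * Ci * r') = m2).
      { unfold m2. replace (2 * PI * Ci * (r' + IZR a)) with (2 * PI * Ci * r' + 2 * PI * Ci * IZR a) by ring.
        rewrite Cexp_plus, Cexp_integer. ring. }
      rewrite Cexp_opp, J1 in H1'. rewrite Cexp_opp, J2 in H2'.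
      replace (/ / m1) with m1 in H1' by (field; auto).
      apply (diagonal_case tau S S' T T' y1 y2 y1' y2' m1 m2 k0); auto.
    + assert (J1 : Cexp (2 * PI * Ci * s') = m1).
      { unfold m1. replace (- (2 * PI * Ci * (- s' + IZR b))) with (2 * PI * Ci * s' + 2 * PI * Ci * IZR (- b))
          by (rewrite opp_IZR, RtoC_opp; ring).
        rewrite Cexp_plus, Cexp_integer. ring. }
      assert (J2 : Cexp (2 * PI * Ci * r') = / m2).
      { rewrite <- I2. replace (- (2 * PI * Ci * (- r' + IZR a))) with (2 * PI * Ci * r' + 2 * PI * Ci * IZR (- a))
          by (rewrite opp_IZR, RtoC_opp; ring).
        rewrite Cexp_plus, Cexp_integer. ring. }
      rewrite Cexp_opp, J1 in H1'. rewrite Cexp_opp, J2 in H2'.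
      replace (/ / m2) with m2 in H2' by (field; auto).
      apply (diagonal_case tau S S' T T' y1 y2 y2' y1' m1 m2 k0); auto using basis_swap, translates_swap.
  - destruct Hsame as [<- [<- <-]].
    destruct Hd as [_ [e1 [e2 [He1 [He2 [[y1 [y2 [HB [H1 H2]]]] [Tr1 Tr2]]]]]]].
    destruct Hd' as [_ [e1' [e2' [He1' [He2' [[y1' [y2' [HB' [H1' H2']]]] [Tr1' Tr2']]]]]]].
    assert (Q1 : e1 * e1 = 1) by (destruct He1 as [->| ->]; ring).
    assert (Q2 : e2 * e2 = 1) by (destruct He2 as [->| ->]; ring).
    assert (Half : forall x y : C, x + x = y + y -> x = y).
    { intros x y E. transitivity (/ 2 * (x + x)); [field|rewrite E; field]. }
    simpl omega in *. unfold trace2 in *.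
    destruct c as [c|]; simpl fst in *; simpl snd in *; unfold scaled_unipotent in *.
    + assert (E1 : e1 = e1').
      { apply Half. rewrite Tr1 in Tr1'. exact Tr1'. }
      assert (E2 : e2 = e2').
      { apply Half. rewrite Tr2 in Tr2'. exact Tr2'. }
      subst e1' e2'.
      apply (translates_of_matrix tau S T) in H1, H2; auto.
      apply (translates_of_matrix tau S' T') in H1', H2'; auto.
      apply (unipotent_case tau S S' T T' y1 y2 y1' y2' e1 e2 1 c k0); auto.
      left. apply C1_nz.
    + assert (E1 : e1 = e1').
      { apply Half. rewrite Tr1 in Tr1'. exact Tr1'. }
      assert (E2 : e2 = e2').
      { apply Half. rewrite Tr2 in Tr2'. exact Tr2'. }
      subst e1' e2'.
      apply (translates_of_matrix tau S T) in H1, H2; auto.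
      apply (translates_of_matrix tau S' T') in H1', H2'; auto.
      apply (unipotent_case tau S S' T T' y1 y2 y1' y2' e1 e2 0 1 k0); auto.
      right. apply C1_nz.
Qed.

(** * Periodicity of wp *)

Definition square_sum (N : nat) (f : Z * Z -> C) : C :=
  Csum (map f (list_prod (Zrange N) (Zrange N))).

Lemma square_sum_box (N : nat) (f : Z * Z -> C) :
  square_sum N f = f (0, 0)%Z + Csum (map f (index_box N)).
Proof.
  unfold square_sum. change (f (0, 0)%Z + Csum (map f (index_box N))) with
    (Csum (map f ((0, 0)%Z :: index_box N))).
  apply Csum_perm, Permutation_map, NoDup_Permutation.
  - apply NoDup_list_prod; apply NoDup_Zrange.
  - constructor; [|apply NoDup_index_box]. intros H. apply in_index_box in H. now destruct H.
  - intros [m n]. simpl. rewrite in_prod_iff, !in_Zrange, in_index_box. unfold supnorm; simpl.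
    destruct (classic ((0, 0)%Z = (m, n))) as [E|E].
    + injection E as <- <-. split; [now left|lia].
    + split; [intros; right; split; [congruence|lia]|]. intros [|[_ ?]]; [tauto|lia].
Qed.

Lemma Csum_map_minus {A : Type} (f g : A -> C) (l : list A) :
  Csum (map (fun x => f x - g x) l) = Csum (map f l) - Csum (map g l).
Proof. unfold Csum. induction l as [|x l IH]; simpl; [ring|]. rewrite IH. ring. Qed.

Lemma Csum_list_prod {A B : Type} (f : A * B -> C) (l : list A) (l' : list B) :
  Csum (map f (list_prod l l')) = Csum (map (fun x => Csum (map (fun y => f (x, y)) l')) l).
Proof.
  induction l as [|x l IH]; simpl; auto.
  rewrite map_app, Csum_app, IH, map_map. reflexivity.
Qed.

Lemma Csum_exchange {A B : Type} (f : A -> B -> C) (l : list A) (l' : list B) :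
  Csum (map (fun x => Csum (map (f x) l')) l) = Csum (map (fun y => Csum (map (fun x => f x y) l)) l').
Proof.
  unfold Csum. induction l as [|x l IH]; simpl.
  - induction l' as [|y l' IH']; simpl; auto. rewrite <- IH'. ring.
  - rewrite IH. clear IH. induction l' as [|y l' IH']; simpl; [ring|]. rewrite <- IH'. ring.
Qed.

Lemma Csum_telescope (g : Z -> C) (N : nat) :
  Csum (map (fun m => g (m - 1)%Z - g m) (Zrange N)) = g (- Z.of_nat N - 1)%Z - g (Z.of_nat N).
Proof.
  unfold Zrange. rewrite map_map.
  assert (H : forall k a, Csum (map (fun i => g (Z.of_nat i - Z.of_nat N - 1)%Z - g (Z.of_nat i - Z.of_nat N)%Z) (seq a k))
     = g (Z.of_nat a - Z.of_nat N - 1)%Z - g (Z.of_nat (a + k) - Z.of_nat N - 1)%Z).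
  { induction k as [|k IH]; intros a; simpl.
    - rewrite Nat.add_0_r. ring.
    - unfold Csum in *. simpl. rewrite IH.
      replace (Z.of_nat (S a) - Z.of_nat N - 1)%Z with (Z.of_nat a - Z.of_nat N)%Z by lia.
      replace (Z.of_nat (S a + k) - Z.of_nat N - 1)%Z with (Z.of_nat (a + S k) - Z.of_nat N - 1)%Z by lia. ring. }
  rewrite H.
  replace (Z.of_nat 0 - Z.of_nat N - 1)%Z with (- Z.of_nat N - 1)%Z by lia.
  replace (Z.of_nat (0 + (2 * N + 1)) - Z.of_nat N - 1)%Z with (Z.of_nat N) by lia.
  reflexivity.
Qed.

(** There are [2 N + 1] points on the line, at distance at least [c N] from the
    origin. *)
Lemma far_line_small (tau z : C) (c : R) (line : nat -> Z -> Z * Z) : lattice_lower tau c ->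
  (forall N m, (Z.of_nat N <= supnorm (line N m))%Z) ->
  cconv (fun N => Csum (map (fun m => 1 / (z - lattice_point tau (line N m)) ^ 2) (Zrange N))) 0.
Proof.
  intros [Hc Hl] Hline e He. assert (Hz := Cmod_ge_0 z).
  destruct (archimed (2 * Cmod z / c + 12 / (c * c * e) + 1)%R) as [Hup _].
  assert (Q1 : 0 <= 2 * Cmod z / c) by (apply Rmult_le_pos; [lra|now apply Rlt_le, Rinv_0_lt_compat]).
  assert (Hcc : 0 < c * c) by now apply Rmult_lt_0_compat.
  assert (Q2 : 0 < 12 / (c * c * e)).
  { apply Rdiv_lt_0_compat; [lra|]. now apply Rmult_lt_0_compat. }
  set (N0 := Z.to_nat (up (2 * Cmod z / c + 12 / (c * c * e) + 1))).
  exists N0. intros N HN.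
  assert (HNR : 2 * Cmod z / c + 12 / (c * c * e) + 1 < INR N).
  { apply Rlt_le_trans with (INR N0); [|now apply le_INR].
    unfold N0. rewrite INR_IZR_INZ, Z2Nat.id; [lra|]. apply le_IZR. lra. }
  set (x := INR N) in *.
  assert (Hx1 : 2 * Cmod z < c * x).
  { apply Rle_lt_trans with (c * (2 * Cmod z / c))%R; [right; field; lra|].
    apply Rmult_lt_compat_l; lra. }
  assert (Hx2 : 12 / (c * c) < e * x).
  { apply Rle_lt_trans with (e * (12 / (c * c * e)))%R; [right; field; lra|].
    apply Rmult_lt_compat_l; lra. }
  set (h := fun m => 1 / (z - lattice_point tau (line N m)) ^ 2).
  replace (Csum (map h (Zrange N)) - 0) with (Csum (map h (Zrange N))) by ring.
  eapply Rle_lt_trans.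
  - assert (Hb : forall l, Cmod (Csum (map h l)) <= INR (length l) * (4 / (c * x * (c * x)))).
    { induction l as [|m l IH]; [simpl; rewrite Cmod_0; lra|].
      change (length (m :: l)) with (S (length l)). rewrite S_INR.
      change (Csum (map h (m :: l))) with (h m + Csum (map h l)). unfold h at 1.
      eapply Rle_trans; [apply Cmod_triangle|].
      set (w := lattice_point tau (line N m)).
      assert (Hw : c * x <= Cmod w).
      { eapply Rle_trans; [|apply Hl]. apply Rmult_le_compat_l; [lra|].
        unfold x. rewrite INR_IZR_INZ. apply IZR_le, Hline. }
      assert (Hzw : c * x / 2 <= Cmod (z - w)).
      { assert (X := Cmod_rev w z). rewrite Cmod_minus_sym in X. lra. }
      assert (Nzw : z - w <> 0) by (apply Cmod_gt_0; lra).
      assert (Hterm : Cmod (1 / (z - w) ^ 2)%C <= 4 / (c * x * (c * x))).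
      { rewrite Cmod_div, Cmod_1, Cmod_pow by now apply Cpow_nz.
        replace (4 / (c * x * (c * x)))%R with (1 / ((c * x / 2) ^ 2))%R by (simpl; field; lra).
        unfold Rdiv. rewrite !Rmult_1_l. apply Rinv_le_contravar; [apply pow_lt; lra|].
        apply pow_incr. lra. }
      lra. }
    apply Hb.
  - rewrite length_Zrange, plus_INR, mult_INR. fold x. simpl INR.
    assert (Hx : 1 < x) by lra.
    apply Rle_lt_trans with (12 / (c * c) / x)%R.
    + apply Rle_trans with (3 * x * (4 / (c * x * (c * x))))%R.
      * apply Rmult_le_compat_r; [|lra]. apply Rlt_le, Rdiv_lt_0_compat; [lra|nra].
      * right. field. lra.
    + apply Rmult_lt_reg_r with x; [lra|].
      replace (12 / (c * c) / x * x)%R with (12 / (c * c))%R by (field; lra). lra.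
Qed.

(** The terms [1 / w ^ 2] of the series do not depend on [z]. They are
    collected in [K], and cancel when two values of [wp] are compared. *)
Lemma wp_square_sum (tau : C) : 0 < Im tau ->
  exists K : nat -> C, forall z, ~ nzlat tau z ->
    cconv (fun N => square_sum N (fun mn => 1 / (z - lattice_point tau mn) ^ 2) - K N) (wp tau z).
Proof.
  intros Ht. exists (fun N => Csum (map (fun w => 1 / w ^ 2) (lattice_box tau N))).
  intros z' Hz'. destruct (away_near tau z' Ht Hz') as [c [c1 [d [Hc [H1 [Hd H]]]]]].
  set (R0 := (Cmod z' + 1)%R) in *. assert (HR : 0 < R0) by (unfold R0; assert (X := Cmod_ge_0 z'); lra).
  assert (Hc1 := proj1 H1).
  assert (K2 : 0 <= R0 * (2 + R0 / c1) / (c * c)).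
  { apply Rmult_le_pos.
    - apply Rmult_le_pos; [lra|]. assert (0 < R0 / c1)%R by now apply Rdiv_lt_0_compat. lra.
    - apply Rlt_le, Rinv_0_lt_compat. nra. }
  assert (Haw : away tau c R0 z').
  { apply H. replace (z' - z') with (RtoC 0) by ring. now rewrite Cmod_0. }
  destruct (lattice_sum_conv tau c1 _ (wp_term z') H1 K2 (wp_term_cubic tau z' c c1 R0 Hc H1 Haw)) as [L _].
  assert (L' := cconv_plus _ _ _ _ (cconv_const (1 / z' ^ 2)) L).
  intros e He. destruct (L' e He) as [N0 HN]. exists N0. intros N HNN. specialize (HN N HNN).
  change (wp tau z') with (1 / z' ^ 2 + lattice_sum tau (wp_term z')).
  rewrite square_sum_box.
  assert (E : Csum (map (fun mn => 1 / (z' - lattice_point tau mn) ^ 2) (index_box N))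
     = Csum (map (fun w => 1 / (z' - w) ^ 2) (lattice_box tau N))).
  { unfold lattice_box. fold (index_box N). now rewrite map_map. }
  rewrite E. clear E.
  replace (lattice_point tau (0, 0)%Z) with (RtoC 0) by (unfold lattice_point; simpl; ring).
  replace (z' - 0) with z' by ring.
  unfold wp_term in HN at 1. rewrite Csum_map_minus in HN.
  match type of HN with (Cmod ?x < _)%R => match goal with |- (Cmod ?y < _)%R => replace y with x by ring end end.
  exact HN.
Qed.

(** Translating the square by a generator of the lattice changes its sum by the
    sums over two opposite sides, which tend to 0. *)
Lemma wp_periodic_gen (tau z : C) : 0 < Im tau -> ~ in_lattice tau z ->
  wp tau (z + 1) = wp tau z /\ wp tau (z + tau) = wp tau z.
Proof.
  intros Ht Hz. destruct (not_in_lattice_split _ _ Hz) as [_ Hn].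
  destruct (wp_square_sum tau Ht) as [K HK].
  destruct (lattice_lower_ex tau Ht) as [c Hc].
  assert (Gen : forall w, in_lattice tau w ->
     cconv (fun N => square_sum N (fun mn => 1 / (z - (lattice_point tau mn - w)) ^ 2)
        - square_sum N (fun mn => 1 / (z - lattice_point tau mn) ^ 2)) 0 ->
     wp tau (z + w) = wp tau z).
  { intros w Hw Hlim.
    assert (Hzw : ~ nzlat tau (z + w)).
    { intros X. apply Hz. replace z with (z + w - w) by ring. apply in_lattice_minus; auto.
      apply in_lattice_cases. now right. }
    assert (L := cconv_plus _ _ _ _ Hlim (HK z Hn)).
    rewrite Cplus_0_l in L. eapply cconv_unique; [|exact L].
    intros e He. destruct (HK (z + w) Hzw e He) as [N0 HN]. exists N0. intros N HNN.
    specialize (HN N HNN).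
    replace (square_sum N (fun mn => 1 / (z + w - lattice_point tau mn) ^ 2))
      with (square_sum N (fun mn => 1 / (z - (lattice_point tau mn - w)) ^ 2)) in HN.
    - match type of HN with (Cmod ?x < _)%R => match goal with |- (Cmod ?y < _)%R => replace y with x by ring end end.
      exact HN.
    - unfold square_sum. f_equal. apply map_ext. intros mn. do 2 f_equal. ring. }
  set (h := fun mn => 1 / (z - lattice_point tau mn) ^ 2).
  split; apply Gen; auto using in_lattice_1, in_lattice_tau.
  - assert (E : forall N, square_sum N (fun mn => 1 / (z - (lattice_point tau mn - 1)) ^ 2) - square_sum N h
       = Csum (map (fun n => h (- Z.of_nat N - 1, n)%Z) (Zrange N))
         - Csum (map (fun n => h (Z.of_nat N, n)) (Zrange N))).
    { intros N. unfold square_sum. rewrite <- Csum_map_minus, Csum_list_prod, Csum_exchange, <- Csum_map_minus.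
      f_equal. apply map_ext. intros n. rewrite <- (Csum_telescope (fun m => h (m, n))).
      f_equal. apply map_ext. intros m. unfold h, lattice_point; cbn [fst snd].
      rewrite minus_IZR, RtoC_minus. do 3 f_equal. ring. }
    assert (L1 := far_line_small tau z c (fun N n => (- Z.of_nat N - 1, n)%Z) Hc).
    assert (L2 := far_line_small tau z c (fun N n => (Z.of_nat N, n)) Hc).
    assert (L := cconv_plus _ _ _ _ (L1 ltac:(intros; unfold supnorm; simpl; lia))
      (cconv_mult _ _ _ _ (cconv_const (-1)) (L2 ltac:(intros; unfold supnorm; simpl; lia)))).
    intros e He. destruct (L e He) as [N0 HN]. exists N0. intros N HNN. specialize (HN N HNN).
    fold h. rewrite E.
    match type of HN with (Cmod ?x < _)%R => match goal with |- (Cmod ?y < _)%R => replace y with x by (unfold h; ring) end end.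
    exact HN.
  - assert (E : forall N, square_sum N (fun mn => 1 / (z - (lattice_point tau mn - tau)) ^ 2) - square_sum N h
       = Csum (map (fun m => h (m, - Z.of_nat N - 1)%Z) (Zrange N))
         - Csum (map (fun m => h (m, Z.of_nat N)) (Zrange N))).
    { intros N. unfold square_sum. rewrite <- Csum_map_minus, Csum_list_prod, <- Csum_map_minus.
      f_equal. apply map_ext. intros m. rewrite <- (Csum_telescope (fun n => h (m, n))).
      f_equal. apply map_ext. intros n. unfold h, lattice_point; cbn [fst snd].
      rewrite minus_IZR, RtoC_minus. do 3 f_equal. ring. }
    assert (L1 := far_line_small tau z c (fun N m => (m, - Z.of_nat N - 1)%Z) Hc).
    assert (L2 := far_line_small tau z c (fun N m => (m, Z.of_nat N)) Hc).
    assert (L := cconv_plus _ _ _ _ (L1 ltac:(intros; unfold supnorm; simpl; lia))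
      (cconv_mult _ _ _ _ (cconv_const (-1)) (L2 ltac:(intros; unfold supnorm; simpl; lia)))).
    intros e He. destruct (L e He) as [N0 HN]. exists N0. intros N HNN. specialize (HN N HNN).
    fold h. rewrite E.
    match type of HN with (Cmod ?x < _)%R => match goal with |- (Cmod ?y < _)%R => replace y with x by (unfold h; ring) end end.
    exact HN.
Qed.

(** As [wp] is even, the two arguments matter only up to the period [omega_k].
    *)
Lemma wp_omega_reflect (tau z : C) (k : nat) : 0 < Im tau -> ~ two_torsion tau z ->
  wp tau (- z + omega tau k / 2) = wp tau (z + omega tau k / 2).
Proof.
  intros Ht Hz.
  assert (N : forall k, ~ in_lattice tau (z + omega tau k / 2) /\ ~ in_lattice tau (z - omega tau k / 2)).
  { intros j. split; intros H; apply Hz; unfold two_torsion.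
    - replace (2 * z) with ((z + omega tau j / 2) + (z + omega tau j / 2) - omega tau j) by field.
      apply in_lattice_minus; [apply in_lattice_plus; auto|apply omega_in_lattice].
    - replace (2 * z) with ((z - omega tau j / 2) + (z - omega tau j / 2) + omega tau j) by field.
      apply in_lattice_plus; [apply in_lattice_plus; auto|apply omega_in_lattice]. }
  replace (- z + omega tau k / 2) with (- (z - omega tau k / 2)) by ring. rewrite wp_even.
  replace (z + omega tau k / 2) with (z - omega tau k / 2 + omega tau k) by field.
  destruct (N k) as [_ Nk]. set (u := z - omega tau k / 2) in *.
  destruct k as [|[|[|k]]]; simpl omega; symmetry.
  - f_equal. ring.
  - now apply wp_periodic_gen.
  - now apply wp_periodic_gen.
  - rewrite Cplus_assoc. transitivity (wp tau (u + 1)); [|now apply wp_periodic_gen].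
    apply wp_periodic_gen; auto. intros H. apply Nk. replace u with (u + 1 - 1) by ring.
    apply in_lattice_minus; auto using in_lattice_1.
Qed.

(** * Local exponents *)

Lemma clim_at_shift (f : C -> C) (a b l : C) : clim f (a + b) l -> clim (fun z => f (z + b)) a l.
Proof.
  intros H. apply clim_ext with (fun z => f (1 * z + b)).
  - apply filter_forall. intros z. f_equal. ring.
  - apply clim_comp_affine; [apply C1_nz|]. now replace (1 * a + b) with (a + b) by ring.
Qed.

(** The shifted functions are examined where they have a pole, [a + b = 0], and
    where they have none; these limits are the coefficients of the indicial
    equations. *)
Lemma wp_shift_pole (tau a b : C) : 0 < Im tau -> a + b = 0 ->
  clim (fun z => (z - a) ^ 2 * wp tau (z + b)) a 1.
Proof.
  intros Ht E. apply clim_ext with (fun z => (fun u => u ^ 2 * wp tau u) (z + b)).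
  - apply filter_forall. intros z. cbv beta. f_equal. f_equal.
    replace b with (- a) by (transitivity (- a + (a + b)); [rewrite E; ring|ring]). ring.
  - apply (clim_at_shift (fun u => u ^ 2 * wp tau u)). rewrite E. now apply wp_pole.
Qed.

Lemma wp_shift_regular (tau a b : C) : 0 < Im tau -> ~ in_lattice tau (a + b) ->
  clim (fun z => (z - a) ^ 2 * wp tau (z + b)) a 0.
Proof.
  intros Ht H. apply (clim_pow_bounded (fun z => wp tau (z + b))); [lia|].
  apply bounded_near_shift. now apply wzeta_wp_bounded.
Qed.

Lemma wzeta_shift_pole (tau a b : C) : 0 < Im tau -> a + b = 0 ->
  clim (fun z => (z - a) * wzeta tau (z + b)) a 1.
Proof.
  intros Ht E. apply clim_ext with (fun z => (fun u => u * wzeta tau u) (z + b)).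
  - apply filter_forall. intros z. cbv beta. f_equal.
    replace b with (- a) by (transitivity (- a + (a + b)); [rewrite E; ring|ring]). ring.
  - apply (clim_at_shift (fun u => u * wzeta tau u)). rewrite E. now apply wzeta_pole.
Qed.

Lemma wzeta_shift_regular (tau a b : C) : 0 < Im tau -> ~ in_lattice tau (a + b) ->
  clim (fun z => (z - a) * wzeta tau (z + b)) a 0.
Proof.
  intros Ht H. apply clim_ext with (fun z => (z - a) ^ 1 * wzeta tau (z + b)).
  - apply filter_forall. intros z. now rewrite Cpow_1_r.
  - apply (clim_pow_bounded (fun z => wzeta tau (z + b))); [lia|].
    apply bounded_near_shift. now apply wzeta_wp_bounded.
Qed.

Lemma clim_id_minus (a : C) : clim (fun z => z - a) a 0.
Proof. eapply clim_eq; [apply clim_minus; [apply clim_id|apply clim_const]|ring]. Qed.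

Lemma wzeta_shift_second (tau a b : C) : 0 < Im tau -> a + b = 0 \/ ~ in_lattice tau (a + b) ->
  clim (fun z => (z - a) ^ 2 * wzeta tau (z + b)) a 0.
Proof.
  intros Ht H.
  assert (X : exists l, clim (fun z => (z - a) * wzeta tau (z + b)) a l).
  { destruct H as [H|H]; [exists 1; now apply wzeta_shift_pole|exists 0; now apply wzeta_shift_regular]. }
  destruct X as [l Hl].
  apply clim_ext with (fun z => (z - a) * ((z - a) * wzeta tau (z + b))).
  { apply filter_forall. intros z. simpl. ring. }
  eapply clim_eq; [apply clim_mult; [apply clim_id_minus|exact Hl]|ring].
Qed.

Lemma clim_square_const (a k : C) : clim (fun z => (z - a) ^ 2 * k) a 0.
Proof.
  apply clim_ext with (fun z => (z - a) * (z - a) * k).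
  { apply filter_forall. intros z. simpl. ring. }
  eapply clim_eq; [apply clim_mult; [apply clim_mult; apply clim_id_minus|apply clim_const]|ring].
Qed.

(** Leading coefficient at [a] of the Darboux--Treibich--Verdier part of the
    potential. *)
Lemma Csum4_lim (tau a : C) (n : nat -> nat) (L : nat -> C) :
  (forall j, (j <= 3)%nat -> clim (fun z => (z - a) ^ 2 * wp tau (z + omega tau j / 2)) a (L j)) ->
  clim (fun z => (z - a) ^ 2 * Csum4 (fun k => coef n k * wp tau (z + omega tau k / 2))) a
    (Csum4 (fun k => coef n k * L k)).
Proof.
  intros H.
  apply clim_ext with (fun z => Csum4 (fun k => coef n k * ((z - a) ^ 2 * wp tau (z + omega tau k / 2)))).
  { apply filter_forall. intros z. unfold Csum4. ring. }
  unfold Csum4. repeat apply clim_plus; apply (clim_mult (fun _ => RtoC _)); try apply clim_const; apply H; lia.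
Qed.

Lemma half_periods_distinct (tau : C) (j k : nat) : 0 < Im tau -> (j <= 3)%nat -> (k <= 3)%nat ->
  j <> k -> ~ in_lattice tau (- (omega tau k / 2) + omega tau j / 2).
Proof.
  intros Ht Hj Hk Hne H.
  assert (Co : forall i, (i <= 3)%nat -> exists p q : R,
     ((p = 0 \/ p = 1) /\ (q = 0 \/ q = 1) /\ INR i = p + 2 * q)%R /\ omega tau i = RtoC p + RtoC q * tau).
  { intros i Hi. destruct i as [|[|[|[|i]]]]; [exists 0%R, 0%R|exists 1%R, 0%R|exists 0%R, 1%R|exists 1%R, 1%R|lia];
      (split; [simpl; repeat split; try lra; auto|simpl; ring]). }
  destruct (Co j Hj) as [p [q [[Hp [Hq Ej]] Oj]]], (Co k Hk) as [p' [q' [[Hp' [Hq' Ek]] Ok]]].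
  rewrite Oj, Ok in H.
  replace (- ((RtoC p' + RtoC q' * tau) / 2) + (RtoC p + RtoC q * tau) / 2)
    with (RtoC ((p - p') / 2) + RtoC ((q - q') / 2) * tau) in H.
  2:{ rewrite !RtoC_div, !RtoC_minus by lra. field. }
  apply lattice_coords in H; auto. destruct H as [m [n [Em En]]].
  assert (Hi : forall x y (m : Z), (x = 0 \/ x = 1)%R -> (y = 0 \/ y = 1)%R -> ((x - y) / 2)%R = IZR m -> x = y).
  { intros x y i [->| ->] [->| ->] E; auto; exfalso.
    - apply (half_not_integer (- i)). rewrite opp_IZR. lra.
    - apply (half_not_integer i). lra. }
  apply Hi in Em; auto. apply Hi in En; auto. subst p' q'. apply Hne, INR_eq. lra.
Qed.

Lemma two_torsion_shift (tau a : C) (j : nat) : in_lattice tau (a + omega tau j / 2) -> two_torsion tau a.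
Proof.
  intros H. unfold two_torsion.
  replace (2 * a) with ((a + omega tau j / 2) + (a + omega tau j / 2) - omega tau j) by field.
  apply in_lattice_minus; [apply in_lattice_plus; auto|apply omega_in_lattice].
Qed.

Lemma Csum4_lim_regular (tau a : C) (n : nat -> nat) : 0 < Im tau -> ~ two_torsion tau a ->
  clim (fun z => (z - a) ^ 2 * Csum4 (fun k => coef n k * wp tau (z + omega tau k / 2))) a 0.
Proof.
  intros Ht Ha. eapply clim_eq; [apply (Csum4_lim tau a n (fun _ => 0))|unfold Csum4; ring].
  intros j Hj. apply wp_shift_regular; auto. intros H. apply Ha. now apply two_torsion_shift with j.
Qed.

Lemma Csum4_lim_half_period (tau : C) (n : nat -> nat) (k : nat) : 0 < Im tau -> (k <= 3)%nat ->
  let a := - (omega tau k / 2) in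
  clim (fun z => (z - a) ^ 2 * Csum4 (fun k => coef n k * wp tau (z + omega tau k / 2))) a (coef n k).
Proof.
  intros Ht Hk a.
  eapply clim_eq; [apply (Csum4_lim tau a n (fun j => if Nat.eqb j k then 1 else 0))|].
  - intros j Hj. destruct (Nat.eqb_spec j k) as [->|Hne].
    + apply wp_shift_pole; auto. unfold a. ring.
    + apply wp_shift_regular; auto. now apply half_periods_distinct.
  - unfold Csum4. destruct k as [|[|[|[|k]]]]; simpl; try ring. lia.
Qed.

Lemma coef_Z (n : nat -> nat) (k : nat) :
  coef n k = RtoC (IZR (Z.of_nat (n k) * (Z.of_nat (n k) + 1))) :> C.
Proof.
  unfold coef. rewrite INR_IZR_INZ. do 2 f_equal. lia.
Qed.

Lemma IZR_C_eq0 (m : Z) : RtoC (IZR m) = 0 -> m = 0%Z.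
Proof. intros H. apply RtoC_inj in H. now apply eq_IZR. Qed.

(** The indicial polynomial is [m ^ 2 + (l0 - 1) * m + i0], so integers with
    the right sum and product are its roots. *)
Lemma indicial_exponents (T : twisted) (q : C) (l0 i0 e1 e2 : Z) (lam mu iota : C) :
  clim (fun z => (z - q) * tl T z) q lam ->
  clim (fun z => (z - q) ^ 2 * tdl T z) q mu ->
  clim (fun z => (z - q) ^ 2 * tV T z) q iota ->
  2 * lam = IZR l0 -> mu + lam * lam - iota = IZR i0 ->
  (e1 + e2 = 1 - l0)%Z -> (e1 * e2 = i0)%Z -> exponents T q e1 e2.
Proof.
  intros Hl Hm Hi El Ei S P y m [_ Hy] O.
  assert (E := indicial T y q m lam mu iota O Hy Hl Hm Hi).
  assert (X : ((m - e1) * (m - e2) = 0)%Z).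
  { apply IZR_C_eq0. rewrite <- E.
    replace ((m - e1) * (m - e2))%Z with (m * (m - 1) + l0 * m + i0)%Z by nia.
    rewrite !plus_IZR, !mult_IZR, minus_IZR, !RtoC_plus, !RtoC_mult, RtoC_minus, <- El, <- Ei. ring. }
  apply Z.mul_eq_0 in X. lia.
Qed.

Lemma exponents_ord_ge (T : twisted) (q : C) (e1 e2 d : Z) (y : C -> C) :
  exponents T q e1 e2 -> (d <= e1)%Z -> (d <= e2)%Z -> local_sol T q y -> ord_ge y q d.
Proof.
  intros H D1 D2 Hy. destruct (proj1 Hy) as [m0 O].
  destruct (ord_dichotomy _ _ _ O) as [Z|[m [_ Om]]]; [now apply ord_ge_zero|].
  apply ord_ge_mono with m; [|now apply ord_eq_ge]. destruct (H y m Hy Om); lia.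
Qed.

Lemma two_torsion_discrete (tau a : C) : 0 < Im tau -> locally' a (fun z => ~ two_torsion tau z).
Proof.
  intros Ht. assert (N2 : RtoC 2 <> 0) by (intros E; apply RtoC_inj in E; lra).
  assert (H := lattice_discrete tau (2 * a + 0) Ht).
  apply (locally'_comp_affine _ a 0 2 N2) in H. revert H. apply filter_imp.
  intros z. unfold two_torsion. now rewrite Cplus_0_r.
Qed.

Lemma two_torsion_opp (tau z : C) : two_torsion tau (- z) -> two_torsion tau z.
Proof.
  unfold two_torsion. intros H. replace (2 * z) with (- (2 * - z)) by ring. now apply in_lattice_opp.
Qed.

Lemma two_torsion_add (tau z w : C) : in_lattice tau w -> two_torsion tau (z + w) -> two_torsion tau z.
Proof.
  unfold two_torsion. intros Hw H. replace (2 * z) with (2 * (z + w) - (w + w)) by ring.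
  apply in_lattice_minus; auto. now apply in_lattice_plus.
Qed.

Lemma lattice_two_torsion (tau z : C) : in_lattice tau z -> two_torsion tau z.
Proof. intros H. unfold two_torsion. replace (2 * z) with (z + z) by ring. now apply in_lattice_plus. Qed.

(** * The equation without apparent singularities *)

Definition Heun_twisted (n : nat -> nat) (B tau : C) : twisted := {|
  tbad := two_torsion tau; tl := fun _ => 0; tdl := fun _ => 0;
  tV := potential (Heun n B tau) |}.

Lemma potential_Heun_even (n : nat -> nat) (B tau z : C) : 0 < Im tau -> ~ two_torsion tau z ->
  potential (Heun n B tau) (- z) = potential (Heun n B tau) z.
Proof. intros Ht Hz. simpl. unfold Csum4. now rewrite !wp_omega_reflect. Qed.

Lemma Heun_exponents_regular (n : nat -> nat) (B tau a : C) : 0 < Im tau -> ~ two_torsion tau a ->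
  exponents (Heun_twisted n B tau) a 0 1.
Proof.
  intros Ht Ha. apply (indicial_exponents _ _ 0 0 0 1 0 0 0); try lia; simpl.
  - eapply clim_eq; [apply clim_mult; [apply clim_id_minus|apply clim_const]|ring].
  - apply clim_square_const.
  - eapply clim_ext; [|eapply clim_eq; [apply clim_plus; [apply (Csum4_lim_regular tau a n Ht Ha)|apply (clim_square_const a B)]|ring]].
    apply filter_forall. intros z. simpl. ring.
  - ring.
  - ring.
Qed.

Lemma Heun_exponents_half (n : nat -> nat) (B tau : C) (k : nat) : 0 < Im tau -> (k <= 3)%nat ->
  exponents (Heun_twisted n B tau) (- (omega tau k / 2)) (- Z.of_nat (n k)) (Z.of_nat (n k) + 1).
Proof.
  intros Ht Hk. set (a := - (omega tau k / 2)).
  apply (indicial_exponents _ _ 0 (- (Z.of_nat (n k) * (Z.of_nat (n k) + 1))) _ _ 0 0 (coef n k)); try lia; simpl.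
  - eapply clim_eq; [apply clim_mult; [apply clim_id_minus|apply clim_const]|ring].
  - apply clim_square_const.
  - eapply clim_ext; [|eapply clim_eq; [apply clim_plus; [apply (Csum4_lim_half_period tau n k Ht Hk)|apply (clim_square_const a B)]|ring]].
    apply filter_forall. intros z. unfold a. simpl. ring.
  - ring.
  - rewrite coef_Z, opp_IZR, RtoC_opp. ring.
Qed.

Lemma Heun_admissible (n : nat -> nat) (B tau : C) : 0 < Im tau -> admissible tau (Heun_twisted n B tau).
Proof.
  intros Ht. constructor; simpl.
  - intros a. now apply two_torsion_discrete.
  - intros z Hz H. now apply Hz, two_torsion_opp.
  - intros z w Hw Hz H. now apply Hz, two_torsion_add with w.
  - intros a Ha. exists 0. split; [apply in_lattice_0|]. intros y Hy. rewrite Cplus_0_r in *.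
    apply (exponents_ord_ge _ _ 0 1 0 y (Heun_exponents_regular n B tau a Ht Ha)); auto; lia.
  - intros z Hz. now apply Heun_exponents_regular.
  - intros z _. apply Cderive_const.
Qed.

Lemma meromorphic_opp (f : C -> C) : meromorphic f -> meromorphic (fun z => f (- z)).
Proof.
  intros H a. destruct (H (- a)) as [N [g [Hg E]]].
  assert (Nm : (-1 : C) <> 0) by (intros X; apply RtoC_inj in X; lra).
  exists N, (fun z => (-1) ^ N * g (-1 * z + 0)). split.
  - replace (- a) with (-1 * a + 0) in Hg by ring.
    apply (locally_comp_affine _ a 0 (-1) Nm) in Hg. revert Hg. apply filter_imp.
    intros z [l Hl]. eexists. apply Cderive_scal. apply Cderive_comp_affine. exact Hl.
  - replace (- a) with (-1 * a + 0) in E at 1 by ring.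
    apply (locally'_comp_affine _ a 0 (-1) Nm) in E.
    generalize (filter_and _ _ E (locally'_ne a)). apply filter_imp. intros z [Ez Hz].
    replace (-1 * z + 0) with (- z) in Ez by ring. rewrite Ez.
    replace (-1 * z + 0) with (- z) by ring.
    replace (- z - - a) with (-1 * (z - a)) by ring. rewrite Cpow_mult_l.
    assert (Np := Cpow_nz _ N (Cminus_ne _ _ Hz)). assert (Nq := Cpow_nz (-1) N Nm).
    assert (E1 : (-1) ^ N * (-1) ^ N = 1).
    { rewrite <- Cpow_mult_l. replace (-1 * -1) with (RtoC 1) by ring. apply Cpow_1_l. }
    transitivity ((-1) ^ N * (-1) ^ N * g (- z) / ((-1) ^ N * (z - a) ^ N)); [rewrite E1; field; auto|].
    field. auto.
Qed.

Lemma Cderive_comp_opp (f : C -> C) (z l : C) : Cderive_at f (- z) l ->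
  Cderive_at (fun z => f (- z)) z (- l).
Proof.
  intros H. apply Cderive_ext with (fun z => f (-1 * z + 0)).
  { apply filter_forall. intros w. f_equal. ring. }
  eapply Cderive_eq; [apply Cderive_comp_affine|].
  - replace (-1 * z + 0) with (- z) by ring. exact H.
  - ring.
Qed.

Lemma tsol_intro (tau : C) (T : twisted) (y : C -> C) : admissible tau T -> meromorphic y ->
  (forall z, ~ tbad T z -> tsolves T z y) -> tsol T y.
Proof.
  intros HA Hm Hs. split; auto. apply meromorphic_mero; auto. intros a.
  generalize (adm_disc _ _ HA a). apply filter_imp. intros z Hz.
  exact (hol_at _ _ (tsolves_hol _ _ _ (Hs z Hz))).
Qed.

Lemma Heun_presents (n : nat -> nat) (B tau : C) : 0 < Im tau ->
  presents tau (Heun_space n B tau) (Heun_twisted n B tau).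
Proof.
  intros Ht. assert (HA := Heun_admissible n B tau Ht). constructor; auto.
  - intros z. simpl. tauto.
  - intros y [Hm [dy Hy]]. apply (tsol_intro tau); auto. intros z Hz. exists dy.
    assert (Hn : locally z (fun z => ~ two_torsion tau z)).
    { apply locally'_center; auto. now apply two_torsion_discrete. }
    revert Hn. apply filter_imp. intros w Hw. destruct (Hy w Hw) as [D1 D2]. split; auto.
    eapply Cderive_eq; [exact D2|]. simpl. ring.
  - intros y [Hm [dy Hy]]. split; [now apply meromorphic_opp|].
    exists (fun z => - dy (- z)). intros z Hz.
    assert (Hz' : ~ two_torsion tau (- z)) by (intros X; now apply Hz, two_torsion_opp).
    destruct (Hy (- z) Hz') as [D1 D2]. split.
    + now apply Cderive_comp_opp.
    + eapply Cderive_eq; [apply Cderive_opp, Cderive_comp_opp, D2|].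
      rewrite potential_Heun_even by auto. ring.
Qed.

(** * The equation with apparent singularities *)

(** A solution is [Psi_p] times a single-valued function; [tl] is the
    logarithmic derivative of [Psi_p]. *)
Definition GLE_twisted (n : nat -> nat) (p A tau : C) : twisted := {|
  tbad := singular (GLE n p A tau);
  tl := fun z => wzeta tau z - / 2 * (wzeta tau (z + p) + wzeta tau (z - p));
  tdl := fun z => - wp tau z + / 2 * (wp tau (z + p) + wp tau (z - p));
  tV := potential (GLE n p A tau) |}.

Lemma potential_GLE_even (n : nat -> nat) (p A tau z : C) : 0 < Im tau -> ~ two_torsion tau z ->
  potential (GLE n p A tau) (- z) = potential (GLE n p A tau) z.
Proof.
  intros Ht Hz. simpl. unfold Csum4. rewrite !wp_omega_reflect by auto.
  replace (- z + p) with (- (z - p)) by ring. replace (- z - p) with (- (z + p)) by ring.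
  rewrite !wp_even, !wzeta_odd. ring.
Qed.

(** The booleans say whether [a] is 0, [- p] or [p]. They determine the leading
    coefficients [v] of the zeta functions and of [wp (z + p)], [wp (z - p)] at
    [a], so that one computation serves at all kinds of points. *)
Lemma GLE_exponents (n : nat -> nat) (p A tau a : C) (x x1 x2 : bool) (c : C) (e1 e2 l0 i0 : Z) :
  0 < Im tau ->
  (if x then a = 0 else ~ in_lattice tau a) ->
  (if x1 then a + p = 0 else ~ in_lattice tau (a + p)) ->
  (if x2 then a - p = 0 else ~ in_lattice tau (a - p)) ->
  clim (fun z => (z - a) ^ 2 * Csum4 (fun k => coef n k * wp tau (z + omega tau k / 2))) a c ->
  let v := fun b : bool => if b then RtoC 1 else RtoC 0 in
  let lam := v x - / 2 * (v x1 + v x2) in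
  let mu := - v x + / 2 * (v x1 + v x2) in
  2 * lam = IZR l0 -> mu + lam * lam - (c + 3 / 4 * (v x1 + v x2)) = IZR i0 ->
  (e1 + e2 = 1 - l0)%Z -> (e1 * e2 = i0)%Z -> exponents (GLE_twisted n p A tau) a e1 e2.
Proof.
  intros Ht H0 H1 H2 Hc v lam mu El Ei S P.
  assert (Z1 : forall (b : bool) s, (if b then a + s = 0 else ~ in_lattice tau (a + s)) ->
     clim (fun z => (z - a) * wzeta tau (z + s)) a (v b) /\
     clim (fun z => (z - a) ^ 2 * wp tau (z + s)) a (v b) /\
     clim (fun z => (z - a) ^ 2 * wzeta tau (z + s)) a 0).
  { intros b s Hb. destruct b; split; [|split| |split]; simpl v;
      auto using wzeta_shift_pole, wp_shift_pole, wzeta_shift_second, wzeta_shift_regular, wp_shift_regular. }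
  assert (H0' : if x then a + 0 = 0 else ~ in_lattice tau (a + 0)) by (rewrite Cplus_0_r; exact H0).
  destruct (Z1 x 0 H0') as [A1 [A2 _]]. destruct (Z1 x1 p H1) as [B1 [B2 B3]].
  destruct (Z1 x2 (- p) H2) as [D1 [D2 D3]].
  apply (indicial_exponents _ _ l0 i0 e1 e2 lam mu (c + 3 / 4 * (v x1 + v x2))); auto; simpl tl; simpl tdl; simpl tV.
  - apply clim_ext with (fun z => (z - a) * wzeta tau (z + 0)
        - / 2 * ((z - a) * wzeta tau (z + p) + (z - a) * wzeta tau (z + - p))).
    + apply filter_forall. intros z. rewrite Cplus_0_r. unfold Cminus. ring.
    + unfold lam. apply clim_minus; auto. apply (clim_mult (fun _ => / 2)); [apply clim_const|]. now apply clim_plus.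
  - apply clim_ext with (fun z => - ((z - a) ^ 2 * wp tau (z + 0))
        + / 2 * ((z - a) ^ 2 * wp tau (z + p) + (z - a) ^ 2 * wp tau (z + - p))).
    + apply filter_forall. intros z. rewrite Cplus_0_r. unfold Cminus. ring.
    + unfold mu. apply clim_plus; [now apply clim_opp|].
      apply (clim_mult (fun _ => / 2)); [apply clim_const|]. now apply clim_plus.
  - apply clim_ext with (fun z => (z - a) ^ 2 * Csum4 (fun k => coef n k * wp tau (z + omega tau k / 2))
        + 3 / 4 * ((z - a) ^ 2 * wp tau (z + p) + (z - a) ^ 2 * wp tau (z + - p))
        + A * ((z - a) ^ 2 * wzeta tau (z + p) - (z - a) ^ 2 * wzeta tau (z + - p))
        + (z - a) ^ 2 * GLE_B n p A tau).
    + apply filter_forall. intros z. unfold Cminus. ring.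
    + eapply clim_eq.
      * apply clim_plus; [apply clim_plus; [apply clim_plus; [exact Hc|]|]|apply clim_square_const].
        -- apply (clim_mult (fun _ => 3 / 4)); [apply clim_const|]. apply clim_plus; eassumption.
        -- apply (clim_mult (fun _ => A)); [apply clim_const|]. apply clim_minus; eassumption.
      * ring.
Qed.

Lemma half_period_off_p (p tau : C) (k : nat) : ~ two_torsion tau p ->
  ~ in_lattice tau (- (omega tau k / 2) + p) /\
  ~ in_lattice tau (- (omega tau k / 2) - p).
Proof.
  intros Hp. split; intros H; apply Hp.
  - apply (two_torsion_add tau p (- omega tau k)); [apply in_lattice_opp, omega_in_lattice|].
    apply two_torsion_shift with k.
    replace (p + - omega tau k + omega tau k / 2) with (- (omega tau k / 2) + p) by field. exact H.
  - apply two_torsion_shift with k.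
    replace (p + omega tau k / 2) with (- (- (omega tau k / 2) - p)) by ring. now apply in_lattice_opp.
Qed.

Lemma GLE_exponents_regular (n : nat -> nat) (p A tau : C) (a : C) : 0 < Im tau -> ~ tbad (GLE_twisted n p A tau) a -> exponents (GLE_twisted n p A tau) a 0 1.
Proof.
  intros Ht Ha. simpl in Ha.
  apply (GLE_exponents n p A tau a false false false 0 0 1 0 0); auto; try lia.
  - intros H. apply Ha. left. now apply lattice_two_torsion.
  - apply Csum4_lim_regular; auto.
  - ring.
  - ring.
Qed.

(** The exponents [- 1 / 2] and [3 / 2] of the original equation are shifted by
    [1 / 2], since [1 / Psi_p] vanishes like a square root at [+- p]. *)
Lemma GLE_exponents_p (n : nat -> nat) (p A tau : C) : 0 < Im tau -> ~ two_torsion tau p ->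
  exponents (GLE_twisted n p A tau) p 0 2 /\ exponents (GLE_twisted n p A tau) (- p) 0 2.
Proof.
  intros Ht Hp. assert (H2p : ~ in_lattice tau (p + p)).
  { intros H. apply Hp. unfold two_torsion. now replace (2 * p) with (p + p) by ring. }
  assert (Hpl : ~ in_lattice tau p) by (intros H; now apply Hp, lattice_two_torsion).
  assert (Hpn : ~ two_torsion tau (- p)) by (intros H; now apply Hp, two_torsion_opp).
  split.
  - apply (GLE_exponents n p A tau p false false true 0 0 2 (-1) 0); auto; try lia.
    + ring. + apply Csum4_lim_regular; auto. + field. + field.
  - apply (GLE_exponents n p A tau (- p) false true false 0 0 2 (-1) 0); auto; try lia.
    + intros H. apply Hpl. replace p with (- - p) by ring. now apply in_lattice_opp.
    + ring.
    + intros H. apply H2p. replace (p + p) with (- (- p - p)) by ring. now apply in_lattice_opp.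
    + apply Csum4_lim_regular; auto. + field. + field.
Qed.

(** The exponents [- n_0] and [n_0 + 1] of the original equation are shifted by
    [- 1], since [Psi_p] has a simple zero at 0. *)
Lemma GLE_exponents_0 (n : nat -> nat) (p A tau : C) : 0 < Im tau -> ~ two_torsion tau p ->
  exponents (GLE_twisted n p A tau) (- (omega tau 0 / 2)) (- Z.of_nat (n 0%nat) - 1) (Z.of_nat (n 0%nat)).
Proof.
  intros Ht Hp. destruct (half_period_off_p p tau 0 Hp) as [P1 P2].
  apply (GLE_exponents n p A tau _ true false false (coef n 0) _ _ 2
     (- (Z.of_nat (n 0%nat) * (Z.of_nat (n 0%nat) + 1)))); auto; try lia.
  - simpl. field.
  - apply Csum4_lim_half_period; auto; lia.
  - ring.
  - rewrite coef_Z, opp_IZR, RtoC_opp. ring.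
Qed.

Lemma GLE_exponents_half (n : nat -> nat) (p A tau : C) (k : nat) : 0 < Im tau -> ~ two_torsion tau p ->
  (1 <= k <= 3)%nat ->
  exponents (GLE_twisted n p A tau) (- (omega tau k / 2)) (- Z.of_nat (n k)) (Z.of_nat (n k) + 1).
Proof.
  intros Ht Hp Hk. destruct (half_period_off_p p tau k Hp) as [P1 P2].
  apply (GLE_exponents n p A tau _ false false false (coef n k) _ _ 0
     (- (Z.of_nat (n k) * (Z.of_nat (n k) + 1)))); auto; try lia.
  - intros H. apply (half_periods_distinct tau 0 k Ht); try lia.
    replace (- (omega tau k / 2) + omega tau 0 / 2) with (- (omega tau k / 2)) by (simpl; field). exact H.
  - apply Csum4_lim_half_period; auto; lia.
  - ring.
  - rewrite coef_Z, opp_IZR, RtoC_opp. ring.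
Qed.

Lemma GLE_not_lattice (n : nat -> nat) (p A tau : C) (z : C) : ~ tbad (GLE_twisted n p A tau) z ->
  ~ in_lattice tau z /\ ~ in_lattice tau (z + p) /\ ~ in_lattice tau (z - p).
Proof.
  simpl. intros H. repeat split; intros X; apply H; auto. left. now apply lattice_two_torsion.
Qed.

Lemma GLE_admissible (n : nat -> nat) (p A tau : C) : 0 < Im tau -> ~ two_torsion tau p ->
  admissible tau (GLE_twisted n p A tau).
Proof.
  intros Ht Hp. constructor.
  - intros a. simpl.
    assert (X : forall b, locally' a (fun z => ~ in_lattice tau (z + b))).
    { intros b. assert (H := lattice_discrete tau (1 * a + b) Ht).
      apply (locally'_comp_affine _ a b 1 C1_nz) in H. revert H. apply filter_imp.
      intros z. now replace (1 * z + b) with (z + b) by ring. }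
    generalize (filter_and _ _ (two_torsion_discrete tau a Ht) (filter_and _ _ (X p) (X (- p)))).
    apply filter_imp. unfold Cminus. tauto.
  - intros z Hz H. apply Hz. simpl in *. destruct H as [H|[H|H]].
    + left. now apply two_torsion_opp.
    + right; right. replace (z - p) with (- (- z + p)) by ring. now apply in_lattice_opp.
    + right; left. replace (z + p) with (- (- z - p)) by ring. now apply in_lattice_opp.
  - intros z w Hw Hz H. apply Hz. simpl in *. destruct H as [H|[H|H]].
    + left. now apply two_torsion_add with w.
    + right; left. replace (z + p) with (z + w + p - w) by ring. now apply in_lattice_minus.
    + right; right. replace (z - p) with (z + w - p - w) by ring. now apply in_lattice_minus.
  - intros a Ha. destruct (classic (in_lattice tau (a + p))) as [Hl|Hl].
    + exists (- (a + p)). split; [now apply in_lattice_opp|]. intros y.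
      replace (a + - (a + p)) with (- p) by ring. intros Hy.
      apply (exponents_ord_ge _ _ 0 2 0 y (proj2 (GLE_exponents_p n p A tau Ht Hp))); auto; lia.
    + destruct (classic (in_lattice tau (a - p))) as [Hl'|Hl'].
      * exists (- (a - p)). split; [now apply in_lattice_opp|]. intros y.
        replace (a + - (a - p)) with p by ring. intros Hy.
        apply (exponents_ord_ge _ _ 0 2 0 y (proj1 (GLE_exponents_p n p A tau Ht Hp))); auto; lia.
      * exists 0. split; [apply in_lattice_0|]. intros y Hy. rewrite Cplus_0_r in *.
        apply (exponents_ord_ge (GLE_twisted n p A tau) a 0 1 0 y); auto; try lia.
        apply GLE_exponents_regular; auto. simpl. tauto.
  - intros z Hz. now apply GLE_exponents_regular.
  - intros z Hz. destruct (GLE_not_lattice n p A tau z Hz) as [N0 [N1 N2]]. simpl.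
    assert (X : forall b, ~ in_lattice tau (z + b) -> Cderive_at (fun z => wzeta tau (z + b)) z (- wp tau (z + b))).
    { intros b Hb. eapply Cderive_eq.
      - apply (Cderive_comp (wzeta tau) (fun z => z + b)); [now apply wzeta_derive|].
        apply Cderive_plus; [apply Cderive_id|apply Cderive_const].
      - ring. }
    eapply Cderive_eq.
    + apply Cderive_minus; [now apply wzeta_derive|]. apply Cderive_scal.
      apply Cderive_plus; [now apply X|exact (X (- p) N2)].
    + unfold Cminus. ring.
Qed.

(** Take the logarithmic derivative of [psi z ^ 2 * (sigma (z + p) * sigma (z -
    p)) = sigma z ^ 2]. *)
Lemma Psi_branch_derive (n : nat -> nat) (p A tau : C) (U : C -> Prop) (psi : C -> C) (z : C) :
  0 < Im tau -> open U -> U z -> (forall z, U z -> ~ tbad (GLE_twisted n p A tau) z) -> Psi_branch tau p U psi ->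
  psi z <> 0 /\ Cderive_at psi z (tl (GLE_twisted n p A tau) z * psi z).
Proof.
  intros Ht HU Hz Hreg [Hh Hs]. destruct (GLE_not_lattice n p A tau z (Hreg z Hz)) as [N0 [N1 N2]].
  assert (S0 := wsigma_ne tau z Ht N0). assert (S1 := wsigma_ne tau _ Ht N1).
  assert (S2 := wsigma_ne tau _ Ht N2).
  assert (Np : psi z <> 0).
  { intros E. apply (Cpow_nz _ 2 S0). rewrite <- Hs by auto. rewrite E. simpl. ring. }
  split; auto. destruct (Hh z Hz) as [l Hl].
  assert (X : forall b, ~ in_lattice tau (z + b) ->
     Cderive_at (fun z => wsigma tau (z + b)) z (wzeta tau (z + b) * wsigma tau (z + b))).
  { intros b Hb. eapply Cderive_eq.
    - apply (Cderive_comp (wsigma tau) (fun z => z + b)); [now apply wsigma_derive|].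
      apply Cderive_plus; [apply Cderive_id|apply Cderive_const].
    - ring. }
  assert (D1 : Cderive_at (fun z => psi z ^ 2 * (wsigma tau (z + p) * wsigma tau (z - p))) z
    (INR 2 * psi z ^ 1 * l * (wsigma tau (z + p) * wsigma tau (z - p)) +
     psi z ^ 2 * (wzeta tau (z + p) * wsigma tau (z + p) * wsigma tau (z - p)
       + wsigma tau (z + p) * (wzeta tau (z - p) * wsigma tau (z - p))))).
  { apply (Cderive_mult (fun z => psi z ^ 2) (fun z => wsigma tau (z + p) * wsigma tau (z - p))).
    - now apply (Cderive_pow psi).
    - apply (Cderive_mult (fun z => wsigma tau (z + p)) (fun z => wsigma tau (z - p)));
        [now apply X|exact (X (- p) N2)]. }
  assert (D2 : Cderive_at (fun z => psi z ^ 2 * (wsigma tau (z + p) * wsigma tau (z - p))) z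
    (INR 2 * wsigma tau z ^ 1 * (wzeta tau z * wsigma tau z))).
  { apply Cderive_ext with (fun z => wsigma tau z ^ 2).
    - generalize (HU z Hz). apply filter_imp. intros w Hw. symmetry. auto.
    - apply (Cderive_pow (wsigma tau)). now apply wsigma_derive. }
  assert (E := Cderive_unique _ _ _ _ D1 D2).
  eapply Cderive_eq; [exact Hl|].
  specialize (Hs z Hz). replace (INR 2) with 2%R in E by (simpl; lra).
  simpl tl. set (s := wsigma tau z) in *. set (s1 := wsigma tau (z + p)) in *. set (s2 := wsigma tau (z - p)) in *.
  assert (E' : 2 * psi z * l * (s1 * s2) = psi z ^ 2 * (s1 * s2) * (2 * wzeta tau z - wzeta tau (z + p) - wzeta tau (z - p))).
  { transitivity (2 * s ^ 1 * (wzeta tau z * s) - psi z ^ 2 * (s1 * s2) * (wzeta tau (z + p) + wzeta tau (z - p))).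
    - rewrite <- E. simpl. ring.
    - replace (2 * s ^ 1 * (wzeta tau z * s)) with (s ^ 2 * (2 * wzeta tau z)) by (simpl; ring).
      rewrite <- Hs. ring. }
  transitivity (2 * psi z * l * (s1 * s2) / (2 * psi z * (s1 * s2))).
  - field. repeat split; auto; intros Z2; apply RtoC_inj in Z2; lra.
  - rewrite E'. simpl. field. repeat split; auto; intros Z2; apply RtoC_inj in Z2; lra.
Qed.

(** Dividing a solution by a branch of [Psi_p] turns the equation into the
    twisted one. The reflection of a branch is a branch, because sigma is odd.
    *)
Lemma GLE_presents (n : nat -> nat) (p A tau : C) : 0 < Im tau -> ~ two_torsion tau p ->
  presents tau (GLE_space n p A tau) (GLE_twisted n p A tau).
Proof.
  intros Ht Hp. assert (HA := GLE_admissible n p A tau Ht Hp). constructor; auto.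
  - intros z. simpl. tauto.
  - intros w [Hm Hw]. apply (tsol_intro tau); auto. intros z0 Hz0.
    destruct (Hw z0 Hz0) as [U [psi [HU [HU0 [Hreg [HPsi [dy Hy]]]]]]].
    exists (fun z => dy z / psi z - tl (GLE_twisted n p A tau) z * w z).
    generalize (HU z0 HU0). apply filter_imp. intros z Hz.
    destruct (Psi_branch_derive n p A tau U psi z Ht HU Hz Hreg HPsi) as [Np Dp].
    destruct (Hy z Hz) as [D1 D2].
    assert (Dw : Cderive_at w z (dy z / psi z - tl (GLE_twisted n p A tau) z * w z)).
    { apply Cderive_ext with (fun z => psi z * w z / psi z).
      - generalize (HU z Hz). apply filter_imp. intros u Hu.
        destruct (Psi_branch_derive n p A tau U psi u Ht HU Hu Hreg HPsi) as [Nu _]. field. auto.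
      - eapply Cderive_eq; [apply Cderive_div; [exact D1|exact Dp|exact Np]|]. cbv beta. field. auto. }
    split; auto. eapply Cderive_eq.
    + apply Cderive_minus; [apply Cderive_div; [exact D2|exact Dp|exact Np]|].
      apply Cderive_mult; [exact (adm_l _ _ HA z (Hreg z Hz))|exact Dw].
    + cbv beta. change (potential (GLE n p A tau) z) with (tV (GLE_twisted n p A tau) z). field. auto.
  - intros w [Hm Hw]. split; [now apply meromorphic_opp|]. intros z0 Hz0.
    assert (Hz0' : ~ tbad (GLE_twisted n p A tau) (- z0)) by now apply (adm_opp _ _ HA).
    destruct (Hw (- z0) Hz0') as [U [psi [HU [HU0 [Hreg [[Hh Hs] [dy Hy]]]]]]].
    assert (Nm : (-1 : C) <> 0) by (intros X; apply RtoC_inj in X; lra).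
    exists (fun z => U (- z)), (fun z => psi (- z)). split; [|split; [|split; [|split]]].
    + intros z Hz. assert (H := HU (- z) Hz). replace (- z) with (-1 * z + 0) in H by ring.
      apply (locally_comp_affine _ z 0 (-1) Nm) in H. revert H. apply filter_imp.
      intros u. now replace (-1 * u + 0) with (- u) by ring.
    + exact HU0.
    + intros z Hz H. apply (Hreg (- z) Hz). revert H.
      change (tbad (GLE_twisted n p A tau) z -> tbad (GLE_twisted n p A tau) (- z)). intros H. apply NNPP. intros N.
      apply (adm_opp _ _ HA) in N. apply N. now replace (- - z) with z by ring.
    + split.
      * intros z Hz. destruct (Hh (- z) Hz) as [l Hl]. exists (- l). now apply Cderive_comp_opp.
      * intros z Hz. assert (E := Hs (- z) Hz).
        replace (- z + p) with (- (z - p)) in E by ring. replace (- z - p) with (- (z + p)) in E by ring.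
        rewrite !wsigma_odd in E.
        transitivity (psi (- z) ^ 2 * (- wsigma tau (z - p) * - wsigma tau (z + p))); [ring|]. rewrite E.
        simpl. ring.
    + exists (fun z => - dy (- z)). intros z Hz. destruct (Hy (- z) Hz) as [D1 D2]. split.
      * exact (Cderive_comp_opp (fun z => psi z * w z) z _ D1).
      * eapply Cderive_eq; [apply Cderive_opp, Cderive_comp_opp, D2|].
        rewrite potential_GLE_even; auto; [ring|]. intros X. apply (Hreg _ Hz). left.
        apply two_torsion_opp. now replace (- - z) with z by ring.
Qed.

Theorem theorem1p3 (n : nat -> nat) (tau : C) (htau : (0 < Im tau)%R) :
  (forall p1 p2 A1 A2 : C,
      ~ two_torsion tau p1 -> ~ two_torsion tau p2 ->
      same_global_monodromy_data tau
        (GLE_space n p1 A1 tau) (GLE_space n p2 A2 tau) ->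
      same_equation (GLE n p1 A1 tau) (GLE n p2 A2 tau))
  /\
  ((exists k : nat, (k <= 3)%nat /\ (1 <= n k)%nat) ->
   forall B1 B2 : C,
      same_global_monodromy_data tau
        (Heun_space n B1 tau) (Heun_space n B2 tau) ->
      same_equation (Heun n B1 tau) (Heun n B2 tau))
  /\
  ((exists k : nat, (k <= 3)%nat /\ (1 <= n k)%nat) ->
   forall k : nat, (k <= 3)%nat ->
   forall B1 B2 : C,
      ~ same_global_monodromy_data tau
          (Heun_space n B1 tau) (Heun_space (bump2 n k) B2 tau)).
Proof.
  assert (Par : forall m : nat, Z.odd (- Z.of_nat m + (Z.of_nat m + 1)) = true).
  { intros m. now replace (- Z.of_nat m + (Z.of_nat m + 1))%Z with 1%Z by lia. }
  assert (Ev : forall a b c : Z, (a + b = 2 * c)%Z -> Z.even (a + b) = true).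
  { intros a b c E. apply Z.even_spec. now exists c. }
  split; [|split].
  - intros p1 p2 A1 A2 Hp1 Hp2 H z Hz1 Hz2.
    apply (same_data_same_potential tau _ _ _ _ 0 htau (GLE_presents n p1 A1 tau htau Hp1)
      (GLE_presents n p2 A2 tau htau Hp2)); auto.
    (* the exponents [- n_0 - 1] and [n_0] at 0 have sum -1, which is the one pole
       that can be afforded; at the other half periods the sum is 1 *)
    intros k Hk. destruct (Nat.eqb_spec k 0) as [->|Hk0].
    + apply (exponents_pairing _ _ _ _ _ _ _ _ (GLE_exponents_0 n p1 A1 tau htau Hp1)
        (GLE_exponents_0 n p2 A2 tau htau Hp2)); try lia.
      * now replace (- Z.of_nat (n 0%nat) - 1 + Z.of_nat (n 0%nat))%Z with (-1)%Z by lia.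
      * apply (Ev _ _ (- Z.of_nat (n 0%nat) - 1)%Z); lia.
      * apply (Ev _ _ (Z.of_nat (n 0%nat))); lia.
    + assert (Hk' : (1 <= k <= 3)%nat) by lia.
      apply (exponents_pairing _ _ _ _ _ _ _ _ (GLE_exponents_half n p1 A1 tau k htau Hp1 Hk')
        (GLE_exponents_half n p2 A2 tau k htau Hp2 Hk')); auto; try lia.
      * apply (Ev _ _ (- Z.of_nat (n k))%Z); lia.
      * apply (Ev _ _ (Z.of_nat (n k) + 1)%Z); lia.
  - intros _ B1 B2 H z Hz1 Hz2.
    apply (same_data_same_potential tau _ _ _ _ 0 htau (Heun_presents n B1 tau htau)
      (Heun_presents n B2 tau htau)); auto.
    intros k Hk.
    apply (exponents_pairing _ _ _ _ _ _ _ _ (Heun_exponents_half n B1 tau k htau Hk)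
        (Heun_exponents_half n B2 tau k htau Hk)); auto; try (destruct (Nat.eqb k 0); lia).
    + apply (Ev _ _ (- Z.of_nat (n k))%Z); lia.
    + apply (Ev _ _ (Z.of_nat (n k) + 1)%Z); lia.
  - intros _ k0 Hk0 B1 B2 H.
    assert (HV : forall z, ~ two_torsion tau z ->
       potential (Heun n B1 tau) z = potential (Heun (bump2 n k0) B2 tau) z).
    { intros z Hz.
      apply (same_data_same_potential tau _ _ _ _ k0 htau (Heun_presents n B1 tau htau)
        (Heun_presents (bump2 n k0) B2 tau htau)); auto.
      intros k Hk.
      assert (Hb : bump2 n k0 k = (n k + (if Nat.eqb k k0 then 2 else 0))%nat).
      { unfold bump2. destruct (Nat.eqb k k0); lia. }
      (* at the half period with [n_k + 2], the exponents [- n_k] and [n_k + 1] meet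
         [n_k + 3] and [- n_k - 2]: the sums are 3 and -1 *)
      apply (exponents_pairing _ _ _ _ _ _ _ _ (Heun_exponents_half n B1 tau k htau Hk)
        (Heun_exponents_half (bump2 n k0) B2 tau k htau Hk)); auto; rewrite Hb.
      - apply (Ev _ _ (- Z.of_nat (n k) - (if Nat.eqb k k0 then 1 else 0))%Z); destruct (Nat.eqb k k0); lia.
      - apply (Ev _ _ (Z.of_nat (n k) + 1 + (if Nat.eqb k k0 then 1 else 0))%Z); destruct (Nat.eqb k k0); lia.
      - destruct (Nat.eqb k k0); lia.
      - destruct (Nat.eqb k k0); lia. }
    (* equal potentials would have equal leading coefficients at the half period *)
    set (a := - (omega tau k0 / 2)).
    assert (L : forall (m : nat -> nat) B, clim (fun z => (z - a) ^ 2 * potential (Heun m B tau) z) a (coef m k0)).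
    { intros m B.
      eapply clim_ext; [|eapply clim_eq; [apply clim_plus; [apply (Csum4_lim_half_period tau m k0 htau Hk0)|apply (clim_square_const a B)]|ring]].
      apply filter_forall. intros z. unfold a. simpl. ring. }
    assert (E : coef n k0 = coef (bump2 n k0) k0).
    { apply RtoC_inj. apply (clim_unique (fun z => (z - a) ^ 2 * potential (Heun n B1 tau) z) a); [apply L|].
      apply clim_ext with (fun z => (z - a) ^ 2 * potential (Heun (bump2 n k0) B2 tau) z); [|apply L].
      generalize (two_torsion_discrete tau a htau). apply filter_imp. intros z Hz. now rewrite HV. }
    unfold coef in E. apply INR_eq in E. unfold bump2 in E. rewrite Nat.eqb_refl in E. nia.
Qed.
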